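(* Let $T>0$, $p\ge 1$, and let $(z^{\varepsilon})_{\varepsilon>0}\subset C^{\infty}([0,T],\mathbb{R}^{d})$ be Cauchy (as $\varepsilon\to 0$) in $p$-variation rough path topology, with rough path limit $\mathbf{z}\in C^{0,p\text{-var}}([0,T],G^{[p]}(\mathbb{R}^{d}))$. Let $u_{0}^{\varepsilon}\in \mathrm{BUC}(\mathbb{R}^{n})$ and $u_0\in \mathrm{BUC}(\mathbb{R}^{n})$ with $u_{0}^{\varepsilon}\to u_{0}$ locally uniformly as $\varepsilon\to0$. Let $F=F(t,x,p,X):[0,T]\times\mathbb{R}^n\times\mathbb{R}^n\times S^n\to\mathbb{R}$ be continuous and degenerate elliptic, and assume that $\partial_t-F$ satisfies $\Phi^{(3)}$-invariant comparison. Let $V=(V_1,\dots,V_d)$ be a collection of $\mathrm{Lip}^{\gamma+2}(\mathbb{R}^n;\mathbb{R}^n)$ vector fields with $\gamma>p$. Assume that for each $\varepsilon>0$ there exists a (necessarily unique) viscosity solution $u^{\varepsilon}\in \mathrm{BC}([0,T)\times\mathbb{R}^n)$ to $$du^{\varepsilon}=F(t,x,Du^{\varepsilon},D^2u^{\varepsilon})\,dt-Du^{\varepsilon}(t,x)\cdot V(x)\,dz^{\varepsilon}(t),\qquad u^{\varepsilon}(0,\cdot)=u_0^{\varepsilon},$$ and that the resulting family $(u^{\varepsilon}:\varepsilon>0)$ is uniformly bounded. Then: (i) There exists a unique $u\in \mathrm{BC}([0,T)\times\mathbb{R}^n)$, dependent only on $\mathbf{z}$ and $u_0$ (for given $F$,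 $V$) but not on the particular approximating sequences, such that $u^{\varepsilon}\to u$ locally uniformly as $\varepsilon\to0$. One writes (formally) $$du=F(t,x,Du,D^2u)\,dt-Du(t,x)\cdot V(x)\,d\mathbf{z}(t),\qquad u(0,\cdot)=u_0,$$ and also $u=u^{\mathbf{z}}$ to indicate the dependence on $\mathbf{z}$. (ii) The contraction property $$\sup_{(t,x)\in[0,T)\times\mathbb{R}^n}|u^{\mathbf{z}}(t,x)-\hat u^{\mathbf{z}}(t,x)|\le \sup_{x\in\mathbb{R}^n}|u_0(x)-\hat u_0(x)|$$ holds, where $\hat u^{\mathbf{z}}$ is defined as the limit, as $\eta\to0$, of solutions $\hat u^{\eta}$ arising in the same way as the $u^{\varepsilon}$: that is, from families $(\hat z^{\eta})_{\eta>0}$ and $(\hat u_0^{\eta})_{\eta>0}$ satisfying all the hypotheses above, with the same rough path limit $\mathbf{z}$ and with $\hat u_0^{\eta}\to\hat u_0\in\mathrm{BUC}(\mathbb{R}^n)$ locally uniformly. (iii) The solution map $(\mathbf{z},u_0)\mapsto u^{\mathbf{z}}$ from $$C^{0,p\text{-var}}([0,T],G^{[p]}(\mathbb{R}^d))\times\mathrm{BUC}(\mathbb{R}^n)\to\mathrm{BC}([0,T)\times\mathbb{R}^n)$$ is continuous.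
   Context: **Spaces.** $\mathrm{BC}$ denotes bounded continuous real functions, $\mathrm{BUC}$ bounded uniformly continuous ones; both carry the topology of locally uniform convergence. $S^n$ is the space of symmetric $n\times n$ matrices. For $\beta=m+\alpha$ with $m\in\mathbb{N}_0$, $\alpha\in(0,1]$, $\mathrm{Lip}^{\beta}$ means $m$ times differentiable with bounded derivatives of orders $0,\dots,m$ and $m$-th derivative globally $\alpha$-Hölder continuous. **Rough paths.** $[p]$ is the integer part of $p$. For smooth $z:[0,T]\to\mathbb{R}^d$ put $z^{(j)}_{s,t}=\int_{s<r_1<\dots<r_j<t}dz_{r_1}\otimes\cdots\otimes dz_{r_j}\in(\mathbb{R}^d)^{\otimes j}$. The $p$-variation rough path distance of smooth $z,\tilde z$ is $$\max_{j=1,\dots,[p]}\Big(\sup_{(t_i)\subset[0,T]}\sum_i|z^{(j)}_{t_i,t_{i+1}}-\tilde z^{(j)}_{t_i,t_{i+1}}|^{p/j}\Big)^{j/p},$$ the supremum being over dissections of $[0,T]$. $C^{0,p\text{-var}}([0,T],G^{[p]}(\mathbb{R}^d))$, the space of (geometric) $p$-rough paths, is the completion of the smooth paths (modulo starting point) for this distance, realized as a space of paths in the free step-$[p]$ nilpotent group $G^{[p]}(\mathbb{R}^d)$; it carries the corresponding $p$-variation rough path topology. **Degenerate elliptic.** $F(t,x,p,A)\le F(t,x,p,A+B)$ whenever $B\ge0$ in the sense of symmetric matrices. **Viscosity solutions.** For a function $G(t,x,p,X)$, an upper semicontinuous $u:[0,T)\times\mathbb{R}^n\to\mathbb{R}$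 is a (viscosity) subsolution of $\partial_t-G=0$ if for every smooth test function $\varphi$ and every local maximum $(\bar t,\bar x)\in(0,T)\times\mathbb{R}^n$ of $u-\varphi$ one has $\partial_t\varphi(\bar t,\bar x)\le G(\bar t,\bar x,D\varphi(\bar t,\bar x),D^2\varphi(\bar t,\bar x))$. A lower semicontinuous function is a supersolution if at local minima of $u-\varphi$ the reverse inequality holds. A solution is both. $D,D^2$ denote spatial gradient and Hessian. The equation $du=F\,dt-Du\cdot V(x)\,dz$ with $z$ smooth means $\partial_tu=F(t,x,Du,D^2u)-\sum_{i=1}^d (Du\cdot V_i(x))\,\dot z^i(t)$. **The class $\Phi^{(k)}$.** $\Phi^{(k)}$ is the set of flows $\phi=(\phi_t:t\in[0,T])$ of $C^k$-diffeomorphisms of $\mathbb{R}^n$ with $\phi_0=\mathrm{Id}$ such that $\phi_t$ and $\phi_t^{-1}$ have $k$ bounded derivatives (orders $1,\dots,k$), uniformly in $t\in[0,T]$; $\phi_t,\phi_t^{-1}$ and these derivatives are continuous in $(t,x)$. **$F^\phi$ and invariant comparison.** For $\phi\in\Phi^{(k)}$, $k\ge2$, $$F^{\phi}(t,x,p,X)=F\big(t,\phi_t(x),\langle p,J\rangle,\langle X,J\otimes J\rangle+\langle p,H\rangle\big),\quad J=D\phi_t^{-1}|_{\phi_t(x)},\ H=D^2\phi_t^{-1}|_{\phi_t(x)},$$ where, with $\phi_t^{-1;m}$ the $m$-th component of $\phi_t^{-1}$ and derivatives evaluated at $\phi_t(x)$, $\langle p,J\rangle_i=\sum_m p_m\partial_i\phi_t^{-1;m}$,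 $\langle X,J\otimes J\rangle_{ij}=\sum_{m,l}X_{ml}\,\partial_i\phi_t^{-1;m}\,\partial_j\phi_t^{-1;l}$, $\langle p,H\rangle_{ij}=\sum_m p_m\,\partial_{ij}\phi_t^{-1;m}$. One says $\partial_t-F$ satisfies $\Phi^{(k)}$-invariant comparison if for every $\phi\in\Phi^{(k)}$: whenever $u$ is a bounded upper semicontinuous subsolution and $v$ a bounded lower semicontinuous supersolution of $\partial_t-F^{\phi}=0$ with $u(0,\cdot)\le v(0,\cdot)$, then $u\le v$ on $[0,T)\times\mathbb{R}^n$.
   Formalization: In (iii), continuity is stated on each set of pairs (z,u_0) that arise from admissible families and whose solutions u^z are bounded by a common constant M; without such a bound (iii) fails for the locally uniform topology on BUC (heat equation with z=0). *)

(* Defs.v *)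
From HB Require Import structures.
From mathcomp Require Import all_boot all_order all_algebra.
From mathcomp Require Import all_classical all_reals all_analysis.
From mathcomp Require Import ring.

Set Implicit Arguments.
Unset Strict Implicit.
Unset Printing Implicit Defensive.

Import Order.TTheory GRing.Theory Num.Theory.
Import numFieldNormedType.Exports.

Local Open Scope classical_set_scope.
Local Open Scope ring_scope.

Section derivatives.
Context {R : realType} {U W : normedModType R}.
Implicit Types (f : U -> W) (vs : seq U).

Definition dderiv vs f : U -> W := foldr (fun v g x => 'D_v g x) f vs.

(* m-fold Frechet differentiability: in finite dimension the (j+1)-st
   derivative exists iff all j-fold directional derivatives are
   differentiable *)
Definition ndiff (m : nat) f :=
  forall vs, (size vs < m)%N -> forall x, differentiable (dderiv vs f) x.

(* the operator norm of the j-th derivative, a j-linear map, is at most M *)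
Definition deriv_bound (j : nat) f (M : R) :=
  forall vs, size vs = j ->
  forall x, `|dderiv vs f x| <= M * \prod_(v <- vs) `|v|.

Definition smooth_on (A : set U) f :=
  forall vs x, A x -> differentiable (dderiv vs f) x.

Definition lip (beta : R) f := exists (m : nat) (alpha : R),
  [/\ beta = m%:R + alpha, 0 < alpha <= 1, ndiff m f,
      forall j, (j <= m)%N -> exists M, deriv_bound j f M &
      exists M, forall vs, size vs = m -> forall x y,
        `|dderiv vs f x - dderiv vs f y|
          <= M * \prod_(v <- vs) `|v| * `|x - y| `^ alpha].

End derivatives.

Section function_classes.
Context {R : realType}.

Definition BUC {U : normedModType R} (f : U -> R) :=
  [bounded f x | x in [set: U]] /\ unif_continuous f.

Definition bounded_continuous_on {X : topologicalType} (A : set X)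
    (f : X -> R) :=
  [bounded f x | x in A] /\ {within A, continuous f}.

Definition lsc_on {X : topologicalType} (A : set X) (f : X -> R) :=
  lower_semicontinuous (fun x : subspace A => (f x)%:E).

Definition usc_on {X : topologicalType} (A : set X) (f : X -> R) :=
  lsc_on A (fun x => - f x).

End function_classes.

Section rough_paths.
Context {R : realType}.

(* A path [0, T] -> R^d is represented by a function on R of which only the
   values on [0, T] matter. *)
Definition smooth_path {d : nat} (T : R) (z : R -> 'rV[R]_d) :=
  exists2 g : R -> 'rV[R]_d, smooth_on setT g & {in `[0, T], z =1 g}.

(* iterated integral along a word, the head of which is integrated last *)
Fixpoint iter_int {d : nat} (z : R -> 'rV[R]_d) (s : R) (w : seq 'I_d)
    (t : R) : R :=
  if w is i :: w' then
    \int[lebesgue_measure]_(r in `[s, t])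
      (iter_int z s w' r * derive1 (fun r' => z r' 0 i) r)
  else 1.

(* T^N(R^d): coordinates indexed by the words of length at most N, those of
   length j being the coordinates of the component in (R^d)^{\otimes j} *)
Definition tensor (d N : nat) := {ffun N.-bseq 'I_d -> R}.

Section tensor_algebra.
Context {d N : nat}.
Implicit Types a b x : tensor d N.

Definition tone : tensor d N := [ffun w : N.-bseq 'I_d => (size w == 0%N)%:R].

Definition tletter (i : 'I_d) : tensor d N :=
  [ffun w : N.-bseq 'I_d => (w == [:: i] :> seq 'I_d)%:R].

Definition tmul a b : tensor d N :=
  [ffun w : N.-bseq 'I_d => \sum_(uv : N.-bseq 'I_d * N.-bseq 'I_d |
                   uv.1 ++ uv.2 == w :> seq 'I_d) a uv.1 * b uv.2].

Definition tpow a (k : nat) : tensor d N := iter k (tmul a) tone.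

(* inverse of the elements x whose component of degree 0 is 1, as 1 - x is
   then nilpotent of order N + 1 *)
Definition tinv x : tensor d N := \sum_(k < N.+1) tpow (tone - x) k.

Definition texp a : tensor d N := \sum_(k < N.+1) (k`!%:R)^-1 *: tpow a k.

Inductive free_lie : tensor d N -> Prop :=
| free_lie_letter i : free_lie (tletter i)
| free_lie0 : free_lie 0
| free_lie_lin (c : R) a b :
    free_lie a -> free_lie b -> free_lie (c *: a + b)
| free_lie_bracket a b :
    free_lie a -> free_lie b -> free_lie (tmul a b - tmul b a).

(* the free step-N nilpotent group G^N(R^d) *)
Definition free_group : set (tensor d N) := texp @` free_lie.

Definition tnorm (j : nat) a : R :=
  Num.sqrt (\sum_(w : N.-bseq 'I_d | size w == j) a w ^+ 2).

Definition increment (x : R -> tensor d N) (s t : R) : tensor d N :=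
  tmul (tinv (x s)) (x t).

End tensor_algebra.

Definition signature {d : nat} (N : nat) (z : R -> 'rV[R]_d) (s t : R) :
  tensor d N := [ffun w : N.-bseq 'I_d => iter_int z s (rev w) t].

Section pvar.
Context {d : nat} (T p : R).
Local Notation N := (Num.truncn p).

Definition pvar_sum (j : nat) (X : R -> R -> tensor d N) (s : seq R) : R :=
  \sum_(i < size s)
    tnorm j (X (nth 0 (0 :: s) i) (nth 0 s i)) `^ (p / j%:R).

Definition pvar_level (j : nat) (X : R -> R -> tensor d N) : \bar R :=
  (ereal_sup [set (pvar_sum j X s)%:E | s in itv_partition 0%R T]
     `^ (j%:R / p)%R)%E.

(* p-variation rough path distance, between the increments of two paths *)
Definition pvar_dist (X Y : R -> R -> tensor d N) : \bar R :=
  \big[maxe/0%E]_(1 <= j < N.+1) pvar_level j (fun s t => X s t - Y s t).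

End pvar.

(* C^{0,p-var}([0, T], G^{[p]}(R^d)), paths starting at the unit and extended
   to R by constants *)
Record rough_path (d : nat) (T p : R) := RoughPath {
  rp_fun :> R -> tensor d (Num.truncn p) ;
  rp_group : forall t, free_group (rp_fun t) ;
  rp_left : forall t, t <= 0 -> rp_fun t = tone ;
  rp_right : forall t, T <= t -> rp_fun t = rp_fun T ;
  rp_closure : exists2 z : nat -> R -> 'rV[R]_d,
    forall k, smooth_path T (z k) &
    (fun k => pvar_dist T (signature _ (z k)) (increment rp_fun))
      @ \oo --> 0%E }.

End rough_paths.

Arguments tensor : clear implicits.

Section pvar_dist_pseudometric.
Context {R : realType}.

Lemma powR_convex (q l x y : R) : 1 <= q -> 0 <= l <= 1 -> 0 <= x -> 0 <= y ->
  (l * x + (1 - l) * y) `^ q <= l * x `^ q + (1 - l) * y `^ q.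
Proof.
move=> q1 /andP[l0 l1] x0 y0.
have /(_ (Itv01 l0 l1) x y) := convex_powR q1.
rewrite !inE /= !in_itv /= !andbT => /(_ x0 y0).
by rewrite !convRE /=.
Qed.

Lemma sum_powR_eq0 (I : finType) (P : pred I) (q : R) (a : I -> R) :
  (forall i, 0 <= a i) -> 
  (\sum_(i | P i) a i `^ q) `^ q^-1 = 0 -> forall i, P i -> a i = 0.
Proof.
move=> a0 /powR_eq0_eq0 /eqP.
rewrite psumr_eq0 => [/allP + i Pi|i _]; last exact: powR_ge0.
by move=> /(_ i); rewrite mem_index_enum Pi => /(_ isT) /eqP /powR_eq0_eq0.
Qed.

Lemma sum_minkowski (I : finType) (P : pred I) (q : R) (a b : I -> R) :
  1 <= q -> (forall i, 0 <= a i) -> (forall i, 0 <= b i) ->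
  (\sum_(i | P i) (a i + b i) `^ q) `^ q^-1 <=
  (\sum_(i | P i) a i `^ q) `^ q^-1 + (\sum_(i | P i) b i `^ q) `^ q^-1.
Proof.
move=> q1 a0 b0; have q0 : 0 < q by exact: lt_le_trans q1.
pose S (c : I -> R) := (\sum_(i | P i) c i `^ q) `^ q^-1.
have SE c : S c = (\sum_(i | P i) c i `^ q) `^ q^-1 by [].
have S0 c : 0 <= S c by exact: powR_ge0.
have Sext c c' : (forall i, P i -> c i = c' i) -> S c = S c'.
  by move=> cc'; congr (_ `^ _); apply: eq_bigr => i Pi; rewrite cc'.
have powK c : S c `^ q = \sum_(i | P i) c i `^ q.
  rewrite /S -powRrM mulVf ?gt_eqF// powRr1// sumr_ge0// => i _.
  exact: powR_ge0.
have Sz c : (forall i, 0 <= c i) -> S c = 0 -> forall i, P i -> c i = 0.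
  exact: sum_powR_eq0.
rewrite -!SE; move: S SE S0 Sext powK Sz => S SE S0 Sext powK Sz.
have [/(Sz _ a0) Az|An] := eqVneq (S a) 0.
  rewrite (Sext _ b) ?ler_wpDl// => i Pi; by rewrite Az// add0r.
have [/(Sz _ b0) Bz|Bn] := eqVneq (S b) 0.
  rewrite (Sext _ a) ?ler_wpDr// => i Pi; by rewrite Bz// addr0.
have := powK b; have := powK a.
have := S0 a; have := S0 b.
move: (S a) (S b) An Bn => A B An Bn B0 A0 AE BE.
have Ap : 0 < A by rewrite lt0r An.
have Bp : 0 < B by rewrite lt0r Bn.
have ABp : 0 < A + B by rewrite addr_gt0.
pose l := A / (A + B).
have l01 : 0 <= l <= 1.
  by rewrite /l divr_ge0 ?(ltW Ap) ?(ltW ABp)//= ler_pdivrMr// mul1r lerDl.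
have l1 : 1 - l = B / (A + B).
  by rewrite /l; field; rewrite gt_eqF.
have key i : (a i + b i) `^ q <=
    (A + B) `^ q * (l * (a i / A) `^ q + (1 - l) * (b i / B) `^ q).
  have -> : a i + b i = (A + B) * (l * (a i / A) + (1 - l) * (b i / B)).
    rewrite l1 /l; field.
    by rewrite !gt_eqF.
  have [l0 l1'] := andP l01.
  rewrite powRM; [|exact: ltW|]; last first.
    apply: addr_ge0; apply: mulr_ge0 => //; rewrite ?subr_ge0//.
      by rewrite divr_ge0// ltW.
    by rewrite divr_ge0// ltW.
  rewrite ler_pM2l ?powR_gt0//.
  by apply: powR_convex => //; apply: divr_ge0.
have norm1 (c : I -> R) C : (forall i, 0 <= c i) -> 0 < C ->
    C `^ q = \sum_(i | P i) c i `^ q -> \sum_(i | P i) (c i / C) `^ q = 1.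
  move=> c0 C0 CE.
  rewrite (eq_bigr (fun i => c i `^ q * C^-1 `^ q)); last first.
    by move=> i _; rewrite powRM// invr_ge0 ltW.
  rewrite -mulr_suml -CE -powRM ?invr_ge0 ?ltW// divff ?gt_eqF//.
  by rewrite powR1.
rewrite SE; have -> : A + B = (A + B) `^ q `^ q^-1.
  by rewrite -powRrM divff ?gt_eqF// powRr1// ltW.
apply: ge0_ler_powR; rewrite ?nnegrE ?powR_ge0 ?invr_ge0 ?(ltW q0)//.
  by apply: sumr_ge0 => i _; exact: powR_ge0.
apply: le_trans (ler_sum _ (fun i _ => key i)) _.
rewrite -mulr_sumr big_split /= -!mulr_sumr.
by rewrite (norm1 a A)// (norm1 b B)// !mulr1 subrKC mulr1.
Qed.

Context {d N : nat}.

Lemma tnorm_ge0 j (a : tensor R d N) : 0 <= tnorm j a.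
Proof. exact: sqrtr_ge0. Qed.

Lemma tnorm0 j : tnorm j (0 : tensor R d N) = 0 :> R.
Proof.
by rewrite /tnorm big1 ?sqrtr0// => w _; rewrite ffunE expr0n.
Qed.

Lemma tnormN j (a : tensor R d N) : tnorm j (- a) = tnorm j a :> R.
Proof.
by rewrite /tnorm; congr Num.sqrt; apply: eq_bigr => w _; rewrite ffunE sqrrN.
Qed.

Lemma ler_tnormD j (a b : tensor R d N) :
  tnorm j (a + b) <= tnorm j a + tnorm j b :> R.
Proof.
have E (c : tensor R d N) : tnorm j c =
    (\sum_(w : N.-bseq 'I_d | size w == j) `|c w| `^ 2%:R) `^ (2%:R)^-1.
  rewrite powR12_sqrt; last by apply: sumr_ge0 => w _; exact: powR_ge0.
  congr Num.sqrt; apply: eq_bigr => w _.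
  by rewrite powR_mulrn// real_normK// num_real.
rewrite !E; apply: le_trans (sum_minkowski _ _ _ _) => //; last first.
  by rewrite ler1n.
rewrite ge0_ler_powR ?nnegrE ?invr_ge0//.
- by apply: sumr_ge0 => w _; exact: powR_ge0.
- by apply: sumr_ge0 => w _; exact: powR_ge0.
apply: ler_sum => w _; rewrite ge0_ler_powR ?nnegrE ?addr_ge0//.
by rewrite ffunE ler_normD.
Qed.

End pvar_dist_pseudometric.

Section pvar_dist_theory.
Context {R : realType} {d : nat} (T p : R).
Local Notation N := (Num.truncn p).
Implicit Types X Y Z : R -> R -> tensor R d N.
Local Open Scope ereal_scope.

Lemma pvar_sum_ge0 j X s : (0 <= pvar_sum j X s)%R.
Proof. by apply: sumr_ge0 => i _; exact: powR_ge0. Qed.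

Lemma pvar_level_ge0 j X : 0 <= pvar_level T j X.
Proof. exact: poweR_ge0. Qed.

Lemma pvar_levelD j X Y : (0 < j)%N -> (j <= N)%N ->
  pvar_level T j (fun s t => X s t + Y s t)%R
    <= pvar_level T j X + pvar_level T j Y.
Proof.
move=> j0 jN.
have jR : (0 < j%:R :> R)%R by rewrite ltr0n.
have jp : (j%:R <= p)%R.
  have [p0|p0] := leP 0%R p; first by rewrite -truncn_ge_nat.
  by move: jN; rewrite truncn_floor leNgt p0 /= leqn0 gtn_eqF.
have p0 : (0 < p)%R by exact: lt_le_trans jp.
have qE : (j%:R / p)%R = (p / j%:R)^-1%R by rewrite invf_div.
have q1 : (1 <= p / j%:R)%R by rewrite ler_pdivlMr// mul1r.
have q0 : (0 < p / j%:R)%R by exact: lt_le_trans q1.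
rewrite /pvar_level qE; set q := (p / j%:R)%R.
set A := _ X; set B := _ Y.
have ub Z s : itv_partition 0%R T s ->
    ((pvar_sum j Z s) `^ q^-1)%R%:E <=
    ereal_sup [set (pvar_sum j Z r)%:E | r in itv_partition 0%R T] `^ q^-1.
  move=> sT; rewrite -poweR_EFin.
  have le1 : (pvar_sum j Z s)%:E <=
      ereal_sup [set (pvar_sum j Z r)%:E | r in itv_partition 0%R T].
    by apply: ereal_sup_ubound; exists s.
  have ge0 : 0 <= (pvar_sum j Z s)%:E by rewrite lee_fin pvar_sum_ge0.
  apply: gt0_ler_poweR => //; first by rewrite invr_ge0 ltW.
  - by rewrite in_itv /= ge0 leey.
  - by rewrite in_itv /= (le_trans ge0)// leey.
have sumD s : itv_partition 0%R T s ->
    ((pvar_sum j (fun s t => X s t + Y s t) s) `^ q^-1)%R%:E <=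
    ereal_sup [set (pvar_sum j X r)%:E | r in itv_partition 0%R T] `^ q^-1 +
    ereal_sup [set (pvar_sum j Y r)%:E | r in itv_partition 0%R T] `^ q^-1.
  move=> sT; apply: le_trans (leeD (ub X s sT) (ub Y s sT)).
  rewrite -EFinD lee_fin /pvar_sum.
  apply: le_trans (sum_minkowski _ _ _ _) => //.
  - rewrite ge0_ler_powR ?nnegrE ?invr_ge0 ?(ltW q0)//.
    + by apply: sumr_ge0 => i _; exact: powR_ge0.
    + by apply: sumr_ge0 => i _; exact: powR_ge0.
    apply: ler_sum => i _; rewrite ge0_ler_powR ?nnegrE ?(ltW q0)//.
    + exact: tnorm_ge0.
    + by rewrite addr_ge0// tnorm_ge0.
    + exact: ler_tnormD.
  - by move=> i; exact: tnorm_ge0.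
  - by move=> i; exact: tnorm_ge0.
rewrite -[leRHS]poweRe1 ?adde_ge0 ?poweR_ge0//.
rewrite -[1%R](@mulfV _ q) ?gt_eqF// poweRrM.
have qV0 : (0 <= q^-1)%R by rewrite invr_ge0 ltW.
set C := (X in _ <= X `^ q `^ _).
have C0 : 0 <= C by rewrite adde_ge0 ?poweR_ge0.
have supC : ereal_sup
    [set (pvar_sum j (fun s t => X s t + Y s t)%R r)%:E |
     r in itv_partition 0%R T] <= C `^ q.
  apply: ge_ereal_sup => _ [s sT <-].
  rewrite -[leLHS]poweRe1 ?lee_fin ?pvar_sum_ge0//.
  rewrite -[X in _ `^ X](@mulVf _ q) ?gt_eqF// poweRrM poweR_EFin.
  apply: gt0_ler_poweR; rewrite ?in_itv/= ?leey ?andbT ?(ltW q0)//.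
  - by rewrite lee_fin powR_ge0.
  - exact: sumD.
have [neg|pos] := ltP (ereal_sup
    [set (pvar_sum j (fun s t => X s t + Y s t)%R r)%:E |
     r in itv_partition 0%R T]) 0.
  have [->|/set0P[s sT]] := eqVneq (itv_partition 0%R T) set0.
    rewrite image_set0 ereal_sup0 poweRNyr ?poweR_ge0//.
    by rewrite gt_eqF// invr_gt0.
  suff : 0 <= ereal_sup
    [set (pvar_sum j (fun s t => X s t + Y s t)%R r)%:E |
     r in itv_partition 0%R T] by rewrite leNgt neg.
  apply: (@le_trans _ _ (pvar_sum j (fun s t => X s t + Y s t)%R s)%:E).
    by rewrite lee_fin pvar_sum_ge0.
  by apply: ereal_sup_ubound; exists s.
by apply: gt0_ler_poweR; rewrite ?in_itv/= ?leey ?andbT ?pos ?poweR_ge0.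
Qed.

Lemma pvar_dist_ge0 X Y : 0 <= pvar_dist T X Y.
Proof.
rewrite /pvar_dist; elim/big_rec: _ => // j x _ x0.
by rewrite le_max x0 orbT.
Qed.

Lemma pvar_distxx X : pvar_dist T X X = 0.
Proof.
rewrite /pvar_dist big_nat_cond; apply: (big_ind (fun x => x = 0)) => //.
  by move=> x y -> ->; rewrite maxxx.
move=> j /[!andbT] /andP[j0 jN].
have jR : (0 < j%:R :> R)%R by rewrite ltr0n.
have jp : (j%:R <= p)%R.
  have [p0|p0] := leP 0%R p; first by rewrite -truncn_ge_nat.
  by move: jN; rewrite ltnS truncn_floor leNgt p0 /= leqn0 gtn_eqF.
have p0 : (0 < p)%R by exact: lt_le_trans jp.
have zero s : pvar_sum j (fun s t => X s t - X s t)%R s = 0%R.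
  apply: big1 => i _; rewrite subrr tnorm0 powR0// gt_eqF//.
  by rewrite divr_gt0.
rewrite /pvar_level.
have r0 : (j%:R / p)%R != 0%R by rewrite gt_eqF// divr_gt0.
have [->|/set0P[s sT]] := eqVneq (itv_partition 0%R T) set0.
  by rewrite image_set0 ereal_sup0 poweRNyr.
rewrite (_ : [set _ | _ in _] = [set 0]) ?ereal_sup1 ?poweR0r//.
apply/seteqP; split=> [_ [r _ <-]/=|_ ->]; first by rewrite zero.
by exists s => //; rewrite zero.
Qed.

Lemma pvar_dist_sym X Y : pvar_dist T X Y = pvar_dist T Y X.
Proof.
apply: eq_bigr => j _; rewrite /pvar_level.
suff -> : pvar_sum j (fun s t => X s t - Y s t)%R =
    pvar_sum j (fun s t => Y s t - X s t)%R by [].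
apply/funext => s; apply: eq_bigr => i _; congr (_ `^ _)%R.
by rewrite -tnormN opprB.
Qed.

Lemma pvar_dist_triangle Y X Z :
  pvar_dist T X Z <= pvar_dist T X Y + pvar_dist T Y Z.
Proof.
have lev j X1 Y1 : (0 < j < N.+1)%N ->
    pvar_level T j (fun s t => X1 s t - Y1 s t)%R <= pvar_dist T X1 Y1.
  move=> jN; rewrite /pvar_dist.
  pose F k := pvar_level T k (fun s t => X1 s t - Y1 s t)%R.
  apply: (le_bigmax_seq 0 j xpredT F) => //.
  by rewrite mem_index_iota.
rewrite {1}/pvar_dist big_nat_cond.
apply: (big_ind (fun x => x <= pvar_dist T X Y + pvar_dist T Y Z)).
- by rewrite adde_ge0 ?pvar_dist_ge0.
- by move=> x y xl yl; rewrite ge_max xl yl.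
move=> j /[!andbT] jN; have /andP[j0 jN'] := jN.
apply: le_trans (leeD (lev j X Y jN) (lev j Y Z jN)).
apply: le_trans (pvar_levelD _ _ j0 jN').
have E : (fun s t => X s t - Z s t)%R =
    (fun s t => (X s t - Y s t) + (Y s t - Z s t))%R.
  by apply/funext => s; apply/funext => t; rewrite addrA subrK.
by rewrite E lexx.
Qed.

End pvar_dist_theory.

Section rough_path_topology.
Context {R : realType} {d : nat} {T p : R}.
Local Notation X := (rough_path d T p).
Implicit Types x y z : X.

HB.instance Definition _ := gen_eqMixin X.
HB.instance Definition _ := gen_choiceMixin X.

Definition rp_dist x y := pvar_dist T (increment x) (increment y).

Definition rp_ball x (e : R) : set X := [set y | (rp_dist x y < e%:E)%E].

HB.instance Definition _ := hasNbhs.Build X (nbhs_ (entourage_ rp_ball)).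

Let rp_ball_center x (e : R) : 0 < e -> rp_ball x e x.
Proof. by move=> e0; rewrite /rp_ball /= /rp_dist pvar_distxx lte_fin. Qed.

Let rp_ball_sym x y (e : R) : rp_ball x e y -> rp_ball y e x.
Proof. by rewrite /rp_ball /= /rp_dist pvar_dist_sym. Qed.

Let rp_ball_triangle x y z (e1 e2 : R) :
  rp_ball x e1 y -> rp_ball y e2 z -> rp_ball x (e1 + e2) z.
Proof.
rewrite /rp_ball /= => xy yz; rewrite EFinD.
apply: le_lt_trans (pvar_dist_triangle _ (increment y) _ _) _.
exact: lteD.
Qed.

HB.instance Definition _ := @Nbhs_isPseudoMetric.Build R X
  (entourage_ rp_ball) erefl rp_ball rp_ball_center rp_ball_sym
  rp_ball_triangle erefl.

End rough_path_topology.

Section viscosity.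
Context {R : realType} {n : nat}.
Local Notation E := 'rV[R]_n.

(* G(t, x, p, X) with X symmetric: values at other matrices never matter *)
Definition generator := R -> E -> E -> 'M[R]_n -> R.

Definition unit_vec (i : 'I_n) : E := delta_mx 0 i.

Definition slab (T : R) : set (R * E) := [set q | 0 <= q.1 < T].

Definition open_slab (T : R) : set (R * E) := [set q | 0 < q.1 < T].

Definition dt (phi : R * E -> R) (q : R * E) : R := 'D_(1, 0) phi q.

Definition grad (phi : R * E -> R) (q : R * E) : E :=
  \row_i 'D_(0, unit_vec i) phi q.

Definition hess (phi : R * E -> R) (q : R * E) : 'M[R]_n :=
  \matrix_(i, j) dderiv [:: (0, unit_vec i); (0, unit_vec j)] phi q.

Definition subsolution (T : R) (G : generator) (u : R * E -> R) :=
  usc_on (slab T) u /\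
  forall phi q, smooth_on (open_slab T) phi -> open_slab T q ->
    (\forall q' \near q, u q' - phi q' <= u q - phi q) ->
    dt phi q <= G q.1 q.2 (grad phi q) (hess phi q).

Definition supersolution (T : R) (G : generator) (u : R * E -> R) :=
  lsc_on (slab T) u /\
  forall phi q, smooth_on (open_slab T) phi -> open_slab T q ->
    (\forall q' \near q, u q - phi q <= u q' - phi q') ->
    G q.1 q.2 (grad phi q) (hess phi q) <= dt phi q.

Definition solution (T : R) (G : generator) (u : R * E -> R) :=
  subsolution T G u /\ supersolution T G u.

Definition continuous_generator (T : R) (F : generator) :=
  {within [set q : R * E * E * 'M[R]_n |
             0 <= q.1.1.1 <= T /\ q.2^T = q.2],
    continuous (fun q => F q.1.1.1 q.1.1.2 q.1.2 q.2)}.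

Definition degenerate_elliptic (T : R) (F : generator) :=
  forall t x p (A B : 'M[R]_n), 0 <= t <= T -> A^T = A -> B^T = B ->
    (forall xi : E, 0 <= (xi *m B *m xi^T) 0 0) ->
    F t x p A <= F t x p (A + B).

(* one half of the definition of Phi^(k), imposed on phi and on its inverse *)
Definition regular_family (k : nat) (T : R) (phi : R -> E -> E) :=
  [/\ forall t, 0 <= t <= T -> ndiff k (phi t),
      forall j, (1 <= j <= k)%N -> exists M,
        forall t, 0 <= t <= T -> deriv_bound j (phi t) M &
      forall vs : seq E, (size vs <= k)%N ->
        {within [set q : R * E | 0 <= q.1 <= T],
          continuous (fun q => dderiv vs (phi q.1) q.2)}].

(* phi belongs to Phi^(k) and psi t is the inverse of phi t *)
Definition flow (k : nat) (T : R) (phi psi : R -> E -> E) :=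
  [/\ forall t, 0 <= t <= T -> cancel (phi t) (psi t) /\
                               cancel (psi t) (phi t),
      phi 0 = id, regular_family k T phi & regular_family k T psi].

Definition transform (F : generator) (phi psi : R -> E -> E) : generator :=
  fun t x p X =>
  let y := phi t x in
  let d1 i m := 'D_(unit_vec i) (psi t) y 0 m in
  let d2 i j m := dderiv [:: unit_vec i; unit_vec j] (psi t) y 0 m in
  F t y
    (\row_i \sum_m p 0 m * d1 i m)
    (\matrix_(i, j) (\sum_m \sum_l X m l * d1 i m * d1 j l
                      + \sum_m p 0 m * d2 i j m)).

Definition invariant_comparison (k : nat) (T : R) (F : generator) :=
  forall phi psi, flow k T phi psi ->
  forall u v : R * E -> R,
    [bounded u q | q in slab T] -> [bounded v q | q in slab T] ->
    subsolution T (transform F phi psi) u ->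
    supersolution T (transform F phi psi) v ->
    (forall x, u (0, x) <= v (0, x)) ->
    forall q, slab T q -> u q <= v q.

(* right-hand side of du = F dt - Du . V dz for a smooth z *)
Definition driven {d : nat} (F : generator) (V : 'I_d -> E -> E)
    (z : R -> 'rV[R]_d) : generator :=
  fun t x p X =>
    F t x p X
    - \sum_i (\sum_m p 0 m * V i x 0 m) * derive1 (fun r => z r 0 i) t.

(* Locally uniform convergence on [0, T) x R^n is uniform convergence on the
   compact subsets of [0, T) x R^n. *)
Definition approx_data {d : nat} (T p : R) (F : generator)
    (V : 'I_d -> E -> E) (Z : rough_path d T p) (u0 : E -> R)
    (z : R -> R -> 'rV[R]_d) (w0 : R -> E -> R) (w : R -> R * E -> R) :=
  [/\ (forall e, 0 < e -> smooth_path T (z e)) /\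
      pvar_dist T (signature _ (z e)) (increment Z) @[e --> 0^'+] --> 0%E,
      BUC u0 /\ forall e, 0 < e -> BUC (w0 e),
      {family compact, w0 @ 0^'+ --> u0},
      forall e, 0 < e ->
        [/\ bounded_continuous_on (slab T) (w e),
            solution T (driven F V (z e)) (w e) &
            forall x, w e (0, x) = w0 e x] &
      exists M, forall e q, 0 < e -> slab T q -> `|w e q| <= M].

Definition approximable {d : nat} (T p : R) (F : generator)
    (V : 'I_d -> E -> E) (Z : rough_path d T p) (u0 : E -> R) :=
  exists z w0 w, approx_data F V Z u0 z w0 w.

End viscosity.

Arguments generator : clear implicits.

(* Main.v *)
(** Following Lions-Souganidis, the transport term is removed by the flow: if u solves the driven
equation for a smooth z and phi is the flow of dy = V(y) dz, then v(t, x) = u(t, phi_t(x)) solves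
d_t v = F^phi(t, x, Dv, D^2 v). The flow and its first three derivatives are continuous functions
of the rough path, uniformly on compact sets, so that the generators F^phi converge. Half-relaxed
limits of the v are then sub- and supersolutions of the limiting equation, a quadratic barrier
gives the initial condition, and the invariant comparison makes the two limits coincide.

The flow is built without differential equations, as the limit over dyadic partitions of
compositions of step-[p] Euler maps y |-> sum_w X^w V_w(y) (Davie's estimate). The derivatives are
obtained by applying the construction to the tangent vector fields (V, DV) on E x E, whose Euler
maps are the tangent maps of the Euler maps of V. *)
Require Import Defs.
From HB Require Import structures.
From mathcomp Require Import all_boot all_order all_algebra.
From mathcomp Require Import all_classical all_reals all_analysis.
From mathcomp Require Import ring lra zify.

Set Implicit Arguments.
Unset Strict Implicit.
Unset Printing Implicit Defensive.

Import Order.TTheory GRing.Theory Num.Theory.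
Import numFieldNormedType.Exports.

Local Open Scope classical_set_scope.
Local Open Scope ring_scope.

(** The obstacle is to bound the failure of [eul] to respect products by the size of the tensor.
    Differentiating along a smooth path only bounds it by the length of the path, and the lengths of
    smooth approximations of a rough path may blow up. No geodesics are used: the tensor is dilated
    by [l], both sides become polynomials in [l] up to [O(l^(m+al))], short paths (small [l]) force
    the polynomials to coincide, and the remainder at the true size depends on [V] alone. The
    resulting error has exponent [theta = (N + al) / p], which exceeds 1 because [gamma > p].
    Tangent fields grow linearly in the tangent vector, so bounds hold on balls of a gauge, and
    conjugation by dilations keeps the step size independent of the radius. Each tangent lift costs
    one derivative; [Lip^(gamma+2)] leaves the third lift enough for Davie's estimate but not for a
    Lipschitz flow, and linearity in the tangent vector makes up for it. The flow is never
    differentiated in time: its first-order expansion along a smooth path suffices to transport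
    jets, which is why sub- and supersolutions are tested by jets. *)

Local Notation letr := le_trans.

(* side conditions of the form [0 <= e] and [0 < e] *)
Ltac pos := solve [repeat first [done | by apply: ltW | apply: mulr_ge0 | apply: addr_ge0
  | apply: divr_ge0 | apply: mulr_gt0 | apply: divr_gt0 | apply: addr_gt0 | apply: ltr_wpDl
  | apply: mulrn_wge0 | apply: powR_ge0 | apply: powR_gt0 | apply: exprn_ge0 | apply: exprn_gt0
  | apply: sumr_ge0 => ? _ | rewrite invr_ge0 | rewrite invr_gt0]].

(** * Normalization of identities in abelian groups *)

Section zmodule_normalization.
Context {V : zmodType}.

Inductive zmod_expr :=
| ZVar of nat | ZAdd of zmod_expr & zmod_expr | ZOpp of zmod_expr | ZZero.

Fixpoint zmod_eval (s : seq V) e : V := match e with | ZVar i => nth 0 s i | ZAdd a b => zmod_eval s a +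
  zmod_eval s b | ZOpp a => - zmod_eval s a | ZZero => 0 end.

Fixpoint zmod_coef (i : nat) e : int := match e with | ZVar j => (i == j)%:R | ZAdd a b => zmod_coef i a +
  zmod_coef i b | ZOpp a => - zmod_coef i a | ZZero => 0 end.

(** Reflection: an expression is determined by the integer coefficients of its atoms, and these are
    computed in [int], so [zmod_eval_eq] closes identities between vectors by conversion alone. *)
Lemma zmod_evalE s e : zmod_eval s e = \sum_(i < size s) nth 0 s i *~ zmod_coef i e.
elim: e => /= [j|a -> b ->|a ->|].
- have [js|js] := ltnP j (size s); last first.
  rewrite nth_default// big1// => i _; rewrite (_ : _ == _ = false) ?mulr0z//.
  by apply/negP => /eqP ij; move: (ltn_ord i); rewrite ij ltnNge js.
 rewrite (bigD1 (Ordinal js))//= eqxx mulr1z big1 ?addr0// => i ij.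
 rewrite (_ : _ == _ = false) ?mulr0z//; apply/negP => /eqP E. by move: ij; rewrite -val_eqE /= E eqxx.
- by rewrite -big_split; apply: eq_bigr => i _; rewrite mulrzDr.
- by rewrite -sumrN; apply: eq_bigr => i _; rewrite mulrNz.
- by rewrite big1// => i _; rewrite mulr0z.
Qed.

Lemma zmod_eval_eq s e f : all (fun i => zmod_coef i e == zmod_coef i f) (iota 0 (size s)) -> zmod_eval s e =
  zmod_eval s f.
move=> /allP H; rewrite !zmod_evalE; apply: eq_bigr => i _.
by congr (_ *~ _); apply/eqP/H; rewrite mem_iota /= add0n.
Qed.

End zmodule_normalization.

Ltac zmod_index x s :=
  lazymatch s with
  | x :: _ => constr:(0%N)
  | _ :: ?t => let n := zmod_index x t in constr:(n.+1)
  end.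

Ltac zmod_atoms t s :=
  lazymatch t with
  | ?a + ?b => let s := zmod_atoms a s in zmod_atoms b s
  | - ?a => zmod_atoms a s
  | 0 => s
  | _ => lazymatch s with
         | context [t :: _] => s
         | _ => constr:(t :: s)
         end
  end.

Ltac zmod_reify t s :=
  lazymatch t with
  | ?a + ?b =>
      let x := zmod_reify a s in let y := zmod_reify b s in constr:(ZAdd x y)
  | - ?a => let x := zmod_reify a s in constr:(ZOpp x)
  | 0 => constr:(ZZero)
  | _ => let n := zmod_index t s in constr:(ZVar n)
  end.

Ltac zmod_set :=
  repeat match goal with
  | |- context [@GRing.scale _ _ ?a ?b] => let z := fresh "z" in
      progress set z := (a *: b)
  end.

(* decides the equations valid in all abelian groups *)
Ltac zmod :=
  zmod_set;
  lazymatch goal with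
  | |- @eq ?T ?a ?b =>
      let s := zmod_atoms a constr:(@nil T) in
      let s := zmod_atoms b s in
      let x := zmod_reify a s in
      let y := zmod_reify b s in
      exact: (@zmod_eval_eq _ s x y isT)
  end.

(** * Differential calculus in normed modules *)

Section calculus.
Context {R : realType}.
Implicit Types (E F W : normedModType R) (e r M : R).

Lemma cvgr_le_bd (I : Type) (G : set_system I) (GF : ProperFilter G) (f : I -> R) l M : f @ G --> l ->
  (\forall i \near G, f i <= M) -> l <= M.
move=> fl fM; rewrite -(cvg_lim (@Rhausdorff R) fl); apply: limr_le => //. by apply/cvg_ex; exists l.
Qed.

Lemma diff_exp E W (f : E -> W) x : differentiable f x -> forall e, 0 < e -> exists2 r, 0 < r & forall h, `|h|
  < r -> `|f (x + h) - f x - 'D_h f x| <= e * `|h|.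
move=> df e e0.
have [oo /eqoP/(_ _ e0) o0 fE] : exists2 oo : E -> W, oo =o_ (0 : E) id & forall h, f (x + h) = f x + 'd f x h
 + oo h.
 have H := diff_locallyxC df; eexists; last by move=> h; rewrite H. by [].
have /nbhs_ballP[r /= r0 Hr] := o0. exists r => // h hr.
rewrite fE deriveE// -[f x + _ + _]addrA (addrC (f x)) addrK addrAC subrr add0r.
by apply: (Hr h); rewrite -ball_normE /= sub0r normrN.
Qed.

(** The bound [M] supplies the continuity of [L], which linearity alone does not give in an
    arbitrary normed module. *)
Lemma diff_intro E W (f : E -> W) x (L : {linear E -> W}) M : (forall v, `|L v| <= M * `|v|) -> (forall e, 0 <
  e -> exists2 r, 0 < r & forall h, `|h| < r -> `|f (x + h) - f x - L h| <= e * `|h|) -> differentiable f x /\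
  forall v, 'D_v f x = L v.
move=> LM fL. have Lc : continuous L.
 apply: (linear_bounded_continuous L).1; apply/linear_boundedP. exists M; split; first by rewrite num_real.
 move=> N MN v; apply: letr (LM v) _. by apply: ler_wpM2r => //; exact: ltW.
have oL : f \o shift x = cst (f x) + L +o_ (0 : E) id.
 apply/eqaddoP => e e0; have [r r0 Hr] := fL e e0.
 apply/nbhs_ballP; exists r => //= h; rewrite -ball_normE /= sub0r normrN => hr.
 have := Hr h hr; rewrite [X in `|X| <= _](_ : _ = f (h + x) - (f x + L h))//.
 by rewrite opprD addrA (addrC x).
have dE := diff_unique Lc oL. have df : differentiable f x by apply/diff_locallyP; rewrite dE.
by split => // v; rewrite deriveE// dE.
Qed.

Lemma der_comp E F W (f : E -> F) (g : F -> W) x v : differentiable f x -> differentiable g (f x) -> 'D_v (g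
  \o f) x = 'D_('D_v f x) g (f x).
move=> df dg; rewrite (deriveE _ (differentiable_comp df dg)).
by rewrite (deriveE _ df) (deriveE _ dg) (diff_comp df dg).
Qed.

Lemma derivable_line E W (f : E -> W) x v t : differentiable f (x + t *: v) -> is_derive t 1 (fun s : R => f
  (x + s *: v)) ('D_v f (x + t *: v)).
move=> df. have dl : is_diff t (fun s : R => x + s *: v) (0 + *:%R^~ v).
 exact: (is_diffD (is_diff_cst x t) (is_diff_scalel _ _)).
have dl' : differentiable (fun s : R => x + s *: v) t := @ex_diff _ _ _ _ _ _ _ dl.
have dc : differentiable (fun s : R => f (x + s *: v)) t.
 exact: (@differentiable_comp _ _ _ _ (fun s : R => x + s *: v) f).
apply: DeriveDef; first exact/diff_derivable. rewrite (@der_comp _ _ _ (fun s : R => x + s *: v) f)//.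
by rewrite (deriveE _ dl') diff_val add0r scale1r.
Qed.

(** The values are vectors, so Rolle's theorem is of no help. With slack [e] in the slope, the set
    of times satisfying the estimate contains its supremum by continuity, and the first-order
    expansion at the supremum goes beyond it unless it is the right end. The ends of [[a, b]], where
    no derivative is assumed, are reached by continuity. *)
Lemma mean_value_le W (f : R -> W) (a b M : R) : a <= b -> {within `[a, b], continuous f} -> (forall t, a < t
  < b -> derivable f t 1 /\ `|'D_1 f t| <= M) -> `|f b - f a| <= M * (b - a).
rewrite le_eqVlt => /predU1P[-> _ _|ab fc fd]; first by rewrite !subrr normr0 mulr0.
have fC t : a < t < b -> {for t, continuous f}.
 move=> /fd[d _]; apply: differentiable_continuous; exact/derivable1_diffP.
suff H c d e : a < c -> c <= d -> d < b -> 0 < e -> `|f d - f c| <= (M + e) * (d - c).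
 have [_ fca fcb] := (continuous_within_itvP f ab).1 fc. apply/ler_addgt0Pr => e e0.
 pose e' := e / (b - a); have e'0 : 0 < e' by rewrite divr_gt0 ?subr_gt0.
 have step c : a < c < b -> `|f b - f c| <= (M + e') * (b - c).
  move=> /andP[ac cb]. have cv1 : `|f d - f c| @[d --> b^'-] --> `|f b - f c|.
   by apply: cvg_norm; apply: cvgB => //; exact: cvg_cst.
  have cv2 : (M + e') * (d - c) @[d --> b^'-] --> (M + e') * (b - c).
   apply: cvgM; first exact: cvg_cst. apply: cvgB; last exact: cvg_cst. exact: cvg_within.
  apply: (ler_cvg_to cv1 cv2). near=> d; apply: H => //; near: d. exact: nbhs_left_ge.
 have : `|f b - f a| <= (M + e') * (b - a).
  have cv1 : `|f b - f c| @[c --> a^'+] --> `|f b - f a|.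
   by apply: cvg_norm; apply: cvgB => //; exact: cvg_cst.
  have cv2 : (M + e') * (b - c) @[c --> a^'+] --> (M + e') * (b - a).
   apply: cvgM; first exact: cvg_cst. apply: cvgB; first exact: cvg_cst. exact: cvg_within.
  apply: (ler_cvg_to cv1 cv2). near=> c; apply: step; apply/andP; split; near: c.
   exact: nbhs_right_gt.
  exact: nbhs_right_lt.
 by rewrite mulrDl /e' mulfVK// gt_eqF ?subr_gt0.
move=> ac cd db e0. pose S := [set t | c <= t <= d /\ `|f t - f c| <= (M + e) * (t - c)].
have Sc : S c by split; rewrite ?lexx ?cd// !subrr normr0 mulr0. have Sd : ubound S d by move=> t [/andP[]].
have hS : has_sup S by split; [exists c | exists d]. pose s := sup S.
have cs : c <= s by exact: sup_upper_bound. have sd : s <= d by exact: ge_sup (ex_intro _ _ Sc) _.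
have sab : a < s < b by lra. have Ss : S s.
 split; first by rewrite cs sd. apply/ler_addgt0Pr => u u0. have g0 : 0 < 1 + `|M + e| by [].
 have u2 : 0 < u / 2 by lra. have /cvgrPdist_lt/(_ _ u2) : f @ s --> f s by exact: fC.
 move=> /nbhs_ballP[r /= r0 Hr]. pose r' := Num.min r (u / 2 / (1 + `|M + e|)).
 have r'0 : 0 < r' by rewrite lt_min r0 !divr_gt0. have [t St str] := sup_adherent r'0 hS.
 have ts : t <= s by exact: sup_upper_bound. have fst : `|f s - f t| < u / 2.
  apply: Hr; rewrite /= -ball_normE /= ger0_norm ?subr_ge0//.
  rewrite ltrBlDr -ltrBlDl; apply: le_lt_trans str. by rewrite lerB// ge_min lexx.
 have -> : f s - f c = (f s - f t) + (f t - f c) by rewrite addrA subrK. apply: letr (ler_normD _ _) _.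
 case: St => _ Ht; apply: letr (lerD (ltW fst) Ht) _. have : `|(M + e) * (t - s)| <= u / 2.
  rewrite normrM distrC (ger0_norm (_ : 0 <= s - t)) ?subr_ge0//.
  have st2 : s - t <= u / 2 / (1 + `|M + e|).
   have : s - t <= r' by rewrite lerBlDr -lerBlDl ltW. by move/letr; apply; rewrite ge_min lexx orbT.
    apply: letr (ler_wpM2l _ st2) _ => //.
  by rewrite mulrCA ler_piMr ?(ltW u2)// ler_pdivrMr// mul1r lerDr.
 rewrite ler_norml => /andP[_]; lra.
move: sd; rewrite le_eqVlt => /predU1P[<-|sd]; first by case: Ss. exfalso. have [ds dM] := fd s sab.
have [r r0 Hr] := diff_exp ((derivable1_diffP _ _).1 ds) e0. pose h := Num.min (r / 2) (d - s).
have h0 : 0 < h by rewrite lt_min divr_gt0// subr_gt0. have hr : `|h| < r.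
 rewrite gtr0_norm// gt_min ltr_pdivrMr// ltr_pMr// ltr1n. by [].
suff : S (s + h).
 by move=> /(sup_upper_bound hS); rewrite -/s gerDl leNgt h0.
split.
 apply/andP; split; first by rewrite (letr cs)// lerDl ltW. by rewrite -lerBrDl ge_min lexx orbT.
have := Hr h hr; rewrite (gtr0_norm h0). have -> : 'D_h f s = h *: 'D_1 f s.
 have dd := (derivable1_diffP _ _).1 ds.
 by rewrite !deriveE// -[X in 'd _ _ X]mulr1 -[h * 1]/(h *: (1:R)) linearZ.
move=> Hh; case: Ss => _ Hs.
have -> : f (s + h) - f c = (f (s + h) - f s - h *: 'D_1 f s) + h *: 'D_1 f s + (f s - f c) by rewrite subrK
 addrA subrK. apply: letr (ler_normD _ _) _; apply: letr (lerD (ler_normD _ _) Hs) _.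
rewrite normrZ (gtr0_norm h0). have := ler_wpM2l (ltW h0) dM; move: Hh; nra. Unshelve. all: by end_near. Qed.

Lemma der_linear E W (f : E -> W) x : differentiable f x -> linear (fun v => 'D_v f x). by move=> df a u v; rewrite !deriveE// linearP. Qed.

Lemma der_scale E W (f : E -> W) x a v : differentiable f x -> 'D_(a *: v) f x = a *: 'D_v f x. by move=> df; rewrite !deriveE// linearZ. Qed.

Lemma derBr E W (f : E -> W) x u v : differentiable f x -> 'D_(u - v) f x = 'D_u f x - 'D_v f x. by move=> df; rewrite !deriveE// linearB. Qed.

Lemma derDr E W (f : E -> W) x u v : differentiable f x -> 'D_(u + v) f x = 'D_u f x + 'D_v f x. by move=> df; rewrite !deriveE// linearD. Qed.

Lemma diff_intro_linear E W (f : E -> W) x (L : E -> W) M : linear L -> (forall v, `|L v| <= M * `|v|) ->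
  (forall e, 0 < e -> exists2 r, 0 < r & forall h, `|h| < r -> `|f (x + h) - f x - L h| <= e * `|h|) ->
  differentiable f x /\ forall v, 'D_v f x = L v.
move=> Llin. pose Lm := GRing.isLinear.Build _ _ _ _ L Llin. pose L' : {linear E -> W} := HB.pack L Lm.
exact: (@diff_intro _ _ f x L').
Qed.

Lemma mean_value_unit W (f : R -> W) M : (forall t : R, 0 <= t <= 1 -> derivable f t 1 /\ `|'D_1 f t| <= M) ->
  `|f 1 - f 0| <= M.
move=> H; rewrite -[M]mulr1 -[X in _ <= M * X](subr0 (1 : R)). apply: mean_value_le => //; last first.
 by move=> t /andP[t0 t1]; apply: H; rewrite !ltW.
apply: derivable_within_continuous => t; rewrite in_itv /= => /H[dt _]. by [].
Qed.

Lemma segment_le E W (f : E -> W) x y M : (forall t : R, 0 <= t <= 1 -> differentiable f (x + t *: (y - x)) /\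
  `|'D_(y - x) f (x + t *: (y - x))| <= M) -> `|f y - f x| <= M.
move=> H; pose g (s : R) := f (x + s *: (y - x)).
have -> : f y - f x = g 1 - g 0 by rewrite /g scale1r scale0r addr0 subrKC.
apply: mean_value_unit => t /H[dt Mt]. by have [d ->] := derivable_line dt.
Qed.

(** The second difference [Dl] is symmetric in its two directions and equals [s^2] times either
    mixed derivative up to [o(s^2)]. Differentiability of the two first derivatives at the single
    point [x] is enough for this. *)
Lemma der_schwarz E W (f : E -> W) x u v : (forall y, differentiable f y) -> differentiable ('D_u f) x ->
  differentiable ('D_v f) x -> 'D_v ('D_u f) x = 'D_u ('D_v f) x.
pose Dl s a b := f (x + s *: a + s *: b) - f (x + s *: a) - f (x + s *: b) + f x. move=> df.
have claim a b : differentiable ('D_a f) x -> forall e, 0 < e -> exists2 r, 0 < r & forall s, 0 < s < r ->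
 `|Dl s a b - s ^+ 2 *: 'D_b ('D_a f) x| <= e * s ^+ 2.
 move=> da e e0. pose N := 1 + `|a| + `|b|. have N0 : 0 < N by rewrite /N -addrA ltr_pwDl.
 have e'0 : 0 < e / (2 * N) by pos. have [r r0 Hr] := diff_exp da e'0.
 exists (r / N); first by rewrite divr_gt0. move=> s /andP[s0]; rewrite ltr_pdivlMr// => sN.
 (* The difference of two translates of [f] along [s *: a], minus the expected main term: its
    derivative is small compared with [s^2], and the mean value inequality bounds the increment from
    0 to 1, which is the quantity to estimate. *)
 pose g (t : R) := f (x + s *: b + t *: (s *: a)) - f (x + t *: (s *: a)) - t *: (s ^+ 2 *: 'D_b ('D_a f) x).
 have -> : Dl s a b - s ^+ 2 *: 'D_b ('D_a f) x = g 1 - g 0.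
  rewrite /g /Dl !scale1r !scale0r !addr0 subr0 [x + s *: a + _]addrAC opprB.
  by rewrite [RHS]addrAC; congr (_ - _); rewrite addrA [RHS]addrAC.
 apply: mean_value_unit => t /andP[t0 t1].
 pose Dg := s *: 'D_a f (x + s *: b + t *: (s *: a)) - s *: 'D_a f (x + t *: (s *: a)) - s ^+ 2 *: 'D_b ('D_a
  f) x. have gD : is_derive t 1 g Dg.
  rewrite /Dg -(der_scale s a (df (x + s *: b + _))). rewrite -(der_scale s a (df (x + t *: _))).
  have dt : is_derive t 1 (fun t => t *: (s ^+ 2 *: 'D_b ('D_a f) x)) (s ^+ 2 *: 'D_b ('D_a f) x).
   have dd : is_diff t (fun t => t *: (s ^+ 2 *: 'D_b ('D_a f) x)) (fun t => t *: (s ^+ 2 *: 'D_b ('D_a f)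
    x)) by exact: is_diff_scalel. apply: DeriveDef; first exact/diff_derivable.
   by rewrite deriveE// diff_val scale1r.
  exact: (is_deriveB (is_deriveB (derivable_line (df _)) (derivable_line (df _))) dt).
 have [? ->] := gD; split=> //. have k2 : `|t *: (s *: a)| <= s * N.
  rewrite !normrZ (ger0_norm t0) (gtr0_norm s0). apply: (@le_trans _ _ (s * `|a|)).
   by rewrite ler_piMl// mulr_ge0// ltW.
  by rewrite ler_pM2l// /N -addrA addrCA lerDl addr_ge0.
 have k1 : `|s *: b + t *: (s *: a)| <= s * N.
  apply: letr (ler_normD _ _) _. rewrite !normrZ (ger0_norm t0) (gtr0_norm s0).
  apply: (@le_trans _ _ (s * `|b| + s * `|a|)).
   by rewrite lerD2l ler_piMl// mulr_ge0// ltW.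
  by rewrite -mulrDr ler_pM2l// /N addrC -addrA lerDr.
 have H1 := Hr _ (le_lt_trans k1 sN); have H2 := Hr _ (le_lt_trans k2 sN).
 have E1 : Dg = s *: (('D_a f (x + (s *: b + t *: (s *: a))) - 'D_a f x - 'D_(s *: b + t *: (s *: a)) ('D_a
  f) x) - ('D_a f (x + t *: (s *: a)) - 'D_a f x - 'D_(t *: (s *: a)) ('D_a f) x)).
  rewrite derDr// (der_scale _ b)// /Dg addrA. set A := 'D_a f _; set B := 'D_a f _; set C := 'D_a f x.
  set Q := 'D_(t *: _) _ x. rewrite -scalerBr expr2 -scalerA -scalerBr; congr (_ *: _).
  set P := s *: 'D_b _ _; zmod.
 rewrite E1 normrZ (gtr0_norm s0). apply: letr (ler_wpM2l (ltW s0) (ler_normB _ _)) _.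
 apply: letr (ler_wpM2l (ltW s0) (lerD H1 H2)) _.
 apply: letr (ler_wpM2l (ltW s0) (lerD (ler_wpM2l (ltW e'0) k1) (ler_wpM2l (ltW e'0) k2))) _.
 rewrite le_eqVlt; apply/orP; left; apply/eqP; field. by rewrite gt_eqF.
move=> du dv; apply/eqP; rewrite -subr_eq0 -normr_le0; apply/ler_addgt0Pr => e e0. have e2 : 0 < e / 2 by lra.
have [r r0 Hr] := claim u v du _ e2; have [q q0 Hq] := claim v u dv _ e2. pose s := Num.min r q / 2.
have s0 : 0 < s by rewrite divr_gt0// lt_min r0.
have sm : s < Num.min r q by rewrite ltr_pdivrMr// ltr_pMr ?ltr1n// lt_min r0.
have /Hr A : 0 < s < r by rewrite s0 (lt_le_trans sm)// ge_min lexx.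
have /Hq B : 0 < s < q by rewrite s0 (lt_le_trans sm)// ge_min lexx orbT. have s2 : 0 < s ^+ 2 by pos.
rewrite add0r -(ler_pM2l s2) -{1}(gtr0_norm s2) -normrZ scalerBr. have DE : Dl s u v = Dl s v u.
 by rewrite /Dl [x + s *: u + _]addrAC; congr (_ + _); exact: addrAC.
rewrite DE distrC in A. set X := _ *: _ in A; set Y := _ *: _ in B.
have -> : X - Y = (X - Dl s v u) + (Dl s v u - Y) by rewrite addrA subrK.
apply: letr (ler_normD _ _) _; apply: letr (lerD A B) _. by rewrite -mulrDl -splitr mulrC.
Qed.

(** This differentiates the limit flow. Linearity of [dg x] is not assumed but inherited from the
    derivatives of [f k]. For the expansion, the mean value inequality compares the increments of
    [f l] and [f k] with a constant independent of [l], before [l] runs to the limit. *)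
Lemma der_unif_lim (I : Type) (G : set_system I) (GF : ProperFilter G) E W (f : I -> E -> W) (g : E -> W) (dg
  : E -> E -> W) x r M : 0 < r -> (forall k y, differentiable (f k) y) -> (forall v, `|dg x v| <= M * `|v|) ->
  (forall y, `|y - x| < r -> f ^~ y @ G --> g y) -> (forall e, 0 < e -> \forall k \near G, forall y v, `|y -
  x| < r -> `|'D_v (f k) y - dg y v| <= e * `|v|) -> differentiable g x /\ forall v, 'D_v g x = dg x v.
move=> r0 fd dgM fg fdg. have xx : `|x - x| < r by rewrite subrr normr0. have dglin : linear (dg x).
 move=> a u v; apply/eqP; rewrite -subr_eq0 -normr_le0; apply/ler_addgt0Pr => e e0.
 pose N := `|a *: u + v| + `|a| * `|u| + `|v| + 1. have N0 : 0 < N by rewrite /N ltr_wpDl// !addr_ge0.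
 have [k Hk] := filter_ex (fdg _ (divr_gt0 e0 N0)). have := der_linear (fd k x) a u v => /= Dl.
 rewrite add0r. have H1 := Hk x (a *: u + v) xx; have H2 := Hk x u xx; have H3 := Hk x v xx.
 have -> : dg x (a *: u + v) - (a *: dg x u + dg x v) = (- ('D_(a *: u + v) (f k) x - dg x (a *: u + v)) + a
  *: ('D_u (f k) x - dg x u)) + ('D_v (f k) x - dg x v).
  rewrite Dl scalerBr; set A := a *: 'D_u _ _; set B := 'D_v _ _. set C := a *: dg _ _; zmod.
 apply: letr (ler_normD _ _) _; apply: letr (lerD (ler_normD _ _) H3) _. rewrite normrN normrZ.
 apply: letr (lerD (lerD H1 (ler_wpM2l _ H2)) (lexx _)) _ => //.
 have -> : e / N * `|a *: u + v| + `|a| * (e / N * `|u|) + e / N * `|v| = e * ((N - 1) / N) by rewrite /N;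
  ring. rewrite ler_piMr ?(ltW e0)// ler_pdivrMr// mul1r; lra.
apply: (diff_intro_linear dglin dgM) => e e0. have e4 : 0 < e / 4 by lra. have [k Hk] := filter_ex (fdg _ e4).
have [q q0 Hq] := diff_exp (fd k x) e4. exists (Num.min r q); first by rewrite lt_min r0.
move=> h; rewrite lt_min => /andP[hr hq].
have H1 : `|(g (x + h) - g x) - (f k (x + h) - f k x)| <= e / 4 * 2 * `|h|.
 have cv : `|(f l (x + h) - f l x) - (f k (x + h) - f k x)| @[l --> G] --> `|(g (x + h) - g x) - (f k (x + h)
  - f k x)|.
  apply: cvg_norm; apply: cvgB; last exact: cvg_cst.
  by apply: cvgB; apply: fg => //; rewrite addrAC subrr add0r.
 apply: (cvgr_le_bd GF cv). near=> l.
 have Hl : forall y v, `|y - x| < r -> `|'D_v (f l) y - dg y v| <= e / 4 * `|v|.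
  by near: l; exact: fdg.
 have E1 : (f l (x + h) - f l x) - (f k (x + h) - f k x) = (f l - f k) (x + h) - (f l - f k) x by rewrite
  !fctE; zmod. rewrite E1; apply: segment_le => t /andP[t0 t1].
 have -> : x + h - x = h by rewrite addrAC subrr add0r. have yr : `|x + t *: h - x| < r.
  rewrite addrAC subrr add0r normrZ (ger0_norm t0); apply: le_lt_trans hr. by rewrite ler_piMl.
 split; first exact: differentiableB. rewrite deriveB; try exact: diff_derivable.
 have -> : 'D_h (f l) (x + t *: h) - 'D_h (f k) (x + t *: h) = ('D_h (f l) (x + t *: h) - dg (x + t *: h) h)
  - ('D_h (f k) (x + t *: h) - dg (x + t *: h) h) by rewrite opprB addrA subrK.
 apply: letr (ler_normB _ _) _. by apply: letr (lerD (Hl _ _ yr) (Hk _ _ yr)) _; lra.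
have H2 := Hq h hq; have H3 := Hk x h xx.
have -> : g (x + h) - g x - dg x h = ((g (x + h) - g x) - (f k (x + h) - f k x)) + (f k (x + h) - f k x - 'D_h
 (f k) x) + ('D_h (f k) x - dg x h).
 by set a := f k _ - f k _; set b := 'D_h _ _; zmod.
apply: letr (ler_normD _ _) _; apply: letr (lerD (ler_normD _ _) H3) _.
by apply: letr (lerD (lerD H1 H2) (lexx _)) _; lra. Unshelve. all: by end_near. Qed.

End calculus.

(** * Linear maps, pairs and products *)

Section differentiable_maps.
Context {R : realType}.
Implicit Types E F W : normedModType R.

Lemma diff_bd E W (f : E -> W) x : differentiable f x -> exists2 M : R, 0 < M & forall v, `|'D_v f x| <= M *
  `|v|.
move=> df; have c := diff_continuous df.
have /linear_boundedP/pinfty_ex_gt0[M M0 HM] := (linear_bounded_continuous ('d f x)).2 c.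
by exists M => // v; rewrite deriveE.
Qed.

Lemma linear_mapD E W (L : E -> W) : linear L -> forall x y, L (x + y) = L x + L y. by move=> Ll x y; have := Ll 1 x y; rewrite !scale1r. Qed.

Lemma linear_mapB E W (L : E -> W) : linear L -> forall x y, L (x - y) = L x - L y. by move=> Ll x y; have := Ll (-1) y x; rewrite !scaleN1r => E1; rewrite addrC E1 addrC. Qed.

Lemma lmap_diff E W (L : E -> W) (M : R) : linear L -> (forall v, `|L v| <= M * `|v|) -> forall x,
  differentiable L x /\ forall v, 'D_v L x = L v.
move=> Llin LM x; apply: (diff_intro_linear Llin LM) => e e0. exists 1 => // h _; rewrite (linear_mapD Llin).
have -> : L x + L h - L x - L h = 0 by zmod. by rewrite normr0 mulr_ge0// ltW.
Qed.

Lemma der_unique E W (f : E -> W) x v w : differentiable f x -> (forall e : R, 0 < e -> exists2 s : R, 0 < s &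
  forall t, 0 < t < s -> `|f (x + t *: v) - f x - t *: w| <= e * t) -> 'D_v f x = w.
move=> df H; apply/eqP; rewrite -subr_eq0 -normr_le0; apply/ler_addgt0Pr => e e0.
have N0 : 0 < 2 * (`|v| + 1) by []. have [r r0 Hr] := diff_exp df (divr_gt0 e0 N0).
have [s s0 Hs] := H (e / 2) (divr_gt0 e0 (ltr0n _ 2)). have v1 : 0 < `|v| + 1 by [].
pose t := Num.min s (r / (`|v| + 1)) / 2.
have m0 : 0 < Num.min s (r / (`|v| + 1)) by rewrite lt_min s0 divr_gt0. have t0 : 0 < t by pos.
have tm : t < Num.min s (r / (`|v| + 1)) by rewrite ltr_pdivrMr// ltr_pMr ?ltr1n.
move: tm; rewrite lt_min => /andP[ts tr]. have tv : `|t *: v| < r.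
 rewrite normrZ (gtr0_norm t0); move: tr; rewrite ltr_pdivlMr//. apply: le_lt_trans; rewrite ler_pM2l//; lra.
have := Hr _ tv; rewrite (der_scale _ _ df) normrZ (gtr0_norm t0) => A.
have B := Hs t; rewrite t0 ts in B; have {}B := B isT.
rewrite add0r -(ler_pM2l t0) -{1}(gtr0_norm t0) -normrZ scalerBr. rewrite distrC.
have -> : t *: w - t *: 'D_v f x = (f (x + t *: v) - f x - t *: 'D_v f x) - (f (x + t *: v) - f x - t *: w).
 by set a := t *: 'D_v _ _; zmod.
apply: letr (ler_normB _ _) _; apply: letr (lerD A B) _.
have -> : e / (2 * (`|v| + 1)) * (t * `|v|) = t * (e / 2) * (`|v| / (`|v| + 1)).
 by field; rewrite gt_eqF.
have : `|v| / (`|v| + 1) <= 1 by rewrite ler_pdivrMr// mul1r lerDl. have te : 0 < t * (e / 2) by pos.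
move=> H1; have := ler_wpM2l (ltW te) H1; lra.
Qed.

Lemma der_pair E F W (f : E -> F) (g : E -> W) x v : differentiable f x -> differentiable g x -> 'D_v (fun x
  => (f x, g x)) x = ('D_v f x, 'D_v g x).
move=> df dg; rewrite (deriveE _ (differentiable_pair df dg)) diff_pair//=. by rewrite !deriveE.
Qed.

Lemma diff_smul E W (a : E -> R) (b : E -> W) x : differentiable a x -> differentiable b x -> differentiable
  (fun y => a y *: b y) x /\ forall v, 'D_v (fun y => a y *: b y) x = 'D_v a x *: b x + a x *: 'D_v b x.
move=> da db. have [A A0 HA] := diff_bd da. have [B B0 HB] := diff_bd db.
apply: (@diff_intro_linear _ _ _ _ _ (fun v => 'D_v a x *: b x + a x *: 'D_v b x) (A * `|b x| + `|a x| * B)).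
- move=> k u v; rewrite !derDr// !der_scale//. rewrite !scalerDl !scalerDr !scalerA -!addrA; congr (_ + _).
 rewrite (mulrC k (a x)) addrCA; congr (_ + _).
- move=> v; apply: letr (ler_normD _ _) _; rewrite !normrZ mulrDl lerD//.
  by rewrite mulrAC ler_wpM2r.
 by rewrite -mulrA ler_wpM2l.
move=> e e0. pose K := `|b x| + `|a x| + (A + 1) * (B + 1) + 1.
have K0 : 0 < K by rewrite /K ltr_wpDl// !addr_ge0// mulr_ge0// addr_ge0// ltW. pose d := Num.min 1 (e / K).
have d0 : 0 < d by rewrite lt_min ltr01 divr_gt0. have d1 : d <= 1 by rewrite ge_min lexx.
have dK : d * K <= e by rewrite -ler_pdivlMr// ge_min lexx orbT. have [r r0 Hr] := diff_exp da d0.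
have [s s0 Hs] := diff_exp db d0. exists (Num.min d (Num.min r s)); first by rewrite lt_min d0 lt_min r0 s0.
move=> h; rewrite lt_min => /andP[hd]; rewrite lt_min => /andP[hr hs].
set a1 := a (x + h); set b1 := b (x + h).
have -> : a1 *: b1 - a x *: b x - ('D_h a x *: b x + a x *: 'D_h b x) = (a1 - a x - 'D_h a x) *: b x + a x *:
 (b1 - b x - 'D_h b x) + (a1 - a x) *: (b1 - b x).
 rewrite !scalerBr !scalerBl. by set p := 'D_h a x *: b x; set q := a x *: 'D_h b x; zmod.
have H1 := Hr h hr; have H2 := Hs h hs. have H3 : `|a1 - a x| <= (A + 1) * `|h|.
 rewrite -[_ - _](subrK ('D_h a x)); apply: letr (ler_normD _ _) _.
 apply: letr (lerD H1 (HA h)) _; rewrite -mulrDl ler_wpM2r//; lra.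
have H4 : `|b1 - b x| <= (B + 1) * `|h|.
 rewrite -[_ - _](subrK ('D_h b x)); apply: letr (ler_normD _ _) _.
 apply: letr (lerD H2 (HB h)) _; rewrite -mulrDl ler_wpM2r//; lra.
apply: letr (ler_normD _ _) _; apply: letr (lerD (ler_normD _ _) (lexx _)) _. rewrite !normrZ.
apply: (@le_trans _ _ (d * `|h| * `|b x| + `|a x| * (d * `|h|) + ((A + 1) * `|h|) * ((B + 1) * d))).
 rewrite lerD// ?lerD ?ler_wpM2l ?ler_wpM2r// ler_pM//.
 apply: letr H4 _; rewrite ler_wpM2l// ?(ltW hd)//; lra.
apply: letr (ler_wpM2r (normr_ge0 h) dK).
have -> : d * `|h| * `|b x| + `|a x| * (d * `|h|) + (A + 1) * `|h| * ((B + 1) * d) = d * (K - 1) * `|h| by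
 rewrite /K; ring. rewrite ler_wpM2r// ler_wpM2l ?(ltW d0)//; lra.
Qed.

End differentiable_maps.

(** * Hoelder classes relative to a gauge *)

Section hoelder_classes.
Context {R : realType}.
Implicit Types E F W : normedModType R.

(** A gauge replaces the norm in local bounds: its sublevel sets are convex, so the mean value
    inequality applies on them, and a displacement enlarges the level by at most its length. The
    zero gauge makes all bounds global in the base point. *)
Definition is_gg E (rho : E -> R) := [/\ forall x, 0 <= rho x, forall x y, rho y <= rho x + `|y - x| & forall
  x y t, 0 <= t <= 1 -> rho (x + t *: (y - x)) <= Num.max (rho x) (rho y)].

(** Tangent fields grow linearly in the tangent vector, which therefore has to be bounded
    separately; the base point keeps its own gauge. *)
Definition tgauge E (rho : E -> R) (q : E * E) : R := Num.max (rho q.1) `|q.2|.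

(** The derivative as one function of base point and direction: iterating the operation stays within
    maps between normed modules, and no spaces of multilinear maps occur. *)
Definition dmap E W (f : E -> W) (q : E * E) : W := 'D_q.2 f q.1.

Definition tmap E W (f : E -> W) (q : E * E) : W * W := (f q.1, 'D_q.2 f q.1).

Definition bd_on E W (rho : E -> R) (f : E -> W) := forall r : R, exists M : R, forall x, rho x <= r -> `|f x|
  <= M.

(* m times differentiable, with derivatives bounded and m-th derivative
   al-Hoelder continuous on the sets where the gauge rho is bounded *)
Fixpoint hcl (al : R) (m : nat) E W (rho : E -> R) (f : E -> W) : Prop :=
  bd_on rho f /\
  match m with
  | 0%N => forall r : R, exists M : R, forall x y, rho x <= r -> rho y <= r ->
      `|f x - f y| <= M * `|x - y| `^ al
  | m'.+1 => (forall x, differentiable f x) /\ hcl al m' (tgauge rho) (dmap f)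
  end.

Definition gcompat E F (rho : E -> R) (rho' : F -> R) (g : E -> F) := forall r : R, exists r', forall x, rho x
  <= r -> rho' (g x) <= r'.

(** The maps admissible as inner functions of a composition: boundedness is asked of the derivative
    and of the effect on gauges, not of [g] itself. *)
Definition gmap (al : R) m E F (rho : E -> R) (rho' : F -> R) (g : E -> F) := [/\ gcompat rho rho' g, forall
  x, differentiable g x & hcl al m (tgauge rho) (dmap g)].

Lemma gauge0 E : is_gg (fun _ : E => 0 : R). by []. Qed.

Lemma tgg_gg E (rho : E -> R) : is_gg rho -> is_gg (tgauge rho).
move=> [g0 g1 g2]; split=> [q|[x u] [y v]|[x u] [y v] t t01]; rewrite /tgauge /=.
- by rewrite le_max g0.
- rewrite prod_normE /= ge_max; apply/andP; split.
  apply: letr (g1 x y) _; apply: lerD; first by rewrite le_max lexx. by rewrite le_max lexx.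
 rewrite -[in leLHS](subrK u v) addrC; apply: letr (ler_normD _ _) _.
 by apply: lerD; rewrite le_max lexx orbT.
- rewrite ge_max; apply/andP; split.
  apply: letr (g2 _ _ _ t01) _; rewrite ge_max !le_max !lexx /=. by lra.
 have /andP[t0 t1] := t01. have -> : u + t *: (v - u) = (1 - t) *: u + t *: v.
  by rewrite scalerBr scalerBl scale1r; zmod.
 apply: letr (ler_normD _ _) _; rewrite !normrZ (ger0_norm t0) ger0_norm ?subr_ge0//.
 set M := Num.max _ _. have uM : `|u| <= M by rewrite /M !le_max lexx orbT.
 have vM : `|v| <= M by rewrite /M !le_max lexx !orbT. have -> : M = (1 - t) * M + t * M by ring.
 by apply: lerD; apply: ler_wpM2l => //; rewrite subr_ge0.
Qed.

Lemma hclass_bd al m E W (rho : E -> R) (f : E -> W) : hcl al m rho f -> bd_on rho f. by case: m => [|m] []. Qed.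

Lemma bd_on_pos E W (rho : E -> R) (f : E -> W) : bd_on rho f -> forall r : R, exists2 M : R, 0 < M & forall
  x, rho x <= r -> `|f x| <= M.
move=> fb r; have [M HM] := fb r; exists (`|M| + 1); first by rewrite ltr_wpDl.
by move=> x /HM/letr; apply; rewrite (letr (ler_norm _))// lerDl.
Qed.

(** The level [Num.max r 1] admits unit vectors as directions; homogeneity in [v] does the rest. *)
Lemma dmap_bd E W (rho : E -> R) (f : E -> W) : (forall x, differentiable f x) -> bd_on (tgauge rho) (dmap f)
  -> forall r : R, exists2 M : R, 0 < M & forall x v, rho x <= r -> `|'D_v f x| <= M * `|v|.
move=> df fb r; have [M M0 HM] := bd_on_pos fb (Num.max r 1).
exists M => // x v xr; have [->|v0] := eqVneq v 0.
 by rewrite derive0 !normr0 mulr0.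
have vp : 0 < `|v| by rewrite normr_gt0.
have -> : 'D_v f x = `|v| *: 'D_(`|v|^-1 *: v) f x by rewrite -der_scale// scalerA divff ?gt_eqF// scale1r.
rewrite normrZ normr_id mulrC ler_pM2r//; apply: (HM (x, _)).
rewrite /tgauge /= normrZ ger0_norm ?invr_ge0// mulVf ?gt_eqF//. by rewrite ge_max !le_max xr lexx orbT.
Qed.

Lemma dmap_lip E W (rho : E -> R) (f : E -> W) : is_gg rho -> (forall x, differentiable f x) -> bd_on (tgauge
  rho) (dmap f) -> forall r : R, exists2 M : R, 0 < M & forall x y, rho x <= r -> rho y <= r -> `|f x - f y|
  <= M * `|x - y|.
move=> [_ _ g2] df fb r; have [M M0 HM] := dmap_bd df fb r.
exists M => // x y xr yr; apply: segment_le => t t01; split=> //; apply: HM.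
by apply: letr (g2 _ _ _ t01) _; rewrite ge_max xr yr.
Qed.

(** At distance at most 1 a Lipschitz bound is stronger than a Hoelder bound; at larger distances
    the Hoelder bound follows from boundedness. Hence the constant [L + M * 2]. *)
Lemma lip_hoelder E W (rho : E -> R) (f : E -> W) (al : R) : 0 < al <= 1 -> bd_on rho f -> (forall r : R,
  exists2 M : R, 0 < M & forall x y, rho x <= r -> rho y <= r -> `|f x - f y| <= M * `|x - y|) -> forall r :
  R, exists M : R, forall x y, rho x <= r -> rho y <= r -> `|f x - f y| <= M * `|x - y| `^ al.
move=> /andP[al0 al1] fb fl r. have [M M0 HM] := bd_on_pos fb r; have [L L0 HL] := fl r.
exists (L + M * 2) => x y xr yr. have [xy1|xy1] := leP `|x - y| 1.
 apply: letr (HL x y xr yr) _. have [->|n0] := eqVneq `|x - y| 0.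
  by rewrite mulr0 mulr_ge0// ?powR_ge0// addr_ge0 ?mulr_ge0// ltW.
 have xy0 : 0 < `|x - y| by rewrite lt0r n0 /=.
 apply: ler_pM; rewrite ?(ltW L0)//; first by rewrite lerDl mulr_ge0// ltW. by rewrite ger1_powR// xy0 xy1.
apply: (@le_trans _ _ (M * 2)).
 by apply: letr (ler_normB _ _) _; have := HM x xr; have := HM y yr; lra.
rewrite -[leLHS]mulr1; apply: ler_pM => //; rewrite ?mulr_ge0 ?(ltW M0)//.
 by lra.
have e1 : 1 `^ al = 1 by rewrite powR1. rewrite -[leLHS]e1.
by apply: ge0_ler_powR; rewrite ?nnegrE ?(ltW al0)//; exact: ltW.
Qed.

Section fixed_exponent.
Context (al : R) (al01 : 0 < al <= 1).

Lemma hclass_dmap m E W (rho : E -> R) (f : E -> W) : hcl al m.+1 rho f -> hcl al m (tgauge rho) (dmap f). by case=> _ []. Qed.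

Lemma hclass_diff m E W (rho : E -> R) (f : E -> W) : hcl al m.+1 rho f -> forall x, differentiable f x. by case=> _ []. Qed.

Lemma hclass_lip al' m E W (rho : E -> R) (f : E -> W) : is_gg rho -> hcl al' m.+1 rho f -> forall r : R,
  exists2 M : R, 0 < M & forall x y, rho x <= r -> rho y <= r -> `|f x - f y| <= M * `|x - y|. by move=> g [_ [df /hclass_bd fb]]; exact: dmap_lip. Qed.

(** One derivative is traded for a Lipschitz bound, hence for a Hoelder bound of any exponent; this
    is why the exponent [al'] of the top derivative may differ from [al]. *)
Lemma hclassW al' m E W (rho : E -> R) (f : E -> W) : is_gg rho -> hcl al' m.+1 rho f -> hcl al m rho f.
elim: m E W rho f => [|m IH] E W rho f g H.
 split; first exact: hclass_bd H. apply: lip_hoelder => //; first exact: hclass_bd H. exact: hclass_lip H.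
split; first exact: hclass_bd H. by case: H => _ [dH H]; split=> //; apply: IH H; exact: tgg_gg.
Qed.

Lemma hclass_le m k E W (rho : E -> R) (f : E -> W) : is_gg rho -> (k <= m)%N -> hcl al m rho f -> hcl al k
  rho f.
move=> g; elim: m => [|m IH]; first by rewrite leqn0 => /eqP ->.
rewrite leq_eqVlt => /predU1P[->//|]; rewrite ltnS => km H. by apply: IH => //; exact: hclassW g H.
Qed.

Lemma hclass_hoelder m E W (rho : E -> R) (f : E -> W) : is_gg rho -> hcl al m rho f -> forall r : R, exists2
  M : R, 0 < M & forall x y, rho x <= r -> rho y <= r -> `|f x - f y| <= M * `|x - y| `^ al.
move=> g /(hclass_le g (leq0n m))[_ H] r; have [M HM] := H r.
exists (`|M| + 1) => [|x y xr yr]; first by rewrite ltr_wpDl.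
apply: letr (HM x y xr yr) _; rewrite ler_wpM2r ?powR_ge0//. by rewrite (letr (ler_norm _))// lerDl.
Qed.

Lemma hclass_ext m E W (rho : E -> R) (f g : E -> W) : f =1 g -> hcl al m rho f -> hcl al m rho g. by move=> /funext ->. Qed.

Lemma hclassD m E W (rho : E -> R) (f g : E -> W) : hcl al m rho f -> hcl al m rho g -> hcl al m rho (fun x =>
  f x + g x).
elim: m E W rho f g => [|m IH] E W rho f g Hf Hg. all: have Hb : bd_on rho (fun x => f x + g x).
1,3: move=> r; have [M HM] := hclass_bd Hf r; have [M' HM'] := hclass_bd Hg r; exists (M + M') => x xr; apply:
 letr (ler_normD _ _) _; exact: lerD (HM _ xr) (HM' _ xr).
- split=> // r; case: Hf => _ /(_ r)[M HM]; case: Hg => _ /(_ r)[M' HM'].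
 exists (M + M') => x y xr yr; rewrite opprD addrACA mulrDl.
 by apply: letr (ler_normD _ _) _; exact: lerD (HM _ _ xr yr) (HM' _ _ xr yr).
- have df := hclass_diff Hf; have dg := hclass_diff Hg.
 split=> //; split; first by move=> x; exact: (differentiableD (df x) (dg x)).
 apply: hclass_ext (IH _ _ _ _ _ (hclass_dmap Hf) (hclass_dmap Hg)) => q.
 by rewrite /dmap (@deriveD _ _ _ f g)//; exact: diff_derivable.
Qed.

Lemma hclass_pair m E W W' (rho : E -> R) (f : E -> W) (g : E -> W') : hcl al m rho f -> hcl al m rho g -> hcl
  al m rho (fun x => (f x, g x)).
elim: m E W W' rho f g => [|m IH] E W W' rho f g Hf Hg. all: have Hb : bd_on rho (fun x => (f x, g x)).
1,3: move=> r; have [M M0 HM] := bd_on_pos (hclass_bd Hf) r; have [M' M0' HM'] := bd_on_pos (hclass_bd Hg) r;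
 exists (M + M') => x xr; rewrite prod_normE /= ge_max; rewrite (letr (HM _ xr)) ?lerDl ?(ltW M0')//
 (letr (HM' _ xr))//; by rewrite lerDr ltW.
- split=> // r; have [M HM] := Hf.2 r; have [M' HM'] := Hg.2 r.
 exists (`|M| + `|M'|) => x y xr yr; rewrite prod_normE /= ge_max.
 apply/andP; split; [apply: letr (HM x y xr yr) _|apply: letr (HM' x y xr yr) _]; rewrite ler_wpM2r
  ?powR_ge0// (letr (ler_norm _))// ?lerDl ?lerDr//.
- have df := hclass_diff Hf; have dg := hclass_diff Hg.
 split=> //; split; first by move=> x; exact: (differentiable_pair (df x) (dg x)).
 apply: hclass_ext (IH _ _ _ _ _ _ (hclass_dmap Hf) (hclass_dmap Hg)) => q. by rewrite /dmap der_pair.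
Qed.

Lemma hclass_linear m E W (rho : E -> R) (L : E -> W) (M : R) : linear L -> (forall v, `|L v| <= M * `|v|) ->
  bd_on rho L -> hcl al m rho L.
elim: m E W rho L M => [|m IH] E W rho L M Ll LM Lb; split=> //.
 apply: lip_hoelder => // r; exists (`|M| + 1) => [|x y _ _]; first by rewrite ltr_wpDl.
 rewrite -linear_mapB//; apply: letr (LM _) _. by rewrite ler_wpM2r// (letr (ler_norm _))// lerDl.
split; first by move=> x; exact: (lmap_diff Ll LM x).1. have -> : dmap L = L \o snd.
 by apply/funext => q; rewrite /dmap (lmap_diff Ll LM _).2.
apply: (IH _ _ _ _ `|M|) => [a u v|v|r] /=; first exact: Ll.
- apply: letr (LM _) _; apply: (@le_trans _ _ (`|M| * `|v.2|)).
  by rewrite ler_wpM2r// ler_norm.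
 by rewrite ler_wpM2l// prod_normE /= le_max lexx orbT.
- exists (`|M| * `|r|) => q; rewrite /tgauge ge_max => /andP[_ qr].
 apply: letr (LM _) _; rewrite (letr (ler_wpM2r _ (ler_norm M)))// ler_wpM2l//.
 by rewrite (letr qr) ?ler_norm.
Qed.

Lemma hclass_sum (I : Type) (r : seq I) m E W (rho : E -> R) (f : I -> E -> W) : (forall i, hcl al m rho (f
  i)) -> hcl al m rho (fun x => \sum_(i <- r) f i x).
move=> Hf; elim: r => [|i r IH].
 apply: (@hclass_ext _ _ _ _ (fun=> 0)) => [x|]; first by rewrite big_nil.
 apply: (@hclass_linear _ _ _ _ _ 0).
 - by move=> a u v; rewrite scaler0 addr0.
 - by move=> v; rewrite normr0 mul0r.
 - by move=> r; exists 0 => x _; rewrite normr0.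
apply: (@hclass_ext _ _ _ _ (fun x => f i x + \sum_(i <- r) f i x)) => [x|].
 by rewrite big_cons.
exact: hclassD.
Qed.

Lemma linear_pair_map E F (L : E -> F) : linear L -> linear (fun q : E * E => (L q.1, L q.2)). by move=> Ll a [u1 u2] [v1 v2]; rewrite /= !Ll. Qed.

Lemma pair_map_bd E F (L : E -> F) C : (forall v, `|L v| <= C * `|v|) -> forall q : E * E, `|(L q.1, L q.2)|
  <= C * `|q|.
move=> LC q; have C0 v : C * `|v| <= `|C| * `|v| by rewrite ler_wpM2r// ler_norm.
rewrite !prod_normE /= ge_max !maxEle; case: ifP => h; rewrite ?LC ?andbT//=.
 case: (leP 0 C) => [C1|C1]; first by rewrite (letr (LC _))// ler_wpM2l.
 have := letr (normr_ge0 _) (LC q.1); rewrite nmulr_rge0// => n1.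
 have n0 : `|q.1| = 0 by apply: le_anti; rewrite n1 normr_ge0.
 have := letr (normr_ge0 _) (LC q.2); rewrite nmulr_rge0// => n2. have n3 : `|q.2| = 0 by lra.
 by have := LC q.1; rewrite n0 n3.
move/negbT: h; rewrite -ltNge => /ltW h.
case: (leP 0 C) => [C1|C1]; first by rewrite (letr (LC _))// ler_wpM2l.
have := letr (normr_ge0 _) (LC q.1); rewrite nmulr_rge0// => n1.
have n0 : `|q.1| = 0 by apply: le_anti; rewrite n1 normr_ge0.
have := letr (normr_ge0 _) (LC q.2); rewrite nmulr_rge0// => n2.
have n3 : `|q.2| = 0 by apply: le_anti; rewrite n2 normr_ge0. by have := LC q.2; rewrite n0 n3.
Qed.

Lemma hclass_comp_linear m E F W (rho : E -> R) (rho' : F -> R) (f : F -> W) (L : E -> F) C : linear L ->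
  (forall v, `|L v| <= C * `|v|) -> gcompat rho rho' L -> hcl al m rho' f -> hcl al m rho (f \o L).
elim: m E F W rho rho' f L => [|m IH] E F W rho rho' f L Ll LC cL Hf. all: have Hb : bd_on rho (f \o L).
1,3: by move=> r; have [r' Hr] := cL r; have [M HM] := hclass_bd Hf r'; exists M => x /Hr /HM.
- split=> // r; have [r' Hr] := cL r; have [M HM] := Hf.2 r'.
 exists (`|M| * `|C| `^ al) => x y /Hr xr /Hr yr /=. apply: letr (HM _ _ xr yr) _.
 apply: (@le_trans _ _ (`|M| * `|L x - L y| `^ al)).
  by rewrite ler_wpM2r ?powR_ge0// ler_norm.
 rewrite -mulrA ler_wpM2l// -powRM// ge0_ler_powR ?nnegrE//.
 - by case/andP: al01 => /ltW.
 - by rewrite -(linear_mapB Ll) (letr (LC _))// ler_wpM2r// ler_norm.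
- have df := hclass_diff Hf. have dL x := (lmap_diff Ll LC x).1.
 split=> //; split; first by move=> x; exact: differentiable_comp.
 apply: hclass_ext (IH _ _ _ _ _ _ _ (linear_pair_map Ll) (pair_map_bd LC) _ (hclass_dmap Hf)).
  by move=> q /=; rewrite /dmap (der_comp _ (dL _) (df _)) (lmap_diff Ll LC _).2.
 move=> r; have [r' Hr] := cL r; exists (Num.max r' (`|C| * `|r|)) => q.
 rewrite /tgauge /= !ge_max !le_max => /andP[/Hr -> qr] /=. apply/orP; right; apply: letr (LC _) _.
 rewrite (letr (ler_wpM2r _ (ler_norm C)))// ler_wpM2l//. by rewrite (letr qr) ?ler_norm.
Qed.

Lemma hclass_linear_comp m E F W (rho : E -> R) (f : E -> F) (L : F -> W) C : linear L -> (forall v, `|L v| <=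
  C * `|v|) -> hcl al m rho f -> hcl al m rho (L \o f).
move=> Ll LC; have {}LC v : `|L v| <= `|C| * `|v|.
 by rewrite (letr (LC _))// ler_wpM2r// ler_norm.
elim: m E rho f => [|m IH] E rho f Hf. all: have Hb : bd_on rho (L \o f).
1,3: by move=> r; have [M HM] := hclass_bd Hf r; exists (`|C| * M) => x /HM xr; rewrite (letr (LC _))//
 ler_wpM2l.
- split=> // r; have [M HM] := Hf.2 r; exists (`|C| * M) => x y xr yr /=.
 rewrite -linear_mapB// (letr (LC _))// -mulrA ler_wpM2l//. exact: HM.
- have df := hclass_diff Hf. have dL x := (lmap_diff Ll LC x).1.
 split=> //; split; first by move=> x; exact: differentiable_comp.
 apply: hclass_ext (IH _ _ _ (hclass_dmap Hf)) => q /=.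
 by rewrite /dmap (der_comp _ (df _) (dL _)) (lmap_diff Ll LC _).2.
Qed.

Lemma fst_bd E F (q : E * F) : `|q.1| <= 1 * `|q|. by rewrite mul1r prod_normE /= le_max lexx. Qed.

Lemma snd_bd E F (q : E * F) : `|q.2| <= 1 * `|q|. by rewrite mul1r prod_normE /= le_max lexx orbT. Qed.

Lemma diff_fst E F (q : E * F) : differentiable (@fst E F) q. exact: (lmap_diff (fun _ _ _ => erefl) (@fst_bd E F) q).1. Qed.

Lemma diff_snd E F (q : E * F) : differentiable (@snd E F) q. exact: (lmap_diff (fun _ _ _ => erefl) (@snd_bd E F) q).1. Qed.

Lemma der_snd E F (q v : E * F) : 'D_v (@snd E F) q = v.2. exact: (lmap_diff (fun _ _ _ => erefl) (@snd_bd E F) q).2. Qed.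

Lemma gcompat_fst E (rho : E -> R) : gcompat (tgauge rho) rho fst. by move=> r; exists r => q; rewrite /tgauge ge_max => /andP[]. Qed.

Lemma hclass_fst m E W (rho : E -> R) (f : E -> W) : hcl al m rho f -> hcl al m (tgauge rho) (fun q => f q.1).
move=> Hf; apply: (hclass_comp_linear (L := fst)) Hf => //.
- exact: fst_bd.
- exact: gcompat_fst.
Qed.

Lemma hclass_snd m E (rho : E -> R) : hcl al m (tgauge rho) (@snd E E).
apply: (@hclass_linear _ _ _ _ _ 1) => //; first exact: snd_bd.
by move=> r; exists r => q; rewrite /tgauge ge_max => /andP[].
Qed.

Lemma gmap_tmap m E F (rho : E -> R) (rho' : F -> R) (g : E -> F) : is_gg rho -> gmap al m.+1 rho rho' g ->
  gmap al m (tgauge rho) (tgauge rho') (tmap g).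
move=> gr [cg dg Hg]; have tg := tgg_gg gr; split.
- move=> r; have [r' Hr] := cg r; have [M HM] := hclass_bd Hg r.
 exists (Num.max r' M) => q qr; rewrite /tgauge /= ge_max !le_max. rewrite (HM _ qr) orbT andbT.
 by move: qr; rewrite /tgauge ge_max => /andP[/Hr ->].
- move=> q; apply: differentiable_pair; last exact: (hclass_diff Hg).
 by apply: (@differentiable_comp _ _ _ _ fst g) => //; exact: diff_fst.
have -> : dmap (tmap g) = fun qk => (dmap g (qk.1.1, qk.2.1), dmap (dmap g) qk).
 apply/funext => -[q k]; rewrite /dmap /tmap /=. have d1 : differentiable (fun q : E * E => g q.1) q.
  by apply: (@differentiable_comp _ _ _ _ fst g) => //; exact: diff_fst.
 rewrite (der_pair _ d1 (hclass_diff Hg q)); congr (_, _).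
apply: hclass_pair; last exact: hclass_dmap. have Hg' := hclassW tg Hg.
apply: (hclass_comp_linear (L := fun qk : (E * E) * (E * E) => (qk.1.1, qk.2.1))) Hg' => //.
- by move=> qk; exact: (pair_map_bd (@fst_bd E E)).
- move=> r; exists r => -[q k]; rewrite /tgauge /= !ge_max => /andP[/andP[-> _]] /=. by lra.
Qed.

(** The chain rule reads [dmap (f \o g) = dmap f \o tmap g], so the induction on [m] replaces [g] by
    its tangent map, and [gmap_tmap] is what keeps the inner function admissible. *)
Lemma hclass_comp m E F W (rho : E -> R) (rho' : F -> R) (f : F -> W) (g : E -> F) : is_gg rho -> hcl al m
  rho' f -> gmap al m rho rho' g -> hcl al m rho (f \o g).
elim: m E F W rho rho' f g => [|m IH] E F W rho rho' f g gr Hf Hg. all: have [cg dg Hdg] := Hg.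
all: have Hb : bd_on rho (f \o g).
1,3: by move=> r; have [r' Hr] := cg r; have [M HM] := hclass_bd Hf r'; exists M => x /Hr /HM.
- split=> // r; have [r' Hr] := cg r; have [M HM] := Hf.2 r'.
 have [L L0 HL] := dmap_lip gr dg (hclass_bd Hdg) r. exists (`|M| * L `^ al) => x y xr yr /=.
 apply: letr (HM _ _ (Hr _ xr) (Hr _ yr)) _. apply: (@le_trans _ _ (`|M| * `|g x - g y| `^ al)).
  by rewrite ler_wpM2r ?powR_ge0// ler_norm.
 rewrite -mulrA ler_wpM2l// -powRM ?(ltW L0)// ge0_ler_powR ?nnegrE//.
 - by case/andP: al01 => /ltW.
 - by pos.
 exact: HL.
- have df := hclass_diff Hf. split=> //; split; first by move=> x; exact: differentiable_comp.
 apply: hclass_ext (IH _ _ _ _ _ _ _ (tgg_gg gr) (hclass_dmap Hf) (gmap_tmap gr Hg)) => q.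
 by rewrite /dmap /= der_comp.
Qed.

Lemma gmap_graph m E (rho : E -> R) (v : E -> E) : hcl al m.+1 rho v -> gmap al m rho (tgauge rho) (fun x =>
  (x, v x)).
move=> Hv; have dv := hclass_diff Hv; split.
- move=> r; have [M HM] := hclass_bd Hv r; exists (Num.max r M) => x xr.
 by rewrite /tgauge /= ge_max !le_max xr (HM _ xr) orbT.
- by move=> x; exact: differentiable_pair.
have -> : dmap (fun x => (x, v x)) = fun q => (q.2, dmap v q).
 by apply/funext => q; rewrite /dmap der_pair// derive_id.
apply: hclass_pair; [exact: hclass_snd|exact: hclass_dmap].
Qed.

Lemma hclass_tmap m E W (rho : E -> R) (f : E -> W) : is_gg rho -> hcl al m.+1 rho f -> hcl al m (tgauge rho)
  (tmap f).
by move=> g Hf; apply: hclass_pair; [exact: (hclass_fst (hclassW g Hf))|exact: hclass_dmap].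
Qed.

Lemma hclass_smul m E W (rho : E -> R) (a : E -> R) (b : E -> W) : is_gg rho -> hcl al m rho a -> hcl al m rho
  b -> hcl al m rho (fun x => a x *: b x).
elim: m E W rho a b => [|m IH] E W rho a b gr Ha Hb. all: have Hab : bd_on rho (fun x => a x *: b x).
1,3: move=> r; have [A HA] := hclass_bd Ha r; have [B HB] := hclass_bd Hb r; exists (A * B) => x xr; rewrite
 normrZ; apply: ler_pM => //; [exact: HA|exact: HB].
- split=> // r; have [A A0 HA] := bd_on_pos (hclass_bd Ha) r. have [B B0 HB] := bd_on_pos (hclass_bd Hb) r.
 have [A' HA'] := Ha.2 r; have [B' HB'] := Hb.2 r. exists (A' * B + A * B') => x y xr yr.
 have -> : a x *: b x - a y *: b y = (a x - a y) *: b x + a y *: (b x - b y).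
  by rewrite scalerBl scalerBr; zmod.
 apply: letr (ler_normD _ _) _; rewrite !normrZ mulrDl; apply: lerD.
  by rewrite mulrAC; apply: ler_pM => //; [exact: HA'|exact: HB].
 by rewrite -mulrA; apply: ler_pM => //; [exact: HA|exact: HB'].
- have da := hclass_diff Ha; have db := hclass_diff Hb.
 split=> //; split; first by move=> x; exact: (diff_smul (da x) (db x)).1.
 apply: (@hclass_ext _ _ _ _ (fun q => dmap a q *: b q.1 + a q.1 *: dmap b q)).
  by move=> q; rewrite /dmap (diff_smul (da _) (db _)).2.
 have Da := hclass_dmap Ha; have Db := hclass_dmap Hb. apply: hclassD.
  exact: (IH _ _ _ _ _ (tgg_gg gr) Da (hclass_fst (hclassW gr Hb))).
 exact: (IH _ _ _ _ _ (tgg_gg gr) (hclass_fst (hclassW gr Ha)) Db).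
Qed.

End fixed_exponent.
End hoelder_classes.

(** * Iterated vector fields along words *)

Section vector_field_words.
Context {R : realType} {d : nat}.
Implicit Types E F W : normedModType R.

(* the iterated vector field V_w = V_{w1} (V_{w2} (... id)) along a word w *)
Fixpoint vf_word E (V : 'I_d -> E -> E) (w : seq 'I_d) : E -> E :=
  if w is i :: w' then fun x => 'D_(V i x) (vf_word V w') x else id.

Lemma vfw1 E (V : 'I_d -> E -> E) i : vf_word V [:: i] = V i. by apply/funext => x; rewrite /= derive_id. Qed.

(** A one-letter word gives [V i] itself and every further letter differentiates once, so a word
    costs one derivative less than its length. *)
Lemma hclass_vfw (al : R) (al01 : 0 < al <= 1) m E (rho : E -> R) (V : 'I_d -> E -> E) w : is_gg rho ->
  (forall i, hcl al m rho (V i)) -> w != [::] -> (size w <= m.+1)%N -> hcl al (m.+1 - size w) rho (vf_word V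
  w).
move=> g HV; elim: w => // i w IH _; have [->|w0] := eqVneq w [::].
 by rewrite vfw1 subSS subn0.
move=> /= wm; have := IH w0 (ltnW wm). have kE k : (k < m.+1)%N -> (m.+1 - k = (m.+1 - k.+1).+1)%N by lia.
rewrite (kE _ wm). move=> /(hclass_dmap) Hw. have HVi : hcl al (m.+1 - (size w).+1).+1 rho (V i).
 apply: (hclass_le al01 g) (HV i); rewrite -(kE _ wm).
 by case: w w0 {IH Hw} wm => //= _ w _ _; rewrite subSS leq_subr.
exact: (hclass_comp al01 g Hw (gmap_graph al01 HVi)).
Qed.

Lemma diff_dmap_fst E W (f : E -> W) x u : differentiable (dmap f) (x, u) -> differentiable ('D_u f) x.
move=> df; apply: (@differentiable_comp _ _ _ _ (fun y => (y, u)) (dmap f)) => //.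
Qed.

Lemma der_slice E F (x a : E) (u : F) : differentiable (fun y => (y, u)) x /\ 'D_a (fun y => (y, u)) x = (a,
  0).
have d1 : differentiable (@id E) x := @ex_diff _ _ _ _ _ _ _ (is_diff_id x).
split; first exact: (differentiable_pair d1 (differentiable_cst u x)).
rewrite (der_pair a d1 (differentiable_cst u x)). by rewrite derive_id derive_cst.
Qed.

Lemma der_graph E F (f : E -> F) x a : differentiable f x -> differentiable (fun y => (y, f y)) x /\ 'D_a (fun
  y => (y, f y)) x = (a, 'D_a f x).
move=> df; have d1 : differentiable (@id E) x := @ex_diff _ _ _ _ _ _ _ (is_diff_id x).
split; first exact: (differentiable_pair d1 df). by rewrite (der_pair a d1 df) derive_id.
Qed.

Lemma der_dmap E W (f : E -> W) x u a b : (forall y, differentiable f y) -> differentiable (dmap f) (x, u) ->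
  'D_(a, b) (dmap f) (x, u) = 'D_a ('D_u f) x + 'D_b f x.
move=> df ddf. have -> : (a, b) = (a, 0) + (0, b) by congr (_, _); rewrite /= ?addr0 ?add0r.
have [di Di] := der_slice x a u. have A : 'D_(a, 0) (dmap f) (x, u) = 'D_a ('D_u f) x.
 have := @der_comp R _ _ _ (fun y : E => (y, u)) (dmap f) x a di ddf. by rewrite Di => H; exact: esym H.
have B : 'D_(0, b) (dmap f) (x, u) = 'D_b f x.
 apply: (der_unique ddf) => e e0; exists 1; first exact: ltr01. move=> t /andP[t0 _].
 have -> : (x, u) + t *: (0, b) = (x + t *: 0, u + t *: b) :> E * E by []. rewrite scaler0 addr0.
 have -> : dmap f (x, u + t *: b) = dmap f (x, u) + t *: 'D_b f x.
  by rewrite -(der_scale t b (df x)); exact: derDr.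
 set k := dmap f _; set l := t *: _; have -> : k + l - k - l = 0 by zmod.
 rewrite normr0; exact: (mulr_ge0 (ltW e0) (ltW t0)).
by rewrite (derDr _ _ ddf) A B.
Qed.

(** Differentiating ['D_(V i x) (vf_word V w) x] in direction [v] gives a second derivative in the
    directions [V i x] and [v], and a first derivative in direction ['D_v (V i) x]. The tangent
    field applied to [dmap (vf_word V w)] gives the same terms with the two directions of the second
    derivative exchanged, so [der_schwarz] concludes. *)
Lemma tmap_vfw (al : R) (al01 : 0 < al <= 1) m E (rho : E -> R) (V : 'I_d -> E -> E) w : is_gg rho -> (forall
  i, hcl al m rho (V i)) -> (size w <= m)%N -> vf_word (fun i => tmap (V i)) w = tmap (vf_word V w).
move=> g HV; elim: w => [_|i w IH wm].
 by apply/funext => -[x v]; rewrite /tmap /= derive_id.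
rewrite /= IH; last exact: ltnW. have [w0|w0] := eqVneq w [::].
 rewrite w0 /=; apply/funext => -[x v]; rewrite /tmap /=. have dV : differentiable (V i) x.
  case: m HV wm {IH} => [|m] HV wm; last exact: (hclass_diff (HV i)). by [].
 have -> : (fun q : E * E => (q.1, 'D_q.2 id q.1)) = id.
  by apply/funext => -[y k]; rewrite derive_id.
 rewrite !derive_id; congr (_, _). by congr ('D_v _ x); apply/funext => y; rewrite derive_id.
have Hw := hclass_vfw al01 g HV w0 (leqW (ltnW wm)).
have kE k : (k.+1 <= m)%N -> (m.+1 - k = (m.+1 - k.+2).+2)%N by lia. have wE := kE (size w) wm.
rewrite wE in Hw; have Dw := hclass_diff Hw. have DDw := hclass_diff (hclass_dmap Hw).
have dV : forall x, differentiable (V i) x.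
 case: m HV wm {IH Hw wE kE} => [|m] HV wm; first by rewrite ltn0 in wm. exact: (hclass_diff (HV i)).
apply/funext => -[x v]; rewrite /tmap /=. have d1 : differentiable (fun q : E * E => vf_word V w q.1) (x, v).
 by apply: (@differentiable_comp _ _ _ _ fst (vf_word V w)) => //; exact: diff_fst.
rewrite (der_pair _ d1 (DDw (x, v))); congr (_, _).
rewrite -[LHS]/('D_(V i x, 'D_v (V i) x) (dmap (vf_word V w)) (x, v)) der_dmap//.
have [dg Dg] := der_graph v (dV x).
have := @der_comp R _ _ _ (fun x => (x, V i x)) (dmap (vf_word V w)) x v dg (DDw _).
rewrite Dg (der_dmap _ _ Dw (DDw (x, V i x))) => H.
have S : 'D_(V i x) ('D_v (vf_word V w)) x = 'D_v ('D_(V i x) (vf_word V w)) x.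
 exact: (der_schwarz Dw (diff_dmap_fst (DDw _)) (diff_dmap_fst (DDw _))).
by rewrite S; exact: esym H.
Qed.

End vector_field_words.

(** * Row vectors, and passage from [lip] to the classes [hcl] *)

Section row_vector_norm.
Context {R : realType} {n : nat}.

Lemma crd_norm_le (v : 'rV[R]_n) j : `|v 0 j| <= `|v|.
rewrite [leRHS]/Num.norm /= mx_normrE. exact: (le_bigmax _ (fun p : 'I_1 * 'I_n => `|v p.1 p.2|) (0, j)).
Qed.

Lemma row_norm_le (v : 'rV[R]_n) M : 0 <= M -> (forall j, `|v 0 j| <= M) -> `|v| <= M.
move=> M0 vM; rewrite [leLHS]/Num.norm /= mx_normrE. by apply: bigmax_le => // -[i j] _ /=; rewrite (ord1 i).
Qed.

Lemma delta_norm_le (j : 'I_n) : `|delta_mx 0 j : 'rV[R]_n| <= 1.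
by apply: row_norm_le => // k; rewrite mxE; case: (_ && _); rewrite ?normr1 ?normr0.
Qed.

End row_vector_norm.

Section lipschitz_classes.
Context {R : realType} {n : nat} {W : normedModType R}.
Local Notation E := 'rV[R]_n.

Lemma hclass_crd (al : R) (al01 : 0 < al <= 1) m j : hcl al m (tgauge (fun _ : E => 0)) (fun q : E * E => q.2
  0 j).
have -> : (fun q : E * E => q.2 0 j) = (fun v : E => v 0 j) \o snd by [].
refine (@hclass_linear_comp R al m (E * E)%type E R _ snd (fun v : E => v 0 j) 1 _ _ (@hclass_snd R al al01 m
 E _)).
 by move=> a u v; rewrite !mxE.
by move=> v; rewrite mul1r crd_norm_le.
Qed.

(** In coordinates [dmap f] is the sum of the coordinates of the direction times the partial
    derivatives of [f], and these satisfy the hypotheses with one derivative less. *)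
Lemma lip_hclass (al : R) (al01 : 0 < al <= 1) m (f : E -> W) : ndiff m f -> (forall j, (j <= m)%N -> exists
  M, deriv_bound j f M) -> (exists M, forall vs, size vs = m -> forall x y, `|dderiv vs f x - dderiv vs f y|
  <= M * \prod_(v <- vs) `|v| * `|x - y| `^ al) -> hcl al m (fun=> 0) f.
elim: m f => [|m IH] f fd fb [M fM]. all: have Hb : bd_on (fun=> 0) f.
1,3: by have [B HB] := fb 0%N isT; move=> r; exists B => x _; have := HB [::] erefl x; rewrite big_nil mulr1.
- split=> // r; exists M => x y _ _; have := fM [::] erefl x y. by rewrite big_nil mulr1.
split=> //; have df x : differentiable f x by exact: (fd [::]). split=> //.
have -> : dmap f = fun q : E * E => \sum_(j < n) q.2 0 j *: 'D_(delta_mx 0 j) f q.1.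
 apply/funext => q; rewrite /dmap [in LHS](row_sum_delta q.2) deriveE// linear_sum.
 by apply: eq_bigr => j _; rewrite linearZ /= deriveE.
have tg := tgg_gg (@gauge0 R E).
have dd j vs : dderiv vs ('D_(delta_mx 0 j) f) = dderiv (rcons vs (delta_mx 0 j)) f by rewrite /dderiv
 foldr_rcons. apply: hclass_sum => // j; apply: hclass_smul => //; first exact: hclass_crd.
apply: (hclass_fst al01 (f := 'D_(delta_mx 0 j) f)); apply: IH.
- by move=> vs vm x; rewrite dd; apply: fd; rewrite size_rcons.
- move=> k km; have [B HB] := fb k.+1 km; exists (`|B|) => vs vk x.
 rewrite dd; apply: letr (HB _ _ x) _; first by rewrite size_rcons vk.
 rewrite -cats1 big_cat /= big_seq1.
 apply: (@le_trans _ _ (`|B| * (\prod_(v <- vs) `|v| * `|delta_mx 0 j : E|))).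
  by rewrite ler_wpM2r ?ler_norm// mulr_ge0// prodr_ge0.
 by rewrite ler_wpM2l// ler_piMr ?delta_norm_le// prodr_ge0.
- exists (`|M|) => vs vk x y; rewrite dd. apply: letr (fM _ _ x y) _; first by rewrite size_rcons vk.
 rewrite ler_wpM2r ?powR_ge0// -cats1 big_cat /= big_seq1.
 apply: (@le_trans _ _ (`|M| * (\prod_(v <- vs) `|v| * `|delta_mx 0 j : E|))).
  by rewrite ler_wpM2r ?ler_norm// mulr_ge0// prodr_ge0.
 by rewrite ler_wpM2l// ler_piMr ?delta_norm_le// prodr_ge0.
Qed.

End lipschitz_classes.

(** [al] is the excess of [gamma] over the integer part of [p], cut off at 1; in both cases
    [p < N + al], the inequality behind [theta_gt1]. If [lip] provides more than [N.+2] derivatives,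
    one of them is spent to obtain the exponent [al]. *)
Lemma lip_hclass_fam {R : realType} {n d : nat} (p gamma : R) (V : 'I_d -> 'rV[R]_n -> 'rV[R]_n) : 1 <= p -> p
  < gamma -> (forall i, lip (gamma + 2) (V i)) -> exists al : R, [/\ 0 < al <= 1, p < (Num.truncn p)%:R + al &
  forall i, hcl al (Num.truncn p).+2 (fun=> 0) (V i)].
move=> p1 pg HV; set N := Num.truncn p. have p0 : 0 <= p by lra.
have /andP[Np pN] := truncn_itv p0; rewrite -/N in Np pN.
pose al := if gamma <= N.+1%:R then gamma - N%:R else 1 : R. have al01 : 0 < al <= 1.
 rewrite /al; case: ifP => [gN|_]; last by rewrite ltr01 lexx.
 rewrite subr_gt0 (le_lt_trans Np pg)/= lerBlDr; move: gN; rewrite -natr1; lra.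
exists al; split=> //.
 rewrite /al; case: ifP => [gN|_]; first by rewrite subrKC. by lra.
move=> i; have [m [a [E a01 fd fb fM]]] := HV i. have [a0 a1] := andP a01. have H := lip_hclass a01 fd fb fM.
have mN : (N.+2 <= m)%N.
 case: (ltnP N.+1 m) => // mN; exfalso. have : m%:R <= N.+1%:R :> R by rewrite ler_nat.
 rewrite -natr1; move: E a1; lra.
move: mN; rewrite leq_eqVlt => /predU1P[mE|mN].
 have aE : al = a.
  move: E; rewrite -mE /al -addn2 natrD => E. have -> : gamma = N%:R + a by move: E; lra.
  by rewrite ifT ?(addrC N%:R) ?addrK// -natr1 addrC lerD2l.
 by rewrite aE mE.
have g0 := @gauge0 R 'rV[R]_n. apply: (hclassW al01 g0 (al' := a)). exact: (hclass_le a01 g0 mN H).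
Qed.

(** * The truncated tensor algebra *)

Section tensor_algebra_theory.
Context {R : realType} {d N : nat}.
Local Notation word := (N.-bseq 'I_d).
Implicit Types a b c x : tensor R d N.

Lemma tmulE a b w : tmul a b w = \sum_(u : word) \sum_(v : word) (u ++ v == w :> seq 'I_d)%:R * (a u * b v).
rewrite ffunE big_mkcond pair_big /=; apply: eq_bigr => -[u v] _ /=. by case: eqP; rewrite ?mul1r ?mul0r.
Qed.

Lemma sum_word_eq (s : seq 'I_d) (f : word -> R) (w : word) : w = s :> seq 'I_d -> \sum_(p : word) (s == p :>
  seq 'I_d)%:R * f p = f w.
move=> ws; rewrite (bigD1 w)//= -ws eqxx mul1r big1 ?addr0// => p pw.
rewrite (_ : _ == _ = false) ?mul0r//; apply/negbTE; apply: contra pw => /eqP pw. by apply/eqP/val_inj.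
Qed.

Lemma sum_word_neq (s : seq 'I_d) (f : word -> R) : (N < size s)%N -> \sum_(p : word) (s == p :> seq 'I_d)%:R
  * f p = 0.
move=> sN; apply: big1 => p _; rewrite (_ : _ == _ = false) ?mul0r//.
by apply/negbTE/negP => /eqP sp; move: sN; rewrite sp ltnNge size_bseq.
Qed.

Lemma tmulA a b c : tmul a (tmul b c) = tmul (tmul a b) c.
apply/ffunP => w; rewrite !tmulE.
transitivity (\sum_(u : word) \sum_(v : word) \sum_(q : word) (u ++ (v ++ q) == w :> seq 'I_d)%:R * (a u * (b
 v * c q))).
 apply: eq_bigr => u _. under eq_bigr => p _ do rewrite tmulE !mulr_sumr.
 under eq_bigr => p _ do under eq_bigr => v _ do rewrite !mulr_sumr.
 rewrite exchange_big; apply: eq_bigr => v _; rewrite exchange_big. apply: eq_bigr => q _.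
 have E p : (u ++ p == w :> seq 'I_d)%:R * (a u * ((v ++ q == p :> seq 'I_d)%:R * (b v * c q))) = (v ++ q ==
  p :> seq 'I_d)%:R * ((u ++ p == w :> seq 'I_d)%:R * (a u * (b v * c q))) by lra.
 under eq_bigr => p _ do rewrite E. have [vqN|vqN] := leqP (size (v ++ q)) N.
  by rewrite (sum_word_eq _ (w := Bseq vqN)).
 rewrite sum_word_neq// (_ : _ == _ = false) ?mul0r//; apply/negbTE/negP => /eqP H.
 have := size_bseq w; rewrite -H size_cat => H'. by move: vqN; rewrite ltnNge (leq_trans (leq_addl _ _) H').
under eq_bigr => u _ do rewrite exchange_big. rewrite exchange_big [RHS]exchange_big; apply: eq_bigr => q _.
under [RHS]eq_bigr => p _ do rewrite tmulE mulr_suml mulr_sumr.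
rewrite [RHS]exchange_big; apply: eq_bigr => u _. under [RHS]eq_bigr => p _ do rewrite mulr_suml mulr_sumr.
rewrite [RHS]exchange_big; apply: eq_bigr => v _.
have E p : (p ++ q == w :> seq 'I_d)%:R * ((u ++ v == p :> seq 'I_d)%:R * (a u * b v) * c q) = (u ++ v == p :>
 seq 'I_d)%:R * ((p ++ q == w :> seq 'I_d)%:R * (a u * (b v * c q))) by lra.
under [RHS]eq_bigr => p _ do rewrite E. have [vqN|vqN] := leqP (size (u ++ v)) N.
 by rewrite (sum_word_eq _ (w := Bseq vqN))//= catA.
rewrite sum_word_neq// (_ : _ == _ = false) ?mul0r//; apply/negbTE/negP => /eqP H.
have := size_bseq w; rewrite -H catA size_cat => H'.
by move: vqN; rewrite ltnNge (leq_trans (leq_addr _ _) H').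
Qed.

Lemma tmulDl a b c : tmul (a + b) c = tmul a c + tmul b c.
apply/ffunP => w; rewrite ffunE [in RHS]ffunE !ffunE -big_split.
by apply: eq_bigr => uv _; rewrite ffunE mulrDl.
Qed.

Lemma tmulDr a b c : tmul a (b + c) = tmul a b + tmul a c.
apply/ffunP => w; rewrite ffunE [in RHS]ffunE !ffunE -big_split.
by apply: eq_bigr => uv _; rewrite ffunE mulrDr.
Qed.

Lemma tmulNl a b : tmul (- a) b = - tmul a b.
apply/ffunP => w; rewrite ffunE [in RHS]ffunE !ffunE -sumrN. by apply: eq_bigr => uv _; rewrite ffunE mulNr.
Qed.

Lemma tmulNr a b : tmul a (- b) = - tmul a b.
apply/ffunP => w; rewrite ffunE [in RHS]ffunE !ffunE -sumrN. by apply: eq_bigr => uv _; rewrite ffunE mulrN.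
Qed.

Lemma tmul1l a : tmul tone a = a.
apply/ffunP => w; rewrite tmulE (bigD1 [bseq])//= [X in _ + X]big1 ?addr0.
 under eq_bigr => v _ do rewrite ffunE /= mul1r eq_sym. by rewrite (sum_word_eq a (w := w)).
move=> u u0; apply: big1 => v _; rewrite ffunE size_eq0.
rewrite (_ : (_ == [::]) = false) ?mul0r ?mulr0//; apply/negbTE. by [].
Qed.

Lemma tmul1r a : tmul a tone = a.
apply/ffunP => w; rewrite tmulE exchange_big (bigD1 [bseq])//= [X in _ + X]big1 ?addr0.
 under eq_bigr => v _ do rewrite ffunE /= mulr1 cats0 eq_sym. by rewrite (sum_word_eq a (w := w)).
move=> u u0; apply: big1 => v _; rewrite [tone _]ffunE size_eq0.
rewrite (_ : (val u == [::]) = false) ?mulr0//; apply/negbTE. by [].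
Qed.

Lemma tpowSr a k : tmul (tpow a k) a = tmul a (tpow a k).
elim: k => [|k IH]; first by rewrite /tpow /= tmul1l tmul1r. by rewrite /tpow iterS -/(tpow a k) -tmulA IH.
Qed.

Lemma tpow_nilpotent a : a [bseq] = 0 -> forall k (w : word), (size w < k)%N -> tpow a k w = 0.
move=> a0; elim=> // k IH w wk; rewrite /tpow iterS -/(tpow a k) tmulE.
apply: big1 => u _; apply: big1 => v _; case: eqP => [E|_]; last by rewrite mul0r.
have [u0|u0] := eqVneq (size u) 0%N.
 have -> : u = [bseq] by apply/val_inj/size0nil. by rewrite a0 mul0r mulr0.
rewrite IH ?mulr0//; move: wk; rewrite -E size_cat; move: u0.
by case: (size u) => // j _; rewrite addSn ltnS => /(leq_ltn_trans (leq_addl _ _)).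
Qed.

Lemma tpow_big a : a [bseq] = 0 -> tpow a N.+1 = 0.
by move=> a0; apply/ffunP => w; rewrite tpow_nilpotent ?ffunE// ltnS size_bseq.
Qed.

Lemma tmul_sumr (I : Type) (r : seq I) a (f : I -> tensor R d N) : tmul a (\sum_(i <- r) f i) = \sum_(i <- r)
  tmul a (f i).
elim: r => [|i r IH]; last by rewrite !big_cons tmulDr IH.
rewrite !big_nil; apply/ffunP => w; rewrite tmulE ffunE big1// => u _.
by rewrite big1// => v _; rewrite ffunE !mulr0.
Qed.

Lemma tmul_suml (I : Type) (r : seq I) a (f : I -> tensor R d N) : tmul (\sum_(i <- r) f i) a = \sum_(i <- r)
  tmul (f i) a.
elim: r => [|i r IH]; last by rewrite !big_cons tmulDl IH.
rewrite !big_nil; apply/ffunP => w; rewrite tmulE ffunE big1// => u _.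
by rewrite big1// => v _; rewrite ffunE mul0r mulr0.
Qed.

(** Neumann series: with [x = 1 - y] the products telescope to [1 - y^(N+1)], and [y] is nilpotent
    because its coordinate along the empty word vanishes. *)
Lemma tinv_mul x : x [bseq] = 1 -> tmul x (tinv x) = tone /\ tmul (tinv x) x = tone.
move=> x1; pose y := tone - x. have y0 : y [bseq] = 0 by rewrite !ffunE x1 subrr.
have xE : x = tone - y by rewrite /y opprB addrC subrK.
have tel : \sum_(k < N.+1) (tpow y k - tpow y k.+1) = tone.
 rewrite -(big_mkord xpredT (fun k => tpow y k - tpow y k.+1)). rewrite -[LHS]opprK -sumrN.
 under eq_bigr do rewrite opprB. by rewrite telescope_sumr// tpow_big// sub0r opprK.
rewrite /tinv -/y {1 2}xE; split.
 rewrite tmul_sumr -[RHS]tel; apply: eq_bigr => k _. by rewrite tmulDl tmul1l tmulNl.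
rewrite tmul_suml -[RHS]tel; apply: eq_bigr => k _. by rewrite tmulDr tmul1r tmulNr tpowSr.
Qed.

Lemma tmul_nil a b : tmul a b [bseq] = a [bseq] * b [bseq].
rewrite tmulE (bigD1 [bseq])//= (bigD1 [bseq])//= mul1r !big1 ?addr0//.
- move=> u u0; apply: big1 => v _; case: eqP => /= [E|_]; last by rewrite mul0r.
 case/negP: u0; apply/eqP/val_inj/size0nil/eqP.
 by rewrite -leqn0 -[X in (_ <= X)%N](erefl (size ([::] : seq 'I_d))) -E size_cat leq_addr.
move=> v v0; case: eqP => /= [E|_]; last by rewrite mul0r. by case/negP: v0; apply/eqP/val_inj.
Qed.

Lemma tinv_nil x : x [bseq] = 1 -> tinv x [bseq] = 1.
move=> x1; have [/ffunP/(_ [bseq]) + _] := tinv_mul x1. by rewrite tmul_nil x1 mul1r ffunE.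
Qed.

Lemma incrementxx (x : R -> tensor R d N) s : x s [bseq] = 1 -> increment x s s = tone. by move=> x1; have [] := tinv_mul x1. Qed.

(** Chen's relation, which for increments of a path in the algebra is pure cancellation at the
    middle time. *)
Lemma inc_chen (x : R -> tensor R d N) s t u : x t [bseq] = 1 -> tmul (increment x s t) (increment x t u) =
  increment x s u.
move=> x1; rewrite /increment -tmulA (tmulA (x t)). by have [-> _] := tinv_mul x1; rewrite tmul1l.
Qed.

Lemma inc_nil (x : R -> tensor R d N) s t : x s [bseq] = 1 -> x t [bseq] = 1 -> increment x s t [bseq] = 1. by move=> xs xt; rewrite tmul_nil tinv_nil// mul1r. Qed.

Lemma texp_nil a : a [bseq] = 0 -> texp a [bseq] = 1.
move=> a0; rewrite /texp sum_ffunE big_ord_recl big1 ?addr0.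
 by rewrite ffunE fact0 invr1 scale1r ffunE.
by move=> k _; rewrite ffunE tpow_nilpotent ?scaler0.
Qed.

Lemma free_lie_nil a : free_lie a -> a [bseq] = 0.
elim=> [i||k b c _ b0 _ c0|b c _ b0 _ c0]; [by rewrite ffunE|by rewrite ffunE| |].
 by rewrite !ffunE b0 c0 scaler0 addr0.
have E : (tmul b c - tmul c b) [bseq] = tmul b c [bseq] - tmul c b [bseq].
 by rewrite [LHS]ffunE; congr (_ + _); rewrite ffunE.
by rewrite E !tmul_nil b0 mul0r mulr0 subrr.
Qed.

Lemma free_group_nil a : free_group a -> a [bseq] = 1. by move=> [b /free_lie_nil b0 <-]; exact: texp_nil. Qed.

End tensor_algebra_theory.

Section tensor_coordinates.
Context {R : realType} {d N : nat}.
Implicit Types a b : tensor R d N.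

(* the coordinate of a tensor along a word, meaningful for words of length at
   most N *)
Definition tcf a (s : seq 'I_d) : R := a (insub_bseq N s).

Lemma val_insub_bseq (s : seq 'I_d) : (size s <= N)%N -> insub_bseq N s = s :> seq _. by move=> sN; rewrite insubdK. Qed.

Lemma tcoefE a (w : N.-bseq 'I_d) : tcf a w = a w. by congr (a _); apply/val_inj; rewrite /= val_insub_bseq// size_bseq. Qed.

Lemma tcoef_nil a : tcf a [::] = a [bseq]. by congr (a _); apply/val_inj; rewrite /= val_insub_bseq. Qed.

Lemma tcoef_tmul a b s : (size s <= N)%N -> tcf (tmul a b) s = \sum_(k < (size s).+1) tcf a (take k s) * tcf b
  (drop k s).
move=> sN; rewrite /tcf ffunE.
rewrite (partition_big (fun uv : N.-bseq 'I_d * N.-bseq 'I_d => inord (size uv.1) : 'I_(size s).+1)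
 xpredT)//=. apply: eq_bigr => k _.
rewrite (big_pred1 (insub_bseq N (take k s), insub_bseq N (drop k s)))// => -[u v] /=.
have ks : (k <= size s)%N by rewrite -ltnS.
have t1 : (size (take k s) <= N)%N by rewrite size_take_min (leq_trans (geq_minr _ _)).
have t2 : (size (drop k s) <= N)%N by rewrite size_drop (leq_trans (leq_subr _ _)).
rewrite (val_insub_bseq sN) xpair_eqE -[u == _]val_eqE -[v == _]val_eqE /=.
rewrite (val_insub_bseq t1) (val_insub_bseq t2). apply/andP/andP => [[/eqP E /eqP kE]|[/eqP -> /eqP ->]].
 have us : (size u < (size s).+1)%N by rewrite -E size_cat ltnS leq_addr.
 have kE' : size u = k by rewrite -kE inordK.
 by rewrite -kE' -[in take _ _]E -[in drop _ _]E take_size_cat// drop_size_cat// !eqxx.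
rewrite cat_take_drop eqxx; split=> //; apply/eqP/val_inj. by rewrite /= size_takel// inord_val.
Qed.

Lemma tcoef_tmul_rcons a b s i : (size s < N)%N -> tcf (tmul a b) (rcons s i) = \sum_(k < (size s).+1) tcf a
  (take k s) * tcf b (rcons (drop k s) i) + tcf a (rcons s i) * tcf b [::].
move=> sN; rewrite tcoef_tmul ?size_rcons// big_ord_recr /=.
rewrite -(size_rcons s i) take_size drop_size; congr (_ + _). rewrite size_rcons; apply: eq_bigr => k _ /=.
have ks : (k <= size s)%N by rewrite -ltnS.
by rewrite -cats1 takel_cat// drop_cat; move: ks; rewrite leq_eqVlt => /predU1P[->|->]; rewrite ?ltnn ?subnn
 ?drop0 ?drop_size ?cats1.
Qed.

End tensor_coordinates.

(** * Signatures of smooth paths *)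

Section smooth_signatures.
Context {R : realType} {d : nat}.
Local Notation mu := (@lebesgue_measure R).
Implicit Types z g : R -> 'rV[R]_d.

Lemma smth_crd g i : smooth_on setT g -> (forall t, derivable (fun r => g r 0 i) t 1) /\ continuous (derive1
  (fun r => g r 0 i)).
move=> sg; have dg t : derivable g t 1 by apply: diff_derivable; exact: (sg [::]).
have dg1 t : derivable ('D_1 g) t 1 by apply: diff_derivable; exact: (sg [:: 1]).
split=> [t|]; first exact: (derivable_mxP _ _ _).1.
have -> : derive1 (fun r => g r 0 i) = fun t => 'D_1 g t 0 i.
 by apply/funext => t; rewrite derive1E derive_mx// mxE.
move=> t; apply: differentiable_continuous; apply/derivable1_diffP.
by have := (derivable_mxP _ _ _).1 (dg1 t) 0 i.
Qed.

(** Induction on the word: continuity of the inner integral makes the fundamental theorem of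
    calculus applicable to the next one. At the starting time [s] continuity is only one-sided,
    hence the separate clause on [[s, b]]. *)
Lemma iter_int_smth g s w : smooth_on setT g -> [/\ forall b, s <= b -> {within `[s, b], continuous (iter_int
  g s w)}, forall t, s < t -> {for t, continuous (iter_int g s w)} & forall i t, s < t -> is_derive t 1
  (iter_int g s (i :: w)) (iter_int g s w t * derive1 (fun r => g r 0 i) t)].
move=> sg; suff H w' : (forall b, s <= b -> {within `[s, b], continuous (iter_int g s w')}) /\ (forall t, s <
 t -> {for t, continuous (iter_int g s w')}) -> [/\ forall i t, s < t -> is_derive t 1 (iter_int g s (i ::
 w')) (iter_int g s w' t * derive1 (fun r => g r 0 i) t) & forall i b, s <= b -> {within `[s, b], continuous
 (iter_int g s (i :: w'))}].
 have H0 : (forall b, s <= b -> {within `[s, b], continuous (iter_int g s w)}) /\ (forall t, s < t -> {for t,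
  continuous (iter_int g s w)}).
  elim: w => [|i w /H[H1 H2]].
   by split=> [b _|t _]; [apply: continuous_subspaceT => t|]; exact: cvg_cst.
  split; first exact: H2. move=> t st; apply: differentiable_continuous; apply/derivable1_diffP.
  by have [] := H1 i t st.
 by have [H1 _] := H _ H0; case: H0.
move=> [cw cw'].
have ci i b : s <= b -> {within `[s, b], continuous (fun r => iter_int g s w' r * derive1 (fun r' => g r' 0 i)
 r)}.
 move=> sb t; apply: cvgM; first exact: cw. apply: continuous_subspaceT; exact: (smth_crd i sg).2.
have ii i b : s <= b -> mu.-integrable `[s, b] (EFin \o (fun r => iter_int g s w' r * derive1 (fun r' => g r'
 0 i) r)).
 move=> sb; apply: continuous_compact_integrable; first exact: segment_compact. exact: ci.
split=> [i t st|i b sb].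
 have tt : t < t + 1 by rewrite ltrDl. have := @continuous_FTC1_closed R _ s t (t + 1) tt (ii i (t + 1) _).
 have stt : s <= t + 1 by lra. move=> /(_ stt st) H.
 have [D1 D2] : derivable (iter_int g s (i :: w')) t 1 /\ derive1 (iter_int g s (i :: w')) t = iter_int g s
  w' t * derive1 (fun r => g r 0 i) t.
  apply: H; apply: cvgM; first exact: cw'. exact: (smth_crd i sg).2.
 exact: (DeriveDef D1 (etrans (esym (derive1E _ _)) D2)).
exact: (parameterized_integral_continuous sb (ii i b sb)).
Qed.

Lemma eq_Rintegral_itv (s t : R) (f h : R -> R) : measurable_fun `]s, t[ h -> (forall r, r \in `]s, t[ -> f r
  = h r) -> \int[mu]_(r in `[s, t]) f r = \int[mu]_(r in `[s, t]) h r.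
move=> mh fh; rewrite /Rintegral; congr fine. apply: eq_integral_itv_bounded => //.
by apply: eq_measurable_fun mh => r; rewrite inE => /fh.
Qed.

(** [z] is prescribed on [[0, T]] only, so its two-sided derivative at the ends carries no
    information; the integrals over the closed interval do not see the ends. *)
Lemma iter_int_smth_path T z g : smooth_on setT g -> {in `[0, T], z =1 g} -> forall s w t, 0 <= s -> t <= T ->
  iter_int z s w t = iter_int g s w t.
move=> sg zg s; elim=> [|i w IH] t s0 tT; first by [].
rewrite /iter_int -/(iter_int z s w) -/(iter_int g s w).
have dE r : 0 < r < T -> derive1 (fun r' => z r' 0 i) r = derive1 (fun r' => g r' 0 i) r.
 move=> rT; rewrite !derive1E; apply: near_eq_derive. have rI : r \in `]0, T[ by [].
 near=> r'; rewrite zg// in_itv /=. have : r' \in `]0, T[ by near: r'; exact: near_in_itvoo.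
 by rewrite in_itv /= => /andP[/ltW -> /ltW ->].
have eqI r : r \in `]s, t[ -> iter_int z s w r * derive1 (fun r' => z r' 0 i) r = iter_int g s w r * derive1
 (fun r' => g r' 0 i) r.
 rewrite in_itv /= => /andP[sr rt]. rewrite dE ?IH//; first by rewrite (letr (ltW rt)). by lra.
have mg : measurable_fun `]s, t[ (fun r => iter_int g s w r * derive1 (fun r' => g r' 0 i) r).
 have [_ c _] := iter_int_smth s w sg.
 apply: measurable_realfun.open_continuous_measurable_fun; first exact: interval_open.
 move=> r; rewrite inE /= in_itv /= => /andP[sr _]. by apply: cvgM; [exact: c|exact: (smth_crd i sg).2].
exact: (eq_Rintegral_itv mg eqI). Unshelve. all: by end_near. Qed.

End smooth_signatures.

(** * Lifts: the differential system of the signature *)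

Section lifts.
Context {R : realType} {d N : nat}.
Implicit Types (x y : R -> tensor R d N) (c : R -> 'I_d -> R).

(** The linear system solved by a signature with velocity [c], the last letter being integrated
    last. It is preserved by left multiplication and, with a rescaled velocity, by dilation, which
    makes it more flexible than iterated integrals. *)
Definition is_lift (a b : R) x c := [/\ forall w, {within `[a, b], continuous (fun t => tcf (x t) w)}, forall
  t, tcf (x t) [::] = 1 & forall w i t, (size w < N)%N -> a < t < b -> is_derive t 1 (fun t => tcf (x t)
  (rcons w i)) (tcf (x t) w * c t i)].

Lemma mean_value_abs (W : normedModType R) (f : R -> W) (a b s t M : R) : a <= s <= b -> a <= t <= b ->
  {within `[a, b], continuous f} -> (forall r, a < r < b -> Num.min s t < r < Num.max s t -> derivable f r 1
  /\ `|'D_1 f r| <= M) -> `|f t - f s| <= M * `|t - s|.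
wlog st : s t / s <= t => [H|].
 case/orP: (le_total s t) => [st|ts]; first exact: H.
 move=> sab tab fc fd; rewrite distrC (distrC t); apply: H => //.
 by move=> r rab; rewrite minC maxC => /(fd _ rab).
move=> /andP[as_ sb] /andP[at_ tb] fc fd; rewrite (ger0_norm (_ : 0 <= t - s)) ?subr_ge0//.
apply: mean_value_le => //.
 apply: continuous_subspaceW fc => r /=; rewrite !in_itv /= => /andP[sr rt].
 by rewrite (letr as_ sr) (letr rt tb).
move=> r /andP[sr rt]; apply: fd.
 by rewrite (le_lt_trans as_ sr) (lt_le_trans rt tb).
by rewrite min_l// max_r// sr rt.
Qed.

Lemma cvg_sumr (U I : Type) (G : set_system U) (FG : Filter G) (W : normedModType R) (r : seq I) (f : I -> U
  -> W) (l : I -> W) : (forall i, f i @ G --> l i) -> (fun t => \sum_(i <- r) f i t) @ G --> \sum_(i <- r) l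
  i.
move=> fl; elim: r => [|i r IH].
 rewrite big_nil; have -> : (fun t => \sum_(i <- [::]) f i t) = cst 0.
  by apply/funext => t; rewrite big_nil.
 exact: cvg_cst.
rewrite big_cons; have -> : (fun t => \sum_(j <- i :: r) f j t) = fun t => f i t + \sum_(j <- r) f j t by
 apply/funext => t; rewrite big_cons. by apply: cvgD.
Qed.

Lemma is_lift_sub (a b a' b' : R) x c : a <= a' -> b' <= b -> is_lift a b x c -> is_lift a' b' x c.
move=> aa bb [xc x1 xd]; split=> //.
 move=> w; apply: continuous_subspaceW (xc w) => r /=.
 by rewrite !in_itv /= => /andP[ar rb]; rewrite (letr aa ar) (letr rb bb).
move=> w i t wN /andP[at_ tb]; apply: xd => //. by lra.
Qed.

Lemma is_lift_tmul (a b : R) (y : tensor R d N) x c : tcf y [::] = 1 -> is_lift a b x c -> is_lift a b (fun t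
  => tmul y (x t)) c.
move=> y1 [xc x1 xd]; split.
- move=> w; have E : (fun t => tcf (tmul y (x t)) w) = fun t => \sum_(k < (size (insub_bseq N w)).+1) tcf y
 (take k (insub_bseq N w)) * tcf (x t) (drop k (insub_bseq N w)).
  by apply/funext => t; rewrite -tcoef_tmul ?size_bseq// tcoefE.
 rewrite E => t; apply: cvg_sumr => k. by apply: cvgM; [exact: cvg_cst|exact: xc].
- by move=> t; rewrite tcoef_nil tmul_nil -!tcoef_nil y1 x1 mulr1.
move=> w i t wN tab.
have E : (fun t => tcf (tmul y (x t)) (rcons w i)) = (fun t => \sum_(k < (size w).+1) tcf y (take k w) * tcf
 (x t) (rcons (drop k w) i)) + cst (tcf y (rcons w i)).
 by apply/funext => r; rewrite tcoef_tmul_rcons// x1 mulr1.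
rewrite E tcoef_tmul ?(ltnW wN)//.
have -> : (fun t => \sum_(k < (size w).+1) tcf y (take k w) * tcf (x t) (rcons (drop k w) i)) = \sum_(k <
 (size w).+1) (tcf y (take k w) \*: (fun t => tcf (x t) (rcons (drop k w) i))).
 by apply/funext => r; rewrite fct_sumE.
have D : is_derive t 1 (\sum_(k < (size w).+1) (tcf y (take k w) \*: (fun t => tcf (x t) (rcons (drop k w)
 i)))) (\sum_(k < (size w).+1) tcf y (take k w) *: (tcf (x t) (drop k w) * c t i)).
 apply: is_derive_sum => k; apply: is_deriveZ; apply: xd => //.
 by rewrite size_drop (leq_ltn_trans (leq_subr _ _)).
have := is_deriveD D (is_derive_cst (tcf y (rcons w i)) t 1).
by rewrite addr0 mulr_suml; under [X in _ -> is_derive _ _ _ X]eq_bigr do rewrite -mulrA.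
Qed.

(** The system is triangular in the length of the word: once the shorter words agree, the difference
    of two solutions has zero derivative. *)
Lemma is_lift_unique (a b : R) x y c : a <= b -> is_lift a b x c -> is_lift a b y c -> x a = y a -> forall t,
  a <= t <= b -> x t = y t.
move=> ab [xc x1 xd] [yc y1 yd] xya t tab; apply/ffunP => w.
rewrite -!tcoefE; move: (size_bseq w) t tab; move: (w : seq 'I_d) => {w} s.
elim/last_ind: s => [_ t tab|s i IH]; first by rewrite x1 y1. rewrite size_rcons => sN t tab.
have aab : a <= a <= b by lra.
have H := @mean_value_abs _ (fun t => tcf (x t) (rcons s i) - tcf (y t) (rcons s i)) a b a t 0 aab tab.
apply/eqP; rewrite -subr_eq0 -normr_le0 -[X in _ <= X](mul0r `|t - a|).
rewrite -[X in `|X|]subr0 -[X in _ - X](subrr (tcf (x a) (rcons s i))) [in X in _ - X]xya.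
rewrite -{1}xya; apply: H.
 by move=> r; apply: cvgB; [exact: xc|exact: yc].
move=> r rab _; have /andP[ar rb] := rab. have [dx Dx] := xd s i r sN rab; have [dy Dy] := yd s i r sN rab.
have D := @is_deriveB _ _ _ (fun t => tcf (x t) (rcons s i)) (fun t => tcf (y t) (rcons s i)) r 1 _ _ (xd s i
 r sN rab) (yd s i r sN rab). have [D1 D2] := D; split; first exact: D1.
have rab' : a <= r <= b by rewrite !ltW. by rewrite [X in `|X|]D2 (IH (ltnW sN) r rab') subrr normr0.
Qed.

Lemma is_lift_bd (a b K s : R) x c : 0 <= K -> (forall t i, a < t < b -> `|c t i| <= K) -> is_lift a b x c ->
  a <= s <= b -> x s = tone -> forall w t, (size w <= N)%N -> a <= t <= b -> `|tcf (x t) w| <= (K * `|t - s|)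
  ^+ size w.
move=> K0 cK [xc x1 xd] sab xs; elim/last_ind => [|w i IH] t.
 by rewrite x1 normr1 expr0.
rewrite size_rcons => wN tab.
have x0 : tcf (x s) (rcons w i) = 0 by rewrite xs /tcf ffunE val_insub_bseq ?size_rcons.
rewrite -[tcf _ _]subr0 -x0 exprSr mulrCA mulrA.
apply: (@mean_value_abs _ (fun t => tcf (x t) (rcons w i)) a b) => // r rab rst.
have [dx Dx] := xd w i r wN rab; split=> //.
rewrite [X in `|X|]Dx normrM mulrC; apply: ler_pM => //; first exact: cK. have /andP[ar rb] := rab.
apply: letr (IH r (ltnW wN) _) _; first by rewrite !ltW.
apply: lerXn2r; rewrite ?nnegrE ?mulr_ge0// ler_wpM2l//. move: rst; case: (leP s t) => st /andP[r1 r2].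
 by rewrite !ger0_norm ?subr_ge0 ?(ltW r1)// lerD2r ltW.
by rewrite !ler0_norm ?subr_le0 ?(ltW r2) ?(ltW st)// lerN2 lerD2r ltW.
Qed.

End lifts.

Section signature_lifts.
Context {R : realType} {d : nat} (N : nat).
Implicit Types (z g : R -> 'rV[R]_d) (s t T : R).

Definition velocity (z : R -> 'rV[R]_d) (t : R) (i : 'I_d) : R := derive1 (fun r => z r 0 i) t.

Lemma vel_smth_path T z g : {in `[0, T], z =1 g} -> forall t i, 0 < t < T -> velocity z t i = velocity g t i.
move=> zg t i tT; rewrite /velocity !derive1E; apply: near_eq_derive. have tI : t \in `]0, T[ by [].
near=> r; rewrite zg// in_itv /=. have : r \in `]0, T[ by near: r; exact: near_in_itvoo.
by rewrite in_itv /= => /andP[/ltW -> /ltW ->]. Unshelve. all: by end_near. Qed.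

Lemma vel_bd T z : smooth_path T z -> exists2 K : R, 0 <= K & forall t i, 0 < t < T -> `|velocity z t i| <= K.
move=> [g sg zg]. have H i : exists2 K : R, 0 <= K & forall t, 0 <= t <= T -> `|velocity g t i| <= K.
 have [T0|T0] := ltP T 0.
  by exists 0 => // t /andP[t0 tT]; have := le_lt_trans (letr t0 tT) T0; rewrite ltxx.
 have c : {within `[0, T], continuous (fun t => `|velocity g t i|)}.
  apply: continuous_subspaceT => t; apply: cvg_norm. exact: (smth_crd i sg).2.
 have [k kT Hk] := EVT_max T0 c. exists `|velocity g k i| => // t tT; apply: Hk; by rewrite in_itv.
pose K i := sval (cid2 (H i)). have K0 i : 0 <= K i by rewrite /K; case: cid2.
exists (\sum_i K i) => [|t i tT]; first by rewrite sumr_ge0. rewrite (vel_smth_path zg)// (bigD1 i)//=.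
have /andP[t0 t1] := tT. have KI : `|velocity g t i| <= K i.
 by rewrite /K; case: cid2 => k _ /(_ t) /=; apply; rewrite !ltW.
by apply: letr KI _; rewrite lerDl sumr_ge0.
Qed.

Lemma vel_cont T z i t : smooth_path T z -> 0 < t < T -> {for t, continuous (velocity z ^~ i)}.
move=> [g sg zg] tT; apply: cvg_trans (_ : velocity g ^~ i @ t --> velocity z t i); last first.
 by rewrite (vel_smth_path zg)//; exact: (smth_crd i sg).2.
apply: near_eq_cvg; have tI : t \in `]0, T[ by rewrite in_itv. near=> r; rewrite (vel_smth_path zg)//.
have : r \in `]0, T[ by near: r; exact: near_in_itvoo. by []. Unshelve. all: by end_near. Qed.

Lemma sig_lift T s z : smooth_path T z -> 0 <= s <= T -> is_lift s T (signature N z s) (velocity z) /\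
  signature N z s s = tone.
move=> [g sg zg] /andP[s0 sT].
have E w t : (size w <= N)%N -> tcf (signature N z s t) w = iter_int z s (rev w) t.
 by move=> wN; rewrite /tcf ffunE val_insub_bseq.
split; last first.
 apply/ffunP => w; rewrite -tcoefE E ?size_bseq// ffunE.
 case: (lastP w) => [//|w' i]; rewrite rev_rcons size_rcons /=. by rewrite set_itv1 Rintegral_set1.
split.
- move=> w; have -> : (fun t => tcf (signature N z s t) w) = iter_int z s (rev (insub_bseq N w)).
  by apply/funext => t; rewrite -E ?size_bseq// tcoefE.
 have [c _ _] := iter_int_smth s (rev (insub_bseq N w)) sg.
 have eqzg : {in `[s, T]%classic, iter_int g s (rev (insub_bseq N w)) =1 iter_int z s (rev (insub_bseq N
  w))}.
  move=> t; rewrite inE /= in_itv /= => /andP[_ tT]. by rewrite (iter_int_smth_path sg zg).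
 exact: (subspace_eq_continuous eqzg (c T sT)).
- by move=> t; rewrite tcoef_nil ffunE.
move=> w i t wN /andP[st tT]. rewrite E ?(ltnW wN)// (vel_smth_path zg) ?(le_lt_trans s0 st)//.
rewrite (iter_int_smth_path sg zg)// ?(ltW tT)//.
have -> : (fun t => tcf (signature N z s t) (rcons w i)) = iter_int z s (i :: rev w).
 by apply/funext => r; rewrite E ?size_rcons// rev_rcons.
have [_ _ D] := iter_int_smth s (rev w) sg. apply: near_eq_is_derive (D i t st).
have tI : t \in `]s, T[ by rewrite in_itv /= st.
near=> r; have : r \in `]s, T[ by near: r; exact: near_in_itvoo. rewrite in_itv /= => /andP[_ rT].
exact: esym (iter_int_smth_path sg zg (i :: rev w) s0 (ltW rT)). Unshelve. all: by end_near. Qed.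

Lemma sig_nil (z : R -> 'rV[R]_d) s t : signature N z s t [bseq] = 1. by rewrite ffunE. Qed.

(** Both sides solve the same system on [[s, T]] and equal [tone] at time [s]; uniqueness replaces
    any manipulation of iterated integrals. *)
Lemma sig_chen T s t z : smooth_path T z -> 0 <= s -> s <= t -> t <= T -> signature N z s t = increment
  (signature N z 0) s t.
move=> sz s0 st tT; have sT := letr st tT; have T0 := letr s0 sT. have s0T : 0 <= s <= T by lra.
have [L1 L2] := sig_lift sz s0T. have T00 : 0 <= (0 : R) <= T by lra. have [L3 _] := sig_lift sz T00.
apply: (is_lift_unique sT L1 (c := velocity z)); last by rewrite st.
 apply: is_lift_tmul; first by rewrite tcoef_nil tinv_nil// sig_nil. exact: is_lift_sub L3.
by rewrite L2 incrementxx// sig_nil.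
Qed.

Lemma inc_lift T s z : smooth_path T z -> 0 <= s <= T -> is_lift 0 T (increment (signature N z 0) s) (velocity
  z) /\ increment (signature N z 0) s s = tone.
move=> sz /andP[s0 sT]; have T0 := letr s0 sT. have T00 : 0 <= (0 : R) <= T by lra.
have [L3 _] := sig_lift sz T00. split; last by rewrite incrementxx// sig_nil.
by apply: is_lift_tmul => //; rewrite tcoef_nil tinv_nil// sig_nil.
Qed.

End signature_lifts.

(** * Sums over words of fixed length *)

Section sums_over_words.
Context {R : realType} {d : nat}.

(** Letters are appended on the right, the side on which [is_lift] differentiates. *)
Fixpoint wsum (W : zmodType) k (f : seq 'I_d -> W) : W := if k is k'.+1 then \sum_(i < d) wsum k' (fun v => f
  (rcons v i)) else f [::].

Lemma eq_wsum (W : zmodType) k (f g : seq 'I_d -> W) : (forall v, size v = k -> f v = g v) -> wsum k f = wsum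
  k g.
elim: k f g => [|k IH] f g fg /=; first exact: fg.
by apply: eq_bigr => i _; apply: IH => v vk; apply: fg; rewrite size_rcons vk.
Qed.

Lemma wsumB (W : zmodType) k (f g : seq 'I_d -> W) : wsum k (fun v => f v - g v) = wsum k f - wsum k g.
elim: k f g => [//|k IH] f g /=; rewrite -sumrN -big_split. by apply: eq_bigr => i _; rewrite IH.
Qed.

Lemma wsum_sum (W : zmodType) (I : Type) (r : seq I) k (f : I -> seq 'I_d -> W) : wsum k (fun v => \sum_(i <-
  r) f i v) = \sum_(i <- r) wsum k (f i).
elim: k f => [//|k IH] f /=; rewrite exchange_big; apply: eq_bigr => i _. by [].
Qed.

Lemma wsum_scale (W : lmodType R) k (f : seq 'I_d -> W) a : wsum k (fun v => a *: f v) = a *: wsum k f.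
elim: k f => [//|k IH] f /=; rewrite scaler_sumr; apply: eq_bigr => i _; exact: IH.
Qed.

Lemma wsum_cat (W : zmodType) j l (f : seq 'I_d -> W) : wsum (j + l) f = wsum l (fun v' => wsum j (fun v => f
  (v ++ v'))).
elim: l f => [|l IH] f /=.
 by rewrite addn0; apply: eq_wsum => v _; rewrite cats0.
rewrite addnS /=; apply: eq_bigr => i _; rewrite IH; apply: eq_wsum => v' _.
by apply: eq_wsum => v _; rewrite rcons_cat.
Qed.

Lemma wsum_map (W W' : zmodType) (L : W -> W') k (f : seq 'I_d -> W) : L 0 = 0 -> (forall x y, L (x + y) = L x
  + L y) -> L (wsum k f) = wsum k (fun v => L (f v)).
move=> L0 LD; elim: k f => [//|k IH] f /=. rewrite (big_morph L LD L0); apply: eq_bigr => i _; exact: IH.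
Qed.

Lemma wsum_norm (W : normedModType R) k (f : seq 'I_d -> W) (C : R) : (forall v, size v = k -> `|f v| <= C) ->
  `|wsum k f| <= d%:R ^+ k * C.
elim: k f C => [|k IH] f C fC /=; first by rewrite expr0 mul1r fC. apply: letr (ler_norm_sum _ _ _) _.
apply: (@le_trans _ _ (\sum_(i < d) d%:R ^+ k * C)).
 by apply: ler_sum => i _; apply: IH => v vk; apply: fC; rewrite size_rcons vk.
by rewrite sumr_const card_ord -[X in X <= _]mulr_natl exprS mulrA.
Qed.

Lemma is_der_wsum (W : normedModType R) k (f : R -> seq 'I_d -> W) (t : R) (df : seq 'I_d -> W) : (forall v,
  size v = k -> is_derive t 1 (fun r => f r v) (df v)) -> is_derive t 1 (fun r => wsum k (f r)) (wsum k df).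
elim: k f df => [|k IH] f df H /=; first exact: H.
have -> : (fun r => \sum_(i < d) wsum k (fun v => f r (rcons v i))) = \sum_(i < d) (fun r => wsum k (fun v =>
 f r (rcons v i))).
 by apply/funext => r; rewrite fct_sumE.
apply: is_derive_sum => i; apply: IH => v vk; apply: H. by rewrite size_rcons vk.
Qed.

Lemma cvg_wsum (U : Type) (G : set_system U) (FG : Filter G) (W : normedModType R) k (f : U -> seq 'I_d -> W)
  l : (forall v, size v = k -> f ^~ v @ G --> l v) -> (fun u => wsum k (f u)) @ G --> wsum k l.
elim: k f l => [|k IH] f l H /=; first exact: H.
apply: cvg_sumr => i; apply: IH => v vk; apply: H; by rewrite size_rcons vk.
Qed.

End sums_over_words.

(** * Taylor expansion along polynomial curves *)

Section polynomial_curves.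
Context {R : realType}.
Implicit Types E F W : normedModType R.

Definition pcurve E n (A : nat -> E) (l : R) : E := \sum_(k < n) l ^+ k *: A k.

Lemma pcurve_bd E n (A : nat -> E) (K l : R) : 0 <= l <= 1 -> (forall k, (k < n)%N -> `|A k| <= K) -> `|pcurve
  n A l| <= n%:R * K.
move=> /andP[l0 l1] AK; apply: letr (ler_norm_sum _ _ _) _. apply: (@le_trans _ _ (\sum_(k < n) K)).
 apply: ler_sum => k _; rewrite normrZ normrX (ger0_norm l0).
 by apply: letr (AK k (ltn_ord k)); rewrite ler_piMl// exprn_ile1.
by rewrite sumr_const card_ord mulr_natl.
Qed.

Lemma pcurve0 E n (A : nat -> E) : pcurve n.+1 A 0 = A 0%N.
rewrite /pcurve big_ord_recl expr0 scale1r big1 ?addr0// => i _. by rewrite exprS mul0r scale0r.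
Qed.

Lemma pcurveS E n (A : nat -> E) l : pcurve n.+1 A l = A 0%N + l *: pcurve n (fun k => A k.+1) l.
rewrite /pcurve big_ord_recl expr0 scale1r scaler_sumr; congr (_ + _).
by apply: eq_bigr => i _; rewrite scalerA exprS.
Qed.

Lemma pcurve_dist0 E n (A : nat -> E) (K l : R) : 0 <= l <= 1 -> (forall k, (0 < k < n.+1)%N -> `|A k| <= K)
  -> `|pcurve n.+1 A l - A 0%N| <= n%:R * K * l.
move=> l01 AK; rewrite pcurveS (addrC (A 0%N)) addrK normrZ.
have /andP[l0 _] := l01; rewrite (ger0_norm l0) mulrC ler_wpM2r//. by apply: pcurve_bd => // k kn; exact: AK.
Qed.

Definition pderiv E (A : nat -> E) n (k : nat) : E := if (k.+1 < n)%N then k.+1%:R *: A k.+1 else 0.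

Lemma is_der_pcurve E n (A : nat -> E) (l : R) : is_derive l 1 (pcurve n A) (pcurve n (pderiv A n) l).
have mono (c : E) k : is_derive l 1 (fun l : R => l ^+ k *: c) ((k%:R * l ^+ k.-1) *: c).
 have dX : is_derive l 1 (fun l : R => l ^+ k) (k%:R * l ^+ k.-1).
  apply: DeriveDef; first exact: exprn_derivable. by rewrite exp_derive /GRing.scale /= mulr1.
 have [dXd DX] := dX. have dd := (derivable1_diffP _ _).1 dXd.
 have [d1 D1] := diff_smul dd (differentiable_cst c l). apply: DeriveDef; first exact: diff_derivable.
 by rewrite D1 DX derive_cst scaler0 addr0.
have -> : pcurve n A = \sum_(k < n) (fun l : R => l ^+ k *: A k).
 by apply/funext => r; rewrite fct_sumE.
have := @is_derive_sum _ _ _ n (fun k (l : R) => l ^+ k *: A k) l 1 (fun k => (k%:R * l ^+ k.-1) *: A k) (fun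
 k => mono (A k) k). rewrite [X in is_derive _ _ _ X -> _](_ : _ = pcurve n (pderiv A n) l)//.
case: n => [|n]; first by rewrite /pcurve !big_ord0.
rewrite /pcurve big_ord_recl mul0r scale0r add0r [RHS]big_ord_recr /pderiv /=.
rewrite ltnn scaler0 addr0; apply: eq_bigr => k _. by rewrite /= ltnS ltn_ord scalerA mulrC.
Qed.

Lemma pderiv_bd E n (A : nat -> E) (K : R) : 0 <= K -> (forall k, (0 < k < n)%N -> `|A k| <= K) -> forall k,
  `|pderiv A n k| <= n%:R * K.
move=> K0 AK k; rewrite /pderiv; case: ifP => [kn|_]; last by rewrite normr0 mulr_ge0.
rewrite normrZ ger0_norm//; apply: ler_pM => //; last exact: AK. by rewrite ler_nat ltnW.
Qed.

Lemma pcurve_pair E F n (A : nat -> E) (B : nat -> F) l : pcurve n (fun k => (A k, B k)) l = (pcurve n A l,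
  pcurve n B l).
rewrite /pcurve; elim: n => [|n IH]; first by rewrite !big_ord0. by rewrite !big_ord_recr /= IH.
Qed.

Lemma is_der_comp1 F W (c : R -> F) (h : F -> W) (t : R) (c' : F) : is_derive t 1 c c' -> differentiable h (c
  t) -> is_derive t 1 (h \o c) ('D_c' h (c t)).
move=> [dc Dc] dh; have dd := (derivable1_diffP _ _).1 dc. apply: DeriveDef; last by rewrite der_comp// Dc.
exact/diff_derivable/differentiable_comp.
Qed.

(** The derivative of [f] along the curve is [dmap f] on the pair formed by the curve and its
    derivative, again a polynomial curve, so induction and integration in [l] apply. The constant
    depends on the gauge level and on a bound for the coefficients of positive degree, not on the
    curve; the dilation argument in [slike_compat] rests on this uniformity. *)
Lemma hclass_pcurve (al : R) (al01 : 0 < al <= 1) m E W (rho : E -> R) (f : E -> W) n (r K : R) : is_gg rho ->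
  0 <= K -> hcl al m rho f -> exists2 C : R, 0 <= C & forall A : nat -> E, (forall k, (0 < k < n.+1)%N -> `|A
  k| <= K) -> (forall l : R, 0 <= l <= 1 -> rho (pcurve n.+1 A l) <= r) -> exists B : nat -> W, forall l : R,
  0 <= l <= 1 -> `|f (pcurve n.+1 A l) - pcurve m.+1 B l| <= C * (l ^+ m * l `^ al).
have al0 : 0 <= al by lra. elim: m E rho f r K => [|m IH] E rho f r K g K0 Hf.
 have [M M0 HM] := hclass_hoelder al01 g Hf r.
 exists (M * (n%:R * K) `^ al); first by rewrite mulr_ge0 ?powR_ge0// ltW.
 move=> A AK Ar; exists (fun=> f (A 0%N)) => l l01; have /andP[l0 l1] := l01.
 rewrite /pcurve big_ord1 expr0 scale1r mul1r.
 have A0r : rho (A 0%N) <= r by rewrite -(pcurve0 n A); apply: Ar; rewrite lexx ler01.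
 apply: letr (HM _ _ (Ar l l01) A0r) _. rewrite -mulrA -powRM ?mulr_ge0// ler_wpM2l ?(ltW M0)//.
 by apply: ge0_ler_powR; rewrite ?nnegrE ?mulr_ge0//; exact: pcurve_dist0.
have df := hclass_diff Hf. pose K' := Num.max K (n.+1%:R * K). have K'0 : 0 <= K' by rewrite le_max K0.
have [C C0 HC] := IH _ _ (dmap f) (Num.max r (n.+1%:R * (n.+1%:R * K))) K' (tgg_gg g) K'0 (hclass_dmap Hf).
exists C => // A AK Ar. have [|l l01|B HB] := HC (fun k => (A k, pderiv A n.+1 k)).
- move=> k kn; rewrite prod_normE /= /K' ge_max !le_max AK//=. by rewrite pderiv_bd ?orbT.
- rewrite pcurve_pair /tgauge /= ge_max !le_max Ar//=; apply/orP; right.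
 by apply: pcurve_bd => // k _; exact: pderiv_bd.
(* The primitive of [B] with the value of [f] at the starting point as constant term, so that the
   remainder [G] vanishes at 0. *)
pose B' k := if k is k'.+1 then (k'.+1%:R)^-1 *: B k' else f (A 0%N).
exists B' => l l01; have /andP[l0 l1] := l01. pose G (mu : R) := f (pcurve n.+1 A mu) - pcurve m.+2 B' mu.
have GD (mu : R) : is_derive mu 1 G (dmap f (pcurve n.+1 A mu, pcurve n.+1 (pderiv A n.+1) mu) - pcurve m.+2
 (pderiv B' m.+2) mu).
 have D1 := is_der_comp1 (is_der_pcurve n.+1 A mu) (df (pcurve n.+1 A mu)).
 exact: (is_deriveB D1 (is_der_pcurve m.+2 B' mu)).
have G0 : G 0 = 0 by rewrite /G !pcurve0 subrr.
have PE (mu : R) : pcurve m.+2 (pderiv B' m.+2) mu = pcurve m.+1 B mu.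
 rewrite /pcurve big_ord_recr /= {2}/pderiv ltnn scaler0 addr0.
 apply: eq_bigr => k _; congr (_ *: _); rewrite /pderiv ltnS ltn_ord /= scalerA.
 by rewrite divff ?scale1r// pnatr_eq0.
rewrite -/(G l) -[G l]subr0 -G0. apply: (@le_trans _ _ (C * (l ^+ m * l `^ al) * (l - 0))); last first.
 by rewrite subr0 exprS -!mulrA [l * (_ * _)]mulrC -mulrA.
apply: mean_value_le => //.
 apply: continuous_subspaceT => mu; apply: differentiable_continuous.
 by apply/derivable1_diffP; have [] := GD mu.
move=> mu /andP[mu0 mul]; have [dG DG] := GD mu; split=> //.
have mu01 : 0 <= mu <= 1 by rewrite (ltW mu0) (letr (ltW mul)).
rewrite DG PE -pcurve_pair; apply: letr (HB mu mu01) _.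
rewrite ler_wpM2l//; apply: ler_pM; rewrite ?exprn_ge0 ?powR_ge0 ?(ltW mu0)//.
 by apply: lerXn2r; rewrite ?nnegrE ?(ltW mu0)// ltW.
by apply: ge0_ler_powR; rewrite ?nnegrE ?(ltW mu0)// ltW.
Qed.

(** Letting [l] tend to 0 kills the constant coefficient; dividing by [l] then gives the same bound
    with [m] lowered by one. *)
Lemma pcurve_eq0 E m (B : nat -> E) (C al s : R) : 0 < al -> 0 < s -> (forall l : R, 0 < l <= s -> `|pcurve
  m.+1 B l| <= C * (l ^+ m * l `^ al)) -> forall k, (k <= m)%N -> B k = 0.
move=> al0 s0. have small (b D : R) : (forall l, 0 < l <= s -> b <= D * (l + l `^ al)) -> b <= 0.
 move=> H. have cv : (fun l : R => D * (l + l `^ al)) @ 0^'+ --> D * (0 + 0).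
  apply: cvgM; first exact: cvg_cst. apply: cvgD; first exact: cvg_within. exact: powR_cvg0.
 have -> : 0 = D * (0 + 0) by lra. have cvb : (fun=> b) @ (0 : R)^'+ --> b by exact: cvg_cst.
 apply: (ler_cvg_to cvb cv); near=> l; apply: H; apply/andP; split=> //. by pos.
elim: m B => [|m IH] B H.
 move=> k; rewrite leqn0 => /eqP ->; apply/eqP; rewrite -normr_le0.
 apply: (small _ `|C|) => l l0s; have := H l l0s.
 rewrite /pcurve big_ord1 expr0 scale1r mul1r => /letr; apply. have /andP[l0 _] := l0s.
 apply: letr (ler_wpM2r (powR_ge0 _ _) (ler_norm C)) _. by rewrite ler_wpM2l// lerDr ltW.
have B0 : B 0%N = 0.
 apply/eqP; rewrite -normr_le0. pose s' := Num.min s 1. have s'0 : 0 < s' by rewrite lt_min s0 ltr01.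
 pose K := \sum_(k < m.+2) `|B k|. have BK k : (0 < k < m.+2)%N -> `|B k| <= K.
  move=> /andP[_ km]; rewrite /K (bigD1 (Ordinal km))//= lerDl sumr_ge0//.
 have KE : 0 <= K by pos.
 have H2 l : 0 < l <= s -> l <= 1 -> `|B 0%N| <= (`|C| + m.+1%:R * K) * (l + l `^ al).
  move=> l0s l1; have /andP[l0 ls] := l0s. have l01 : 0 <= l <= 1 by lra.
  have := pcurve_dist0 l01 BK; rewrite distrC => H3. rewrite -[B 0%N](subrK (pcurve m.+2 B l)).
  apply: letr (ler_normD _ _) _; rewrite mulrDl addrC; apply: lerD.
   apply: letr (H l l0s) _; apply: letr (ler_wpM2r _ (ler_norm C)) _.
    by pos.
   rewrite ler_wpM2l//; apply: (@le_trans _ _ (l `^ al)).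
    by rewrite ler_piMl ?powR_ge0// exprn_ile1// ltW.
   by lra.
  apply: letr H3 _; rewrite ler_wpM2l ?mulr_ge0//. by rewrite lerDl powR_ge0.
 apply: (small _ ((`|C| + m.+1%:R * K) * (1 + s / s'))) => l l0s. have /andP[l0 ls] := l0s.
 have [l1|l1] := leP l s'.
  apply: letr (H2 l l0s _) _; first by rewrite (letr l1)// ge_min lexx orbT.
  rewrite ler_wpM2r ?addr_ge0 ?powR_ge0 ?(ltW l0)//.
  by rewrite ler_peMr ?addr_ge0 ?mulr_ge0// lerDl divr_ge0// ltW.
 have s's : 0 < s' <= s by lra. apply: letr (H2 s' s's _) _; first by rewrite ge_min lexx orbT.
 rewrite -mulrA ler_wpM2l ?addr_ge0 ?mulr_ge0//. apply: (@le_trans _ _ (l + l `^ al)).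
  rewrite lerD ?(ltW l1)//.
  by apply: ge0_ler_powR; rewrite ?nnegrE ?(ltW al0) ?(ltW s'0) ?(ltW l0) ?(ltW l1).
 by rewrite ler_peMl ?addr_ge0 ?powR_ge0 ?(ltW l0)// lerDl divr_ge0// ltW.
case=> [//|k] km; apply: (IH (fun k => B k.+1)) => // l l0s. have /andP[l0 _] := l0s; have := H l l0s.
rewrite pcurveS B0 add0r normrZ (gtr0_norm l0) exprS -!mulrA mulrCA. by rewrite ler_pM2l. Unshelve. all: by end_near. Qed.

End polynomial_curves.

Section uniform_constants.
Context {R : realType}.

Lemma unif_bd (I : finType) (P : I -> R -> Prop) : (forall i C C', C <= C' -> P i C -> P i C') -> (forall i,
  exists C, P i C) -> exists2 C, 0 < C & forall i, P i C.
move=> mono H; have [c Hc] := choice H. exists (1 + \sum_i `|c i|); first by rewrite ltr_pwDl// sumr_ge0.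
move=> i; apply: mono (Hc i); apply: letr (ler_norm _) _.
by rewrite (bigD1 i)//= addrCA lerDl addr_ge0// sumr_ge0.
Qed.

Lemma unif_bd_words d N (P : seq 'I_d -> R -> Prop) : (forall w C C', C <= C' -> P w C -> P w C') -> (forall
  w, (size w <= N)%N -> exists C, P w C) -> exists2 C, 0 < C & forall w, (size w <= N)%N -> P w C.
move=> mono H. have [i|C C0 HC] := @unif_bd (N.-bseq 'I_d) (fun w => P w) (fun w => @mono w).
 by apply: H; exact: size_bseq.
exists C => // w wN; have := HC (insub_bseq N w); by rewrite val_insub_bseq.
Qed.

End uniform_constants.

(** * Pairing of tensors with families indexed by words *)

Section tensor_sums.
Context {R : realType} {d N : nat}.
Implicit Types (a : tensor R d N) (W : normedModType R).

Definition tsum W m a (f : seq 'I_d -> W) : W := \sum_(k < m) wsum k (fun v => tcf a v *: f v).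

Lemma eq_tsum W m a (f f' : seq 'I_d -> W) : (forall v, (size v < m)%N -> f v = f' v) -> tsum m a f = tsum m a
  f'.
move=> ff'; apply: eq_bigr => k _; apply: eq_wsum => v vk; by rewrite ff' ?vk.
Qed.

Lemma tsum1 W a (f : seq 'I_d -> W) : tcf a [::] = 1 -> tsum 1 a f = f [::]. by move=> a1; rewrite /tsum big_ord1 /= a1 scale1r. Qed.

Lemma tsum_tail W m1 m2 a (f : seq 'I_d -> W) (k M : R) : (m1 <= m2)%N -> 0 <= k <= 1 -> 0 <= M -> (forall v,
  (m1 <= size v < m2)%N -> `|tcf a v| <= k ^+ size v /\ `|f v| <= M) -> `|tsum m2 a f - tsum m1 a f| <=
  (\sum_(j < m2) d%:R ^+ j) * M * k ^+ m1.
move=> m12 /andP[k0 k1] M0 H. rewrite /tsum -(subnKC m12) big_split_ord /= addrAC subrr add0r subnKC//.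
apply: letr (ler_norm_sum _ _ _) _.
apply: (@le_trans _ _ (\sum_(i < m2 - m1) d%:R ^+ (m1 + i) * (M * k ^+ m1))).
 apply: ler_sum => i _; apply: wsum_norm => v vi.
 have [|H1 H2] := H v; first by rewrite vi leq_addr /=; case: i {vi} => i /=; lia.
 rewrite normrZ mulrC; apply: ler_pM => //; apply: letr H1 _.
 by rewrite vi exprD ler_piMr ?exprn_ge0// exprn_ile1.
rewrite -mulr_suml -mulrA ler_wpM2r ?mulr_ge0 ?exprn_ge0//.
rewrite -[in leRHS](subnKC m12) [leRHS]big_split_ord /= lerDr. by pos.
Qed.

Lemma tsum_tone W m (f : seq 'I_d -> W) : (m <= N)%N -> tsum m.+1 tone f = f [::].
have toneE (v : seq 'I_d) : (size v <= N)%N -> tcf (tone : tensor R d N) v = (size v == 0%N)%:R.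
 by move=> vN; rewrite /tcf ffunE val_insub_bseq.
move=> mN; rewrite /tsum big_ord_recl /= toneE// scale1r big1 ?addr0// => k _. apply/eqP; rewrite -normr_le0.
have := @wsum_norm _ d W (0 + k.+1) (fun v => tcf tone v *: f v) 0.
rewrite mulr0; apply => v vk; have kN := ltn_ord k. by rewrite toneE ?vk; [rewrite scale0r normr0|lia].
Qed.

Lemma tsumB W m a (f f' : seq 'I_d -> W) : tsum m a (fun v => f v - f' v) = tsum m a f - tsum m a f'.
rewrite /tsum -sumrB; apply: eq_bigr => k _; rewrite -wsumB. by apply: eq_wsum => v _; rewrite scalerBr.
Qed.

Lemma is_der_tsum (T t : R) W m (y : R -> tensor R d N) c (f : seq 'I_d -> W) : (m <= N)%N -> is_lift 0 T y c
  -> 0 < t < T -> is_derive t 1 (fun r => tsum m.+1 (y r) f) (\sum_i c t i *: tsum m (y t) (fun v => f (rcons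
  v i))).
move=> mN [yc y1 yd] tT.
have -> : (fun r => tsum m.+1 (y r) f) = (fun r => f [::]) + \sum_(k < m) (fun r => wsum k.+1 (fun v => tcf (y
 r) v *: f v)).
 apply/funext => r; rewrite /tsum big_ord_recl /= y1 scale1r. by congr (_ + _); rewrite fct_sumE.
rewrite -[X in is_derive _ _ _ X]add0r; apply: is_deriveD.
have -> : \sum_i c t i *: tsum m (y t) (fun v => f (rcons v i)) = \sum_(k < m) \sum_i wsum k (fun v => (tcf (y
 t) v * c t i) *: f (rcons v i)).
 rewrite exchange_big; apply: eq_bigr => i _; rewrite scaler_sumr.
 apply: eq_bigr => k _; rewrite -wsum_scale; apply: eq_wsum => v _. by rewrite scalerA mulrC.
apply: is_derive_sum => k.
pose D v := if v is j :: v' then (tcf (y t) (belast j v') * c t (last j v')) *: f v else 0.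
have -> : \sum_i wsum k (fun v => (tcf (y t) v * c t i) *: f (rcons v i)) = wsum k.+1 D.
 apply: eq_bigr => i _; apply: eq_wsum => v vk; rewrite /D.
 by case: v vk => [|j v] vk //=; rewrite belast_rcons last_rcons.
apply: is_der_wsum => v; case: (lastP v) => [//|v' i]. rewrite size_rcons => -[v'k].
have v'N : (size v' < N)%N by rewrite v'k; exact: leq_trans (ltn_ord k) mN. have [dd DD] := yd v' i t v'N tT.
have DE : D (rcons v' i) = (tcf (y t) v' * c t i) *: f (rcons v' i).
 by rewrite /D; case: (v') => [|j u] //=; rewrite belast_rcons last_rcons.
have dif := (derivable1_diffP _ _).1 dd.
have [d1 D1] := diff_smul dif (differentiable_cst (f (rcons v' i)) t).
apply: DeriveDef; first exact: diff_derivable. by rewrite D1 DD derive_cst scaler0 addr0 DE.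
Qed.

Lemma cont_tsum (T : R) W m (y : R -> tensor R d N) c (f : seq 'I_d -> W) : is_lift 0 T y c -> {within `[0,
  T], continuous (fun r => tsum m (y r) f)}.
move=> [yc _ _] t; apply: cvg_sumr => k; apply: cvg_wsum => v _. apply: cvgZr_tmp; exact: yc.
Qed.

End tensor_sums.

Lemma der_sumr {R : realType} {E W : normedModType R} (f : E -> W) x (I : Type) (r : seq I) (c : I -> R) (u :
  I -> E) : differentiable f x -> 'D_(\sum_(i <- r) c i *: u i) f x = \sum_(i <- r) c i *: 'D_(u i) f x.
move=> df; elim: r => [|i r IH]; last by rewrite !big_cons derDr// IH der_scale.
by rewrite !big_nil -(scale0r 0) der_scale// scale0r.
Qed.

(** * Euler maps: how iterated fields act on the image point *)

Section euler_compatibility.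
Context {R : realType} {d M : nat} (al : R) (al01 : 0 < al <= 1).
Local Notation N := M.+1.
Implicit Types E : normedModType R.

Definition eul E (V : 'I_d -> E -> E) (a : tensor R d N) (x : E) : E := tsum N.+1 a (fun w => vf_word V w x).

(* [K] bounds the speed and [K * T] the length of the underlying path *)
Definition bd_lift (T K s t : R) (y : R -> tensor R d N) c :=
  [/\ is_lift 0 T y c, 0 <= K /\ forall r i, 0 < r < T -> `|c r i| <= K,
      0 <= s <= T /\ 0 <= t <= T & y s = tone].

Lemma bd_lift_val (T K s t : R) y c w : bd_lift T K s t y c -> (size w <= N)%N -> `|tcf (y t) w| <= (K * T) ^+
  size w.
move=> [ly [K0 cK] [/andP[s0 sT] /andP[t0 tT]] ys] wN.
apply: letr (is_lift_bd K0 cK ly _ ys wN _) _; rewrite ?s0 ?t0//.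
apply: lerXn2r; rewrite ?nnegrE ?mulr_ge0//; first exact: letr t0 tT.
by rewrite ler_wpM2l// ler_norml; apply/andP; split; lra.
Qed.

Lemma vfw_bd E (rho : E -> R) (V : 'I_d -> E -> E) : is_gg rho -> (forall i, hcl al M rho (V i)) -> forall r :
  R, exists2 C, 0 < C & forall w, (0 < size w <= N)%N -> forall x, rho x <= r -> `|vf_word V w x| <= C.
move=> g HV r.
have [|w wN|C C0 HC] := @unif_bd_words R d N (fun w C => (0 < size w)%N -> forall x, rho x <= r -> `|vf_word V
 w x| <= C).
- by move=> w C C' CC H w0 x xr; apply: letr CC; exact: H.
- case: w wN => [|i w] wN; first by exists 0.
 have /hclass_bd /(_ r) [C HC] := hclass_vfw al01 g HV (isT : i :: w != [::]) wN. by exists C.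
- by exists C => // w /andP[w0 wN]; exact: HC.
Qed.

Lemma eul_dist E (rho : E -> R) (V : 'I_d -> E -> E) : is_gg rho -> (forall i, hcl al M rho (V i)) -> forall r
  : R, exists2 C, 0 < C & forall (a : tensor R d N) x k, rho x <= r -> 0 <= k <= 1 -> (forall v, (size v <=
  N)%N -> `|tcf a v| <= k ^+ size v) -> tcf a [::] = 1 -> `|eul V a x - x| <= C * k.
move=> g HV r; have [C C0 HC] := vfw_bd g HV r. exists ((\sum_(j < N.+1) d%:R ^+ j) * C).
 by rewrite mulr_gt0// big_ord_recl expr0 ltr_pwDl// sumr_ge0.
move=> a x k xr k01 ak a1. have := @tsum_tail R d N E 1 N.+1 a (fun w => vf_word V w x) k C isT k01 (ltW C0).
rewrite expr1 tsum1//; apply => v /andP[v0 vN]; split; first exact: ak. by apply: HC; rewrite ?v0.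
Qed.

Definition taylor_bd E (rho : E -> R) (V : 'I_d -> E -> E) m w (r C : R) := forall T K s t y c x, bd_lift T K
  s t y c -> K * T <= 1 -> rho x <= r -> `|vf_word V w (eul V (y t) x) - tsum m.+1 (y t) (fun v => vf_word V
  (v ++ w) x)| <= C * ((K * T) ^+ m * (K * T) `^ al).

(** Induction on [m] by differentiating the defect in time. Its derivative is governed by the case
    [m] for the words [[:: i]] and [i :: w], and integration over time [T] at speed [K] gains the
    missing factor [K * T]. The bound is in terms of the length of the path, hence not yet usable
    for the approximations of a rough path. *)
Lemma taylor_bd_exists E (rho : E -> R) (V : 'I_d -> E -> E) : is_gg rho -> (forall i, hcl al M rho (V i)) ->
  forall m w, (0 < size w)%N -> (size w + m <= N)%N -> forall r : R, exists2 C, 0 < C & taylor_bd rho V m w r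
  C.
move=> g HV; have [al0 al1] := andP al01. have KT0 T K s t y c : bd_lift T K s t y c -> 0 <= K * T.
 by move=> [_ [K0 _] [/andP[s0 sT] _] _]; rewrite mulr_ge0// (letr s0).
have one T K s t y c : bd_lift T K s t y c -> forall r, tcf (y r) [::] = 1 by move=> [[]].
have near_x r : exists2 C, 0 < C & forall T K s t y c x, bd_lift T K s t y c -> K * T <= 1 -> rho x <= r ->
 `|eul V (y t) x - x| <= C * (K * T).
 have [C C0 HC] := eul_dist g HV r.
 exists C => // T K s t y c x B KT1 xr; apply: HC; rewrite ?KT1 ?(KT0 _ _ _ _ _ _ B)//.
  by move=> v; exact: bd_lift_val B.
 exact: one B _.
have rho_eul r : exists r', forall T K s t y c x, bd_lift T K s t y c -> K * T <= 1 -> rho x <= r -> rho (eul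
 V (y t) x) <= r' /\ rho x <= r'.
 have [C C0 HC] := near_x r; exists (r + C) => T K s t y c x B KT1 xr.
 have [_ gl _] := g; split; last by rewrite (letr xr)// lerDl ltW.
 apply: letr (gl x _) _; rewrite lerD//; apply: letr (HC _ _ _ _ _ _ _ B KT1 xr) _.
 by rewrite ler_piMr// ltW.
have w0 (w : seq 'I_d) : (0 < size w)%N -> w != [::] by case: w. elim=> [|m IH] w wpos wm r.
 have [r' Hr'] := rho_eul r; have [C C0 HC] := near_x r. rewrite addn0 in wm.
 have [L L0 HL] := hclass_hoelder al01 g (hclass_vfw al01 g HV (w0 _ wpos) wm) r'.
 exists (L * C `^ al) => [|T K s t y c x B KT1 xr]; first by rewrite mulr_gt0// powR_gt0.
 have [e1 e2] := Hr' _ _ _ _ _ _ _ B KT1 xr. rewrite tsum1 /=; last exact: one B _.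
 apply: letr (HL _ _ e1 e2) _; rewrite mul1r -mulrA -powRM ?(ltW C0) ?(KT0 _ _ _ _ _ _ B)//.
 rewrite ler_wpM2l ?(ltW L0)//; apply: ge0_ler_powR; rewrite ?nnegrE ?(ltW al0)//.
  by rewrite mulr_ge0 ?(ltW C0) ?(KT0 _ _ _ _ _ _ B).
 exact: HC B KT1 xr.
have wN : (size w <= N)%N by lia. have m1N : (m.+1 <= N)%N by lia. have [r' Hr'] := rho_eul r.
have sz : hcl al (N - size w).-1.+1 rho (vf_word V w).
 by have := hclass_vfw al01 g HV (w0 _ wpos) wN; rewrite prednK//; lia.
have dw := hclass_diff sz. have [D D0 HD] := dmap_bd dw (hclass_bd (hclass_dmap sz)) r'.
have [S S0 HS] := vfw_bd g HV r.
have tb_mono u C C' : C <= C' -> taylor_bd rho V m u r C -> taylor_bd rho V m u r C'.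
 move=> CC H T K s t y c x B KT1 xr; apply: letr (H _ _ _ _ _ _ _ B KT1 xr) _.
 by rewrite ler_wpM2r// mulr_ge0 ?powR_ge0// exprn_ge0// (KT0 _ _ _ _ _ _ B).
have [i C C'||C1 C10 H1] := @unif_bd R 'I_d (fun i => taylor_bd rho V m [:: i] r).
- exact: tb_mono.
- by move=> i; have [||C C0 HC] := IH [:: i] _ _ r => //; exists C.
have [i C C'||C2 C20 H2] := @unif_bd R 'I_d (fun i => taylor_bd rho V m (i :: w) r).
- exact: tb_mono.
- by move=> i; have [||C C0 HC] := IH (i :: w) _ _ r => //=; [lia|exists C].
(* [B0] collects the errors of the derivative: the derivative [D] of [vf_word V w] times the error
   of the velocity ([C1] from the induction hypothesis, [L] from the words longer than [m]), plus
   the error [C2] for the word [i :: w]. *)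
pose L := (\sum_(j < N) d%:R ^+ j) * S. have L0 : 0 <= L by pos. pose B0 := D * (C1 + L) + C2.
have B00 : 0 <= B0 by rewrite addr_ge0 ?mulr_ge0 ?addr_ge0 ?(ltW C10) ?(ltW C20) ?(ltW D0).
exists (d%:R * B0 + 1) => [|T K s t y c x B KT1 xr]; first by rewrite ltr_wpDl// mulr_ge0.
have k0 := KT0 _ _ _ _ _ _ B. set k := K * T in KT1 k0 *; set X := k ^+ m * k `^ al. have X0 : 0 <= X by pos.
have kX : k ^+ m.+1 <= X.
 rewrite exprSr ler_wpM2l ?exprn_ge0//. have [->|kn0] := eqVneq k 0; first exact: powR_ge0.
 rewrite -[leLHS]powRr1//; apply: ger_powR => //. by rewrite KT1 lt_def kn0 k0.
pose G r0 := vf_word V w (eul V (y r0) x) - tsum m.+2 (y r0) (fun v => vf_word V (v ++ w) x).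
have [ly [K0 cK] [sT tT] ys] := B.
have Gs : G s = 0 by rewrite /G /eul ys (tsum_tone _ (leqnn N)) (tsum_tone _ m1N) subrr.
rewrite -/(G t) -[G t]subr0 -Gs. have [/andP[s0 sT'] /andP[t0 tT']] := (sT, tT).
apply: (@le_trans _ _ (d%:R * (K * (B0 * X)) * `|t - s|)); last first.
 apply: (@le_trans _ _ (d%:R * (K * (B0 * X)) * T)).
  rewrite ler_wpM2l ?(mulr_ge0 _ (mulr_ge0 K0 (mulr_ge0 B00 X0)))//.
  by rewrite ler_norml; apply/andP; split; lra.
 have -> : d%:R * (K * (B0 * X)) * T = d%:R * B0 * (k * X) by rewrite /k; ring.
 have -> : k ^+ m.+1 * k `^ al = k * X by rewrite exprS /X mulrA.
 by rewrite (ler_wpM2r (mulr_ge0 k0 X0))// lerDl.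
apply: (mean_value_abs sT tT).
 have c1 := cont_tsum (m := N.+1) (f := fun v => vf_word V v x) ly.
 have c2 := cont_tsum (m := m.+2) (f := fun v => vf_word V (v ++ w) x) ly.
 move=> z; apply: cvgB; last exact: c2.
 apply: (continuous_comp (c1 z)); exact: differentiable_continuous (dw _).
move=> r0 r0T _. have r0T' : 0 <= r0 <= T by case/andP: r0T => *; rewrite !ltW.
have Br : bd_lift T K s r0 y c by split. have d1 := is_der_tsum (fun v => vf_word V v x) (leqnn N) ly r0T.
have d2 := is_der_tsum (fun v => vf_word V (v ++ w) x) m1N ly r0T.
have [dG DG] := is_deriveB (is_der_comp1 d1 (dw _)) d2. split; first exact: dG.
have -> : 'D_1 G r0 = \sum_i c r0 i *: ( 'D_(tsum N (y r0) (fun v => vf_word V (rcons v i) x)) (vf_word V w)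
 (eul V (y r0) x) - tsum m.+1 (y r0) (fun v => vf_word V (rcons v i ++ w) x)).
 rewrite [LHS]DG der_sumr// -sumrB; apply: eq_bigr => i _. by rewrite scalerBr.
apply: letr (ler_norm_sum _ _ _) _.
apply: (@le_trans _ _ (\sum_(i < d) K * (B0 * X))); last by rewrite sumr_const card_ord mulr_natl.
apply: ler_sum => i _; rewrite normrZ; apply: ler_pM => //; first exact: cK.
set u := tsum N _ _; set e := eul V _ _. have [e1 e2] := Hr' _ _ _ _ _ _ _ Br KT1 xr.
have ub : `|u - V i e| <= (C1 + L) * X.
 have := H1 i _ _ _ _ _ _ _ Br KT1 xr; rewrite vfw1 -/e -/k -/X => h1.
 have h2 : `|u - tsum m.+1 (y r0) (fun v => vf_word V (v ++ [:: i]) x)| <= L * X.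
  apply: (@le_trans _ _ (L * k ^+ m.+1)); last by rewrite ler_wpM2l.
  rewrite /u (eq_tsum _ (f' := fun v => vf_word V (v ++ [:: i]) x)); last first.
   by move=> v _; rewrite cats1.
  apply: tsum_tail; rewrite ?k0//; first exact: ltW.
  move=> v /andP[vm vN]; split; first by apply: bd_lift_val Br _; exact: ltnW.
  by apply: HS; rewrite // size_cat addn1.
 rewrite mulrDl (addrC (C1 * X)); rewrite distrC in h1; apply: letr (lerD h2 h1). exact: ler_distD.
have h3 := H2 i _ _ _ _ _ _ _ Br KT1 xr; rewrite -/e -/k -/X in h3.
have -> : 'D_u (vf_word V w) e = 'D_(u - V i e) (vf_word V w) e + vf_word V (i :: w) e by rewrite derBr//
 subrK. rewrite -addrA /B0 mulrDl; apply: letr (ler_normD _ _) _; apply: lerD.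
 apply: letr (HD _ _ e1) _; rewrite -mulrA. by apply: ler_wpM2l; rewrite ?(ltW D0).
rewrite (eq_tsum _ (f' := fun v => vf_word V (v ++ i :: w) x))// => v _. by rewrite cat_rcons.
Qed.

Definition tdil (l : R) (a : tensor R d N) : tensor R d N := [ffun w : N.-bseq 'I_d => l ^+ size w * a w].

Lemma tcoef_tdil l a v : (size v <= N)%N -> tcf (tdil l a) v = l ^+ size v * tcf a v. by move=> vN; rewrite /tcf ffunE val_insub_bseq. Qed.

Lemma tdil_tone l : tdil l tone = tone.
apply/ffunP => w; rewrite !ffunE. by case: eqP => [->|_]; rewrite ?expr0 ?mulr1 ?mulr0.
Qed.

Lemma tdilK l a : l != 0 -> tdil l (tdil l^-1 a) = a.
by move=> l0; apply/ffunP => w; rewrite !ffunE mulrA -exprMn mulfV// expr1n mul1r.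
Qed.

Lemma tsum_tdil E m l a (f : seq 'I_d -> E) : (m <= N.+1)%N -> tsum m (tdil l a) f = pcurve m (fun k => wsum k
  (fun v => tcf a v *: f v)) l.
move=> mN; apply: eq_bigr => k _; rewrite -wsum_scale; apply: eq_wsum => v vk.
by rewrite scalerA tcoef_tdil ?vk//; have := ltn_ord k; lia.
Qed.

Lemma bd_lift_tdil (l T K s t : R) y c : 0 <= l -> bd_lift T K s t y c -> bd_lift T (l * K) s t (fun r => tdil
  l (y r)) (fun r i => l * c r i).
move=> l0 [[yc y1 yd] [K0 cK] st ys]; split=> //; last by rewrite ys tdil_tone.
 split=> [w|r|w i r wN rT].
 - have -> : (fun r => tcf (tdil l (y r)) w) = (fun r => l ^+ size (insub_bseq N w) * tcf (y r) w).
   by apply/funext => r; rewrite /tcf ffunE.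
  by move=> z; apply: cvgM; [exact: cvg_cst|exact: yc].
 - by rewrite tcoef_tdil// expr0 mul1r.
 - have -> : (fun r => tcf (tdil l (y r)) (rcons w i)) = l ^+ (size w).+1 \*: (fun r => tcf (y r) (rcons w
  i)).
   by apply/funext => u; rewrite tcoef_tdil size_rcons.
  have -> : tcf (tdil l (y r)) w * (l * c r i) = l ^+ (size w).+1 *: (tcf (y r) w * c r i).
   rewrite tcoef_tdil ?(ltnW wN)// /GRing.scale /= exprSr; ring.
  have [d1 D1] := yd w i r wN rT. by apply: DeriveDef; [exact: derivableZ|rewrite deriveZ// D1].
split; first exact: mulr_ge0. by move=> r i rT; rewrite normrM (ger0_norm l0) ler_wpM2l// cK.
Qed.

Definition slike (a : tensor R d N) := exists T K s t y c, bd_lift T K s t y c /\ a = y t.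

(** The change of yardstick from path length to tensor size. Let [b] be [a] rescaled to size 1. At
    [tdil l b] both sides are polynomials in [l] up to [O(l^(m+al))]: the right one exactly, the
    left one by [hclass_pcurve], with a constant that depends on [V] only. For small [l] the path is
    short and [taylor_bd_exists] forces the coefficients to agree; the length of the path enters
    this comparison alone and then disappears. Taking [l = k] gives the claim. *)
Lemma slike_compat E (rho : E -> R) (V : 'I_d -> E -> E) w : is_gg rho -> (forall i, hcl al M rho (V i)) -> (0
  < size w <= N)%N -> forall r : R, exists2 C, 0 < C & forall a x k, rho x <= r -> slike a -> 0 < k <= 1 ->
  (forall v, (size v <= N)%N -> `|tcf a v| <= k ^+ size v) -> `|vf_word V w (eul V a x) - tsum (N - size w).+1
  a (fun v => vf_word V (v ++ w) x)| <= C * (k ^+ (N - size w) * k `^ al).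
move=> g HV /andP[wpos wN] r; set m := (N - size w)%N. have mN : (m.+1 <= N.+1)%N by rewrite /m; lia.
have wne : w != [::] by case: (w) wpos. have [al0 _] := andP al01. have [S S0 HS] := vfw_bd g HV r.
have [L L0 HL] := eul_dist g HV r.
have [|Ct Ct0 HCt] := taylor_bd_exists g HV (m := m) wpos _ r; first by rewrite /m; lia.
have [|Cp Cp0 HCp] := @hclass_pcurve _ al al01 m E E rho (vf_word V w) N (r + L) (d%:R ^+ N * S + \sum_(j <
 N.+1) d%:R ^+ j * S) g _ (hclass_vfw al01 g HV wne wN).
 by rewrite addr_ge0 ?sumr_ge0// ?mulr_ge0 ?exprn_ge0 ?(ltW S0)// => j _; rewrite mulr_ge0 ?exprn_ge0 ?(ltW
  S0).
exists (Cp + 1) => [|a x k xr [T [K [s [t [y [c [B aE]]]]]]] /andP[k0 k1] ak].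
 by rewrite ltr_wpDl.
pose b := tdil k^-1 a. have abk : tdil k b = a by rewrite tdilK// gt_eqF.
have b1 v : (size v <= N)%N -> `|tcf b v| <= 1.
 move=> vN; rewrite tcoef_tdil// normrM normrX gtr0_norm ?invr_gt0//.
 by rewrite exprVn mulrC ler_pdivrMr ?exprn_gt0// mul1r ak.
have bnil : tcf b [::] = 1.
 by rewrite tcoef_tdil// expr0 mul1r aE; case: B => [[]].
pose A j := wsum j (fun v => tcf b v *: vf_word V v x).
have AE l : pcurve N.+1 A l = eul V (tdil l b) x by rewrite /eul tsum_tdil.
have [j /andP[j0 jN]|l /andP[l0 l1]|Q HQ] := HCp A.
- apply: (@le_trans _ _ (d%:R ^+ j * S)).
  apply: wsum_norm => v vj; rewrite -[S]mul1r normrZ; apply: ler_pM => //.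
   by apply: b1; rewrite vj.
  by apply: HS; rewrite // vj j0.
 apply: ler_wpDl; first by rewrite mulr_ge0 ?exprn_ge0// ltW.
 rewrite (bigD1 (Ordinal jN))//= lerDl sumr_ge0// => i _. by pos.
- rewrite AE; have [_ gl _] := g; apply: letr (gl x _) _; rewrite lerD//.
 rewrite -[L]mulr1; apply: HL => //; rewrite ?ler01 ?lexx//.
  move=> v vN; rewrite expr1n tcoef_tdil// normrM normrX (ger0_norm l0).
  by rewrite mulr_ile1 ?exprn_ge0 ?exprn_ile1 ?b1.
 by rewrite tcoef_tdil// expr0 mul1r.
pose Q' j := wsum j (fun v => tcf b v *: vf_word V (v ++ w) x).
have Q'E l : pcurve m.+1 Q' l = tsum m.+1 (tdil l b) (fun v => vf_word V (v ++ w) x) by rewrite tsum_tdil.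
(* [q] is the length of the path belonging to the rescaled tensor, and the range [l <= (1 + q)^-1]
   below guarantees [l * q <= 1], the condition for the length estimate. *)
pose q := k^-1 * K * T. have q0 : 0 <= q.
 have [_ [K0 _] [/andP[s0 sT] _] _] := B. by rewrite !mulr_ge0 ?invr_ge0 ?(ltW k0)// (letr s0).
have QQ' : forall j, (j <= m)%N -> Q j - Q' j = 0.
 apply: (@pcurve_eq0 _ _ m (fun j => Q j - Q' j) (Cp + Ct * (q ^+ m * q `^ al)) al (1 + q)^-1) => //; first
  by rewrite invr_gt0 ltr_pwDl. move=> l /andP[l0 lq].
 have l1 : l <= 1 by rewrite (letr lq)// invf_le1 ?lerDl ?ltr_pwDl.
 have -> : pcurve m.+1 (fun j => Q j - Q' j) l = pcurve m.+1 Q l - pcurve m.+1 Q' l.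
  by rewrite /pcurve -sumrB; apply: eq_bigr => j _; rewrite scalerBr.
 have Bl := bd_lift_tdil (ltW l0) (bd_lift_tdil (_ : 0 <= k^-1) B : bd_lift _ _ _ _ _ _).
 have k'0 : 0 <= k^-1 by pos. have := HCt _ _ _ _ _ _ x (Bl k'0).
 have lqE : l * (k^-1 * K) * T = l * q by rewrite /q; ring. have lq1 : l * q <= 1.
  move: lq; rewrite -[_^-1]div1r ler_pdivlMr ?ltr_pwDl// mulrDr mulr1.
  by apply: letr; rewrite lerDr ltW.
 rewrite lqE => /(_ lq1 xr); rewrite -aE -/b -Q'E -AE => h1.
 have h2 : `|vf_word V w (pcurve N.+1 A l) - pcurve m.+1 Q l| <= Cp * (l ^+ m * l `^ al).
  by apply: HQ; rewrite l1 ltW.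
 have -> : (Cp + Ct * (q ^+ m * q `^ al)) * (l ^+ m * l `^ al) = Cp * (l ^+ m * l `^ al) + Ct * ((l * q) ^+ m
  * (l * q) `^ al).
  rewrite (exprMn m l q) powRM ?(ltW l0)//. by move: (l ^+ m) (q ^+ m) (l `^ al) (q `^ al) => *; ring.
 apply: letr (lerD h2 h1); rewrite [X in _ <= X + _]distrC. exact: ler_distD.
have -> : tsum m.+1 a (fun v => vf_word V (v ++ w) x) = pcurve m.+1 Q k.
 rewrite -abk -Q'E; apply: eq_bigr => j _; congr (_ *: _).
 apply/eqP; rewrite eq_sym -subr_eq0; apply/eqP/QQ'; exact: (ltn_ord j).
rewrite -{1}abk -AE; apply: letr (HQ k _) _; first by rewrite (ltW k0).
by rewrite ler_wpM2r ?lerDl// mulr_ge0 ?powR_ge0 ?exprn_ge0 ?(ltW k0).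
Qed.

(** The closure of [slike]: an increment of a rough path is a limit of signatures without being
    one. *)
Definition glike (a : tensor R d N) := forall e, 0 < e -> exists2 b, slike b & forall v, `|tcf a v - tcf b v|
  <= e.

Lemma slike_nil a : slike a -> tcf a [::] = 1. by move=> [T [K [s [t [y [c [[[_ y1 _] _ _ _] ->]]]]]]]. Qed.

Lemma glike_nil a : glike a -> tcf a [::] = 1.
move=> H; apply/eqP; rewrite -subr_eq0 -normr_le0; apply/ler_addgt0Pl => e e0.
have [b /slike_nil b1 /(_ [::])] := H e e0. by rewrite b1 addr0.
Qed.

Lemma hclass_cont E (W : normedModType R) m (rho : E -> R) (f : E -> W) : is_gg rho -> hcl al m rho f ->
  continuous f.
move=> g Hf x; have [L L0 HL] := hclass_hoelder al01 g Hf (rho x + 1). have [al0 _] := andP al01.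
apply/cvgrPdist_le => e e0. pose de := Num.min 1 ((e / L) `^ al^-1).
have d0 : 0 < de by rewrite lt_min ltr01 powR_gt0// divr_gt0. near=> y. have yd : `|x - y| <= de by [].
have [_ gl _] := g. apply: letr (HL _ _ _ _) _; first by rewrite lerDl.
 apply: letr (gl x _) _; rewrite lerD2l distrC (letr yd)// ge_min lexx//.
rewrite -ler_pdivlMl// mulrC; apply: (@le_trans _ _ (de `^ al)).
 by apply: ge0_ler_powR; rewrite ?nnegrE ?(ltW al0) ?(ltW d0).
apply: (@le_trans _ _ (((e / L) `^ al^-1) `^ al)).
 apply: ge0_ler_powR; rewrite ?nnegrE ?(ltW al0) ?(ltW d0) ?powR_ge0//. by rewrite ge_min lexx orbT.
by rewrite -powRrM mulVf ?gt_eqF// powRr1// divr_ge0 ?(ltW e0) ?(ltW L0). Unshelve. all: by end_near. Qed.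

Lemma cvg_tsum E m (u : nat -> tensor R d N) (a : tensor R d N) (f : seq 'I_d -> E) : (forall v, (fun n => tcf
  (u n) v) @ \oo --> tcf a v) -> (fun n => tsum m (u n) f) @ \oo --> tsum m a f.
move=> H; apply: cvg_sumr => k; apply: cvg_wsum => v _; apply: cvgZr_tmp; exact: H.
Qed.

(** Approximants of [a] have coordinates at most [k^N + k^(size v)], hence at most [(2 k)^(size v)]
    on nonempty words. This doubling is the origin of the condition [k *+ 2 <= 1] and of the powers
    of 2 in the constant. *)
Lemma glike_compat E (rho : E -> R) (V : 'I_d -> E -> E) : is_gg rho -> (forall i, hcl al M rho (V i)) ->
  forall r : R, exists2 C, 0 < C & forall a x k w, rho x <= r -> glike a -> 0 < k -> k *+ 2 <= 1 -> (0 < size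
  w <= N)%N -> (forall v, (size v <= N)%N -> `|tcf a v| <= k ^+ size v) -> `|vf_word V w (eul V a x) - tsum (N
  - size w).+1 a (fun v => vf_word V (v ++ w) x)| <= C * (k ^+ (N - size w) * k `^ al).
move=> g HV r. have [al0 _] := andP al01.
have [|w wN|C C0 HC] := @unif_bd_words R d N (fun w C => (0 < size w)%N -> forall a x k, rho x <= r -> slike a
 -> 0 < k <= 1 -> (forall v, (size v <= N)%N -> `|tcf a v| <= k ^+ size v) -> `|vf_word V w (eul V a x) -
 tsum (N - size w).+1 a (fun v => vf_word V (v ++ w) x)| <= C * (k ^+ (N - size w) * k `^ al)).
- move=> w C C' CC H w0 a x k xr sa k01 ak; apply: letr (H w0 a x k xr sa k01 ak) _.
 by case/andP: k01 => k0 _; rewrite ler_wpM2r// mulr_ge0 ?powR_ge0// exprn_ge0// ltW.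
- have [->|w0] := eqVneq w [::]; first by exists 0.
 have [|C C0 HC] := slike_compat g HV (w := w) _ r; first by rewrite wN andbT; case: (w) w0.
 by exists C => _.
exists (C * (2 ^+ N * 2 `^ al)) => [|a x k w xr ga k0 k1 /andP[w0 wN] ak].
 by pos.
have k2 : 0 < k *+ 2 by lra. have n0 n : 0 < (n.+1%:R : R)^-1 by [].
have [u Hu] := choice (fun n : nat => let: ex_intro2 b h1 h2 := ga _ (n0 n) in ex_intro (fun b => slike b /\
 forall v, `|tcf a v - tcf b v| <= n.+1%:R^-1) b (conj h1 h2)).
have cu v : (fun n => tcf (u n) v) @ \oo --> tcf a v.
 apply/cvgrPdist_le => e e0; near=> n. apply: letr ((Hu n).2 v) _; apply/ltW; near: n.
 exact: near_infty_natSinv_lt (PosNum e0).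
set m := (N - size w)%N. have wne : w != [::] by case: (w) w0.
pose D b := `|vf_word V w (eul V b x) - tsum m.+1 b (fun v => vf_word V (v ++ w) x)|.
have cD : D (u n) @[n --> \oo] --> D a.
 apply: cvg_norm; apply: cvgB; last exact: cvg_tsum. apply: continuous_cvg; last exact: cvg_tsum.
 exact: (hclass_cont g (hclass_vfw al01 g HV wne wN)).
rewrite -/(D a); apply: (cvgr_le_bd _ cD); near=> n.
apply: letr (HC w wN w0 (u n) x (k *+ 2) xr (Hu n).1 _ _) _; rewrite ?k2//.
- move=> v vN; have [->|v0] := eqVneq v [::].
  by rewrite expr0 (slike_nil (Hu n).1) normr1.
 have vpos : (0 < size v)%N by case: (v) v0.
 have k1' : k <= 1 by apply: letr k1; rewrite mulr2n lerDl ltW.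
 rewrite -[tcf _ v](subrK (tcf a v)); apply: letr (ler_normD _ _) _.
 rewrite distrC; apply: (@le_trans _ _ (k ^+ N + k ^+ size v)).
  apply: lerD (ak _ vN); apply: letr ((Hu n).2 v) _; apply/ltW; near: n.
  exact: (near_infty_natSinv_lt (PosNum (exprn_gt0 N k0))).
 apply: (@le_trans _ _ (k ^+ size v *+ 2)).
  by rewrite mulr2n lerD2r; apply: ler_wiXn2l => //; exact: ltW.
 rewrite -mulr_natl -[X in _ <= X ^+ _]mulr_natl exprMn ler_wpM2r ?exprn_ge0 ?(ltW k0)//.
 by rewrite -[leLHS]expr1; apply: ler_weXn2l => //; rewrite ler1n.
have -> : k *+ 2 = 2 * k by rewrite mulr_natl.
rewrite -mulrA ler_wpM2l ?(ltW C0)// exprMn powRM ?(ltW k0)// -/m.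
have -> : 2 ^+ m * k ^+ m * (2 `^ al * k `^ al) = 2 ^+ m * (2 `^ al * (k ^+ m * k `^ al)) :> R.
 by rewrite -!mulrA; congr (_ * _); rewrite mulrCA.
rewrite -mulrA; apply: ler_wpM2r.
 by rewrite !mulr_ge0 ?powR_ge0 ?exprn_ge0 ?(ltW k0).
by apply: ler_weXn2l; [rewrite ler1n|rewrite /m leq_subr]. Unshelve. all: by end_near. Qed.

End euler_compatibility.

(** * The Euler map of a product of tensors *)

Section euler_split.
Context {R : realType} {d M : nat}.
Local Notation N := M.+1.

Lemma sum_triangle (W : zmodType) n (F : nat -> nat -> W) : \sum_(k < n) \sum_(j < k.+1) F j (k - j)%N =
  \sum_(l < n) \sum_(j < n - l) F j l.
elim: n => [|n IH]; first by rewrite !big_ord0.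
rewrite big_ord_recr /= IH [RHS]big_ord_recr /= subSn// subnn big_ord1.
rewrite [X in _ = X + _](eq_bigr (fun l : 'I_n => \sum_(j < n - l) F j l + F (n - l)%N l)); last first.
 by move=> l _; rewrite subSn 1?ltnW// big_ord_recr.
rewrite big_split /= -addrA; congr (_ + _).
rewrite [LHS](reindex_inj rev_ord_inj) /= big_ord_recr /= subSS subnn subn0 addrC.
rewrite [LHS]addrC; congr (_ + _); apply: eq_bigr => l _.
rewrite subSS; congr (F _ _); by have := ltn_ord l; lia.
Qed.

Lemma wsum_takedrop (W : lmodType R) k j (a b : tensor R d N) (f : seq 'I_d -> W) : (j <= k)%N -> wsum k (fun
  w => (tcf a (take j w) * tcf b (drop j w)) *: f w) = wsum (k - j) (fun v' => tcf b v' *: wsum j (fun v =>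
  tcf a v *: f (v ++ v'))).
move=> jk; rewrite -{1}(subnKC jk) wsum_cat; apply: eq_wsum => v' _.
rewrite -wsum_scale; apply: eq_wsum => v vj. by rewrite take_size_cat ?drop_size_cat// scalerA mulrC.
Qed.

Lemma tsum_tmul (E : normedModType R) (a b : tensor R d N) (f : seq 'I_d -> E) : tsum N.+1 (tmul a b) f =
  \sum_(l < N.+1) wsum l (fun v' => tcf b v' *: tsum (N - l).+1 a (fun v => f (v ++ v'))).
transitivity (\sum_(k < N.+1) \sum_(j < k.+1) wsum (k - j) (fun v' => tcf b v' *: wsum j (fun v => tcf a v *:
 f (v ++ v')))).
 apply: eq_bigr => k _.
 transitivity (\sum_(j < k.+1) wsum k (fun w => (tcf a (take j w) * tcf b (drop j w)) *: f w)).
  rewrite -wsum_sum; apply: eq_wsum => w wk.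
  by rewrite tcoef_tmul wk ?scaler_suml//; have := ltn_ord k; lia.
 apply: eq_bigr => j _; apply: wsum_takedrop; by have := ltn_ord j; lia.
rewrite (sum_triangle N.+1 (fun j l => wsum l (fun v' => tcf b v' *: wsum j (fun v => tcf a v *: f (v ++
 v'))))). apply: eq_bigr => l _; rewrite -wsum_sum; apply: eq_wsum => v' _.
rewrite /tsum scaler_sumr subSn//; have := ltn_ord l; lia.
Qed.

(** Exact algebra: grouping the words of the product by the suffix [v'] read from [b] leaves for
    each suffix precisely the difference bounded by [glike_compat], up to replacing [eul V a x] by
    [y]. *)
Lemma eul_tmul (E : normedModType R) (V : 'I_d -> E -> E) (a b : tensor R d N) x y : tcf b [::] = 1 -> eul V b
  y - eul V (tmul a b) x = (y - eul V a x) + \sum_(l < N) wsum l.+1 (fun v' => tcf b v' *: (vf_word V v' y -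
  tsum (N - l.+1).+1 a (fun v => vf_word V (v ++ v') x))).
move=> b1; rewrite {2}/eul tsum_tmul [in LHS]/eul /tsum 2!(big_ord_recl N).
have -> : wsum (ord0 : 'I_N.+1) (fun v => tcf b v *: vf_word V v y) = y by rewrite /= b1 scale1r.
have -> : wsum (ord0 : 'I_N.+1) (fun v' => tcf b v' *: (\sum_(k < (N - (ord0 : 'I_N.+1)).+1) wsum k (fun v =>
 tcf a v *: vf_word V (v ++ v') x))) = eul V a x.
 rewrite /= b1 scale1r /eul /tsum subn0; apply: eq_bigr => k _. by apply: eq_wsum => v _; rewrite cats0.
rewrite opprD addrACA -sumrB; congr (_ + _); apply: eq_bigr => l _.
by rewrite -wsumB; apply: eq_wsum => v' _; rewrite -scalerBr.
Qed.

End euler_split.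

(* [lia] preprocesses the whole context; keep only what concerns [nat] *)
Ltac nlia :=
  repeat match goal with H : ?P |- _ =>
    lazymatch P with
    | nat => fail
    | is_true (leq _ _) => fail
    | is_true (andb (leq _ _) (leq _ _)) => fail
    | @eq nat _ _ => fail
    | _ => clear H
    end
  end; lia.

(** * Davie's estimate on a finite grid *)

Section discrete_davie.
Context {R : realType} {d M : nat} (al p : R).
Context (al01 : 0 < al <= 1) (p1 : 1 <= p) (pN : p < M.+1%:R + al).
Local Notation N := M.+1.
Implicit Types E : normedModType R.

Definition theta : R := (N%:R + al) / p.

(** All that Davie's argument sees of a rough path: Chen's relation and a superadditive [W] whose
    root of order [p] dominates the tensors. Having no continuous time, it fits any partition of any
    interval. *)
Definition rough_grid m (A : nat -> nat -> tensor R d N) (W : nat -> nat -> R) := [/\ forall i j, (i < j <=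
  m)%N -> glike (A i j) /\ forall v, (size v <= N)%N -> `|tcf (A i j) v| <= (W i j `^ p^-1) ^+ size v, forall
  i k j, (i <= k <= j)%N -> (j <= m)%N -> tmul (A i k) (A k j) = A i j, forall i, (i <= m)%N -> A i i = tone
  /\ W i i = 0, forall i j, (i < j <= m)%N -> 0 < W i j & forall i k j, (i <= k <= j)%N -> (j <= m)%N -> W i k
  + W k j <= W i j].

Let p0 : 0 < p. exact: lt_le_trans p1. Qed.

Lemma theta_gt1 : 1 < theta. by rewrite /theta ltr_pdivlMr// mul1r. Qed.

Lemma powR_theta (x : R) : 0 <= x -> x `^ theta = (x `^ p^-1) ^+ N * (x `^ p^-1) `^ al.
move=> x0; have [->|xn0] := eqVneq x 0.
 have al0 : al != 0 by case/andP: al01 => /lt0r_neq0.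
 have th0 : theta != 0 by rewrite gt_eqF// (lt_trans ltr01)// theta_gt1.
 by rewrite (powR0 th0) powR0 ?invr_eq0 ?(gt_eqF p0)// (powR0 al0) mulr0.
rewrite -powR_mulrn ?powR_ge0// -!powRrM -powRD; last by rewrite xn0 implybT.
by congr (_ `^ _); rewrite /theta mulrDl mulrC; congr (_ + _); rewrite mulrC.
Qed.

Lemma grid_ge0 m A W i j : rough_grid m A W -> (i <= j <= m)%N -> 0 <= W i j.
move=> [_ _ W0 Wp _] /andP[]; rewrite leq_eqVlt => /orP[/eqP->|ij] jm.
 by rewrite (W0 _ jm).2.
by apply/ltW/Wp; rewrite ij.
Qed.

Lemma grid_le m A W i j i' j' : rough_grid m A W -> (i' <= i)%N -> (i <= j)%N -> (j <= j')%N -> (j' <= m)%N ->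
  W i j <= W i' j'.
move=> G ii ij jj jm; have [_ _ _ _ Ws] := G. have h1 := Ws i' i j' (_ : (i' <= i <= j')%N) jm.
have h2 := Ws i j j' (_ : (i <= j <= j')%N) jm. have g1 : 0 <= W i' i by apply: (grid_ge0 G); lia.
have g2 : 0 <= W j j' by apply: (grid_ge0 G); lia. have {}h1 : W i' i + W i j' <= W i' j' by apply: h1; lia.
have {}h2 : W i j + W j j' <= W i j' by apply: h2; lia. lra.
Qed.

Lemma grid_compat m A W i j k : rough_grid m A W -> (i < j)%N -> (j <= k)%N -> (k <= m)%N -> forall i' v, (i'
  <= i)%N -> (size v <= N)%N -> `|tcf (A i j) v| <= (W i' k `^ p^-1) ^+ size v.
move=> G ij jk km i' v i'i vN; have [HA _ _ _ _] := G. have [|_ /(_ v vN) H] := HA i j; first by lia.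
apply: letr H _; apply: lerXn2r; rewrite ?nnegrE ?powR_ge0//.
apply: ge0_ler_powR; rewrite ?invr_ge0 ?nnegrE ?(ltW p0)//.
- by apply: (grid_ge0 G); lia.
- by apply: (grid_ge0 G); lia.
- by apply: (grid_le G) => //; lia.
Qed.

(** [k] is the last index with [W i k <= W i j / 2]; then [W i k.+1] carries at least half, and
    superadditivity leaves at most half beyond [k.+1]. The cell from [k] to [k.+1] may be large, but
    it is a single Euler step and contributes no error of its own. *)
Lemma grid_split m A W i j : rough_grid m A W -> (i < j <= m)%N -> exists k, [/\ (i <= k < j)%N, W i k <= W i
  j / 2 & W k.+1 j <= W i j / 2].
move=> G ijm; have [_ _ W0 Wp Ws] := G; have /andP[ij jm] := ijm. have Wij := Wp i j ijm.
pose P k := (i <= k)%N && (W i k <= W i j / 2). have exP : exists k, P k && (k < j)%N.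
 exists i; rewrite /P leqnn ij (W0 i _).2 ?(leq_trans (ltnW ij))// andbT. by lra.
have ub k : P k && (k < j)%N -> (k <= j)%N by case/andP => _ /ltnW.
case: (ex_maxnP exP ub) => k /andP[/andP[ik Wk] kj] kmax. exists k; split=> //; first by rewrite ik.
have h : W i k.+1 + W k.+1 j <= W i j by apply: Ws => //; lia. suff : W i j / 2 <= W i k.+1 by lra.
have [jk|jk] := leqP j k.+1.
 have -> : k.+1 = j by lia. by lra.
rewrite leNgt; apply/negP => /ltW H. by have := kmax k.+1; rewrite /P H jk (leqW ik) ltnn => /(_ isT).
Qed.

(** In [eul_tmul] the fields of words shorter than [N] are Lipschitz, those of words of length [N]
    only Hoelder. Replacing [eul V a x] by [y] costs [k * J] for the first and [k^N * J^al] for the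
    second; the two conditions on [J] keep both below [k^N * k^al]. *)
Lemma eul_defect E (rho : E -> R) (V : 'I_d -> E -> E) : is_gg rho -> (forall i, hcl al M rho (V i)) -> forall
  r : R, exists2 D, 0 < D & forall (a b : tensor R d N) x y (k J : R), glike a -> glike b -> rho x <= r -> rho
  y <= r -> 0 < k -> k *+ 2 <= 1 -> (forall v, (size v <= N)%N -> `|tcf a v| <= k ^+ size v /\ `|tcf b v| <= k
  ^+ size v) -> `|y - eul V a x| <= J -> J <= k -> J * k <= k ^+ N * k `^ al -> `|eul V b y - eul V (tmul a b)
  x - (y - eul V a x)| <= D * (k ^+ N * k `^ al).
move=> g HV r; have [al0 _] := andP al01. have [C C0 HC] := glike_compat al01 g HV r.
have [B B0 HB] := eul_dist al01 g HV r.
have [|w wN|L L0 HL] := @unif_bd_words R d N (fun w L => (0 < size w)%N -> forall x y, rho x <= r + B -> rho y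
 <= r + B -> ((size w < N)%N -> `|vf_word V w x - vf_word V w y| <= L * `|x - y|) /\ (size w = N -> `|vf_word
 V w x - vf_word V w y| <= L * `|x - y| `^ al)).
- move=> w L L' LL H w0 x y xr yr; have [h1 h2] := H w0 x y xr yr; split=> wN.
  by apply: letr (h1 wN) _; rewrite ler_wpM2r.
 by apply: letr (h2 wN) _; rewrite ler_wpM2r// powR_ge0.
- have [->|w0] := eqVneq w [::]; first by exists 0. have Hw := hclass_vfw al01 g HV w0 wN.
 have [wN'|wN'] := ltnP (size w) N.
  have Hw' : hcl al (N - size w).-1.+1 rho (vf_word V w).
   by move: Hw; rewrite prednK// subn_gt0.
  have [L L0 HL] := hclass_lip g Hw' (r + B). exists L => _ x y xr yr; split=> [_|wE]; first exact: HL.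
  by move: wN'; rewrite wE ltnn.
 have [L L0 HL] := hclass_hoelder al01 g Hw (r + B). by exists L => _ x y xr yr; split=> [//|_]; exact: HL.
exists ((\sum_(l < N) d%:R ^+ l.+1) * (L + C) + 1) => [|a b x y k J ga gb xr yr k0 k1 abk yJ Jk JX].
 by rewrite ltr_wpDl// mulr_ge0 ?addr_ge0 ?(ltW L0) ?(ltW C0)// sumr_ge0.
set X := k ^+ N * k `^ al. have k1' : k <= 1 by apply: letr k1; rewrite mulr2n lerDl ltW.
have X0 : 0 <= X by pos. have J0 : 0 <= J by exact: letr yJ. have er : rho (eul V a x) <= r + B.
 have [_ gl _] := g; apply: letr (gl x _) _; rewrite lerD//.
 apply: (@le_trans _ _ (B * k)); last by rewrite ler_piMr// ltW. apply: HB => //; first by rewrite k1' ltW.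
  by move=> v /abk[].
 exact: glike_nil.
have yr' : rho y <= r + B by rewrite (letr yr)// lerDl ltW. rewrite eul_tmul; last exact: glike_nil.
rewrite addrAC subrr add0r; apply: letr (ler_norm_sum _ _ _) _.
apply: (@le_trans _ _ (\sum_(l < N) d%:R ^+ l.+1 * ((L + C) * X))); last first.
 by rewrite -mulr_suml mulrA ler_wpM2r// lerDl.
apply: ler_sum => l _; apply: wsum_norm => v vl. have v0 : (0 < size v)%N by rewrite vl.
have vN : (size v <= N)%N by rewrite vl. have vkN : (0 < size v <= N)%N by rewrite v0.
have := HC a x k v xr ga k0 k1 vkN (fun v vN => (abk v vN).1); rewrite -vl => h1. have bv := (abk v vN).2.
rewrite normrZ -(subrKA (vf_word V v (eul V a x))) mulrDl.
apply: (@le_trans _ _ (k ^+ size v * `|vf_word V v y - vf_word V v (eul V a x)| + k ^+ size v * (C * (k ^+ (N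
 - size v) * k `^ al)))).
 rewrite -mulrDr; apply: ler_pM => //; apply: letr (ler_normD _ _) _. by rewrite lerD2l.
have [h2 h3] := HL v vN v0 _ _ yr' er. apply: lerD; last first.
 by rewrite mulrCA [k ^+ _ * (_ * _)]mulrA -exprD subnKC.
have [vN'|vN'] := ltnP (size v) N.
 apply: (@le_trans _ _ (k * (L * J))).
  apply: ler_pM; rewrite ?exprn_ge0 ?(ltW k0)//.
   by rewrite -[leRHS]expr1; apply: ler_wiXn2l; rewrite ?(ltW k0).
  by apply: letr (h2 vN') _; rewrite ler_wpM2l// ltW.
 by rewrite mulrC -mulrA ler_wpM2l// ltW.
have {}vN' : size v = N by apply/eqP; rewrite eqn_leq vN.
rewrite vN' mulrC /X [X in _ <= L * X]mulrC mulrA ler_wpM2r ?exprn_ge0 ?(ltW k0)//.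
apply: letr (h3 vN') _; rewrite ler_wpM2l ?(ltW L0)//.
apply: ge0_ler_powR; rewrite ?nnegrE ?(ltW al0) ?(ltW k0)//. exact: letr Jk.
Qed.

Lemma eul_tone E (V : 'I_d -> E -> E) x : eul V (tone : tensor R d N) x = x. exact: (tsum_tone _ (leqnn N)). Qed.

Lemma davie_small (L k : R) : 0 <= L -> 0 <= k <= 1 -> L * k `^ al <= 1 -> L * (k ^+ N * k `^ al) <= k /\ L *
  (k ^+ N * k `^ al) * k <= k ^+ N * k `^ al.
move=> L0 /andP[k0 k1] Lk; have [al0 al1] := andP al01.
have kN : k ^+ N <= k by rewrite exprS ler_piMr// exprn_ile1. split.
 apply: letr kN; rewrite mulrCA ler_piMr// exprn_ge0//.
rewrite mulrAC ler_piMl ?mulr_ge0 ?exprn_ge0 ?powR_ge0//. apply: letr Lk; rewrite ler_wpM2l//.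
have [->|kn0] := eqVneq k 0; first exact: powR_ge0. by apply: ger1_powR => //; rewrite k1 lt_def kn0 k0.
Qed.

(** Sewing by halving: [grid_split] cuts an interval into two parts of at most half the control and
    one exact cell. Each part contributes [h / 2] times the error constant, with
    [h = 2^(1 - theta) < 1], and gluing takes two defects [D]; hence [L] is the solution of
    [L = h * L + 2 * D]. The gauge bound that makes the constants available is proved in the same
    induction along the grid. *)
Lemma davie E (rho : E -> R) (V : 'I_d -> E -> E) : is_gg rho -> (forall i, hcl al M rho (V i)) -> forall r :
  R, exists (L K : R), [/\ 0 < L, 0 < K & forall m A W (y : nat -> E), rough_grid m A W -> (forall i, (i <
  m)%N -> y i.+1 = eul V (A i i.+1) (y i)) -> W 0%N m <= K -> rho (y 0%N) <= r -> forall j, (j <= m)%N -> rho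
  (y j) <= r + 1 /\ forall i, (i <= j)%N -> `|y j - eul V (A i j) (y i)| <= L * W i j `^ theta].
move=> g HV r; have [al0 al1] := andP al01. have th1 := theta_gt1. have [D D0 HD] := eul_defect g HV (r + 1).
have [B B0 HB] := eul_dist al01 g HV r. pose h : R := 2 `^ (1 - theta). have h1 : h < 1.
 have ln2 : 0 < ln (2 : R) by rewrite ln_gt0// ltr1n.
 have neg : (1 - theta) * ln 2 < 0 by rewrite pmulr_llt0// subr_lt0.
 by rewrite /h /powR pnatr_eq0 /= -[X in _ < X]expR0 ltr_expR.
have half x : 0 <= x -> (x / 2) `^ theta = h / 2 * x `^ theta.
 move=> x0; rewrite powRM ?invr_ge0// mulrC; congr (_ * _).
 rewrite /h powRB ?pnatr_eq0 ?implybT// powRr1// -(@powR_inv1 R 2)// powRAC.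
 by rewrite powR_inv1 ?powR_ge0// mulrAC (@powR_inv1 R 2)// divff ?mul1r.
pose L := 2 * D / (1 - h). have L0 : 0 < L by rewrite divr_gt0 ?mulr_gt0// subr_gt0.
have LE : h * L + 2 * D = L.
 by rewrite /L; field; rewrite subr_eq0 gt_eqF.
(* Three demands on the step size: [k *+ 2 <= 1] for [eul_defect], [L * k^al <= 1] so that the error
   is an admissible [J], and [B * k <= 1 / 2] so that the trajectory moves by at most 1. *)
pose k0 : R := Num.min (2^-1) (Num.min (L^-1 `^ al^-1) ((2 * B)^-1)).
have k00 : 0 < k0 by rewrite /k0 !lt_min invr_gt0 ltr0n /= powR_gt0 ?invr_gt0//= mulr_gt0.
exists L, (k0 `^ p); split=> //; first exact: powR_gt0. move=> m A W y G yS WK y0r.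
have [HA Chen W0 Wp Ws] := G. have A_glike i j : (i < j)%N -> (j <= m)%N -> glike (A i j).
 by move=> ij jm; have [|] := HA i j; first by rewrite ij.
have small i j : (i <= j)%N -> (j <= m)%N -> let k := W i j `^ p^-1 in [/\ k *+ 2 <= 1, L * k `^ al <= 1 & B *
 k <= 2^-1].
 move=> ij jm k. have kk0 : k <= k0.
  have -> : k0 = (k0 `^ p) `^ p^-1 by rewrite -powRrM mulfV ?gt_eqF// powRr1// ltW.
  apply: ge0_ler_powR; rewrite ?invr_ge0 ?(ltW p0) ?nnegrE ?powR_ge0//.
   by apply: (grid_ge0 G); rewrite ij.
  by apply: letr WK; apply: (grid_le G).
 have k_ge0 : 0 <= k by pos. move: kk0; rewrite !le_min => /andP[e1 /andP[e2 e3]]; split.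
 - by rewrite -mulr_natr -ler_pdivlMr// div1r.
 - rewrite -ler_pdivlMl// mulr1.
  have -> : L^-1 = (L^-1 `^ al^-1) `^ al by rewrite -powRrM mulVf ?gt_eqF// powRr1// invr_ge0 ltW.
  by apply: ge0_ler_powR; rewrite ?nnegrE ?powR_ge0 ?(ltW al0).
 - by rewrite -ler_pdivlMl// -invfM mulrC.
have step n : forall i j, (j - i <= n)%N -> (i <= j <= m)%N -> (forall l, (l < j)%N -> rho (y l) <= r + 1) ->
 `|y j - eul V (A i j) (y i)| <= L * W i j `^ theta.
 elim: n => [|n IH] i j jin /andP[ij jm] ry.
  have -> : j = i by nlia. have [-> ->] := W0 i (leq_trans ij jm).
  by rewrite eul_tone subrr normr0 mulr_ge0 ?powR_ge0// ltW.
 have [ji|ltij] := leqP j i; first by apply: IH => //; nlia. have ijm : (i < j <= m)%N by rewrite ltij.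
 have [k [/andP[ik kj] Wik Wkj]] := grid_split G ijm. set k1 := W i j `^ p^-1.
 have [s1 s2 s3] := small i j ij jm; rewrite -/k1 in s1 s2 s3.
 have k1_gt0 : 0 < k1 by apply: powR_gt0; apply: Wp; rewrite ltij.
 have k1_le1 : k1 <= 1 by apply: letr s1; rewrite mulr2n lerDl ltW.
 have k101 : 0 <= k1 <= 1 by rewrite k1_le1 ltW. have [t1 t2] := davie_small (ltW L0) k101 s2.
 have XE : W i j `^ theta = k1 ^+ N * k1 `^ al.
  by apply: powR_theta; apply: (grid_ge0 G); rewrite ij.
 pose J a b := y b - eul V (A a b) (y a). have J0 a : (a <= m)%N -> J a a = 0.
  by move=> am; rewrite /J (W0 a am).1 eul_tone subrr.
 have defect a b c : (i <= a)%N -> (a <= b)%N -> (b <= c)%N -> (c <= j)%N -> `|J a b| <= L * W i j `^ theta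
  -> `|J a c - J b c - J a b| <= D * W i j `^ theta.
  move=> ia ab bc cj Jab. have triv : 0 <= D * W i j `^ theta by rewrite mulr_ge0 ?powR_ge0// ltW.
  have [E1|ltab] := eqVneq a b.
   by rewrite -E1 J0 ?subr0 ?subrr ?normr0//; nlia.
  have [E1|ltbc] := eqVneq b c.
   by rewrite -E1 J0 ?subr0 ?subrr ?normr0//; nlia.
  have {}ltab : (a < b)%N by rewrite ltn_neqAle ltab. have {}ltbc : (b < c)%N by rewrite ltn_neqAle ltbc.
  have cm : (c <= m)%N by nlia. have bm : (b <= m)%N by nlia. have aj : (a < j)%N by nlia.
  have bj : (b < j)%N by nlia. have ab' : (a <= b <= c)%N by nlia.
  have vbound v : (size v <= N)%N -> `|tcf (A a b) v| <= k1 ^+ size v /\ `|tcf (A b c) v| <= k1 ^+ size v.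
   move=> vN; have bj' : (b <= j)%N by nlia. have ib : (i <= b)%N by nlia.
   split; first exact: (grid_compat G ltab bj' jm ia vN). exact: (grid_compat G ltbc cj jm ib vN).
  have := HD _ _ _ _ k1 (L * W i j `^ theta) (A_glike a b ltab bm) (A_glike b c ltbc cm) (ry a aj) (ry b bj)
   k1_gt0 s1 vbound Jab. rewrite XE (Chen a b c ab' cm) => /(_ t1 t2).
  rewrite (_ : J a c - J b c - J a b = eul V (A b c) (y b) - eul V (A a c) (y a) - (y b - eul V (A a b) (y
   a)))//. by rewrite /J; zmod.
 have mono a b : (i <= a)%N -> (a <= b)%N -> (b <= j)%N -> W a b `^ theta <= W i j `^ theta.
  move=> ia ab bj; apply: ge0_ler_powR; rewrite ?nnegrE.
  - exact: ltW (lt_trans ltr01 th1).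
  - by apply: (grid_ge0 G); nlia.
  - by apply: (grid_ge0 G); nlia.
  - by apply: (grid_le G).
 have Jik : `|J i k| <= L * W i k `^ theta.
  apply: IH; [nlia|nlia|] => l lk; apply: ry; nlia.
 have Jkj : `|J k.+1 j| <= L * W k.+1 j `^ theta.
  apply: IH; [nlia|nlia|] => l lk; apply: ry; nlia.
 have Jkk : J k k.+1 = 0 by rewrite /J yS ?subrr//; nlia. have kj' : (k <= j)%N by nlia.
 have d1 : `|J i j - J k j - J i k| <= D * W i j `^ theta.
  apply: defect => //; apply: letr Jik _; rewrite ler_wpM2l ?(ltW L0)//. exact: mono.
 have d2 : `|J k j - J k.+1 j - J k k.+1| <= D * W i j `^ theta.
  by apply: defect => //; rewrite Jkk normr0 mulr_ge0 ?powR_ge0// ltW.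
 have Wik0 : 0 <= W i k by apply: (grid_ge0 G); nlia. have Wkj0 : 0 <= W k.+1 j by apply: (grid_ge0 G); nlia.
 have Wij0 : 0 <= W i j by apply: (grid_ge0 G); nlia.
 have up x : 0 <= x -> x <= W i j / 2 -> L * x `^ theta <= h / 2 * L * W i j `^ theta.
  move=> x0 xW; have -> : h / 2 * L * W i j `^ theta = L * (h / 2 * W i j `^ theta).
   by rewrite [RHS]mulrCA mulrA.
  rewrite -half// ler_wpM2l ?(ltW L0)//.
  by apply: (ge0_ler_powR (ltW (lt_trans ltr01 th1))); rewrite ?nnegrE ?divr_ge0.
 have {}Jik := letr Jik (up _ Wik0 Wik). have {}Jkj := letr Jkj (up _ Wkj0 Wkj).
 have -> : y j - eul V (A i j) (y i) = (J i j - J k j - J i k) + (J k j - J k.+1 j - J k k.+1) + (J i k + J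
  k.+1 j).
  by rewrite Jkk -/(J i j); zmod.
 apply: letr (ler_normD _ _) _. apply: letr (lerD (ler_normD _ _) (ler_normD _ _)) _.
 apply: letr (lerD (lerD d1 d2) (lerD Jik Jkj)) _. rewrite -mulrDl -mulrDl -mulrDl ler_wpM2r ?powR_ge0//.
 by rewrite -[leRHS]LE; lra.
have main j : (j <= m)%N -> rho (y j) <= r + 1.
 elim/ltn_ind: j => j IH jm. have [->|j0] := eqVneq j 0%N; first by rewrite (letr y0r)// lerDl.
 have jpos : (0 < j <= m)%N by rewrite lt0n j0.
 have hj := step j 0%N j (_ : (j - 0 <= j)%N) (_ : (0 <= j <= m)%N) (fun l lj => IH l lj (leq_trans (ltnW lj)
  jm)). have [s1 s2 s3] := small 0%N j isT jm. set k := W 0%N j `^ p^-1 in s1 s2 s3.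
 have kg : 0 <= k by pos. have k1 : k <= 1 by apply: letr s1; rewrite mulr2n lerDl.
 have [gA bA] := HA 0%N j jpos. have h2 : `|eul V (A 0%N j) (y 0%N) - y 0%N| <= B * k.
  apply: HB => //; first by rewrite kg. exact: glike_nil.
 have h3 : L * W 0%N j `^ theta <= k.
  rewrite (powR_theta (grid_ge0 G _)) ?leq0n//. by apply: (davie_small (ltW L0) _ s2).1; rewrite kg.
 have {}hj : `|y j - eul V (A 0%N j) (y 0%N)| <= k.
  apply: letr h3; apply: hj => //; nlia.
 have [_ gl _] := g; apply: letr (gl (y 0%N) _) _; apply: lerD => //.
 have := ler_distD (eul V (A 0%N j) (y 0%N)) (y j) (y 0%N). move: s1; rewrite mulr2n => s1 hh; lra.
move=> j jm; split; first exact: main. move=> i ij; apply: (step j) => //; [by nlia|by rewrite ij|].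
move=> l lj; apply: main; nlia.
Qed.

End discrete_davie.

(** * Derivatives and linear symmetries of Euler maps *)

Section euler_maps.
Context {R : realType} {d M : nat} (al : R) (al01 : 0 < al <= 1).
Local Notation N := M.+1.
Implicit Types E W : normedModType R.

Lemma der_tsum E W m (a : tensor R d N) (f : seq 'I_d -> E -> W) x : (forall v, (size v < m)%N ->
  differentiable (f v) x) -> differentiable (fun y => tsum m a (fun v => f v y)) x /\ forall u, 'D_u (fun y =>
  tsum m a (fun v => f v y)) x = tsum m a (fun v => 'D_u (f v) x).
have sumE n (g : 'I_n -> E -> W) : (fun y => \sum_(i < n) g i y) = \sum_(i < n) g i.
 by apply/funext => y; rewrite fct_sumE.
have wl k : forall c f', (forall v, size v = k -> differentiable (f' v) x) -> differentiable (fun y => wsum k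
 (fun v => c v *: f' v y)) x /\ forall u, 'D_u (fun y => wsum k (fun v => c v *: f' v y)) x = wsum k (fun v :
 seq 'I_d => c v *: 'D_u (f' v) x : W).
 elim: k => [|k IH] c f' H /=.
  have d0 := H [::] erefl; split; first exact: differentiableZ.
  by move=> u; rewrite deriveZ//; exact: diff_derivable.
 have Hi i := IH (fun v => c (rcons v i)) (fun v => f' (rcons v i)) (fun v vk => H (rcons v i) (etrans
  (size_rcons v i) (congr1 S vk))).
 rewrite sumE; split; first by apply: differentiable_sum => i; exact: (Hi i).1.
 move=> u; rewrite derive_sum; last by move=> i; apply: diff_derivable; exact: (Hi i).1.
 by apply: eq_bigr => i _; exact: (Hi i).2.
move=> H; rewrite /tsum.
have Hk (k : 'I_m) := wl k (fun v => tcf a v) f (fun v vk => H v (eq_ind_r (fun j => (j < m)%N) (ltn_ord k)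
 vk)). rewrite sumE; split; first by apply: differentiable_sum => k; exact: (Hk k).1.
move=> u; rewrite derive_sum; last by move=> k; apply: diff_derivable; exact: (Hk k).1.
by apply: eq_bigr => k _; exact: (Hk k).2.
Qed.

Lemma vfw_diff E (rho : E -> R) (V : 'I_d -> E -> E) m w x : is_gg rho -> (forall i, hcl al m rho (V i)) ->
  (size w <= m)%N -> differentiable (vf_word V w) x.
move=> g HV wm; case: w wm => [|i w] wm; first exact: (@ex_diff _ _ _ _ _ _ _ (is_diff_id x)).
have H := hclass_vfw al01 g HV (isT : i :: w != [::]) (leqW wm).
have {H} : hcl al (m - size (i :: w)).+1 rho (vf_word V (i :: w)) by rewrite -subSn.
by move/hclass_diff; apply.
Qed.

Lemma eul_diff E (rho : E -> R) (V : 'I_d -> E -> E) (a : tensor R d N) x : is_gg rho -> (forall i, hcl al N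
  rho (V i)) -> differentiable (eul V a) x.
move=> g HV; apply: (der_tsum (f := vf_word V) a _).1 => v vN. exact: vfw_diff g HV vN.
Qed.

Lemma tsum_pair E W m (a : tensor R d N) (f : seq 'I_d -> E) (h : seq 'I_d -> W) : tsum m a (fun v => (f v, h
  v)) = (tsum m a f, tsum m a h).
have wl k : forall c f' h', wsum k (fun v : seq 'I_d => c v *: (f' v, h' v) : E * W) = (wsum k (fun v => c v
 *: f' v), wsum k (fun v => c v *: h' v)).
 elim: k => [//|k IH] c f' h' /=.
 rewrite (eq_bigr _ (fun i _ => IH (fun v => c (rcons v i)) (fun v => f' (rcons v i)) (fun v => h' (rcons v
  i)))). by elim/big_rec3: _ => // i y1 y2 y3 _ ->.
rewrite /tsum (eq_bigr _ (fun (k : 'I_m) _ => wl k (tcf a) f h)). by elim/big_rec3: _ => // i y1 y2 y3 _ ->.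
Qed.

Lemma tmap_eul E (rho : E -> R) (V : 'I_d -> E -> E) (a : tensor R d N) : is_gg rho -> (forall i, hcl al N rho
  (V i)) -> eul (fun i => tmap (V i)) a = tmap (eul V a).
move=> g HV; apply/funext => -[x v]; rewrite /tmap /=. rewrite (der_tsum (f := vf_word V) a _).2; last first.
 by move=> w wN; exact: vfw_diff g HV wN.
rewrite /eul -tsum_pair; apply: eq_tsum => w wN. by rewrite (tmap_vfw al01 g HV wN).
Qed.

Lemma linear_map0 E W (L : E -> W) : linear L -> L 0 = 0. by move=> Ll; rewrite -[X in L X](subrr 0) linear_mapB// subrr. Qed.

Lemma linear_mapZ E W (L : E -> W) : linear L -> forall (a : R) x, L (a *: x) = a *: L x. by move=> Ll a x; rewrite -[a *: x]addr0 Ll (linear_map0 Ll) addr0. Qed.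

Lemma tsum_linear E W (L : E -> W) m (a : tensor R d N) (f : seq 'I_d -> E) : linear L -> L (tsum m a f) =
  tsum m a (fun v => L (f v)).
move=> Ll; have L0 := linear_map0 Ll; have LD := linear_mapD Ll.
rewrite /tsum (big_morph L LD L0); apply: eq_bigr => k _.
by rewrite (wsum_map _ _ L0 LD); apply: eq_wsum => v _; rewrite (linear_mapZ Ll).
Qed.

Lemma vfw_linear E (rho : E -> R) (V : 'I_d -> E -> E) (L : E -> E) (C : R) w : is_gg rho -> (forall i, hcl al
  M rho (V i)) -> linear L -> (forall v, `|L v| <= C * `|v|) -> (forall i x, V i (L x) = L (V i x)) -> (size w
  <= N)%N -> forall x, vf_word V w (L x) = L (vf_word V w x).
move=> g HV Ll LC VL; elim: w => [//|i w IH] wN x /=.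
have dw y : differentiable (vf_word V w) y by exact: vfw_diff g HV wN. have {}IH y := IH (ltnW wN) y.
have [dL DL] := lmap_diff Ll LC x. have [dL' DL'] := lmap_diff Ll LC (vf_word V w x).
have E1 : vf_word V w \o L = L \o vf_word V w by apply/funext => y; exact: IH.
have := congr1 (fun f => 'D_(V i x) f x) E1. by rewrite der_comp// DL der_comp// DL' -VL.
Qed.

Lemma eul_linear E (rho : E -> R) (V : 'I_d -> E -> E) (L : E -> E) (C : R) a : is_gg rho -> (forall i, hcl al
  M rho (V i)) -> linear L -> (forall v, `|L v| <= C * `|v|) -> (forall i x, V i (L x) = L (V i x)) -> forall
  x, eul V (a : tensor R d N) (L x) = L (eul V a x).
move=> g HV Ll LC VL x; rewrite /eul tsum_linear//; apply: eq_tsum => w wN.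
exact: vfw_linear g HV Ll LC VL wN x.
Qed.

(* conjugation by the dilations [L] reduces arbitrary radii to radius 1, so that
   a single step size works for all of them *)
Definition dilatable E (rho : E -> R) (V : 'I_d -> E -> E) := forall r : R,
  exists (L L' : E -> E) (C r' : R),
  [/\ linear L /\ forall v, `|L v| <= C * `|v|,
      linear L' /\ forall v, `|L' v| <= C * `|v|,
      forall x, L (L' x) = x,
      forall i x, V i (L x) = L (V i x) &
      (forall x, rho x <= r -> rho (L' x) <= 1) /\ forall x, rho x <= 2 -> rho (L x) <= r'].

Lemma dilatable0 E (V : 'I_d -> E -> E) : dilatable (fun=> 0) V.
move=> r; exists id, id, 1, 0; split=> //.
- by split=> [a u v //|v]; rewrite mul1r.
- by split=> [a u v //|v]; rewrite mul1r.
Qed.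

(** A tangent field is linear in the tangent vector, so it commutes with scaling that vector as
    well. The factor [c], built from [C0] and [r], is large enough for its inverse to bring the
    images under [L'] of all admissible tangent vectors into the unit ball. *)
Lemma dilatable_tmap E (rho : E -> R) (V : 'I_d -> E -> E) : (forall i x, differentiable (V i) x) -> dilatable
  rho V -> dilatable (tgauge rho) (fun i => tmap (V i)).
move=> dV S r; have [L [L' [C [r' [[Ll LC] [L'l L'C] LL' VL [S1 S2]]]]]] := S r. pose C0 := Num.max C 0.
have C00 : 0 <= C0 by rewrite le_max lexx orbT. have LC0 v : `|L v| <= C0 * `|v|.
 by apply: letr (LC v) _; rewrite ler_wpM2r// le_max lexx.
have L'C0 v : `|L' v| <= C0 * `|v|.
 by apply: letr (L'C v) _; rewrite ler_wpM2r// le_max lexx.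
pose c := 1 + C0 * `|r|. have c1 : 1 <= c by rewrite lerDl mulr_ge0. have c0 : 0 < c by lra.
have cI : c^-1 <= 1 by rewrite invf_le1. pose T (q : E * E) := (L q.1, c *: L q.2).
pose T' (q : E * E) := (L' q.1, c^-1 *: L' q.2).
have big (a : R) (K : E -> E) (q : E * E) : 0 <= a <= c -> (forall v, `|K v| <= C0 * `|v|) -> `|(K q.1, a *: K
 q.2) : E * E| <= (c * C0) * `|q|.
 move=> /andP[a0 ac] KC; rewrite prod_normE /= ge_max; apply/andP; split.
  apply: letr (KC _) _; apply: ler_pM => //; first by rewrite ler_peMl.
  by have := fst_bd q; rewrite mul1r.
 rewrite normrZ (ger0_norm a0) -mulrA; apply: ler_pM => //. apply: letr (KC _) _; rewrite ler_wpM2l//.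
 by have := snd_bd q; rewrite mul1r.
have lin (a : R) (K : E -> E) : linear K -> linear (fun q : E * E => (K q.1, a *: K q.2)).
 move=> Kl b u v; apply: (congr2 pair); first exact: Kl. have -> : (b *: u + v).2 = b *: u.2 + v.2 by [].
 by rewrite Kl scalerDr scalerA mulrC -scalerA.
exists T, T', (c * C0), (Num.max r' (c * (C0 * 2))); split.
- by split; [exact: lin|move=> q; apply: big; rewrite // lexx ltW].
- split; [exact: lin|move=> q; apply: big => //]. by rewrite invr_ge0 (ltW c0) (letr cI).
- move=> [x v]; rewrite /T /T' /= LL'; congr pair.
 by rewrite (linear_mapZ Ll) LL' scalerA mulfV ?gt_eqF// scale1r.
- move=> i [x v]; rewrite /T /tmap /= VL; congr pair. have [dL DL] := lmap_diff Ll LC0 x.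
 have [dL' DL'] := lmap_diff Ll LC0 (V i x). rewrite der_scale; last exact: dV.
 have E1 : V i \o L = L \o V i by apply/funext => y; exact: VL. have := congr1 (fun f => 'D_v f x) E1.
 by rewrite der_comp// DL der_comp// DL' => ->.
- split=> -[x v]; rewrite /tgauge /= ge_max => /andP[h1 h2].
  rewrite ge_max S1//= normrZ gtr0_norm ?invr_gt0// mulrC ler_pdivrMr// mul1r.
  apply: letr (L'C0 _) _; rewrite /c; apply: ler_wpDl => //.
  by rewrite ler_wpM2l// (letr h2)// ler_norm.
 rewrite ge_max !le_max S2//= normrZ (gtr0_norm c0); apply/orP; right.
 rewrite ler_wpM2l ?(ltW c0)//; apply: letr (LC0 _) _; by rewrite ler_wpM2l.
Qed.

End euler_maps.

(** * Compositions of Euler maps along partitions *)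

Section euler_flows.
Context {R : realType} {d M : nat} (al p : R).
Context (al01 : 0 < al <= 1) (p1 : 1 <= p) (pN : p < M.+1%:R + al).
Local Notation N := M.+1.
Local Notation theta := (@theta R M al p).
Implicit Types (E W : normedModType R) (X : R -> R -> tensor R d N) (om : R -> R -> R).

(** The continuous-time counterpart of [rough_grid]. The control is positive off the diagonal
    because the Euler estimates rescale tensors by its root. *)
Definition driver (T : R) X om := [/\ forall s t, 0 <= s -> s < t -> t <= T -> glike (X s t) /\ forall v,
  (size v <= N)%N -> `|tcf (X s t) v| <= (om s t `^ p^-1) ^+ size v, forall s u t, 0 <= s -> s <= u -> u <= t
  -> t <= T -> tmul (X s u) (X u t) = X s t, forall s, 0 <= s <= T -> X s s = tone /\ om s s = 0, forall s t,
  0 <= s -> s < t -> t <= T -> 0 < om s t & forall s u t, 0 <= s -> s <= u -> u <= t -> t <= T -> om s u + om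
  u t <= om s t].

Fixpoint efl E (V : 'I_d -> E -> E) X (s : R) (D : seq R) (x : E) : E := if D is u :: D' then efl V X u D'
  (eul V (X s u) x) else x.

Lemma efl_cat E (V : 'I_d -> E -> E) X s D1 D2 x : efl V X s (D1 ++ D2) x = efl V X (last s D1) D2 (efl V X s
  D1 x). by elim: D1 s x => [//|u D1 IH] s x /=; rewrite IH. Qed.

Lemma tmap_comp E W (F : normedModType R) (f : E -> F) (h : F -> W) : (forall x, differentiable f x) ->
  (forall x, differentiable h x) -> tmap (h \o f) = tmap h \o tmap f. by move=> df dh; apply/funext => -[x v]; rewrite /tmap /= der_comp. Qed.

Lemma efl_tmap E (rho : E -> R) (V : 'I_d -> E -> E) X s D : is_gg rho -> (forall i, hcl al N rho (V i)) ->
  (forall x, differentiable (efl V X s D) x) /\ efl (fun i => tmap (V i)) X s D = tmap (efl V X s D).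
move=> g HV; elim: D s => [|u D IH] s.
 split=> [x|]; first exact: (@ex_diff _ _ _ _ _ _ _ (is_diff_id x)).
 apply/funext => -[x v]; rewrite /tmap /=; congr (_, _). by rewrite derive_id.
have dE x : differentiable (eul V (X s u)) x by exact: eul_diff g HV. have [IH1 IH2] := IH u; split=> [x|].
 exact: (differentiable_comp (dE x) (IH1 _)).
rewrite -[efl V X s (u :: D)]/(efl V X u D \o eul V (X s u)) tmap_comp//.
by rewrite -(tmap_eul al01 (X s u) g HV) -IH2.
Qed.

Lemma efl_linear E (rho : E -> R) (V : 'I_d -> E -> E) (L : E -> E) (C : R) X s D : is_gg rho -> (forall i,
  hcl al M rho (V i)) -> linear L -> (forall v, `|L v| <= C * `|v|) -> (forall i x, V i (L x) = L (V i x)) ->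
  forall x, efl V X s D (L x) = L (efl V X s D x).
move=> g HV Ll LC VL; elim: D s => [//|u D IH] s x /=. by rewrite (eul_linear al01 _ g HV Ll LC VL).
Qed.

Lemma driver_mono T X om s u t r : driver T X om -> 0 <= s -> s <= u -> u <= t -> t <= r -> r <= T -> om u t
  <= om s r.
move=> [_ _ o0 op os] s0 su ut tr rT. have pos a b : 0 <= a -> a <= b -> b <= T -> 0 <= om a b.
 move=> a0; rewrite le_eqVlt => /orP[/eqP <- aT|ab bT].
  by rewrite (o0 a _).2// a0.
 by apply/ltW/op.
have h1 := os s u r s0 su (letr ut tr) rT. have h2 := os u t r (letr s0 su) ut tr rT.
have g1 := pos s u s0 su (letr ut (letr tr rT)).
have g2 := pos t r (letr s0 (letr su ut)) tr rT. lra.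
Qed.

Lemma driver_ge0 T X om s t : driver T X om -> 0 <= s -> s <= t -> t <= T -> 0 <= om s t.
move=> [_ _ o0 op _] s0; rewrite le_eqVlt => /orP[/eqP <- tT|st tT].
 by rewrite (o0 s _).2// s0.
by apply/ltW/op.
Qed.

Lemma part_grid T X om s t D : driver T X om -> itv_partition s t D -> 0 <= s -> t <= T -> rough_grid p (size
  D) (fun i j => X (nth t (s :: D) i) (nth t (s :: D) j)) (fun i j => om (nth t (s :: D) i) (nth t (s :: D)
  j)).
move=> [XB Xc X0 op os] PD s0 tT. have [sD /eqP lD] := PD. pose tau := nth t (s :: D).
have sorted_D : sorted <%R (s :: D) by []. have tau_lt i j : (i < j <= size D)%N -> tau i < tau j.
 move=> /andP[ij jD]; apply: (sorted_ltn_nth lt_trans) => //; rewrite inE /= ltnS//.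
 exact: leq_trans (ltnW ij) jD.
have tau_le i j : (i <= j <= size D)%N -> tau i <= tau j.
 move=> /andP[]; rewrite leq_eqVlt => /orP[/eqP ->//|ij jD]. by apply/ltW/tau_lt; rewrite ij.
have tau0 i : (i <= size D)%N -> 0 <= tau i.
 by move=> iD; rewrite (letr s0)//; apply: (tau_le 0%N).
have tauT i : (i <= size D)%N -> tau i <= T.
 move=> iD; apply: letr tT; rewrite -(itv_partition_nth_size t PD). by apply: tau_le; rewrite iD leqnn.
split.
- move=> i j ijD; have /andP[ij jD] := ijD.
 apply: XB; [exact: tau0 (leq_trans (ltnW ij) jD)|exact: tau_lt|exact: tauT].
- move=> i k j /andP[ik kj] jD; have kD := leq_trans kj jD.
 apply: Xc; [exact: tau0 (leq_trans ik kD)|by apply: tau_le; rewrite ik| |exact: tauT].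
 by apply: tau_le; rewrite kj.
- by move=> i iD; apply: X0; rewrite (tau0 _ iD) (tauT _ iD).
- move=> i j ijD; have /andP[ij jD] := ijD.
 apply: op; [exact: tau0 (leq_trans (ltnW ij) jD)|exact: tau_lt|exact: tauT].
- move=> i k j /andP[ik kj] jD; have kD := leq_trans kj jD.
 apply: os; [exact: tau0 (leq_trans ik kD)|by apply: tau_le; rewrite ik| |exact: tauT].
 by apply: tau_le; rewrite kj.
Qed.

Lemma efl_take E (V : 'I_d -> E -> E) X s t D x i : (i < size D)%N -> efl V X s (take i.+1 D) x = eul V (X
  (nth t (s :: D) i) (nth t (s :: D) i.+1)) (efl V X s (take i D) x).
move=> iD; rewrite (take_nth t)// -cats1 efl_cat /=.
congr (eul V (X _ _) _); rewrite (last_nth t) size_take iD. by case: i iD => [//|i] iD /=; rewrite nth_take.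
Qed.

Lemma davie_efl E (rho : E -> R) (V : 'I_d -> E -> E) : is_gg rho -> (forall i, hcl al M rho (V i)) -> forall
  r : R, exists L K : R, [/\ 0 < L, 0 < K & forall T X om s t D x, driver T X om -> 0 <= s -> t <= T ->
  itv_partition s t D -> om s t <= K -> rho x <= r -> rho (efl V X s D x) <= r + 1 /\ `|efl V X s D x - eul V
  (X s t) x| <= L * om s t `^ theta].
move=> g HV r; have [L [K [L0 K0 H]]] := davie al01 p1 pN g HV r.
exists L, K; split=> // T X om s t D x dX s0 tT PD oK xr. have G := part_grid dX PD s0 tT.
have [|||h1 h2] := H _ _ _ (fun i => efl V X s (take i D) x) G _ _ _ (size D) (leqnn _).
- by move=> i iD; exact: efl_take.
- by rewrite /= (itv_partition_nth_size t PD).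
- by rewrite take0.
rewrite take_size in h1 h2; split; first exact: h1.
by have := h2 0%N isT; rewrite take0 /= (itv_partition_nth_size t PD).
Qed.

Definition mesh_le om (K s : R) D := path (fun a b => om a b <= K) s D.

Fixpoint cost om (s : R) D : R := if D is u :: D' then om s u `^ theta + cost om u D' else 0.

Lemma part_split (s t u : R) D1 D2 : itv_partition s t (D1 ++ u :: D2) -> [/\ itv_partition s (last s D1) D1,
  last s D1 < u, itv_partition u t D2 & itv_partition s u (rcons D1 u)].
rewrite /itv_partition last_cat /= cat_path /= => -[/and3P[h1 h2 h3] h4].
by split=> //; rewrite rcons_path last_rcons eqxx h1 h2.
Qed.

Lemma mesh_le_split om K s u D1 D2 : mesh_le om K s (D1 ++ u :: D2) -> [/\ mesh_le om K s D1, om (last s D1) u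
  <= K, mesh_le om K u D2 & mesh_le om K s (rcons D1 u)].
rewrite /mesh_le cat_path /= => /and3P[h1 h2 h3]; split=> //. by rewrite rcons_path h1.
Qed.

Lemma mesh_leW om K K' s D : K <= K' -> mesh_le om K s D -> mesh_le om K' s D. by move=> KK; apply: sub_path => a b /letr; apply. Qed.

(** One factor [om] is kept for superadditivity, the other [theta - 1] powers are bounded by the
    mesh; this is where [theta > 1] makes sums over fine partitions small. *)
Lemma cost_le T X om s t D (h : R) : driver T X om -> 0 <= s -> t <= T -> 0 <= h -> itv_partition s t D ->
  mesh_le om h s D -> cost om s D <= h `^ (theta - 1) * om s t.
move=> dX s0 tT h0; have th1 := @theta_gt1 R M al p p1 pN. elim: D s s0 => [|u D IH] s s0 PD FD /=.
 by rewrite mulr_ge0 ?powR_ge0// (driver_ge0 dX)// (itv_partition_le PD).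
have [_ su PD' _] := @part_split s t u [::] D PD. have [_ ou FD' _] := @mesh_le_split om h s u [::] D FD.
rewrite /= in su ou; have ut := itv_partition_le PD'. have u0 : 0 <= u by lra. have [_ _ _ op os] := dX.
apply: letr (ler_wpM2l (powR_ge0 _ _) (os s u t s0 (ltW su) ut tT)).
rewrite mulrDr; apply: lerD; last exact: IH. have ou0 := driver_ge0 dX s0 (ltW su) (letr ut tT).
rewrite -mulr_powRB1//; last exact: lt_trans ltr01 th1.
rewrite mulrC ler_wpM2r//; apply: ge0_ler_powR; rewrite ?nnegrE// subr_ge0 ltW//.
Qed.

(** No explosion. Davie's estimate asks for [om <= K] with [K] depending on the radius, and the
    radius grows from block to block. Conjugation by the maps of [dilatable] lets the [K] of radius
    1 serve all radii, so a control of at most [Om] is exhausted by a number of blocks fixed in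
    advance. *)
Lemma efl_bd E (rho : E -> R) (V : 'I_d -> E -> E) : is_gg rho -> (forall i, hcl al M rho (V i)) -> dilatable
  rho V -> exists2 K : R, 0 < K & forall r Om : R, exists r' : R, forall T X om s t D x, driver T X om -> 0 <=
  s -> t <= T -> itv_partition s t D -> mesh_le om K s D -> om s t <= Om -> rho x <= r -> rho (efl V X s D x)
  <= r'.
move=> g HV S; have [L [K [L0 K0 H]]] := davie_efl g HV 1.
have block (r : R) : exists r', forall T X om s t D x, driver T X om -> 0 <= s -> t <= T -> itv_partition s t
 D -> om s t <= K -> rho x <= r -> rho (efl V X s D x) <= r'.
 have [A [A' [C [r' [[Al AC] [A'l A'C] AA' VA [S1 S2]]]]]] := S r.
 exists r' => T X om s t D x dX s0 tT PD oK xr. rewrite -(AA' x) (efl_linear _ _ _ g HV Al AC VA); apply: S2.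
 have [h _] := H T X om s t D (A' x) dX s0 tT PD oK (S1 _ xr). by [].
exists K => // r Om.
suff main n : forall r : R, exists r' : R, forall T X om s t D x, driver T X om -> 0 <= s -> t <= T ->
 itv_partition s t D -> mesh_le om K s D -> om s t <= n%:R * K -> rho x <= r -> rho (efl V X s D x) <= r'.
 have [r' Hr'] := main (Num.bound `|Om / K|) r. exists r' => T X om s t D x dX s0 tT PD FD oO xr.
 apply: (Hr' T X om s t D x) => //; apply: letr oO _.
 rewrite -ler_pdivrMr//; apply/ltW; apply: le_lt_trans (ler_norm _) _. exact: archi_boundP (normr_ge0 _).
elim: n => [|n IH] {}r.
 have [r1 Hr1] := block r; exists r1 => T X om s t D x dX s0 tT PD FD oO xr.
 apply: (Hr1 T X om s t D x) => //; apply: letr oO _. by lra.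
have [r1 Hr1] := block r; have [r2 Hr2] := block r1; have [r3 Hr3] := IH r2.
exists (Num.max r1 r3) => T X om s t D x dX s0 tT PD FD oO xr. have [_ _ o0 op os] := dX.
have st := itv_partition_le PD. have oss : om s s <= K by rewrite (o0 s _).2 ?s0 ?(letr st)// ltW.
have [hasD|nhas] := boolP (has (fun u => K < om s u) D); last first.
 rewrite le_max; apply/orP; left; apply: (Hr1 T X om s t D x) => //. have [_ /eqP <-] := PD.
 case: (D) nhas => [//|u D'] /hasPn H'.
 by rewrite leNgt; apply: H'; rewrite -[last _ _]/(last u D') mem_last.
(* A block ends at the last point before the control from [s] exceeds [K]; the cell crossing the
   threshold is small by the mesh condition and is treated as a block of its own. Beyond it the
   remaining control has dropped by [K]. *)
set k := find (fun u => K < om s u) D; pose u := nth t D k. have kD : (k < size D)%N by rewrite -has_find.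
have DE : D = take k D ++ u :: drop k.+1 D by rewrite -drop_nth ?cat_take_drop.
move: PD FD; rewrite {1 2}DE => PD FD.
have [P1 au P2 _] := part_split PD; have [_ oau F2 _] := mesh_le_split FD.
set a := last s (take k D) in P1 au oau. have sa := itv_partition_le P1; have ut := itv_partition_le P2.
have a0 := letr s0 sa; have u0 : 0 <= u by rewrite (letr a0)// ltW.
have uT := letr ut tT; have aT : a <= T by rewrite (letr _ uT)// ltW. have oa : om s a <= K.
 rewrite /a; case kE: k => [|k0]; first by rewrite take0. have k0D : (k0 < size D)%N by rewrite ltnW// -kE.
 rewrite (take_nth t k0D) last_rcons leNgt. have := @before_find _ t (fun u => K < om s u) D k0.
 by rewrite -/k kE ltnSn => /(_ isT) ->.
have ou : K < om s u.
 by have := nth_find t hasD; rewrite -/k -/u.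
rewrite {1}DE efl_cat /= -/a le_max; apply/orP; right. apply: (Hr3 T X om u t) => //.
 have := os s u t s0 (letr sa (ltW au)) ut tT. move: oO; rewrite -natr1 mulrDl mul1r => h1 h2; lra.
apply: (Hr2 T X om a u [:: u]) => //; first exact: itv_partition1. exact: (Hr1 T X om s a).
Qed.

Lemma der_bd_unit E W (f : E -> W) z (C : R) : differentiable f z -> (forall v, `|v| <= 1 -> `|'D_v f z| <= C)
  -> forall v, `|'D_v f z| <= C * `|v|.
move=> df H v; have [->|v0] := eqVneq v 0; first by rewrite derive0 !normr0 mulr0.
have vp : 0 < `|v| by rewrite normr_gt0.
have -> : 'D_v f z = `|v| *: 'D_(`|v|^-1 *: v) f z by rewrite -der_scale// scalerA divff ?gt_eqF// scale1r.
rewrite normrZ normr_id mulrC ler_pM2r//; apply: H => //.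
by rewrite normrZ ger0_norm ?invr_ge0// mulVf ?gt_eqF.
Qed.

(** One derivative more than Davie's estimate needs ([N] instead of [M]), so that the tangent system
    still satisfies that estimate; this yields Lipschitz flows. *)
Definition good_sys E (rho : E -> R) (V : 'I_d -> E -> E) := [/\ is_gg rho, forall i, hcl al N rho (V i) &
  dilatable rho V].

Lemma good_weak E (rho : E -> R) (V : 'I_d -> E -> E) : good_sys rho V -> forall i, hcl al M rho (V i). by move=> [g HV _] i; apply: (hclass_le al01 g _ (HV i)). Qed.

Lemma good_tmap_weak E (rho : E -> R) (V : 'I_d -> E -> E) : good_sys rho V -> [/\ is_gg (tgauge rho), forall
  i, hcl al M (tgauge rho) (tmap (V i)) & dilatable (tgauge rho) (fun i => tmap (V i))].
move=> [g HV S]; split; first exact: tgg_gg.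
 by move=> i; exact: hclass_tmap al01 _ _ _ _ _ g (HV i).
by apply: dilatable_tmap => // i x; exact: hclass_diff (HV i) x.
Qed.

(** The derivative of the composed map is the second component of the composition for the tangent
    system, so the gauge bound [efl_bd] for that system already bounds the derivative. *)
Lemma efl_tan_bd E (rho : E -> R) (V : 'I_d -> E -> E) : good_sys rho V -> exists2 K : R, 0 < K & forall r Om
  : R, exists C : R, forall T X om s t D x v, driver T X om -> 0 <= s -> t <= T -> itv_partition s t D ->
  mesh_le om K s D -> om s t <= Om -> rho x <= r -> `|'D_v (efl V X s D) x| <= C * `|v|.
move=> GV; have [g HV S] := GV; have [g' HV' S'] := good_tmap_weak GV. have [K K0 HK] := efl_bd g' HV' S'.
exists K => // r Om; have [C HC] := HK (Num.max r 1) Om. exists C => T X om s t D x v dX s0 tT PD FD oO xr.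
have [dE TE] := efl_tmap X s D g HV. apply: der_bd_unit => // {}v v1.
have := HC T X om s t D (x, v) dX s0 tT PD FD oO. rewrite {1}/tgauge /= ge_max !le_max xr v1 orbT => /(_ isT).
by rewrite TE /tgauge /tmap /= ge_max => /andP[].
Qed.

Lemma efl_lip E (rho : E -> R) (V : 'I_d -> E -> E) : good_sys rho V -> exists2 K : R, 0 < K & forall r Om :
  R, exists C : R, forall T X om s t D x y, driver T X om -> 0 <= s -> t <= T -> itv_partition s t D ->
  mesh_le om K s D -> om s t <= Om -> rho x <= r -> rho y <= r -> `|efl V X s D x - efl V X s D y| <= C * `|x
  - y|.
move=> GV; have [[_ _ g2] HV S] := GV; have [K K0 HK] := efl_tan_bd GV.
exists K => // r Om; have [C HC] := HK r Om. exists C => T X om s t D x y dX s0 tT PD FD oO xr yr.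
have [g' _ _] := GV; have [dE _] := efl_tmap X s D g' HV.
apply: segment_le => l l01; split=> //; apply: (HC T X om s t D) => //.
by apply: letr (g2 _ _ _ l01) _; rewrite ge_max xr yr.
Qed.

Lemma part_lt (s t : R) D u : itv_partition s t D -> u \in D -> s < u. by move=> [/lt_path_min/allP H _] /H. Qed.

Lemma part_subset (s t u : R) D D1 D2 : itv_partition u t D -> itv_partition s t (D1 ++ u :: D2) -> {subset u
  :: D <= D1 ++ u :: D2} -> {subset D <= D2}.
move=> PD PD' sub z zD; have uz := part_lt PD zD.
have := sub z; rewrite inE zD orbT => /(_ isT); rewrite mem_cat inE => /or3P[zD1|/eqP zu|//].
 have [_ _ _ [P1 _]] := part_split PD'.
 move: P1; rewrite (lt_path_sortedE) => /andP[_]; rewrite -cats1 (lt_sorted_pairwise).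
 rewrite pairwise_cat => /and3P[/allrelP H _ _]. by have := H z u zD1 (mem_head _ _); rewrite ltNge (ltW uz).
by lra.
Qed.

(** Telescoping over the cells of [D]: Davie's estimate bounds the replacement of one Euler step by
    the refined block, and the Lipschitz bound of the remaining composition carries that error to
    time [t]. *)
Lemma refine_efl E (rho : E -> R) (V : 'I_d -> E -> E) : good_sys rho V -> forall r1 Om : R, exists K C : R,
  [/\ 0 < K, 0 <= C & forall T X om s t D D' x, driver T X om -> 0 <= s -> t <= T -> itv_partition s t D ->
  itv_partition s t D' -> {subset D <= D'} -> mesh_le om K s D -> mesh_le om K s D' -> om s t <= Om -> (forall
  k, rho (efl V X s (take k D) x) <= r1) -> `|efl V X s D' x - efl V X s D x| <= C * cost om s D].
move=> GV r1 Om; have [g HV S] := GV. have [L [K1 [L0 K10 HL]]] := davie_efl g (good_weak GV) r1.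
have [K2 K20 HK] := efl_lip GV. have [C HC] := HK (r1 + 1) Om. pose K := Num.min K1 K2.
have KK1 : K <= K1 by rewrite ge_min lexx. have KK2 : K <= K2 by rewrite ge_min lexx orbT.
exists K, (`|C| * L); split; rewrite ?lt_min ?K10 ?mulr_ge0 ?(ltW L0)//.
move=> T X om s t D D' x dX; elim: D D' s x => [|u D IH] D' s x s0 tT PD PD' sub FD FD' oO bd.
 have ts := itv_partition_nil PD. by rewrite -ts in PD'; rewrite (itv_partitionxx PD') /= subrr normr0 mulr0.
have uD' : u \in D' by apply: sub; exact: mem_head.
move: PD' sub FD' => /[swap]; case/splitPr: uD' => D1 D2 sub PD' FD'.
have [_ su PuD _] := @part_split s t u [::] D PD. have [P1 au P2 P3] := part_split PD'.
have [_ ou FuD _] := @mesh_le_split om K s u [::] D FD. have [F1 oau F2 F3] := mesh_le_split FD'.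
rewrite /= in su ou. have u0 : 0 <= u by rewrite (letr s0)// ltW.
have ut := itv_partition_le P2; have uT := letr ut tT. have [_ _ _ _ os] := dX. have ouO : om u t <= Om.
 apply: letr oO; exact: driver_mono dX s0 (ltW su) ut (lexx t) tT.
have -> : D1 ++ u :: D2 = rcons D1 u ++ D2 by rewrite cat_rcons. rewrite efl_cat last_rcons /=.
set y1 := efl V X s (rcons D1 u) x; set y2 := eul V (X s u) x. have b0 := bd 0%N; rewrite take0 /= in b0.
have b1 : rho y2 <= r1 by have := bd 1%N; rewrite /= take0.
have [h1 h2] := HL T X om s u (rcons D1 u) x dX s0 uT P3 (letr ou KK1) b0.
have b1' : rho y2 <= r1 + 1 by rewrite (letr b1)// lerDl.
have h3 := HC T X om u t D2 y1 y2 dX u0 tT P2 (mesh_leW KK2 F2) ouO h1 b1'.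
have h4 : `|efl V X u D2 y2 - efl V X u D y2| <= `|C| * L * cost om u D.
 apply: IH => //; first exact: (part_subset PuD PD' sub). by move=> k; have := bd k.+1.
rewrite mulrDr; apply: letr (ler_distD (efl V X u D2 y2) _ _) _.
apply: lerD h4; apply: letr h3 _; rewrite -mulrA. apply: letr (ler_wpM2r _ (ler_norm C)) _ => //.
by rewrite ler_wpM2l.
Qed.

Lemma common_refinement (s t : R) D1 D2 : itv_partition s t D1 -> itv_partition s t D2 -> exists2 D,
  itv_partition s t D & {subset D1 <= D} /\ {subset D2 <= D}.
move=> P1 P2; pose D := sort <=%R (undup (D1 ++ D2)).
have memD z : (z \in D) = (z \in D1) || (z \in D2) by rewrite mem_sort mem_undup mem_cat.
exists D; last by split=> z; rewrite memD => ->; rewrite ?orbT.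
have sD : sorted <%R D by rewrite sort_lt_sorted undup_uniq.
have mem_le z D0 : itv_partition s t D0 -> z \in D0 -> z <= t.
 by move=> P zD; case/splitPr: zD P => A B /part_split[_ _ /itv_partition_le].
split.
 rewrite lt_path_sortedE sD andbT; apply/allP => z; rewrite memD.
 by case/orP => zD; [exact: (part_lt P1)|exact: (part_lt P2)].
have [E|st] := eqVneq s t.
 by rewrite -E in P1 P2 *; rewrite /D (itv_partitionxx P1) (itv_partitionxx P2).
have tD1 : t \in D1.
 have [_ /eqP l1] := P1; case: (D1) l1 => [/= /eqP|u D' <-]; first by rewrite (negbTE st).
 exact: (mem_last u D').
have tD : t \in D by rewrite memD tD1. have Dn0 : D != [::] by case: (D) tD.
have lD : last s D \in D by case: (D) Dn0 => // u D' _; exact: (mem_last u D'). have l1 : last s D <= t.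
 by move: lD; rewrite memD => /orP[] zD; [exact: mem_le P1 zD|exact: mem_le P2 zD].
have l2 : t <= last s D.
 case/splitPr: tD {memD Dn0 lD l1} sD => A B sAB. rewrite last_cat /=; case: B sAB => [//|b B] sAB.
 have : path <%R t (b :: B).
  by move: sAB; case: (A) => [|a A'] //=; rewrite cat_path => /andP[_ /= /andP[]].
 by move/lt_path_min/allP => H; apply/ltW/H; exact: (mem_last b B).
by lra.
Qed.

Lemma mesh_le_whole T X om K s t D : driver T X om -> 0 <= s -> t <= T -> itv_partition s t D -> om s t <= K
  -> mesh_le om K s D.
move=> dX; elim: D s => [//|u D IH] s s0 tT PD oK. have [_ /= su PuD _] := @part_split s t u [::] D PD.
have ut := itv_partition_le PuD; have u0 : 0 <= u by rewrite (letr s0)// ltW. apply/andP; split.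
 apply: letr oK; exact: driver_mono dX s0 (lexx s) (ltW su) ut tT.
apply: IH => //; apply: letr oK; exact: driver_mono dX s0 (ltW su) ut (lexx t) tT.
Qed.

Lemma mesh_le_subset T X om K s t D D' : driver T X om -> 0 <= s -> t <= T -> itv_partition s t D ->
  itv_partition s t D' -> {subset D <= D'} -> mesh_le om K s D -> mesh_le om K s D'.
move=> dX; elim: D D' s => [|u D IH] D' s s0 tT PD PD' sub FD.
 have ts := itv_partition_nil PD. by rewrite -ts in PD'; rewrite (itv_partitionxx PD').
have uD' : u \in D' by apply: sub; exact: mem_head.
move: PD' sub => /[swap]; case/splitPr: uD' => D1 D2 sub PD'.
have [_ /= su PuD _] := @part_split s t u [::] D PD. have [_ _ P2 P3] := part_split PD'.
have [_ /= ou FuD _] := @mesh_le_split om K s u [::] D FD. have u0 : 0 <= u by lra.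
have ut := itv_partition_le P2. have := mesh_le_whole dX s0 (letr ut tT) P3 ou.
have := IH _ _ u0 tT PuD P2 (part_subset PuD PD' sub) FuD.
by rewrite -cat_rcons /mesh_le cat_path last_rcons => -> ->.
Qed.

Lemma part_take (s t : R) D k : itv_partition s t D -> itv_partition s (last s (take k D)) (take k D) /\ last
  s (take k D) <= t.
move=> PD; have [P1 /eqP l1] := PD; split.
 by split=> //; exact: take_path.
rewrite -[D](cat_take_drop k) last_cat in l1; rewrite -l1. have : path <%R (last s (take k D)) (drop k D).
 by move: P1; rewrite -{1}[D](cat_take_drop k) cat_path => /andP[].
case: (drop k D) => [//|b B] /lt_path_min/allP H; apply/ltW/H; exact: (mem_last b B).
Qed.

Lemma efl_bd_prefix E (rho : E -> R) (V : 'I_d -> E -> E) : is_gg rho -> (forall i, hcl al M rho (V i)) ->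
  dilatable rho V -> exists2 K : R, 0 < K & forall r Om : R, exists r' : R, forall T X om s t D x, driver T X
  om -> 0 <= s -> t <= T -> itv_partition s t D -> mesh_le om K s D -> om s t <= Om -> rho x <= r -> forall k,
  rho (efl V X s (take k D) x) <= r'.
move=> g HV S; have [K K0 H] := efl_bd g HV S; exists K => // r Om.
have [r' Hr'] := H r Om; exists r' => T X om s t D x dX s0 tT PD FD oO xr k.
have [P1 lt1] := part_take k PD; have sl := itv_partition_le P1.
apply: (Hr' T X om s _ _ x dX s0 (letr lt1 tT) P1) => //.
 by rewrite /mesh_le take_path.
apply: letr oO; exact: driver_mono dX s0 (lexx s) sl lt1 tT.
Qed.

Lemma two_parts E (rho : E -> R) (V : 'I_d -> E -> E) : good_sys rho V -> forall r Om : R, exists K C : R, [/\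
  0 < K, 0 <= C & forall T X om s t D D' x, driver T X om -> 0 <= s -> t <= T -> itv_partition s t D ->
  itv_partition s t D' -> mesh_le om K s D -> mesh_le om K s D' -> om s t <= Om -> rho x <= r -> `|efl V X s
  D' x - efl V X s D x| <= C * (cost om s D + cost om s D')].
move=> GV r Om; have [g HV S] := GV. have [K0 K00 H0] := efl_bd_prefix g (good_weak GV) S.
have [r1 Hr1] := H0 r Om; have [K [C [Kp C0 HC]]] := refine_efl GV r1 Om.
exists (Num.min K0 K), C; split=> //; first by rewrite lt_min K00.
have KK0 : Num.min K0 K <= K0 by rewrite ge_min lexx. have KK : Num.min K0 K <= K by rewrite ge_min lexx orbT.
move=> T X om s t D D' x dX s0 tT PD PD' FD FD' oO xr. have [F PF [DF D'F]] := common_refinement PD PD'.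
have FF := mesh_le_subset dX s0 tT PD PF DF FD.
have b k := Hr1 _ _ _ _ _ _ _ dX s0 tT PD (mesh_leW KK0 FD) oO xr k.
have b' k := Hr1 _ _ _ _ _ _ _ dX s0 tT PD' (mesh_leW KK0 FD') oO xr k.
have h1 := HC _ _ _ _ _ _ _ _ dX s0 tT PD PF DF (mesh_leW KK FD) (mesh_leW KK FF) oO b.
have h2 := HC _ _ _ _ _ _ _ _ dX s0 tT PD' PF D'F (mesh_leW KK FD') (mesh_leW KK FF) oO b'.
rewrite mulrDr [leRHS]addrC; rewrite distrC in h2. apply: letr (lerD h2 h1); exact: ler_distD.
Qed.

Lemma tsum_dist E m (a : tensor R d N) (f f' : seq 'I_d -> E) (C : R) : (m <= N.+1)%N -> (forall v, (size v <
  m)%N -> `|tcf a v| <= 1 /\ `|f v - f' v| <= C) -> `|tsum m a f - tsum m a f'| <= (\sum_(k < m) d%:R ^+ k) *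
  C.
move=> mN H; rewrite -tsumB mulr_suml; apply: letr (ler_norm_sum _ _ _) _.
apply: ler_sum => k _; apply: wsum_norm => v vk. have [|h1 h2] := H v; first by rewrite vk.
by rewrite normrZ -[C]mul1r; apply: ler_pM.
Qed.

Lemma eul_hoelder E (rho : E -> R) (V : 'I_d -> E -> E) : is_gg rho -> (forall i, hcl al M rho (V i)) ->
  forall r : R, exists2 C : R, 0 <= C & forall (a : tensor R d N) x y, (forall v, (size v <= N)%N -> `|tcf a
  v| <= 1) -> rho x <= r -> rho y <= r -> `|eul V a x - eul V a y| <= C * (`|x - y| + `|x - y| `^ al).
move=> g HV r.
have [|w wN|C C0 HC] := @unif_bd_words R d N (fun w C => forall x y, rho x <= r -> rho y <= r -> `|vf_word V w
 x - vf_word V w y| <= C * (`|x - y| + `|x - y| `^ al)).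
- move=> w C C' CC H x y xr yr; apply: letr (H x y xr yr) _. by rewrite ler_wpM2r// addr_ge0// powR_ge0.
- have [->|w0] := eqVneq w [::].
  by exists 1 => x y _ _ /=; rewrite mul1r lerDl powR_ge0.
 have [C C0 HC] := hclass_hoelder al01 g (hclass_vfw al01 g HV w0 wN) r.
 exists C => x y xr yr; apply: letr (HC x y xr yr) _. by rewrite ler_wpM2l ?(ltW C0)// lerDr.
exists ((\sum_(k < N.+1) d%:R ^+ k) * C).
 by pos.
move=> a x y a1 xr yr; rewrite -mulrA. by apply: tsum_dist => // v vN; split; [exact: a1|exact: HC].
Qed.

Lemma tan_telescope E (rho : E -> R) (V : 'I_d -> E -> E) : good_sys rho V -> forall r1 Om : R, exists K C :
  R, [/\ 0 < K, 0 <= C & forall eta T X om s t G D D' x z u, driver T X om -> 0 <= s -> t <= T -> om s t <= Om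
  -> itv_partition s t G -> itv_partition s t D -> itv_partition s t D' -> {subset G <= D} -> {subset G <= D'}
  -> mesh_le om K s G -> mesh_le om K s D -> mesh_le om K s D' -> (forall k, tgauge rho (efl (fun i => tmap (V
  i)) X s (take k D) (x, u)) <= r1) -> (forall k, rho (efl V X s (take k D') z) <= r1) -> `|x - z| <= eta ->
  (forall g D1 D2 D1' D2', D = D1 ++ g :: D2 -> D' = D1' ++ g :: D2' -> `|efl V X s (rcons D1 g) x - efl V X s
  (rcons D1' g) z| <= eta) -> `|'D_u (efl V X s D) x - 'D_u (efl V X s D') z| <= C * (cost om s G + (size
  G)%:R * (eta + eta `^ al))].
move=> GV r1 Om; have [g HV S] := GV; have [g' HV' S'] := good_tmap_weak GV. have [al0 _] := andP al01.
have [L [K1 [L0 K10 HL]]] := davie_efl g' HV' r1. have [K2 K20 HK2] := efl_tan_bd GV.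
have [Lp HLp] := HK2 r1 Om. have [H H0 HH] := eul_hoelder g' HV' r1. pose K := Num.min 1 (Num.min K1 K2).
have KK1 : K <= K1 by rewrite !ge_min lexx orbT. have KK2 : K <= K2 by rewrite !ge_min lexx !orbT.
have K1' : K <= 1 by rewrite ge_min lexx. exists K, (`|Lp| * (L *+ 2 + H)); split.
- by rewrite !lt_min ltr01 K10.
- by pos.
move=> eta T X om s t G D D' x z u dX. have [XB _ _ _ _] := dX.
elim: G D D' s x z u => [|h G IH] D D' s x z u s0 tT oO PG PD PD' GD GD' FG FD FD' bD bD' xz mid.
 have ts := itv_partition_nil PG; rewrite -ts in PD PD'.
 rewrite (itv_partitionxx PD) (itv_partitionxx PD') !derive_id subrr normr0. by rewrite mul0r addr0 mulr0.
have hD : h \in D by apply: GD; exact: mem_head. have hD' : h \in D' by apply: GD'; exact: mem_head.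
have [A [B DE]] : exists A B, D = A ++ h :: B by case/splitPr: hD => A B; exists A, B.
have [A' [B' DE']] : exists A B, D' = A ++ h :: B by case/splitPr: hD' => A0 B0; exists A0, B0.
have [_ /= sh PhG _] := @part_split s t h [::] G PG.
have [_ /= oh FhG _] := @mesh_le_split om K s h [::] G FG.
have PD1 := PD; have PD1' := PD'; have FD1 := FD; have FD1' := FD'.
rewrite DE in PD1 FD1; rewrite DE' in PD1' FD1'.
have [_ _ PB PA] := part_split PD1; have [_ _ FB FA] := mesh_le_split FD1.
have [_ _ PB' PA'] := part_split PD1'; have [_ _ FB' FA'] := mesh_le_split FD1'.
have h0 : 0 <= h by rewrite (letr s0)// ltW. have ht := itv_partition_le PB; have hT := letr ht tT.
have ohO : om h t <= Om by apply: letr oO; exact: driver_mono dX s0 (ltW sh) ht (lexx t) tT.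
pose P := efl V X s (rcons A h); pose P' := efl V X s (rcons A' h).
have [dP TP] := efl_tmap X s (rcons A h) g HV; have [dP' TP'] := efl_tmap X s (rcons A' h) g HV.
have [dB _] := efl_tmap X h B g HV; have [dB' _] := efl_tmap X h B' g HV.
have DC : D = rcons A h ++ B by rewrite cat_rcons. have DC' : D' = rcons A' h ++ B' by rewrite cat_rcons.
have eD : efl V X s D = efl V X h B \o P.
 by apply/funext => y; rewrite DC efl_cat last_rcons.
have eD' : efl V X s D' = efl V X h B' \o P'.
 by apply/funext => y; rewrite DC' efl_cat last_rcons.
rewrite eD eD' der_comp// der_comp//. set u1 := 'D_u P x; set v1 := 'D_u P' z.
have xu : tgauge rho (x, u) <= r1 by have := bD 0%N; rewrite take0.
have zr : rho z <= r1 by have := bD' 0%N; rewrite take0. have zu : tgauge rho (z, u) <= r1.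
 by move: xu; rewrite /tgauge /= !ge_max zr => /andP[].
have osK1 : om s h <= K1 by exact: letr oh KK1.
have [_ d1] := HL T X om s h (rcons A h) (x, u) dX s0 hT PA osK1 xu.
have [_ d2] := HL T X om s h (rcons A' h) (z, u) dX s0 hT PA' osK1 zu.
have coef1 v : (size v <= N)%N -> `|tcf (X s h) v| <= 1.
 move=> vN; have [_ /(_ v vN) b] := XB s h s0 sh hT; apply: letr b _. rewrite exprn_ile1 ?powR_ge0//.
 have pV : 0 <= p^-1 by rewrite invr_ge0 (letr ler01).
 have := @ge0_ler_powR _ _ pV (om s h) 1; rewrite powR1 !nnegrE ler01.
 apply=> //; last exact: letr oh K1'. exact: driver_ge0 dX s0 (ltW sh) hT.
have d3 := HH (X s h) (x, u) (z, u) coef1 xu zu. have xzE : `|(x, u) - (z, u) : E * E| = `|x - z|.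
 have -> : (x, u) - (z, u) = (x - z, 0) :> E * E by rewrite -(subrr u).
 by rewrite prod_normE /= normr0 (max_idPl _).
have uv : `|u1 - v1| <= (L *+ 2) * om s h `^ theta + H * (eta + eta `^ al).
 have -> : u1 - v1 = (efl (fun i => tmap (V i)) X s (rcons A h) (x, u) - efl (fun i => tmap (V i)) X s (rcons
  A' h) (z, u)).2 by rewrite TP TP'.
 apply: letr (_ : _ <= `|efl (fun i => tmap (V i)) X s (rcons A h) (x, u) - efl (fun i => tmap (V i)) X s
  (rcons A' h) (z, u)|) _.
  by have := snd_bd (efl (fun i => tmap (V i)) X s (rcons A h) (x, u) - efl (fun i => tmap (V i)) X s (rcons
   A' h) (z, u)); rewrite mul1r.
 rewrite xzE in d3; have {}d3 := letr d3 (_ : _ <= H * (eta + eta `^ al)).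
 have {}d3 : `|eul (fun i => tmap (V i)) (X s h) (x, u) - eul (fun i => tmap (V i)) (X s h) (z, u)| <= H *
  (eta + eta `^ al).
  apply: d3; rewrite ler_wpM2l// lerD//; apply: (ge0_ler_powR (ltW al0)); rewrite ?nnegrE//.
  exact: letr xz.
 rewrite distrC in d2. rewrite mulrnAl mulr2n addrAC. apply: letr (lerD (lerD d1 d3) d2).
 apply: letr (ler_distD (eul (fun i => tmap (V i)) (X s h) (z, u)) _ _) _. by rewrite lerD2r ler_distD.
have IH' : `|'D_u1 (efl V X h B) (P x) - 'D_u1 (efl V X h B') (P' z)| <= `|Lp| * (L *+ 2 + H) * (cost om h G +
 (size G)%:R * (eta + eta `^ al)).
 apply: IH => //.
 - apply: (part_subset PhG PD1); by rewrite -DE.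
 - apply: (part_subset PhG PD1'); by rewrite -DE'.
 - move=> k; have := bD (size (rcons A h) + k)%N.
  rewrite DC takeD take_size_cat// drop_size_cat// efl_cat last_rcons.
  by rewrite -[efl _ X s (rcons A h) (x, u)]/(efl (fun i => tmap (V i)) X s (rcons A h) (x, u)) TP.
 - move=> k; have := bD' (size (rcons A' h) + k)%N.
  by rewrite DC' takeD take_size_cat// drop_size_cat// efl_cat last_rcons.
 - exact: mid DE DE'.
 - move=> b D1 D2 D1' D2' BE BE'. have := mid b (rcons A h ++ D1) D2 (rcons A' h ++ D1') D2'.
  rewrite -!catA -BE -BE' => /(_ DC DC'). by rewrite !rcons_cat !efl_cat !last_rcons.
have b2 := HLp T X om h t B' (P' z) (u1 - v1) dX h0 tT PB' (mesh_leW KK2 FB') ohO _.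
have {}b2 : `|'D_(u1 - v1) (efl V X h B') (P' z)| <= Lp * `|u1 - v1|.
 apply: b2; have := bD' (size (rcons A' h)). by rewrite DC' take_size_cat.
rewrite derBr// in b2. apply: letr (ler_distD ('D_u1 (efl V X h B') (P' z)) _ _) _.
apply: letr (lerD IH' b2) _.
have b3 : Lp * `|u1 - v1| <= `|Lp| * ((L *+ 2) * om s h `^ theta + H * (eta + eta `^ al)).
 by apply: letr (ler_wpM2r _ (ler_norm Lp)) _ => //; rewrite ler_wpM2l.
apply: letr (lerD (lexx _) b3) _. have eta0 : 0 <= eta by exact: letr xz.
set ee := eta + eta `^ al; set oo := om s h `^ theta; set cc := cost om h G.
have ee0 : 0 <= ee by rewrite addr_ge0// powR_ge0. have oo0 : 0 <= oo by pos.
rewrite /= -/oo -/cc -subr_ge0 -natr1.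
have -> : `|Lp| * (L *+ 2 + H) * (oo + cc + ((size G)%:R + 1) * ee) - (`|Lp| * (L *+ 2 + H) * (cc + (size
 G)%:R * ee) + `|Lp| * (L *+ 2 * oo + H * ee)) = `|Lp| * (H * oo + L *+ 2 * ee) by ring.
by rewrite mulr_ge0// addr_ge0 ?mulr_ge0// mulrn_wge0// ltW.
Qed.

End euler_flows.

(** * Dyadic partitions *)

Section dyadic_partitions.
Context {R : realType}.

Definition tick n (s t : R) (i : nat) : R := s + (t - s) * (i%:R / 2 ^+ n).

Definition dya n (s t : R) : seq R := mkseq (fun i => tick n s t i.+1) (2 ^ n).

Lemma tick0 n s t : tick n s t 0 = s. by rewrite /tick mul0r mulr0 addr0. Qed.

Lemma tick_last n s t : tick n s t (2 ^ n) = t. by rewrite /tick natrX divff ?mulr1 ?subrKC// gt_eqF// exprn_gt0. Qed.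

Lemma nth_dya n s t x i : (i <= 2 ^ n)%N -> nth x (s :: dya n s t) i = tick n s t i. by case: i => [|i] ni /=; rewrite ?tick0// nth_mkseq. Qed.

Lemma tick_mesh n s t i : tick n s t i.+1 - tick n s t i = (t - s) / 2 ^+ n.
rewrite /tick -natr1 opprD addrACA subrr add0r -mulrBr -mulrBl. by lra.
Qed.

Lemma tickxx n s i : tick n s s i = s. by rewrite /tick subrr mul0r addr0. Qed.

Lemma dya_part n s t : s < t -> itv_partition s t (dya n s t).
move=> st; split.
 apply/(pathP s) => i; rewrite size_mkseq => ni. rewrite nth_dya ?(ltnW ni)// nth_mkseq//.
 by rewrite -subr_gt0 tick_mesh divr_gt0 ?subr_gt0// exprn_gt0.
rewrite (last_nth s) size_mkseq nth_dya// tick_last//.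
Qed.

Lemma dya_nested n m s t : (n <= m)%N -> {subset dya n s t <= dya m s t}.
move=> nm z /mapP[i]; rewrite mem_iota add0n => /andP[_ ni] ->. apply/mapP; exists (i.+1 * 2 ^ (m - n)).-1.
 have pos : (0 < 2 ^ (m - n))%N by rewrite expn_gt0. rewrite mem_iota add0n /= prednK ?muln_gt0 ?pos//.
 by rewrite -[X in (_ <= 2 ^ X)%N](subnKC nm) expnD leq_mul2r ni orbT.
rewrite prednK ?muln_gt0 ?expn_gt0// /tick; congr (_ + _ * _).
have mE : 2 ^+ m = 2 ^+ n * 2 ^+ (m - n) :> R by rewrite -exprD subnKC. rewrite natrM natrX mE; field.
by rewrite !gt_eqF ?exprn_gt0.
Qed.

Lemma tick_itv n s t i : s <= t -> (i <= 2 ^ n)%N -> s <= tick n s t i <= t.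
move=> st ni; rewrite /tick lerDl mulr_ge0 ?subr_ge0 ?divr_ge0//=.
rewrite -lerBrDl ler_piMr ?subr_ge0// ler_pdivrMr ?exprn_gt0// mul1r -natrX. by rewrite ler_nat.
Qed.

End dyadic_partitions.

(** * The limit flow: differentiability, cocycle, reversal, closeness *)

Section limit_flow.
Context {R : realType} {d M : nat} (al p : R).
Context (al01 : 0 < al <= 1) (p1 : 1 <= p) (pN : p < M.+1%:R + al).
Local Notation N := M.+1.
Local Notation theta := (@theta R M al p).
Local Notation driver := (@driver R d M p).
Local Notation good_sys := (@good_sys R d M al).
Local Notation cost := (@cost R M al p).
Implicit Types (E W : normedModType R) (X Y : R -> R -> tensor R d N) (om : R -> R -> R).
Implicit Types (s t : R).

(** Drivers with a common total control and a common modulus of smallness of the control. A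
    convergent sequence of rough paths and its limit lie in one such class ([unif_fams]), and
    estimates uniform over the class make the flow continuous in the path. *)
Definition dfam (T Om : R) (mu : R -> R) X om := [/\ driver T X om, om 0 T <= Om & forall e, 0 < e -> forall s
  t, 0 <= s -> s <= t -> t <= T -> t - s <= mu e -> om s t <= e].

Lemma fam_le T Om mu X om s t : dfam T Om mu X om -> 0 <= s -> s <= t -> t <= T -> om s t <= Om.
move=> [dX oO _] s0 st tT; apply: letr oO. exact: driver_mono dX (lexx 0) s0 st tT (lexx T).
Qed.

Lemma mesh_le_dya (T Om : R) (mu : R -> R) : 0 <= T -> (forall e, 0 < e -> 0 < mu e) -> forall h, 0 < h ->
  exists n0, forall n, (n0 <= n)%N -> forall X om s t, dfam T Om mu X om -> 0 <= s -> s <= t -> t <= T ->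
  mesh_le om h s (dya n s t) /\ forall i, (i < 2 ^ n)%N -> om (tick n s t i) (tick n s t i.+1) <= h.
move=> T0 mu0 h h0; have m0 := mu0 h h0. exists (Num.bound (T / mu h)) => n n0 X om s t [dX _ oh] s0 st tT.
have cell i : (i < 2 ^ n)%N -> om (tick n s t i) (tick n s t i.+1) <= h.
 move=> ni; have /andP[a1 a2] := tick_itv st (ltnW ni). have /andP[b1 b2] := tick_itv st ni.
 apply: oh => //; first exact: letr a1.
 - by rewrite -subr_ge0 tick_mesh divr_ge0 ?subr_ge0.
 - by lra.
 rewrite tick_mesh ler_pdivrMr ?exprn_gt0// -ler_pdivrMl// mulrC. apply: (@le_trans _ _ (T / mu h)).
  by rewrite ler_wpM2r ?invr_ge0 ?(ltW m0)//; lra.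
 apply/ltW; apply: lt_le_trans (archi_boundP _) _; first by rewrite divr_ge0// ltW.
 by rewrite -natrX ler_nat; exact: leq_trans n0 (ltnW (ltn_expl _ _)).
split=> //; apply/(pathP s) => i; rewrite size_mkseq => ni.
by rewrite nth_dya ?(ltnW ni)// nth_mkseq//; exact: cell.
Qed.

Lemma small_power e : 0 < e -> exists2 h : R, 0 < h & h `^ (theta - 1) <= e.
move=> e0; have th : 0 < theta - 1 by rewrite subr_gt0; exact: theta_gt1.
exists (e `^ (theta - 1)^-1); first exact: powR_gt0. by rewrite -powRrM mulVf ?gt_eqF// powRr1// ltW.
Qed.

Definition euler_cauchy E (rho : E -> R) (V : 'I_d -> E -> E) := forall (T Om : R) mu, 0 <= T -> (forall e, 0
  < e -> 0 < mu e) -> forall r e : R, 0 < e -> exists n0, forall n m, (n0 <= n)%N -> (n0 <= m)%N -> forall X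
  om s t x, dfam T Om mu X om -> 0 <= s -> s <= t -> t <= T -> rho x <= r -> `|efl V X s (dya n s t) x - efl V
  X s (dya m s t) x| <= e.

Lemma efl_dyaxx E (V : 'I_d -> E -> E) T X om n s x : driver T X om -> 0 <= s <= T -> efl V X s (dya n s s) x
  = x.
move=> [_ _ X0 _ _] sT; have -> : dya n s s = nseq (2 ^ n) s.
 apply: (@eq_from_nth _ s); rewrite size_mkseq ?size_nseq// => i ni.
 by rewrite nth_mkseq// nth_nseq ni tickxx.
by elim: (2 ^ n)%N => [//|k IH] /=; rewrite (X0 s sT).1 eul_tone.
Qed.

Lemma good_cauchy E (rho : E -> R) (V : 'I_d -> E -> E) : good_sys rho V -> euler_cauchy rho V.
move=> GV T Om mu T0 mu0 r e e0. have [K [C [K0 C0 H]]] := two_parts al01 p1 pN GV r Om.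
pose c := C * `|Om| *+ 2 + 1. have c0 : 0 < c by rewrite ltr_wpDl// mulrn_wge0// mulr_ge0.
have [h h0 hs] := small_power (divr_gt0 e0 c0). have hK0 : 0 < Num.min h K by rewrite lt_min h0.
have [n0 Hn0] := mesh_le_dya Om T0 mu0 hK0. exists n0 => n m n0n n0m X om s t x FX s0 st tT xr.
have [dX _ _] := FX. move: st; rewrite le_eqVlt => /orP[/eqP E1|st].
 by rewrite -E1 !(efl_dyaxx _ _ _ dX) ?s0 ?E1// subrr normr0 ltW.
have [f1 _] := Hn0 n n0n X om s t FX s0 (ltW st) tT. have [f2 _] := Hn0 m n0m X om s t FX s0 (ltW st) tT.
have Kh : Num.min h K <= h by rewrite ge_min lexx. have KK : Num.min h K <= K by rewrite ge_min lexx orbT.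
have P1 := dya_part n st; have P2 := dya_part m st. have oO := fam_le FX s0 (ltW st) tT. rewrite distrC.
apply: letr (H _ _ _ _ _ _ _ _ dX s0 tT P1 P2 (mesh_leW KK f1) (mesh_leW KK f2) oO xr) _.
have cb D : itv_partition s t D -> mesh_le om (Num.min h K) s D -> cost om s D <= e / c * `|Om|.
 move=> PD FD; apply: letr (cost_le p1 pN dX s0 tT (ltW h0) PD (mesh_leW Kh FD)) _.
 by apply: ler_pM; rewrite ?powR_ge0 ?(driver_ge0 dX) ?(ltW st)// (letr oO)// ler_norm.
apply: letr (ler_wpM2l C0 (lerD (cb _ P1 f1) (cb _ P2 f2))) _.
have -> : C * (e / c * `|Om| + e / c * `|Om|) = e * ((C * `|Om| *+ 2) / c).
 by rewrite mulr2n; field; rewrite gt_eqF.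
by rewrite ler_piMr ?(ltW e0)// ler_pdivrMr// mul1r lerDl.
Qed.

Lemma cost_small : forall Om e : R, 0 < e -> exists2 h : R, 0 < h & forall T X om s t D, driver T X om -> 0 <=
  s -> s <= t -> t <= T -> om s t <= Om -> itv_partition s t D -> mesh_le om h s D -> cost om s D <= e.
move=> Om e e0; have c0 : 0 < `|Om| + 1 by rewrite ltr_wpDl. have [h h0 hs] := small_power (divr_gt0 e0 c0).
exists h => // T X om s t D dX s0 st tT oO PD FD. apply: letr (cost_le p1 pN dX s0 tT (ltW h0) PD FD) _.
apply: (@le_trans _ _ (e / (`|Om| + 1) * `|Om|)).
 by apply: ler_pM; rewrite ?powR_ge0 ?(driver_ge0 dX)// (letr oO)// ler_norm.
by rewrite -mulrA ler_piMr ?(ltW e0)// mulrC ler_pdivrMr// mul1r lerDl.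
Qed.

Lemma small_modulus (C e : R) : 0 <= C -> 0 < e -> exists2 eta : R, 0 < eta & C * (eta + eta `^ al) <= e.
move=> C0 e0; have [al0 al1] := andP al01. have c0 : 0 < C *+ 2 + 1 by lra.
pose b := Num.min 1 (e / (C *+ 2 + 1)). have b0 : 0 < b by rewrite lt_min ltr01 divr_gt0.
exists (b `^ al^-1); first exact: powR_gt0.
have E1 : (b `^ al^-1) `^ al = b by rewrite -powRrM mulVf ?gt_eqF// powRr1// ltW.
rewrite E1; have le1 : b `^ al^-1 <= b.
 by apply: ge1r_powR; [rewrite b0 ge_min lexx|rewrite invf_ge1].
apply: (@le_trans _ _ (C * (b + b))); first by rewrite ler_wpM2l// lerD2r.
have -> : C * (b + b) = (C *+ 2) * b by lra. apply: (@le_trans _ _ ((C *+ 2) * (e / (C *+ 2 + 1)))).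
 by rewrite ler_wpM2l ?mulrn_wge0// ge_min lexx orbT.
by rewrite mulrCA ler_piMr ?(ltW e0)// ler_pdivrMr// mul1r lerDl.
Qed.

(** The order of choices matters: level [n1] makes the cost of the coarse partition small, [eta] is
    then chosen against its [2 ^ n1] cells, and only afterwards does level [n2] make the base
    trajectories [eta]-close at all common points. *)
Lemma good_tmap_cauchy E (rho : E -> R) (V : 'I_d -> E -> E) : good_sys rho V -> euler_cauchy (tgauge rho)
  (fun i => tmap (V i)).
move=> GV T Om mu T0 mu0 r e e0; have [g HV S] := GV. have [g' HV' S'] := good_tmap_weak al01 GV.
have [K0 K00 H0] := efl_bd_prefix al01 p1 pN g' HV' S'. have [r1 Hr1] := H0 r Om.
have [K1 [C1 [K10 C10 H1]]] := two_parts al01 p1 pN GV r Om.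
have [K2 [C2 [K20 C20 H2]]] := tan_telescope al01 p1 pN GV r1 Om.
have [nc Hnc] := good_cauchy GV Om T0 mu0 r e0. have C2' : 0 < C2 + 1 by rewrite ltr_wpDl.
have C1' : 0 < C1 *+ 2 + 1 by rewrite ltr_wpDl// mulrn_wge0. have e2 : 0 < e / 2 by pos.
have [h h0 Hh] := cost_small Om (divr_gt0 e2 C2'). pose h1 := Num.min h (Num.min K0 (Num.min K1 K2)).
have h10 : 0 < h1 by rewrite !lt_min h0 K00 K10. have [n1 Hn1] := mesh_le_dya Om T0 mu0 h10.
have [eta eta0 Heta] := @small_modulus (C2 * (2 ^ n1)%:R) (e / 2) (mulr_ge0 C20 (ler0n _ _)) e2.
have [h2 h20 Hh2] := cost_small Om (divr_gt0 eta0 C1'). pose h3 := Num.min h2 h1.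
have h30 : 0 < h3 by rewrite lt_min h20. have [n2 Hn2] := mesh_le_dya Om T0 mu0 h30.
have leh1 : [/\ h1 <= h, h1 <= K0, h1 <= K1 & h1 <= K2].
 by rewrite /h1; split; rewrite !ge_min lexx ?orbT.
have [lh lK0 lK1 lK2] := leh1. have lh2 : h3 <= h2 by rewrite ge_min lexx.
have lh3 : h3 <= h1 by rewrite ge_min lexx orbT.
exists (maxn nc (maxn n1 n2)) => n m; rewrite !geq_max => /and3P[ncn n1n n2n] /and3P[ncm n1m n2m].
move=> X om s t [x u] FX s0 st tT xr; have [dX _ _] := FX. move: st; rewrite le_eqVlt => /orP[/eqP E1|st].
 by rewrite -E1 !(efl_dyaxx _ _ _ dX) ?s0 ?E1// subrr normr0 ltW.
have oO := fam_le FX s0 (ltW st) tT. have [f0 _] := Hn1 n1 (leqnn _) X om s t FX s0 (ltW st) tT.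
have [f1 _] := Hn2 n n2n X om s t FX s0 (ltW st) tT. have [f2 _] := Hn2 m n2m X om s t FX s0 (ltW st) tT.
have P0 := dya_part n1 st; have P1 := dya_part n st; have P2 := dya_part m st.
have f1' := mesh_leW lh3 f1; have f2' := mesh_leW lh3 f2.
have bD := Hr1 _ _ _ _ _ _ _ dX s0 tT P1 (mesh_leW lK0 f1') oO xr.
have bD' k : rho (efl V X s (take k (dya m s t)) x) <= r1.
 have := Hr1 _ _ _ _ _ _ _ dX s0 tT P2 (mesh_leW lK0 f2') oO xr k.
 have [_ ->] := efl_tmap al01 X s (take k (dya m s t)) g HV. by rewrite /tgauge /= ge_max => /andP[].
have xr' : rho x <= r by move: xr; rewrite /tgauge /= ge_max => /andP[].
have mid : forall b D1 D2 D1' D2', dya n s t = D1 ++ b :: D2 -> dya m s t = D1' ++ b :: D2' -> `|efl V X s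
 (rcons D1 b) x - efl V X s (rcons D1' b) x| <= eta.
 move=> b D1 D2 D1' D2' E1 E2; rewrite E1 in P1 f1; rewrite E2 in P2 f2.
 have [_ _ Q1 Q2] := part_split P1; have [_ _ Q1' Q2'] := part_split P2.
 have [_ _ _ F2] := mesh_le_split f1; have [_ _ _ F2'] := mesh_le_split f2.
 have bt := itv_partition_le Q1; have bT := letr bt tT. have sb := itv_partition_le Q2.
 have obO : om s b <= Om by exact: fam_le FX s0 sb bT. have G2 := mesh_leW lK1 (mesh_leW lh3 F2).
 have G2' := mesh_leW lK1 (mesh_leW lh3 F2'). rewrite distrC.
 apply: letr (H1 _ _ _ _ _ _ _ _ dX s0 bT Q2 Q2' G2 G2' obO xr') _.
 have c1 := Hh2 _ _ _ _ _ _ dX s0 sb bT obO Q2 (mesh_leW lh2 F2).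
 have c2 := Hh2 _ _ _ _ _ _ dX s0 sb bT obO Q2' (mesh_leW lh2 F2').
 apply: letr (ler_wpM2l C10 (lerD c1 c2)) _.
 have -> : C1 * (eta / (C1 *+ 2 + 1) + eta / (C1 *+ 2 + 1)) = eta * ((C1 *+ 2) / (C1 *+ 2 + 1)).
  by rewrite mulr2n; field; rewrite -mulr2n gt_eqF.
 by rewrite ler_piMr ?(ltW eta0)// ler_pdivrMr// mul1r lerDl.
have xx : `|x - x| <= eta by rewrite subrr normr0 ltW.
have := H2 _ _ _ _ _ _ _ _ _ _ _ _ dX s0 tT oO P0 P1 P2 (dya_nested n1n) (dya_nested n1m) (mesh_leW lK2 f0)
 (mesh_leW lK2 f1') (mesh_leW lK2 f2') bD bD' xx mid. rewrite size_mkseq => key.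
have c0 := Hh _ _ _ _ _ _ dX s0 (ltW st) tT oO P0 (mesh_leW lh f0).
have key2 : `|'D_u (efl V X s (dya n s t)) x - 'D_u (efl V X s (dya m s t)) x| <= e.
 apply: letr key _; rewrite mulrDr mulrA. apply: letr (lerD (ler_wpM2l C20 c0) Heta) _.
 rewrite [X in _ <= X](splitr e) lerD2r mulrCA ler_piMr ?(ltW e2)//. by rewrite ler_pdivrMr// mul1r lerDl.
have [_ ->] := efl_tmap al01 X s (dya n s t) g HV. have [_ ->] := efl_tmap al01 X s (dya m s t) g HV.
rewrite /tmap /= prod_normE /= ge_max; apply/andP; split; last exact: key2.
exact: Hnc ncn ncm _ _ _ _ _ FX s0 (ltW st) tT xr'.
Qed.

(** Completeness as a property of a bare normed module, in a form that passes to the products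
    [E * E] on which tangent systems live. *)
Definition seq_compl E := forall u : nat -> E, (forall e, 0 < e -> exists n0, forall n m, (n0 <= n)%N -> (n0
  <= m)%N -> `|u n - u m| <= e) -> exists l : E, u @ \oo --> l.

Lemma seq_compl_pair E W : seq_compl E -> seq_compl W -> seq_compl (E * W)%type.
move=> cE cW u H. have [e e0|l1 H1] := cE (fun n => (u n).1).
 have [n0 Hn] := H e e0; exists n0 => n m nn mm; apply: letr (Hn n m nn mm).
 by have := fst_bd (u n - u m); rewrite mul1r.
have [e e0|l2 H2] := cW (fun n => (u n).2).
 have [n0 Hn] := H e e0; exists n0 => n m nn mm; apply: letr (Hn n m nn mm).
 by have := snd_bd (u n - u m); rewrite mul1r.
exists (l1, l2); apply/cvgrPdist_le => e e0; near=> n.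
rewrite prod_normE /= ge_max; apply/andP; split; near: n.
 by move/cvgrPdist_le: H1 => /(_ e e0).
by move/cvgrPdist_le: H2 => /(_ e e0). Unshelve. all: by end_near. Qed.

Lemma cvg_components E W (u : nat -> E * W) (l : E * W) : u n @[n --> \oo] --> l -> (u n).1 @[n --> \oo] -->
  l.1 /\ (u n).2 @[n --> \oo] --> l.2.
move=> /cvgrPdist_le H; split; apply/cvgrPdist_le => e e0; near=> n.
 apply: (@le_trans _ _ `|l - u n|); last by near: n; exact: H. by have := fst_bd (l - u n); rewrite mul1r.
apply: (@le_trans _ _ `|l - u n|); last by near: n; exact: H. by have := snd_bd (l - u n); rewrite mul1r.
Unshelve. all: by end_near. Qed.

Lemma seq_compl_row n : seq_compl 'rV[R]_n.
move=> u H; apply/cvg_ex; apply/cauchy_cvgP; apply: cauchy_exP => e e0.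
have [n0 Hn0] := H (e / 2) (divr_gt0 e0 (ltr0n _ 2)). exists (u n0); exists n0 => // k /= kn.
rewrite -ball_normE /=; apply: le_lt_trans (Hn0 _ _ (leqnn _) kn) _. by lra.
Qed.

Definition flw E (V : 'I_d -> E -> E) X s t (x : E) : E := lim (efl V X s (dya n s t) x @[n --> \oo]).

Lemma cvg_le_dist E (u : nat -> E) l (x : E) (C : R) n0 : u n @[n --> \oo] --> l -> (forall n, (n0 <= n)%N ->
  `|x - u n| <= C) -> `|x - l| <= C.
move=> ul H; have cv : `|x - u n| @[n --> \oo] --> `|x - l|.
 by apply: cvg_norm; apply: cvgB => //; exact: cvg_cst.
by apply: (cvgr_le_bd _ cv); exists n0 => // n /=; exact: H.
Qed.

Lemma flw_unif E (rho : E -> R) (V : 'I_d -> E -> E) : seq_compl E -> euler_cauchy rho V -> forall (T Om : R)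
  mu, 0 <= T -> (forall e, 0 < e -> 0 < mu e) -> forall r e : R, 0 < e -> exists n0, forall n, (n0 <= n)%N ->
  forall X om s t x, dfam T Om mu X om -> 0 <= s -> s <= t -> t <= T -> rho x <= r -> `|efl V X s (dya n s t)
  x - flw V X s t x| <= e.
move=> cE cV T Om mu T0 mu0 r e e0; have [n0 H] := cV T Om mu T0 mu0 r e e0.
exists n0 => n nn X om s t x FX s0 st tT xr. have [e' e'0|l Hl] := cE (fun n => efl V X s (dya n s t) x).
 have [n1 H1] := cV T Om mu T0 mu0 r e' e'0.
 by exists n1 => k m kk mm; apply: H1 kk mm _ _ _ _ _ FX s0 st tT xr.
rewrite /flw (cvg_lim _ Hl); last exact: norm_hausdorff. apply: (cvg_le_dist (n0 := n0) Hl) => m mm.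
exact: H nn mm _ _ _ _ _ FX s0 st tT xr.
Qed.

Lemma flw_cvg E (rho : E -> R) (V : 'I_d -> E -> E) : seq_compl E -> euler_cauchy rho V -> forall (T Om : R)
  mu, 0 <= T -> (forall e, 0 < e -> 0 < mu e) -> forall X om s t x, dfam T Om mu X om -> 0 <= s -> s <= t -> t
  <= T -> efl V X s (dya n s t) x @[n --> \oo] --> flw V X s t x.
move=> cE cV T Om mu T0 mu0 X om s t x FX s0 st tT; apply/cvgrPdist_le => e e0.
have [n0 H] := flw_unif cE cV Om T0 mu0 (rho x) e0. near=> n; rewrite distrC; apply: (H n _ X om) => //.
by near: n; exact: nbhs_infty_ge. Unshelve. all: by end_near. Qed.

(** The tangent maps of the dyadic approximations are the dyadic approximations for the tangent
    system, which converge uniformly on gauge balls by [good_tmap_cauchy]; [der_unif_lim] then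
    differentiates the limit. *)
Lemma tmap_flw E (rho : E -> R) (V : 'I_d -> E -> E) : seq_compl E -> good_sys rho V -> forall (T Om : R) mu,
  0 <= T -> (forall e, 0 < e -> 0 < mu e) -> forall X om s t, dfam T Om mu X om -> 0 <= s -> s <= t -> t <= T
  -> (forall x, differentiable (flw V X s t) x) /\ flw (fun i => tmap (V i)) X s t = tmap (flw V X s t).
move=> cE GV T Om mu T0 mu0 X om s t FX s0 st tT; have [g HV S] := GV. have cTE := seq_compl_pair cE cE.
have cV := good_cauchy GV; have cTV := good_tmap_cauchy GV. pose f n := efl V X s (dya n s t).
pose TV := fun i => tmap (V i).
have fT n : efl TV X s (dya n s t) = tmap (f n) := (efl_tmap al01 X s (dya n s t) g HV).2.
have df n y : differentiable (f n) y := (efl_tmap al01 X s (dya n s t) g HV).1 y.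
have Tc q : tmap (f n) q @[n --> \oo] --> flw TV X s t q.
 have : efl TV X s (dya n s t) q @[n --> \oo] --> flw TV X s t q.
  exact: (flw_cvg cTE cTV T0 mu0 FX s0 st tT).
 by under eq_fun do rewrite fT.
have c1 x : f n x @[n --> \oo] --> flw V X s t x .
 exact: (flw_cvg cE cV T0 mu0 FX s0 st tT).
have c1' q : (flw TV X s t q).1 = flw V X s t q.1.
 have h1 : (tmap (f n) q).1 @[n --> \oo] --> (flw TV X s t q).1.
  exact: (cvg_components (Tc q)).1.
 exact: (cvg_unique (@norm_hausdorff _ E) h1 (c1 q.1)).
have c2 q : 'D_q.2 (f n) q.1 @[n --> \oo] --> (flw TV X s t q).2.
 exact: (cvg_components (Tc q)).2.
pose dg y v := (flw TV X s t (y, v)).2. have [K K0 HK] := efl_tan_bd al01 p1 pN GV.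
have main x : differentiable (flw V X s t) x /\ forall v, 'D_v (flw V X s t) x = dg x v.
 have [C HC] := HK (rho x) Om. have [n0 Hn0] := mesh_le_dya Om T0 mu0 K0.
 have gl : forall x y, rho y <= rho x + `|y - x| by case: g.
 apply: (@der_unif_lim R nat \oo _ E E f _ _ x 1 (Num.max C 1) ltr01 df).
 - move=> v; have -> : `|dg x v| = `|0 - dg x v| by rewrite sub0r normrN.
  apply: (cvg_le_dist (n0 := n0) (c2 (x, v))) => n nn; rewrite sub0r normrN /=. have [E1|st'] := eqVneq s t.
   have -> : f n = id.
    have [dX _ _] := FX; apply/funext => y. by rewrite /f -E1 (efl_dyaxx _ _ _ dX)// s0 E1.
   by rewrite derive_id ler_peMl// le_max lexx orbT.
  have lst : s < t by rewrite lt_neqAle st'.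
  apply: (@le_trans _ _ (C * `|v|)); last by rewrite ler_wpM2r// le_max lexx.
  have [fn _] := Hn0 n nn X om s t FX s0 st tT; have [dX _ _] := FX.
  exact: HC dX s0 tT (dya_part n lst) fn (fam_le FX s0 st tT) (lexx _).
 - by [].
 move=> e e0; have [n1 H1] := cTV T Om mu T0 mu0 (Num.max (rho x + 1) 1) e e0.
 exists n1 => // k /= kn y v yx. apply: (cvg_le_dist (n0 := n1) (c2 (y, v))) => m mn /=.
 have dB : differentiable (f k - f m) y by apply: differentiableB; exact: df.
 have DB w : 'D_w (f k - f m) y = 'D_w (f k) y - 'D_w (f m) y.
  by apply: deriveB; apply: diff_derivable; exact: df.
 rewrite -DB; apply: (der_bd_unit dB) => w w1; rewrite DB.
 have := H1 k m kn mn X om s t (y, w) FX s0 st tT; rewrite !fT => H2.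
 apply: letr (_ : _ <= `|tmap (f k) (y, w) - tmap (f m) (y, w)|) (H2 _).
  by have := snd_bd (tmap (f k) (y, w) - tmap (f m) (y, w)); rewrite mul1r.
 rewrite /tgauge /= ge_max !le_max w1 orbT andbT (letr (gl x y))//. by rewrite lerD2l ltW.
split=> [x|]; first exact: (main x).1.
apply/funext => -[x v]; rewrite /tmap /= (main x).2 /dg [LHS]surjective_pairing.
congr pair; exact: (c1' (x, v)).
Qed.

Lemma flw_refl E (V : 'I_d -> E -> E) T X om s x : driver T X om -> 0 <= s <= T -> flw V X s s x = x.
move=> dX sT; rewrite /flw; under eq_fun do rewrite (efl_dyaxx _ _ _ dX)//.
apply: cvg_lim; [exact: norm_hausdorff|exact: cvg_cst].
Qed.

Lemma flw_part E (rho : E -> R) (V : 'I_d -> E -> E) : seq_compl E -> good_sys rho V -> forall r Om : R,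
  exists K C : R, [/\ 0 < K, 0 <= C & forall T mu X om s t D x, 0 <= T -> (forall e, 0 < e -> 0 < mu e) ->
  dfam T Om mu X om -> 0 <= s -> t <= T -> itv_partition s t D -> mesh_le om K s D -> rho x <= r -> `|efl V X
  s D x - flw V X s t x| <= C * cost om s D].
move=> cE GV r Om. have [K [C [K0 C0 H]]] := two_parts al01 p1 pN GV r Om.
exists K, C; split=> // T mu X om s t D x T0 mu0 FX s0 tT PD FD xr.
have [dX _ _] := FX; have st := itv_partition_le PD. have oO := fam_le FX s0 st tT.
have cv : efl V X s (dya n s t) x @[n --> \oo] --> flw V X s t x.
 exact: (flw_cvg cE (good_cauchy GV) T0 mu0 FX s0 st tT).
apply/ler_addgt0Pr => e e0. have [E1|st'] := eqVneq s t.
 rewrite -E1 in PD *; rewrite (itv_partitionxx PD) /= (flw_refl _ _ dX); last by rewrite s0 E1.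
 by rewrite subrr normr0 mulr0 add0r ltW.
have lst : s < t by rewrite lt_neqAle st'. have c0 : 0 < C + 1 by rewrite ltr_wpDl.
have [h h0 Hh] := cost_small Om (divr_gt0 e0 c0). have hK0 : 0 < Num.min h K by rewrite lt_min h0.
have [n0 Hn0] := mesh_le_dya Om T0 mu0 hK0. have hK : Num.min h K <= K by rewrite ge_min lexx orbT.
have hh : Num.min h K <= h by rewrite ge_min lexx. apply: (cvg_le_dist (n0 := n0) cv) => n nn.
have [f1 _] := Hn0 n nn X om s t FX s0 st tT. have P1 := dya_part n lst. rewrite distrC.
apply: letr (H _ _ _ _ _ _ _ _ dX s0 tT PD P1 FD (mesh_leW hK f1) oO xr) _. rewrite mulrDr lerD2l.
have c1 := Hh _ _ _ _ _ _ dX s0 st tT oO P1 (mesh_leW hh f1). apply: letr (ler_wpM2l C0 c1) _.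
by rewrite mulrCA ler_piMr ?(ltW e0)// ler_pdivrMr// mul1r lerDl.
Qed.

Lemma flw_bd E (rho : E -> R) (V : 'I_d -> E -> E) : seq_compl E -> is_gg rho -> (forall i, hcl al M rho (V
  i)) -> dilatable rho V -> euler_cauchy rho V -> forall r Om : R, exists r' : R, forall T mu, 0 <= T ->
  (forall e, 0 < e -> 0 < mu e) -> forall X om s t x, dfam T Om mu X om -> 0 <= s -> s <= t -> t <= T -> rho x
  <= r -> rho (flw V X s t x) <= r'.
move=> cE g HV S cV r Om; have [K K0 HK] := efl_bd al01 p1 pN g HV S.
have [r1 Hr1] := HK r Om; have [_ gl _] := g.
exists (Num.max r1 r + 1) => T mu T0 mu0 X om s t x FX s0 st tT xr.
have [dX _ _] := FX; have oO := fam_le FX s0 st tT. have [n1 H1] := flw_unif cE cV Om T0 mu0 r (@ltr01 R).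
have [n2 H2] := mesh_le_dya Om T0 mu0 K0. have nn1 := leq_maxl n1 n2; have nn2 := leq_maxr n1 n2.
apply: letr (gl (efl V X s (dya (maxn n1 n2) s t) x) _) _; apply: lerD; last first.
 by rewrite distrC; exact: H1 nn1 _ _ _ _ _ FX s0 st tT xr.
rewrite le_max; have [E1|st'] := eqVneq s t.
 by rewrite -E1 (efl_dyaxx _ _ _ dX) ?xr ?orbT// s0 E1.
have lst : s < t by rewrite lt_neqAle st'. have [f1 _] := H2 _ nn2 X om s t FX s0 st tT.
by rewrite (Hr1 _ _ _ _ _ _ _ dX s0 tT (dya_part _ lst) f1 oO xr).
Qed.

Lemma flw_lip E (rho : E -> R) (V : 'I_d -> E -> E) : seq_compl E -> good_sys rho V -> forall r Om : R,
  exists2 C : R, 0 <= C & forall T mu, 0 <= T -> (forall e, 0 < e -> 0 < mu e) -> forall X om s t x y, dfam T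
  Om mu X om -> 0 <= s -> s <= t -> t <= T -> rho x <= r -> rho y <= r -> `|flw V X s t x - flw V X s t y| <=
  C * `|x - y|.
move=> cE GV r Om; have [K K0 HK] := efl_lip al01 p1 pN GV. have [C HC] := HK r Om; have cV := good_cauchy GV.
exists (Num.max C 1) => [|T mu T0 mu0 X om s t x y FX s0 st tT xr yr].
 by rewrite le_max ler01 orbT.
have [dX _ _] := FX; have oO := fam_le FX s0 st tT. have [n2 H2] := mesh_le_dya Om T0 mu0 K0.
have cvx : efl V X s (dya n s t) x @[n --> \oo] --> flw V X s t x.
 exact: (flw_cvg cE cV T0 mu0 FX s0 st tT).
have cvy : efl V X s (dya n s t) y @[n --> \oo] --> flw V X s t y.
 exact: (flw_cvg cE cV T0 mu0 FX s0 st tT).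
have cvxy : (efl V X s (dya n s t) x - efl V X s (dya n s t) y) @[n --> \oo] --> flw V X s t x - flw V X s t y
 by exact: cvgB.
have -> : `|flw V X s t x - flw V X s t y| = `|0 - (flw V X s t x - flw V X s t y)| by rewrite sub0r normrN.
apply: (cvg_le_dist (n0 := n2) cvxy) => n nn; rewrite sub0r normrN. have [E1|st'] := eqVneq s t.
 rewrite -E1 !(efl_dyaxx _ _ _ dX) ?s0 ?E1//. by rewrite ler_peMl// le_max lexx orbT.
have lst : s < t by rewrite lt_neqAle st'. have [f1 _] := H2 _ nn X om s t FX s0 st tT.
apply: letr (HC _ _ _ _ _ _ _ _ dX s0 tT (dya_part _ lst) f1 oO xr yr) _.
by rewrite ler_wpM2r// le_max lexx.
Qed.

Lemma mesh_le_cat om (K : R) s D1 D2 : mesh_le om K s D1 -> mesh_le om K (last s D1) D2 -> mesh_le om K s (D1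
  ++ D2). by rewrite /mesh_le cat_path => -> ->. Qed.

Lemma cost_cat om s D1 D2 : cost om s (D1 ++ D2) = cost om s D1 + cost om (last s D1) D2. by elim: D1 s => [|u D1 IH] s /=; rewrite ?add0r// IH addrA. Qed.

Lemma flw_cocycle E (rho : E -> R) (V : 'I_d -> E -> E) : seq_compl E -> good_sys rho V -> forall T Om mu, 0
  <= T -> (forall e, 0 < e -> 0 < mu e) -> forall X om s u t x, dfam T Om mu X om -> 0 <= s -> s <= u -> u <=
  t -> t <= T -> flw V X u t (flw V X s u x) = flw V X s t x.
move=> cE GV T Om mu T0 mu0 X om s u t x FX s0 su ut tT.
have [dX _ _] := FX; have [g HV S] := GV; have gW := good_weak al01 GV. have cV := good_cauchy GV.
have u0 := letr s0 su; have uT := letr ut tT. have [E1|su'] := eqVneq s u.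
 by rewrite -E1 (flw_refl _ _ dX)// s0 E1.
have [E1|ut'] := eqVneq u t.
 by rewrite -E1 (flw_refl _ _ dX)// u0 E1.
have lsu : s < u by lra. have lut : u < t by lra. have [r1 Hr1] := flw_bd cE g gW S cV (rho x) Om.
have b1 := Hr1 T mu T0 mu0 X om s u x FX s0 su uT (lexx _).
have [K1 [C1 [K10 C10 H1]]] := flw_part cE GV (rho x) Om.
have [K2 [C2 [K20 C20 H2]]] := flw_part cE GV (r1 + 1) Om. have [C3 C30 H3] := flw_lip cE GV (r1 + 1) Om.
apply/eqP; rewrite -subr_eq0 -normr_le0; apply/ler_addgt0Pr => e e0; rewrite add0r.
pose c := C3 + C2 + C1 *+ 2 + 1. have c0 : 0 < c by rewrite ltr_wpDl// !addr_ge0 ?mulrn_wge0.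
pose e' := Num.min 1 (e / c). have e'0 : 0 < e' by rewrite lt_min ltr01 divr_gt0.
have [h h0 Hh] := cost_small Om e'0. have hK0 : 0 < Num.min h (Num.min K1 K2) by rewrite !lt_min h0 K10.
have [n1 Hn1] := mesh_le_dya Om T0 mu0 hK0. have [n2 Hn2] := flw_unif cE cV Om T0 mu0 (rho x) e'0.
set h' := Num.min h _ in Hn1. have [lh lK1 lK2] : [/\ h' <= h, h' <= K1 & h' <= K2].
 by rewrite /h'; split; rewrite !ge_min lexx ?orbT.
pose n := maxn n1 n2; have nn1 : (n1 <= n)%N := leq_maxl n1 n2. have nn2 : (n2 <= n)%N := leq_maxr n1 n2.
have [f1 _] := Hn1 n nn1 X om s u FX s0 su uT. have [f2 _] := Hn1 n nn1 X om u t FX u0 ut tT.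
have P1 := dya_part n lsu; have P2 := dya_part n lut. have [_ /eqP l1] := P1.
pose y := efl V X s (dya n s u) x.
have yd : `|y - flw V X s u x| <= e' by exact: Hn2 n nn2 X om s u x FX s0 su uT (lexx _).
have yr : rho y <= r1 + 1.
 have [_ gl _] := g; apply: letr (gl (flw V X s u x) _) _; rewrite lerD//.
 by rewrite (letr yd)// ge_min lexx.
have b1' : rho (flw V X s u x) <= r1 + 1 by rewrite (letr b1)// lerDl.
have d3 := H3 T mu T0 mu0 X om u t _ _ FX u0 ut tT b1' yr.
have d2 := H2 T mu X om u t _ y T0 mu0 FX u0 tT P2 (mesh_leW lK2 f2) yr. have P12 := itv_partition_cat P1 P2.
have f12 : mesh_le om h' s (dya n s u ++ dya n u t).
 by apply: mesh_le_cat; rewrite ?l1.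
have d1 := H1 T mu X om s t _ x T0 mu0 FX s0 tT P12 (mesh_leW lK1 f12) (lexx _).
rewrite efl_cat l1 -/y cost_cat l1 in d1.
have c1 := Hh _ _ _ _ _ _ dX s0 su uT (fam_le FX s0 su uT) P1 (mesh_leW lh f1).
have c2 := Hh _ _ _ _ _ _ dX u0 ut tT (fam_le FX u0 ut tT) P2 (mesh_leW lh f2).
rewrite distrC in yd; rewrite distrC in d2. have {}d3 := letr d3 (ler_wpM2l C30 yd).
have {}d2 := letr d2 (ler_wpM2l C20 c2). have {}d1 := letr d1 (ler_wpM2l C10 (lerD c1 c2)).
apply: letr (ler_distD (flw V X u t y) _ _) _.
apply: letr (lerD d3 (letr (ler_distD (efl V X u (dya n u t) y) _ _) (lerD d2 d1))) _.
apply: (@le_trans _ _ (c * e')).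
 by rewrite -subr_ge0 (_ : _ - _ = e'); [exact: ltW|rewrite /c; ring].
by rewrite mulrC -ler_pdivlMr// ge_min lexx orbT.
Qed.

Definition rev_driver T X om Y om' := [/\ forall s t, 0 <= s <= T -> 0 <= t <= T -> Y s t = X (T - s) (T - t),
  forall s t, 0 <= s <= T -> 0 <= t <= T -> om' s t = om (T - t) (T - s) & forall s t, 0 <= s -> s <= t -> t
  <= T -> tmul (X s t) (X t s) = tone].

(** Forward and back along one small interval: both flows are replaced by Euler steps, and since
    their tensors multiply to [tone], [eul_defect] with [J = 0] bounds the distance of the composed
    steps from the identity. *)
Lemma rev_step E (rho : E -> R) (V : 'I_d -> E -> E) : seq_compl E -> good_sys rho V -> forall r Om : R,
  exists K C : R, [/\ 0 < K, 0 <= C & forall T mu X om Y om' s t x, 0 <= T -> (forall e, 0 < e -> 0 < mu e) ->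
  dfam T Om mu X om -> dfam T Om mu Y om' -> rev_driver T X om Y om' -> 0 <= s -> s < t -> t <= T -> om s t <=
  K -> rho x <= r -> `|flw V Y (T - t) (T - s) (flw V X s t x) - x| <= C * om s t `^ theta].
move=> cE GV r Om; have p0 : 0 < p by exact: lt_le_trans p1.
have [g HV S] := GV; have gW := good_weak al01 GV. have [r1 Hr1] := flw_bd cE g gW S (good_cauchy GV) r Om.
have [K1 [C1 [K10 C10 H1]]] := flw_part cE GV r Om. pose r2 := Num.max r (r1 + C1).
have [K2 [C2 [K20 C20 H2]]] := flw_part cE GV r2 Om. have [C3 C30 H3] := flw_lip cE GV r2 Om.
have [Q Q0 HQ] := eul_defect al01 g gW r2. pose K := Num.min ((2^-1) `^ p) (Num.min K1 K2).
exists K, (C3 * C1 + (C2 + Q)); split.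
- by rewrite !lt_min K10 K20 powR_gt0 ?invr_gt0.
- by rewrite !addr_ge0 ?mulr_ge0// ltW.
move=> T mu X om Y om' s t x T0 mu0 FX FY rXY s0 st tT; rewrite !le_min => /and3P[oh o1 o2] xr.
have [dX _ _] := FX; have [dY _ _] := FY; have [YE oE XX] := rXY.
have [XB _ _ op _] := dX; have [YB _ _ _ _] := dY; have t0 : 0 <= t by lra.
have [h1 h2 h3 h4] : [/\ 0 <= T - t, T - t < T - s, T - s <= T & T - t <= T - s].
 by split; lra.
have YE1 : Y (T - t) (T - s) = X t s by rewrite YE ?subKr ?h1//=; lra.
have oE1 : om' (T - t) (T - s) = om s t by rewrite oE ?subKr ?h1//=; lra.
pose k := om s t `^ p^-1; have k0 : 0 < k by apply: powR_gt0; exact: op. have kh : k <= 2^-1.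
 have -> : 2^-1 = ((2^-1 : R) `^ p) `^ p^-1 by rewrite -powRrM mulfV ?gt_eqF// powRr1// invr_ge0.
 by apply: ge0_ler_powR; rewrite ?nnegrE ?powR_ge0 ?invr_ge0 ?(ltW p0)//; exact/ltW/op.
have o0 : 0 <= om s t by exact: ltW (op s t s0 st tT).
have XE : om s t `^ theta = k ^+ N * k `^ al by exact: powR_theta. have X1 : om s t `^ theta <= 1.
 have [al0 _] := andP al01; rewrite XE mulr_ile1 ?powR_ge0 ?exprn_ge0 ?exprn_ile1 ?(ltW k0)//; first lra.
 have k1 : k <= 1 by lra.
 by have := @ge0_ler_powR _ _ (ltW al0) k 1; rewrite powR1 !nnegrE ler01 (ltW k0); apply.
set z := flw V X s t x; set y := eul V (X s t) x. have yz : `|y - z| <= C1 * om s t `^ theta.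
 have := H1 T mu X om s t [:: t] x T0 mu0 FX s0 tT (itv_partition1 st).
 by rewrite /= /cost /= o1 addr0; apply.
have zr1 : rho z <= r1 := Hr1 T mu T0 mu0 _ _ _ _ _ FX s0 (ltW st) tT xr.
have zr : rho z <= r2 by rewrite le_max; apply/orP; right; rewrite (letr zr1)// lerDl.
have yr : rho y <= r2.
 have [_ gl _] := g; rewrite le_max; apply/orP; right; apply: letr (gl z y) _.
 by rewrite lerD// (letr yz)// ler_piMr.
have d1 := H3 T mu T0 mu0 Y om' _ _ z y FY h1 h4 h3 zr yr.
have d2 : `|eul V (X t s) y - flw V Y (T - t) (T - s) y| <= C2 * om s t `^ theta.
 have := H2 T mu Y om' (T - t) (T - s) [:: T - s] y T0 mu0 FY h1 h3 (itv_partition1 h2).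
 by rewrite /= /cost /= oE1 YE1 o2 addr0; apply.
have d3 : `|eul V (X t s) y - x| <= Q * om s t `^ theta.
 have [gX bX] := XB s t s0 st tT; have [gY bY] := YB (T - t) (T - s) h1 h2 h3. rewrite YE1 oE1 in gY bY.
 have xr2 : rho x <= r2 by rewrite le_max xr. have k2 : k *+ 2 <= 1 by lra.
 have h := HQ (X s t) (X t s) x y k 0 gX gY xr2 yr k0 k2 _ _ _ _.
 rewrite XX ?(ltW st)// eul_tone subrr subr0 in h; rewrite XE; apply: h => //.
 - by move=> v vN; split; [exact: bX|exact: bY].
 - by rewrite normr0.
 - by pos.
 - by rewrite mul0r; pos.
rewrite distrC in yz; rewrite distrC in d2; have {}d1 := letr d1 (ler_wpM2l C30 yz).
apply: letr (ler_distD (flw V Y (T - t) (T - s) y) _ _) _.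
rewrite !mulrDl -mulrA lerD// (letr (ler_distD (eul V (X t s) y) _ _))// lerD//.
Qed.

(** The one-step errors of [rev_step] are peeled off from the end of a partition and transported by
    the Lipschitz backward flow; their sum is a multiple of [cost], which vanishes with the mesh. *)
Lemma flw_rev E (rho : E -> R) (V : 'I_d -> E -> E) : seq_compl E -> good_sys rho V -> forall T Om mu, 0 <= T
  -> (forall e, 0 < e -> 0 < mu e) -> forall X om Y om' s t x, dfam T Om mu X om -> dfam T Om mu Y om' ->
  rev_driver T X om Y om' -> 0 <= s -> s <= t -> t <= T -> flw V Y (T - t) (T - s) (flw V X s t x) = x.
move=> cE GV T Om mu T0 mu0 X om Y om' s t x FX FY rXY s0 st tT; have [g HV S] := GV.
have [dX _ _] := FX; have [dY _ _] := FY; have gW := good_weak al01 GV.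
have [hs hTs] : 0 <= s <= T /\ 0 <= T - s <= T by split; apply/andP; split; lra.
have [E1|st'] := eqVneq s t; first by rewrite -E1 (flw_refl _ _ dX hs) (flw_refl _ _ dY hTs).
have [r1 Hr1] := flw_bd cE g gW S (good_cauchy GV) (rho x) Om.
have [K [C [K0 C0 HK]]] := rev_step cE GV r1 Om. have [r2 Hr2] := flw_bd cE g gW S (good_cauchy GV) r1 Om.
have [r3 Hr3] := flw_bd cE g gW S (good_cauchy GV) r2 Om. have [L L0 HL] := flw_lip cE GV (Num.max r1 r3) Om.
have tele D : forall u, u <= T -> itv_partition s u D -> mesh_le om K s D -> `|flw V Y (T - u) (T - s) (flw V
 X s u x) - x| <= L * C * cost om s D.
 elim/last_ind: D => [u uT PD _|D v IH u uT PD FD].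
  rewrite -(itv_partition_nil PD) (flw_refl _ _ dX hs) (flw_refl _ _ dY hTs).
  by rewrite subrr normr0 /cost mulr0.
 have vu : v = u by have [_] := PD; rewrite last_rcons => /eqP. rewrite {}vu -cats1 in PD FD *.
 have [P1 lu _ _] := part_split PD; have [F1 ol _ _] := mesh_le_split FD.
 have sl := itv_partition_le P1; have cE1 := cost_cat om s D [:: u]. set l := last s D in sl P1 lu ol cE1.
 have [l0 lT u0] : [/\ 0 <= l, l <= T & 0 <= u] by split; lra.
 have [h1 h2 h3 h4] : [/\ 0 <= T - u, T - u <= T - l, T - l <= T - s & T - s <= T].
  by split; lra.
 rewrite -(flw_cocycle cE GV T0 mu0 x FX s0 sl (ltW lu) uT).
 rewrite -(flw_cocycle cE GV T0 mu0 _ FY h1 h2 h3 h4).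
 set y := flw V X s l x; have yr : rho y <= r1 by exact: (Hr1 T mu T0 mu0 _ _ _ _ _ FX s0 sl lT (lexx _)).
 have d1 := HK T mu X om Y om' l u y T0 mu0 FX FY rXY l0 lu uT ol yr.
 have zr := Hr2 T mu T0 mu0 _ _ _ _ _ FX l0 (ltW lu) uT yr.
 have wr := Hr3 T mu T0 mu0 _ _ _ _ _ FY h1 h2 (letr h3 h4) zr. have TL : 0 <= T - l by rewrite subr_ge0.
 have := HL T mu T0 mu0 Y om' (T - l) (T - s) _ y FY TL h3 h4 _ _.
 move=> /(_ (flw V Y (T - u) (T - l) (flw V X l u y))); rewrite !le_max wr yr orbT => /(_ isT isT) d2.
 rewrite cE1 /= mulrDr [leRHS]addrC; apply: letr (ler_distD (flw V Y (T - l) (T - s) y) _ _) _.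
 apply: lerD; last exact: IH. apply: letr d2 _; rewrite -mulrA /cost /= addr0; exact: ler_wpM2l.
apply/eqP; rewrite -subr_eq0 -normr_le0; apply/ler_addgt0Pr => e e0; rewrite add0r.
have c0 : 0 < L * C + 1 by rewrite ltr_wpDl ?mulr_ge0. have [h h0 Hh] := cost_small Om (divr_gt0 e0 c0).
have hK : 0 < Num.min h K by rewrite lt_min h0.
have [n Hn] := mesh_le_dya Om T0 mu0 hK; have [f _] := Hn n (leqnn n) X om s t FX s0 st tT.
have lst : s < t by rewrite lt_neqAle st'.
have [m1 m2] : Num.min h K <= h /\ Num.min h K <= K by rewrite !ge_min !lexx orbT. have PD := dya_part n lst.
have c1 := Hh _ _ _ _ _ _ dX s0 st tT (fam_le FX s0 st tT) PD (mesh_leW m1 f).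
apply: letr (tele _ _ tT PD (mesh_leW m2 f)) _. apply: letr (ler_wpM2l (mulr_ge0 L0 C0) c1) _.
by rewrite mulrCA ler_piMr ?(ltW e0)// ler_pdivrMr// mul1r lerDl.
Qed.

Definition close_tensors (e : R) (a b : tensor R d N) := forall v, (size v <= N)%N -> [/\ `|tcf a v| <= 1,
  `|tcf b v| <= 1 & `|tcf a v - tcf b v| <= e].

Lemma eul_close E (rho : E -> R) (V : 'I_d -> E -> E) : is_gg rho -> (forall i, hcl al M rho (V i)) -> forall
  r e : R, 0 < e -> exists2 de, 0 < de <= 1 & forall a b x y, close_tensors de a b -> tcf a [::] = 1 -> tcf b
  [::] = 1 -> rho x <= r -> `|x - y| <= de -> `|eul V a x - eul V b y| <= e.
move=> g HV r e e0; have gl : forall x y, rho y <= rho x + `|y - x| by case: g.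
have [C C0 HC] := eul_hoelder al01 g HV (r + 1). have [B B0 HB] := vfw_bd al01 g HV r.
pose S : R := \sum_(k < N.+1) d%:R ^+ k. have S0 : 0 <= S by pos. have e2 : 0 < e / 2 by lra.
have [eta eta0 Heta] := small_modulus C0 e2. have c0 : 0 < S * B + 1 by rewrite ltr_wpDl// mulr_ge0// ltW.
pose de := Num.min 1 (Num.min eta (e / 2 / (S * B + 1))).
exists de => [|a b x y cab a1 b1 xr xy]; first by rewrite !lt_min ltr01 eta0 divr_gt0//= ge_min lexx.
have yr : rho y <= r + 1.
 apply: letr (gl x y) _; rewrite lerD// distrC (letr xy)// ge_min lexx//.
have xr' : rho x <= r + 1 by rewrite (letr xr)// lerDl.
rewrite (splitr e); apply: letr (ler_distD (eul V b x) _ _) _; apply: lerD; last first.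
 apply: letr (HC b x y _ xr' yr) _; first by move=> v /cab[]. apply: letr Heta; rewrite ler_wpM2l//.
 have xe : `|x - y| <= eta by rewrite (letr xy)// !ge_min lexx orbT. have [al0 _] := andP al01.
 apply: lerD => //; apply: (ge0_ler_powR (ltW al0)); rewrite ?nnegrE//; exact: ltW.
have -> : eul V a x - eul V b x = \sum_(k < N.+1) wsum k (fun v => (tcf a v - tcf b v) *: vf_word V v x).
 rewrite /eul /tsum -sumrB; apply: eq_bigr => k _; rewrite -wsumB.
 by apply: eq_wsum => v _; rewrite scalerBl.
apply: (@le_trans _ _ (S * (B * de))); last first.
 rewrite mulrA; apply: (@le_trans _ _ (S * B * (e / 2 / (S * B + 1)))).
  by rewrite ler_wpM2l ?mulr_ge0 ?(ltW B0)// !ge_min lexx !orbT.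
 by rewrite mulrCA ler_piMr ?(ltW e2)// ler_pdivrMr// mul1r lerDl.
have de0 : 0 <= de by rewrite !le_min ler01 (ltW eta0) divr_ge0 ?(ltW e2) ?(ltW c0).
rewrite /S mulr_suml; apply: letr (ler_norm_sum _ _ _) _; apply: ler_sum => k _.
apply: wsum_norm => v vk; rewrite normrZ. have vN : (size v <= N)%N by rewrite vk -ltnS.
have [v0|v0] := eqVneq v [::].
 by rewrite v0 a1 b1 subrr normr0 mul0r mulr_ge0// ltW.
rewrite mulrC; apply: ler_pM => //; last by have [] := cab v vN. by apply: HB => //; rewrite vN; case: (v) v0.
Qed.

Definition efold E (V : 'I_d -> E -> E) (l : seq (tensor R d N)) (x : E) : E := foldl (fun y a => eul V a y) x
  l.

Lemma efl_efold E (V : 'I_d -> E -> E) X s D x : efl V X s D x = efold V (pairmap X s D) x. by elim: D s x => [//|u D IH] s x /=; rewrite IH. Qed.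

Lemma efold_close E (rho : E -> R) (V : 'I_d -> E -> E) : is_gg rho -> (forall i, hcl al M rho (V i)) ->
  forall m (r e : R), 0 < e -> exists2 de, 0 < de <= 1 & forall l l' x y, size l = m -> size l' = m -> (forall
  i, (i < m)%N -> close_tensors de (nth tone l i) (nth tone l' i) /\ tcf (nth tone l i) [::] = 1 /\ tcf (nth
  tone l' i) [::] = 1) -> rho x <= r -> `|x - y| <= de -> `|efold V l x - efold V l' y| <= e.
move=> g HV; have gl : forall x y, rho y <= rho x + `|y - x| by case: g. elim=> [|m IH] r e e0.
 exists (Num.min 1 e) => [|[|//] [|//] x y _ _ _ _ /=]; first by rewrite lt_min ltr01 e0 ge_min lexx.
 by move/letr; apply; rewrite ge_min lexx orbT.
have [B B0 HB] := eul_dist al01 g HV r. have [d1 /andP[d10 d11] H1] := IH (r + B) e e0.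
have [d2 /andP[d20 d21] H2] := eul_close g HV r d10.
exists (Num.min d1 d2) => [|[//|a l] [//|b l'] x y /= [sl] [sl'] H xr xy].
 by rewrite lt_min d10 d20 ge_min d11.
have mono c1 c2 a' b' : c1 <= c2 -> close_tensors c1 a' b' -> close_tensors c2 a' b'.
 by move=> cc h v /h[h1 h2 h3]; split=> //; exact: letr cc.
have [ca [a1 b1]] := H 0%N isT. have xr' : rho (eul V a x) <= r + B.
 apply: letr (gl x _) _; rewrite lerD//; rewrite -[B]mulr1. apply: HB; rewrite ?ler01 ?lexx// => v vN.
 by rewrite expr1n; have [] := ca v vN.
apply: H1 => //.
- move=> i im; have [ci [i1 i2]] := H i.+1 im; split; last by split. by apply: mono ci; rewrite ge_min lexx.
- apply: H2 => //; first by apply: mono ca; rewrite ge_min lexx orbT.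
 by rewrite (letr xy)// ge_min lexx orbT.
Qed.

(** Up to an error uniform over [dfam] the flow is a composition of [2 ^ n] Euler maps, so closeness
    of finitely many increments suffices. The two time intervals are matched tick by tick and need
    not coincide. *)
Lemma flw_close E (rho : E -> R) (V : 'I_d -> E -> E) : seq_compl E -> is_gg rho -> (forall i, hcl al M rho (V
  i)) -> euler_cauchy rho V -> forall T Om mu, 0 <= T -> (forall e, 0 < e -> 0 < mu e) -> forall r e : R, 0 <
  e -> exists n (de : R), 0 < de /\ forall X om Y om' s t s' t' x y, dfam T Om mu X om -> dfam T Om mu Y om'
  -> 0 <= s -> s <= t -> t <= T -> 0 <= s' -> s' <= t' -> t' <= T -> (forall i v, (i < 2 ^ n)%N -> (size v <=
  N)%N -> `|tcf (X (tick n s t i) (tick n s t i.+1)) v - tcf (Y (tick n s' t' i) (tick n s' t' i.+1)) v| <=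
  de) -> rho x <= r -> `|x - y| <= de -> `|flw V X s t x - flw V Y s' t' y| <= e.
move=> cE g HV cV T Om mu T0 mu0 r e e0. have gl : forall x y, rho y <= rho x + `|y - x| by case: g.
have e3 : 0 < e / 3 by lra. have [n1 H1] := flw_unif cE cV Om T0 mu0 (r + 1) e3.
have [n2 H2] := mesh_le_dya Om T0 mu0 (@ltr01 R).
pose n := maxn n1 n2; have nn1 : (n1 <= n)%N := leq_maxl n1 n2. have nn2 : (n2 <= n)%N := leq_maxr n1 n2.
have [de /andP[de0 de1] Hde] := efold_close g HV (2 ^ n)%N r e3.
exists n, de; split=> // X om Y om' s t s' t' x y FX FY s0 st tT s'0 st' tT' cXY xr xy.
have xr' : rho x <= r + 1 by rewrite (letr xr)// lerDl. have yr : rho y <= r + 1.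
 by apply: letr (gl x y) _; rewrite lerD// distrC (letr xy).
have h1 := H1 n nn1 X om s t x FX s0 st tT xr'. have h2 := H1 n nn1 Y om' s' t' y FY s'0 st' tT' yr.
have cell Z omZ a b i : dfam T Om mu Z omZ -> 0 <= a -> a <= b -> b <= T -> (i < 2 ^ n)%N -> nth tone (pairmap
 Z a (dya n a b)) i = Z (tick n a b i) (tick n a b i.+1) /\ (tcf (Z (tick n a b i) (tick n a b i.+1)) [::] =
 1 /\ forall v, (size v <= N)%N -> `|tcf (Z (tick n a b i) (tick n a b i.+1)) v| <= 1).
 move=> FZ a0 ab bT ni; have [dZ _ _] := FZ; have [ZB _ Z0 _ _] := dZ.
 rewrite (nth_pairmap a) ?size_mkseq// nth_dya ?(ltnW ni)// nth_mkseq//; split=> //.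
 have /andP[t1 t2] := tick_itv ab (ltnW ni); have /andP[t3 t4] := tick_itv ab ni.
 have [E1|ab'] := eqVneq a b.
  rewrite -E1 !tickxx (Z0 a _).1 ?a0 ?E1//.
  have tv (v : seq 'I_d) : (size v <= N)%N -> tcf (tone : tensor R d N) v = (size v == 0%N)%:R.
   by move=> vN; rewrite /tcf ffunE val_insub_bseq.
  by split=> [|v vN]; rewrite tv//; case: (size v == _); rewrite ?normr1 ?normr0.
 have ltt : tick n a b i < tick n a b i.+1 by rewrite -subr_gt0 tick_mesh divr_gt0 ?exprn_gt0// subr_gt0
  lt_neqAle ab'. have [gZ bZ] := ZB _ _ (letr a0 t1) ltt (letr t4 bT).
 split; first exact: glike_nil gZ. move=> v vN; apply: letr (bZ v vN) _; rewrite exprn_ile1 ?powR_ge0//.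
 have [_ o1] := H2 n nn2 Z omZ a b FZ a0 ab bT. have pV : 0 <= p^-1 by rewrite invr_ge0 (letr ler01).
 have := @ge0_ler_powR _ _ pV (omZ (tick n a b i) (tick n a b i.+1)) 1.
 rewrite powR1 !nnegrE ler01; apply=> //; last exact: o1.
 exact: driver_ge0 dZ (letr a0 t1) (ltW ltt) (letr t4 bT).
have h3 : `|efl V X s (dya n s t) x - efl V Y s' (dya n s' t') y| <= e / 3.
 rewrite !efl_efold; apply: Hde; rewrite ?size_pairmap ?size_mkseq// => i ni.
 have [-> [n1' b1]] := cell X om s t i FX s0 st tT ni.
 have [-> [n2' b2]] := cell Y om' s' t' i FY s'0 st' tT' ni.
 by split=> // v vN; split; [exact: b1|exact: b2|exact: cXY].
rewrite distrC in h1. apply: letr (ler_distD (efl V X s (dya n s t) x) _ _) _.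
apply: letr (lerD h1 (letr (ler_distD (efl V Y s' (dya n s' t') y) _ _) (lerD h3 h2))) _. lra.
Qed.

End limit_flow.

(** * Convergence and homogeneous bounds of tensors *)

Section tensor_convergence.
Context {R : realType} {d N : nat}.
Implicit Types a b x y : tensor R d N.

Definition tcvg {I : Type} (G : set_system I) (u : I -> tensor R d N) a := forall v, tcf (u i) v @[i --> G]
  --> tcf a v.

Lemma tcvg_crd I (G : set_system I) (u : I -> tensor R d N) a : tcvg G u a <-> forall w, u i w @[i --> G] -->
  a w.
split=> H w; last exact: H. have := H w; rewrite tcoefE. by under eq_fun do rewrite tcoefE.
Qed.

Lemma tcvg_tmul I (G : set_system I) (GF : Filter G) (u v : I -> tensor R d N) a b : tcvg G u a -> tcvg G v b
  -> tcvg G (fun i => tmul (u i) (v i)) (tmul a b).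
move=> /tcvg_crd ua /tcvg_crd vb; apply/tcvg_crd => w. rewrite tmulE; under eq_fun do rewrite tmulE.
apply: cvg_sumr => w1; apply: cvg_sumr => w2; apply: cvgM; first exact: cvg_cst.
by apply: cvgM; [exact: ua|exact: vb].
Qed.

Lemma tcvg_cst I (G : set_system I) (GF : Filter G) a : tcvg G (fun=> a) a. by move=> v; exact: cvg_cst. Qed.

Lemma tcvg_tinv I (G : set_system I) (GF : Filter G) (u : I -> tensor R d N) a : tcvg G u a -> tcvg G (fun i
  => tinv (u i)) (tinv a).
move=> ua. have u1 : tcvg G (fun i => tone - u i) (tone - a).
 have subE b w : (tone - b) w = tone w - b w by rewrite !ffunE.
 apply/tcvg_crd => w; rewrite subE; under eq_fun do rewrite subE.
 by apply: cvgB; [exact: cvg_cst|exact: (tcvg_crd _ _ _).1].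
have pk k : tcvg G (fun i => tpow (tone - u i) k) (tpow (tone - a) k).
 by elim: k => [|k IH]; [exact: tcvg_cst|exact: tcvg_tmul].
apply/tcvg_crd => w; rewrite /tinv sum_ffunE; under eq_fun do rewrite sum_ffunE.
by apply: cvg_sumr => k; exact: (tcvg_crd _ _ _).1.
Qed.

Lemma tcoef_tone (v : seq 'I_d) : (size v <= N)%N -> tcf (tone : tensor R d N) v = (size v == 0%N)%:R. by move=> vN; rewrite /tcf ffunE val_insub_bseq. Qed.

Lemma tmul_bd (A B k : R) a b : 0 <= A -> 0 <= B -> 0 <= k -> (forall v, (size v <= N)%N -> `|tcf a v| <= A *
  k ^+ size v) -> (forall v, (size v <= N)%N -> `|tcf b v| <= B * k ^+ size v) -> forall v, (size v <= N)%N ->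
  `|tcf (tmul a b) v| <= N.+1%:R * A * B * k ^+ size v.
move=> A0 B0 k0 Ha Hb v vN; rewrite tcoef_tmul//. apply: letr (ler_norm_sum _ _ _) _.
apply: (@le_trans _ _ (\sum_(j < (size v).+1) A * B * k ^+ size v)).
 apply: ler_sum => j _; have jv : (j <= size v)%N by rewrite -ltnS.
 rewrite normrM; apply: (@le_trans _ _ (A * k ^+ j * (B * k ^+ (size v - j)))).
  apply: ler_pM => //.
   by have := Ha (take j v); rewrite size_takel//; apply; exact: leq_trans vN.
  by have := Hb (drop j v); rewrite size_drop; apply; rewrite (leq_trans _ vN)// leq_subr.
 by rewrite mulrACA -exprD subnKC.
rewrite sumr_const card_ord -[X in X <= _]mulr_natl -!mulrA ler_wpM2r ?mulr_ge0 ?exprn_ge0//.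
by rewrite ler_nat ltnS.
Qed.

(** Inversion preserves homogeneous size up to a constant, because each product in the Neumann
    series does. It serves to bound the time-reversed driver by the same control. *)
Lemma tinv_bd : exists2 C : R, 1 <= C & forall x (k : R), 0 <= k -> (forall v, (size v <= N)%N -> `|tcf x v|
  <= k ^+ size v) -> forall v, (size v <= N)%N -> `|tcf (tinv x) v| <= C * k ^+ size v.
pose B : R := N.+1%:R * 2. exists (\sum_(j < N.+1) B ^+ j) => [|x k k0 Hx].
 by rewrite big_ord_recl expr0 lerDl sumr_ge0// => j _; rewrite exprn_ge0// mulr_ge0.
have h1 v : (size v <= N)%N -> `|tcf (tone - x) v| <= 2 * k ^+ size v.
 move=> vN; have -> : tcf (tone - x) v = tcf (tone : tensor R d N) v - tcf x v.
  by rewrite /tcf !ffunE.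
 apply: letr (ler_normB _ _) _; rewrite mulr2n mulrDl !mul1r; apply: lerD (Hx v vN).
 rewrite tcoef_tone//; case: eqP => [->|_]; rewrite ?normr1 ?expr0// normr0 exprn_ge0//.
have hp j : forall v, (size v <= N)%N -> `|tcf (tpow (tone - x) j) v| <= B ^+ j * k ^+ size v.
 elim: j => [|j IH] v vN.
  rewrite expr0 mul1r tcoef_tone//; case: eqP => [->|_]; rewrite ?normr1 ?expr0//.
  by rewrite normr0 exprn_ge0.
 have Bj : 0 <= B ^+ j by pos. by have := tmul_bd (ler0n _ 2) Bj k0 h1 IH vN; rewrite exprS.
move=> v vN.
have -> : tcf (tinv x) v = \sum_(j < N.+1) tcf (tpow (tone - x) j) v by rewrite /tcf /tinv sum_ffunE.
apply: letr (ler_norm_sum _ _ _) _; rewrite mulr_suml. by apply: ler_sum => j _; exact: hp.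
Qed.

Lemma tnorm_coef j a (v : seq 'I_d) : (size v <= N)%N -> size v = j -> `|tcf a v| <= tnorm j a.
move=> vN vj; rewrite /tnorm -sqrtr_sqr; apply: ler_wsqrtr.
rewrite (bigD1 (insub_bseq N v)) /= ?val_insub_bseq// ?vj//.
by rewrite lerDl sumr_ge0// => w _; rewrite sqr_ge0.
Qed.

Lemma tnorm_le j a (m : R) : 0 <= m -> (forall v, size v = j -> (size v <= N)%N -> `|tcf a v| <= m) -> tnorm j
  a <= #|{: N.-bseq 'I_d}|%:R * m.
move=> m0 H; set n := #|_|. have n0 : 0 <= n%:R * m by pos.
rewrite /tnorm -[leRHS]ger0_norm// -sqrtr_sqr; apply: ler_wsqrtr.
apply: (@le_trans _ _ (\sum_(w : N.-bseq 'I_d) m ^+ 2)).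
 rewrite big_mkcond /=; apply: ler_sum => w _; case: eqP => [wj|_]; last exact: sqr_ge0.
 rewrite -(real_normK (num_real (a w))) lerXn2r ?nnegrE// -tcoefE. by apply: H => //; exact: size_bseq.
rewrite sumr_const -/n -[X in X <= _]mulr_natl exprMn ler_wpM2r ?exprn_ge0//.
by rewrite -natrX ler_nat; case: (n) => // k; rewrite expnS expn1 leq_pmulr.
Qed.

End tensor_convergence.

(** * Superadditive functions from sums over partitions *)

Section partition_sums.
Context {R : realType}.
Implicit Types (f : R -> R -> R) (s t T : R) (D : seq R).

Fixpoint psum f s D : R := if D is u :: D' then f s u + psum f u D' else 0.

Lemma psum_cat f s D1 D2 : psum f s (D1 ++ D2) = psum f s D1 + psum f (last s D1) D2. by elim: D1 s => [|u D1 IH] s /=; rewrite ?add0r// IH addrA. Qed.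

Lemma psum_ge0 f s D : (forall a b, 0 <= f a b) -> 0 <= psum f s D. by move=> f0; elim: D s => //= u D IH s; rewrite addr_ge0. Qed.

Lemma psumE f s D : psum f s D = \sum_(i < size D) f (nth 0 (s :: D) i) (nth 0 D i).
elim: D s => [|u D IH] s /=; first by rewrite big_ord0. by rewrite big_ord_recl IH.
Qed.

Lemma eq_psum f g s t T D : (forall a b, 0 <= a -> a < b -> b <= T -> f a b = g a b) -> 0 <= s -> t <= T ->
  itv_partition s t D -> psum f s D = psum g s D.
move=> fg; elim: D s => [//|u D IH] s s0 tT PD /=. have [_ /= su PuD _] := @part_split R s t u [::] D PD.
have ut := itv_partition_le PuD. rewrite fg//; last exact: letr tT. by rewrite IH// (letr s0)// ltW.
Qed.

Lemma le_psum f g s t T D : (forall a b, 0 <= a -> a < b -> b <= T -> f a b <= g a b) -> 0 <= s -> t <= T ->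
  itv_partition s t D -> psum f s D <= psum g s D.
move=> fg; elim: D s => [//|u D IH] s s0 tT PD /=. have [_ /= su PuD _] := @part_split R s t u [::] D PD.
have ut := itv_partition_le PuD. apply: lerD; first by apply: fg => //; exact: letr tT.
by rewrite IH// (letr s0)// ltW.
Qed.

(** The rough path distance is a supremum over partitions of all of [[0, T]]; a partition of a
    subinterval is completed by at most two points, and nonnegative terms can only increase the
    sum. *)
Lemma psum_extend f s t T D : (forall a b, 0 <= f a b) -> 0 <= s -> t <= T -> itv_partition s t D -> exists2
  D', itv_partition 0 T D' & psum f s D <= psum f 0 D'.
move=> f0 s0 tT PD. pose A := if s == 0 then [::] else [:: s]. pose B := if t == T then [::] else [:: T].
have PA : itv_partition 0 s A.
 rewrite /A; case: eqVneq => [->|s0']; first by split=> //=.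
 by apply: itv_partition1; rewrite lt_neqAle eq_sym s0'.
have PB : itv_partition t T B.
 rewrite /B; case: eqVneq => [->|tT']; first by split=> //=. by apply: itv_partition1; rewrite lt_neqAle tT'.
exists (A ++ (D ++ B)); first exact: itv_partition_cat PA (itv_partition_cat PD PB).
have [_ /eqP lA] := PA; rewrite psum_cat lA psum_cat addrCA lerDl. by rewrite addr_ge0 ?psum_ge0.
Qed.

Definition sup_psum f s t : R := sup [set psum f s D | D in [set D | itv_partition s t D]].

Definition psum_bd f T (B : R) := forall s t D, 0 <= s -> t <= T -> itv_partition s t D -> psum f s D <= B.

Lemma sup_psum_ub f T B s t D : psum_bd f T B -> 0 <= s -> t <= T -> itv_partition s t D -> psum f s D <=
  sup_psum f s t.
move=> fB s0 tT PD; apply: sup_upper_bound; last by exists D. split; first by exists (psum f s D), D.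
by exists B => _ [D' PD' <-]; exact: fB PD'.
Qed.

Lemma sup_psum_le f s t (C : R) : s <= t -> (forall D, itv_partition s t D -> psum f s D <= C) -> sup_psum f s
  t <= C.
move=> st H; apply: sup_le_ub; last by move=> _ [D PD <-]; exact: H.
have [->|st'] := eqVneq s t; first by exists (psum f t [::]), [::] => //; split=> //=.
exists (psum f s [:: t]), [:: t] => //; apply: itv_partition1. by lra.
Qed.

Lemma sup_psum_super f T B s u t : psum_bd f T B -> 0 <= s -> s <= u -> u <= t -> t <= T -> sup_psum f s u +
  sup_psum f u t <= sup_psum f s t.
move=> fB s0 su ut tT; have u0 := letr s0 su; have uT := letr ut tT.
rewrite -lerBrDr; apply: sup_psum_le => // D1 P1; rewrite lerBrDr addrC -lerBrDr.
apply: sup_psum_le => // D2 P2; rewrite lerBrDr addrC.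
have [_ /eqP l1] := P1; rewrite -[X in _ + psum f X _]l1 -psum_cat.
by apply: (sup_psum_ub fB) => //; exact: itv_partition_cat P1 P2.
Qed.

Lemma sup_psumxx f s : sup_psum f s s = 0.
rewrite /sup_psum (_ : [set _ | _ in _] = [set 0]) ?sup1//.
apply/seteqP; split=> [_ [D PD <-]/=|_ ->]; first by rewrite (itv_partitionxx PD).
by exists [::] => //; split=> //=.
Qed.

End partition_sums.

(** * Controls of rough paths *)

Section rough_path_control.
Context {R : realType} {d : nat} (T p : R) (T0 : 0 < T) (p1 : 1 <= p).
Local Notation N := (Num.truncn p).
Implicit Types (X Y : R -> R -> tensor R d N) (x : R -> tensor R d N) (s t : R).

Let p0 : 0 < p. exact: lt_le_trans p1. Qed.

Lemma lv_le j : (0 < j < N.+1)%N -> 0 < (j%:R : R) <= p.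
by move=> /andP[j0 jN]; rewrite ltr0n j0 -truncn_ge_nat// ltW.
Qed.

Definition lev j X s t : R := tnorm j (X s t) `^ (p / j%:R).

(** The sum over the levels of [|X^(j)|^(p/j)], whose supremum over partitions is the usual control
    of a rough path. *)
Definition pvf X s t : R := \sum_(1 <= j < N.+1) lev j X s t.

Lemma lev_ge0 j X s t : 0 <= lev j X s t. by pos. Qed.

Lemma pvf_ge0 X s t : 0 <= pvf X s t. by pos. Qed.

Lemma pvar_dist_psum j X Y (de : R) D : (0 < j < N.+1)%N -> 0 < de -> (pvar_dist T X Y < de%:E)%E ->
  itv_partition 0 T D -> psum (lev j (fun s t => X s t - Y s t)) 0 D <= de `^ (p / j%:R).
move=> jN de0 dXY PD; have /andP[j0 jp] := lv_le jN. set Z := fun s t : R => _. have q0 : 0 < p / j%:R by pos.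
have q'0 : 0 <= j%:R / p by pos. have lt1 : (pvar_level T j Z < de%:E)%E.
 apply: le_lt_trans dXY; rewrite /pvar_dist. pose F k := pvar_level T k (fun s t => X s t - Y s t).
 by apply: (le_bigmax_seq 0%E j xpredT F) => //; rewrite mem_index_iota.
have E1 : psum (lev j Z) 0 D = pvar_sum j Z D by rewrite psumE. have S0 := pvar_sum_ge0 j Z D.
have le1 : (((pvar_sum j Z D) `^ (j%:R / p))%R%:E <= pvar_level T j Z)%E.
 rewrite -poweR_EFin /pvar_level.
 have le2 : ((pvar_sum j Z D)%:E <= ereal_sup [set (pvar_sum j Z s)%:E | s in itv_partition 0%R T])%E.
  by apply: ereal_sup_ubound; exists D.
 apply: gt0_ler_poweR => //.
  by rewrite in_itv /= lee_fin S0 leey.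
 by rewrite in_itv /= leey andbT (letr _ le2)// lee_fin.
have {le1 lt1} := le_lt_trans le1 lt1; rewrite lte_fin => /ltW h.
rewrite E1; have -> : pvar_sum j Z D = (pvar_sum j Z D `^ (j%:R / p)) `^ (p / j%:R).
 rewrite -powRrM; have -> : j%:R / p * (p / j%:R) = 1.
  by field; rewrite !gt_eqF.
 by rewrite powRr1.
by apply: (ge0_ler_powR (ltW q0)); rewrite ?nnegrE ?powR_ge0// ltW.
Qed.

(** Signatures and increments of the signature from 0 agree for ordered times in [[0, T]]
    ([sig_chen]), and sums over partitions involve no other times. *)
Lemma eq_pvar_dist X X' Y Y' : (forall s t, 0 <= s -> s < t -> t <= T -> X s t = X' s t) -> (forall s t, 0 <=
  s -> s < t -> t <= T -> Y s t = Y' s t) -> pvar_dist T X Y = pvar_dist T X' Y'.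
move=> XX YY; apply: eq_bigr => j _; rewrite /pvar_level.
have E1 D : itv_partition 0 T D -> pvar_sum j (fun s t => X s t - Y s t) D = pvar_sum j (fun s t => X' s t -
 Y' s t) D.
 move=> PD; transitivity (psum (lev j (fun s t => X s t - Y s t)) 0 D); first by rewrite psumE.
 transitivity (psum (lev j (fun s t => X' s t - Y' s t)) 0 D); last by rewrite psumE.
 apply: (eq_psum _ (lexx 0) (lexx T) PD) => a b a0 ab bT.
 by rewrite /lev (XX a b a0 ab bT) (YY a b a0 ab bT).
have gen (S1 S2 : seq R -> R) : (forall D, itv_partition 0 T D -> S1 D = S2 D) -> [set (S1 D)%:E | D in
 itv_partition 0 T] = [set (S2 D)%:E | D in itv_partition 0 T].
 move=> SS; apply/seteqP; split=> _ [D PD <-]; exists D; rewrite ?SS//.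
by rewrite (gen _ _ E1).
Qed.

Lemma powR_add_le (a b q : R) : 0 <= a -> 0 <= b -> 0 <= q -> (a + b) `^ q <= 2 `^ q * (a `^ q + b `^ q).
move=> a0 b0 q0; wlog ab : a b a0 b0 / a <= b.
 by move=> H; have [/H->//|/ltW /H] := leP a b; rewrite addrC [b `^ q + _]addrC; apply.
apply: (@le_trans _ _ ((2 * b) `^ q)).
 apply: (ge0_ler_powR q0); rewrite ?nnegrE ?addr_ge0 ?mulr_ge0//; lra.
by rewrite powRM// ler_wpM2l ?powR_ge0// lerDr powR_ge0.
Qed.

Lemma psum_lin (c : nat -> R) (f g : nat -> R -> R -> R) s D : psum (fun a b => \sum_(1 <= j < N.+1) c j * (f
  j a b + g j a b)) s D = \sum_(1 <= j < N.+1) c j * (psum (f j) s D + psum (g j) s D).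
elim: D s => [|u D IH] s /=; first by rewrite big1// => j _; rewrite addr0 mulr0.
by rewrite IH -big_split /=; apply: eq_bigr => j _; ring.
Qed.

Lemma psum_length (A s : R) D t : itv_partition s t D -> psum (fun a b => A * (b - a)) s D = A * (t - s).
elim: D s => [|u D IH] s PD /=; first by rewrite (itv_partition_nil PD) subrr mulr0.
by rewrite IH; [ring|exact: itv_partition_cons PD].
Qed.

Definition lip_lvs Y (A : R) := forall j s t, (0 < j < N.+1)%N -> 0 <= s -> s < t -> t <= T -> lev j Y s t <=
  A * (t - s).

(** What a distance [de] to a smooth path contributes to the control; the powers of 2 come from
    [powR_add_le]. *)
Definition gg_fun (de : R) : R := \sum_(1 <= j < N.+1) 2 `^ (p / j%:R) * de `^ (p / j%:R).

Definition lv_cst : R := \sum_(1 <= j < N.+1) 2 `^ (p / j%:R).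

(** A path near a smooth one has a control of at most a small constant plus a multiple of the length
    of the interval. One smooth path serves a whole tail of a convergent sequence, which makes the
    controls equicontinuous. *)
Lemma psum_pvf X Y (de A : R) s t D : 0 < de -> (pvar_dist T X Y < de%:E)%E -> lip_lvs Y A -> 0 <= s -> t <= T
  -> itv_partition s t D -> psum (pvf X) s D <= gg_fun de + lv_cst * A * (t - s).
move=> de0 dXY LY s0 tT PD. pose Z := fun s t : R => X s t - Y s t.
apply: (@le_trans _ _ (psum (fun a b => \sum_(1 <= j < N.+1) 2 `^ (p / j%:R) * (lev j Z a b + lev j Y a b)) s
 D)).
 apply: (le_psum _ s0 tT PD) => a b a0 ab bT.
 rewrite /pvf big_nat_cond [leRHS]big_nat_cond; apply: ler_sum => j /andP[jN _].
 have /andP[j0 _] := lv_le jN. have q0 : 0 <= p / j%:R by pos.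
 apply: letr (powR_add_le (tnorm_ge0 _ _) (tnorm_ge0 _ _) q0).
 apply: (ge0_ler_powR q0); rewrite ?nnegrE ?addr_ge0 ?tnorm_ge0//.
 by have := ler_tnormD j (Z a b) (Y a b); rewrite /Z subrK.
rewrite psum_lin /gg_fun /lv_cst mulr_suml mulr_suml -big_split /=.
rewrite big_nat_cond [leRHS]big_nat_cond; apply: ler_sum => j /andP[jN _].
rewrite -mulrA -mulrDr ler_wpM2l ?powR_ge0//; apply: lerD.
 have [D' PD' /letr] := psum_extend (lev_ge0 j Z) s0 tT PD; apply. exact: pvar_dist_psum.
rewrite -(psum_length _ PD); apply: (le_psum _ s0 tT PD) => a b a0 ab bT. exact: LY.
Qed.

Lemma gg_fun_small (e : R) : 0 < e -> exists2 de, 0 < de & gg_fun de <= e.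
move=> e0. have L0 : 0 <= lv_cst by pos. have c0 : 0 < lv_cst + 1 by lra.
pose de := Num.min 1 (e / (lv_cst + 1)). have de0 : 0 < de by rewrite lt_min ltr01 divr_gt0.
exists de => //; apply: (@le_trans _ _ (lv_cst * de)).
 rewrite /gg_fun /lv_cst mulr_suml big_nat_cond [leRHS]big_nat_cond.
 apply: ler_sum => j /andP[jN _]; have /andP[j0 jp] := lv_le jN.
 rewrite ler_wpM2l ?powR_ge0//; apply: ge1r_powR; first by rewrite de0 ge_min lexx.
 by rewrite ler_pdivlMr// mul1r.
apply: (@le_trans _ _ (lv_cst * (e / (lv_cst + 1)))).
 by rewrite ler_wpM2l// ge_min lexx orbT.
by rewrite mulrCA ler_piMr ?(ltW e0)// ler_pdivrMr// mul1r lerDl.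
Qed.

Definition smth_inc (z : R -> 'rV[R]_d) : R -> R -> tensor R d N := increment (signature N z 0).

Lemma smth_inc_coef z : smooth_path T z -> exists2 K : R, 0 <= K & forall s t v, 0 <= s <= T -> 0 <= t <= T ->
  (size v <= N)%N -> `|tcf (smth_inc z s t) v| <= (K * `|t - s|) ^+ size v.
move=> sz; have [K K0 HK] := vel_bd sz; exists K => // s t v sT tT vN. have [L1 L2] := inc_lift N sz sT.
exact: is_lift_bd K0 HK L1 sT L2 v t vN tT.
Qed.

(** Level [j] of a smooth path is of order [(K (t - s))^j], its power [p / j] of order [(t - s)^p],
    and this is at most [T^(p-1) (t - s)] because [p >= 1]. *)
Lemma smth_lip_lvs z : smooth_path T z -> exists2 A : R, 0 <= A & lip_lvs (smth_inc z) A.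
move=> sz; have [K K0 HK] := smth_inc_coef sz. pose B : R := #|{: N.-bseq 'I_d}|%:R + 1.
pose C : R := \sum_(1 <= j < N.+1) B `^ (p / j%:R). have B0 : 0 <= B by pos. have C0 : 0 <= C by pos.
exists (C * (K `^ p * T `^ (p - 1))); first by rewrite !mulr_ge0 ?powR_ge0.
move=> j s t jN s0 st tT; have /andP[j0 jp] := lv_le jN. have q0 : 0 <= p / j%:R by pos.
have ts : 0 < t - s by lra. have Kts : 0 <= K * (t - s) by pos.
have h1 : tnorm j (smth_inc z s t) <= B * (K * (t - s)) ^+ j.
 apply: letr (tnorm_le (exprn_ge0 j Kts) _) _.
  move=> v vj vN; have := HK s t v; rewrite s0 tT (letr (ltW st) tT) (letr s0 (ltW st)).
  by move=> /(_ isT isT vN); rewrite vj (gtr0_norm ts).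
 by rewrite ler_wpM2r ?exprn_ge0// lerDl.
apply: (@le_trans _ _ ((B * (K * (t - s)) ^+ j) `^ (p / j%:R))).
 by apply: (ge0_ler_powR q0); rewrite ?nnegrE ?tnorm_ge0 ?mulr_ge0 ?exprn_ge0.
rewrite powRM ?exprn_ge0// -powR_mulrn// -powRrM.
have -> : j%:R * (p / j%:R) = p by rewrite mulrC divfK// gt_eqF.
rewrite -mulrA; apply: ler_pM; rewrite ?powR_ge0//.
 have /andP[j1 j2] := jN. rewrite /C (bigD1_seq j) ?mem_index_iota ?iota_uniq//= lerDl. by pos.
rewrite powRM ?(ltW ts)// -mulrA ler_wpM2l ?powR_ge0//.
rewrite -mulr_powRB1 ?(ltW ts)// mulrC ler_wpM2r ?(ltW ts)//. have pm : 0 <= p - 1 by rewrite subr_ge0.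
apply: (ge0_ler_powR pm); rewrite ?nnegrE ?(ltW ts) ?(ltW T0)//; lra.
Qed.

(** Covers the given rough paths and the signatures of smooth paths alike, so that approximation
    becomes convergence within one class. *)
Definition rpath x := [/\ x 0 = tone, forall t, tcf (x t) [::] = 1 & forall de : R, 0 < de -> exists2 z,
  smooth_path T z & (pvar_dist T (smth_inc z) (increment x) < de%:E)%E].

Lemma rpath_smth z : smooth_path T z -> rpath (signature N z 0).
move=> sz; split.
- have h0 : (0 : R) <= 0 <= T by rewrite lexx ltW. exact: (sig_lift N sz h0).2.
- by move=> t; rewrite tcoef_nil sig_nil.
- move=> de de0; exists z => //; rewrite pvar_distxx// lte_fin.
Qed.

Lemma rpath_rough (Z : rough_path d T p) : rpath Z.
split.
- exact: rp_left.
- by move=> t; rewrite tcoef_nil free_group_nil//; exact: rp_group.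
- move=> de de0; have [z sz cz] := rp_closure Z. have d0 : (0 < de%:E :> \bar R)%E by rewrite lte_fin.
 have nb : nbhs (0 : \bar R) [set y | (y < de%:E)%E].
  by apply: open_nbhs_nbhs; split; [exact: open_ereal_lt_ereal|exact: d0].
 have [k _ Hk] := cz _ nb. exists (z k) => //; have := Hk k (leqnn k); rewrite /=.
 rewrite (eq_pvar_dist (X' := smth_inc (z k)) (Y' := increment Z))//.
 by move=> s t s0 st tT; apply: sig_chen (sz k) s0 (ltW st) tT.
Qed.

Lemma tcoef_sub (a b : tensor R d N) v : tcf (a - b) v = tcf a v - tcf b v. by rewrite /tcf !ffunE. Qed.

Lemma pvar_dist_coef X Y (de : R) s t v : 0 < de -> (pvar_dist T X Y < de%:E)%E -> 0 <= s -> s < t -> t <= T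
  -> (0 < size v <= N)%N -> `|tcf (X s t) v - tcf (Y s t) v| <= de.
move=> de0 dXY s0 st tT /andP[v0 vN]; rewrite -tcoef_sub. apply: letr (tnorm_coef _ vN erefl) _.
have jN : (0 < size v < N.+1)%N by rewrite v0. have /andP[j0 jp] := lv_le jN.
have q0 : 0 < p / (size v)%:R by pos.
have [D' PD' h] := psum_extend (lev_ge0 (size v) (fun s t => X s t - Y s t)) s0 tT (itv_partition1 st).
have {h} := letr h (pvar_dist_psum jN de0 dXY PD').
rewrite /= addr0 /lev => h; rewrite leNgt; apply/negP => h2. move: h; rewrite leNgt => /negP; apply.
by apply: (gt0_ltr_powR q0); rewrite ?nnegrE ?tnorm_ge0 ?(ltW de0).
Qed.

(** The summand [t - s] keeps the control positive off the diagonal even where the path is constant;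
    the factor [c] makes room for the inverses of the increments. *)
Definition ctrl (c : R) X s t : R := c * (sup_psum (pvf X) s t + (t - s)).

Lemma rpath_bd x : rpath x -> exists B, psum_bd (pvf (increment x)) T B.
move=> [_ _ H]; have [z sz dz] := H 1 ltr01; have [A A0 HA] := smth_lip_lvs sz. have L0 : 0 <= lv_cst by pos.
exists (gg_fun 1 + lv_cst * A * T) => s t D s0 tT PD. rewrite pvar_dist_sym in dz.
apply: letr (psum_pvf ltr01 dz HA s0 tT PD) _. rewrite lerD2l ler_wpM2l ?mulr_ge0//; lra.
Qed.

Lemma ctrl_le (c : R) X z (de A : R) s t : 0 <= c -> 0 < de -> (pvar_dist T X (smth_inc z) < de%:E)%E ->
  lip_lvs (smth_inc z) A -> 0 <= s -> s <= t -> t <= T -> ctrl c X s t <= c * (gg_fun de + (lv_cst * A + 1) *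
  (t - s)).
move=> c0 de0 dz HA s0 st tT; rewrite /ctrl.
have h : sup_psum (pvf X) s t <= gg_fun de + lv_cst * A * (t - s).
 by apply: sup_psum_le => // D PD; exact: psum_pvf dz HA s0 tT PD.
have -> : gg_fun de + (lv_cst * A + 1) * (t - s) = gg_fun de + lv_cst * A * (t - s) + (t - s) by ring.
by apply: ler_wpM2l => //; rewrite lerD2r.
Qed.

Lemma lev_coef j X s t v (C : R) : (0 < j < N.+1)%N -> size v = j -> (0 <= C) -> lev j X s t <= C -> `|tcf (X
  s t) v| <= (C `^ p^-1) ^+ j.
move=> jN vj C0 lC; have /andP[j0 jp] := lv_le jN; have /andP[_ jN'] := jN.
apply: letr (tnorm_coef _ _ vj) _; first by rewrite vj. rewrite -powR_mulrn ?powR_ge0// -powRrM.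
have -> : tnorm j (X s t) = lev j X s t `^ (p^-1 * j%:R).
 rewrite /lev -powRrM; have -> : p / j%:R * (p^-1 * j%:R) = 1.
  by field; rewrite !gt_eqF.
 by rewrite powRr1// tnorm_ge0.
have q0 : 0 <= p^-1 * j%:R by pos. by apply: (ge0_ler_powR q0); rewrite ?nnegrE ?lev_ge0.
Qed.

Definition rpath_cvg (xk : nat -> R -> tensor R d N) x := forall de : R, 0 < de -> exists k0, forall k, (k0 <=
  k)%N -> (pvar_dist T (increment (xk k)) (increment x) < de%:E)%E.

Lemma rpath_bseq x t : rpath x -> x t [bseq] = 1. by move=> [_ H _]; rewrite -tcoef_nil. Qed.

Lemma inc_split x s t : rpath x -> increment x s t = tmul (tinv (increment x 0 s)) (increment x 0 t).
move=> rx; have b u := rpath_bseq u rx. rewrite -[in RHS](inc_chen 0 t (b s)) tmulA.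
by rewrite (tinv_mul _).2 ?tmul1l// inc_nil.
Qed.

Lemma inc_inv x s t : rpath x -> increment x t s = tinv (increment x s t).
move=> rx; have b u := rpath_bseq u rx. have [_ h2] := tinv_mul (inc_nil (b s) (b t)).
have := inc_chen s s (b t); rewrite (incrementxx (b s)) => h1. by rewrite -[LHS]tmul1l -h2 -tmulA h1 tmul1r.
Qed.

Lemma rpath_coef_nil x s t : rpath x -> tcf (increment x s t) [::] = 1. by move=> rx; rewrite tcoef_nil inc_nil//; exact: rpath_bseq. Qed.

Lemma tcoef_long (a b : tensor R d N) (C : R) : 0 <= C -> (forall v, (size v <= N)%N -> `|tcf a v - tcf b v|
  <= C) -> forall v, `|tcf a v - tcf b v| <= C.
move=> C0 H v; have := H (insub_bseq N v) (size_bseq _). by rewrite !tcoefE.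
Qed.

Lemma pvar_dist_path x y (de : R) t : rpath x -> rpath y -> 0 < de -> (pvar_dist T (increment x) (increment y)
  < de%:E)%E -> 0 <= t <= T -> forall v, `|tcf (increment x 0 t) v - tcf (increment y 0 t) v| <= de.
move=> rx ry de0 dxy /andP[t0 tT]; apply: tcoef_long => [|v vN]; first exact: ltW.
have [->|v0] := eqVneq v [::].
 by rewrite !rpath_coef_nil// subrr normr0 ltW.
have [<-|t0'] := eqVneq 0 t.
 by rewrite !incrementxx ?subrr ?normr0 ?ltW//; exact: rpath_bseq.
apply: pvar_dist_coef dxy _ _ tT _ => //; first by rewrite lt_neqAle t0'. by rewrite vN andbT; case: (v) v0.
Qed.

Lemma rpath_cont x t v : rpath x -> 0 <= t <= T -> forall e : R, 0 < e -> exists2 de, 0 < de & forall u, 0 <=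
  u <= T -> `|u - t| <= de -> `|tcf (increment x 0 u) v - tcf (increment x 0 t) v| <= e.
move=> rx tT e e0; have e3 : 0 < e / 3 by rewrite divr_gt0. have [_ _ H] := rx; have [z sz dz] := H _ e3.
have rz := rpath_smth sz. have h0 : (0 : R) <= 0 <= T by lra. have [[yc _ _] _] := inc_lift N sz h0.
have tI : `[0, T]%classic t by []. have /subspace_continuousP/(_ t tI)/cvgrPdist_le/(_ _ e3) := yc v.
rewrite near_withinE => /nbhs_normP[r /= r0 Hr]. exists (r / 2) => [|u uT ut]; first by rewrite divr_gt0.
have h1 := pvar_dist_path rz rx e3 dz uT v; have h2 := pvar_dist_path rz rx e3 dz tT v.
have h3 : `|tcf (smth_inc z 0 t) v - tcf (smth_inc z 0 u) v| <= e / 3.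
 apply: Hr; last by rewrite /= in_itv. by rewrite /= distrC (le_lt_trans ut)// ltr_pdivrMr// ltr_pMr// ltr1n.
rewrite -/(smth_inc z) in h1 h2.
have -> : tcf (increment x 0 u) v - tcf (increment x 0 t) v = - (tcf (smth_inc z 0 u) v - tcf (increment x 0
 u) v) + - (tcf (smth_inc z 0 t) v - tcf (smth_inc z 0 u) v) + (tcf (smth_inc z 0 t) v - tcf (increment x 0
 t) v) by ring. apply: letr (ler_normD _ _) _. apply: letr (lerD (ler_normD _ _) (lexx _)) _.
by rewrite !normrN; lra.
Qed.

(** The distance controls the increments from time 0 uniformly in time, and these are continuous in
    time for the limit. General increments follow by [inc_split], also when both endpoints move. *)
Lemma rpath_tcvg (xk : nat -> R -> tensor R d N) x (ak bk : nat -> R) (a b : R) : (forall k, rpath (xk k)) ->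
  rpath x -> rpath_cvg xk x -> (forall k, 0 <= ak k <= T) -> (forall k, 0 <= bk k <= T) -> 0 <= a <= T -> 0 <=
  b <= T -> ak @ \oo --> a -> bk @ \oo --> b -> tcvg \oo (fun k => increment (xk k) (ak k) (bk k)) (increment
  x a b).
move=> rk rx kx akT bkT aT bT aka bkb.
have one (ck : nat -> R) c : (forall k, 0 <= ck k <= T) -> 0 <= c <= T -> ck @ \oo --> c -> tcvg \oo (fun k =>
 increment (xk k) 0 (ck k)) (increment x 0 c).
 move=> ckT cT cc v; apply/cvgrPdist_le => e e0. have e2 : 0 < e / 2 by lra.
 have [k0 Hk0] := kx _ e2; have [de de0 Hde] := rpath_cont v rx cT e2. near=> k; rewrite distrC.
 apply: letr (ler_distD (tcf (increment x 0 (ck k)) v) _ _) _. rewrite (splitr e); apply: lerD.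
  apply: (pvar_dist_path (rk k) rx e2) => //; apply: Hk0; near: k; exact: nbhs_infty_ge.
 apply: Hde => //; rewrite distrC; near: k; move/cvgrPdist_le: cc; exact.
have -> : (fun k => increment (xk k) (ak k) (bk k)) = (fun k => tmul (tinv (increment (xk k) 0 (ak k)))
 (increment (xk k) 0 (bk k))).
 by apply/funext => k; exact: (inc_split (ak k) (bk k) (rk k)).
rewrite (inc_split a b rx); apply: tcvg_tmul; last exact: one. by apply: tcvg_tinv; exact: one. Unshelve. all: by end_near. Qed.

Lemma rpath_approx x : rpath x -> exists2 zk : nat -> R -> 'rV[R]_d, forall k, smooth_path T (zk k) &
  rpath_cvg (fun k => signature N (zk k) 0) x.
move=> [_ _ H]. have n0 n : 0 < (n.+1%:R : R)^-1 by [].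
have [zk Hz] := choice (fun n : nat => let: ex_intro2 z h1 h2 := H _ (n0 n) in ex_intro (fun z => smooth_path
 T z /\ (pvar_dist T (smth_inc z) (increment x) < (n.+1%:R^-1)%:E)%E) z (conj h1 h2)).
exists zk => [k|de de0]; first exact: (Hz k).1. have := near_infty_natSinv_lt (PosNum de0) => -[k0 _ Hk0].
exists k0 => k kk; apply: lt_trans (Hz k).2 _. by rewrite lte_fin; exact: Hk0.
Qed.

End rough_path_control.

(** [Num.truncn p] equals a successor only propositionally, while the Euler estimates are indexed by
    [M.+1]. *)
Definition tcast {R : realType} {d n m : nat} (h : n = m) (a : tensor R d n) : tensor R d m := ecast k (tensor
  R d k) h a.

Section tensor_cast.
Context {R : realType} {d n m : nat} (h : n = m).
Implicit Types a b : tensor R d n.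

Lemma tcoef_tcast a v : tcf (tcast h a) v = tcf a v. by case: m / h. Qed.

Lemma tmul_tcast a b : tmul (tcast h a) (tcast h b) = tcast h (tmul a b). by case: m / h. Qed.

Lemma tcast_tone : tcast h (tone : tensor R d n) = tone. by case: m / h. Qed.

Lemma is_lift_tcast (a b : R) (x : R -> tensor R d n) c : is_lift a b x c -> is_lift a b (fun t => tcast h (x
  t)) c. by case: m / h. Qed.

End tensor_cast.

Lemma bd_prefix (R : realType) (f : nat -> R) n : exists B, forall k, (k < n)%N -> f k <= B.
elim: n => [|n [B HB]]; first by exists 0. exists (Num.max B (f n)) => k.
rewrite ltnS leq_eqVlt le_max => /orP[/eqP ->|/HB ->//]. by lra.
Qed.

(** * The driver of a rough path and of its time reversal *)

Section rough_path_drivers.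
Context {R : realType} {d M : nat} (T p : R) (T0 : 0 < T) (p1 : 1 <= p).
Local Notation N := (Num.truncn p).
Context (hM : Num.truncn p = M.+1).
Implicit Types (x : R -> tensor R d N) (s t : R).
Local Notation rpath := (@rpath R d T p).
Local Notation rpath_cvg := (@rpath_cvg R d T p).
Local Notation dfam := (@dfam R d M p).

Let p0 : 0 < p. exact: lt_le_trans p1. Qed.

Definition inv_cst : R := projT1 (cid2 (@tinv_bd R d N)).

Lemma inv_cst_ge1 : 1 <= inv_cst. by rewrite /inv_cst; case: cid2. Qed.

Lemma inv_cstP (a : tensor R d N) (k : R) : 0 <= k -> (forall v, (size v <= N)%N -> `|tcf a v| <= k ^+ size v)
  -> forall v, (size v <= N)%N -> `|tcf (tinv a) v| <= inv_cst * k ^+ size v. by rewrite /inv_cst; case: cid2 => C /= _; apply. Qed.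

Definition drv x s t : tensor R d M.+1 := tcast hM (increment x s t).

(** The constant is raised to the power [p] because the control acts through its root of order [p];
    increments and their inverses then obey the same bound. *)
Definition drv_ctrl x s t : R := ctrl (inv_cst `^ p) (increment x) s t.

Lemma smth_slike z s t : smooth_path T z -> 0 <= s <= T -> 0 <= t <= T -> slike (drv (signature N z 0) s t).
move=> sz sT tT; have [K K0 HK] := vel_bd sz. have [L1 L2] := inc_lift N sz sT.
exists T, K, s, t, (fun r => drv (signature N z 0) s r), (velocity z); split=> //.
split=> //; first exact: is_lift_tcast. by rewrite /drv L2 tcast_tone.
Qed.

Lemma drv_glike x s t : rpath x -> 0 <= s <= T -> 0 <= t <= T -> glike (drv x s t).
move=> rx sT tT; have [zk sz cz] := rpath_approx rx.
have cst (a : R) : (fun _ : nat => a) @ \oo --> a by exact: cvg_cst.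
have cv := rpath_tcvg T0 p1 (fun k => rpath_smth p T0 (sz k)) rx cz (fun=> sT) (fun=> tT) sT tT (cst s) (cst
 t). move=> e e0.
have : \forall k \near \oo, forall w : N.-bseq 'I_d, `|tcf (increment x s t) w - tcf (increment (signature N
 (zk k) 0) s t) w| <= e.
 by apply: filter_forall => w; have /cvgrPdist_le/(_ e e0) := cv w.
case=> k _ /(_ k (leqnn k)) Hk. exists (drv (signature N (zk k) 0) s t); first exact: smth_slike.
move=> v; rewrite !tcoef_tcast.
by apply: tcoef_long => [|w wN]; [exact: ltW|have := Hk (insub_bseq N w); rewrite val_insub_bseq].
Qed.

Lemma drv_chen x s u t : rpath x -> tmul (drv x s u) (drv x u t) = drv x s t. by move=> rx; rewrite tmul_tcast inc_chen// (rpath_bseq _ rx). Qed.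

Lemma drvxx x s : rpath x -> drv x s s = tone. by move=> rx; rewrite /drv incrementxx ?tcast_tone// (rpath_bseq _ rx). Qed.

Lemma drv_bd x s t v : rpath x -> 0 <= s -> s < t -> t <= T -> (size v <= M.+1)%N -> `|tcf (drv x s t) v| <=
  (drv_ctrl x s t `^ p^-1) ^+ size v /\ `|tcf (drv x t s) v| <= (drv_ctrl x s t `^ p^-1) ^+ size v.
move=> rx s0 st tT vM; have C1 := inv_cst_ge1; set C := inv_cst in C1 *. have C0 : 0 <= C by lra.
have [B HB] := rpath_bd T0 p1 rx. set W := sup_psum (pvf (increment x)) s t + (t - s).
have S0 : pvf (increment x) s t <= sup_psum (pvf (increment x)) s t.
 have := sup_psum_ub HB s0 tT (itv_partition1 st); by rewrite /= addr0.
have W0 : 0 <= W by rewrite addr_ge0 ?(letr (pvf_ge0 _ _ _) S0)// subr_ge0 ltW.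
have oE : drv_ctrl x s t `^ p^-1 = C * W `^ p^-1.
 rewrite /drv_ctrl /ctrl -/W powRM ?powR_ge0// -powRrM mulfV ?gt_eqF// powRr1//.
set k := W `^ p^-1 in oE *; have k0 : 0 <= k by exact: powR_ge0.
have b1 u : (size u <= N)%N -> `|tcf (increment x s t) u| <= k ^+ size u.
 move=> uN; have [->|u0] := eqVneq u [::]; first by rewrite (rpath_coef_nil s t rx) normr1 expr0.
 have uN' : (0 < size u < N.+1)%N by rewrite ltnS uN andbT; case: (u) u0. apply: lev_coef => //.
 apply: letr (_ : _ <= pvf (increment x) s t) _; last first.
  by apply: letr S0 _; rewrite lerDl subr_ge0 ltW.
 rewrite /pvf (bigD1_seq (size u)) ?mem_index_iota ?iota_uniq//= lerDl. by pos.
have vN : (size v <= N)%N by rewrite hM. rewrite oE !tcoef_tcast exprMn; split.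
 apply: letr (b1 v vN) _; rewrite ler_peMl ?exprn_ge0//; exact: exprn_ege1.
rewrite (inc_inv _ _ rx). have [->|v0] := eqVneq v [::].
 by rewrite -(inc_inv _ _ rx) (rpath_coef_nil t s rx) normr1 !expr0 mulr1.
apply: letr (inv_cstP k0 b1 vN) _; rewrite ler_wpM2r ?exprn_ge0//.
rewrite -[X in X <= _]expr1; apply: ler_weXn2l => //. by case: (v) v0.
Qed.

Lemma drv_driver x : rpath x -> driver p T (drv x) (drv_ctrl x).
move=> rx; have [B HB] := rpath_bd T0 p1 rx. have C1 := inv_cst_ge1.
have c0 : 0 < inv_cst `^ p by apply: powR_gt0; exact: lt_le_trans C1. split.
- move=> s t s0 st tT; split; last by move=> v vM; exact: (drv_bd rx s0 st tT vM).1.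
 by apply: drv_glike => //; rewrite ?s0 ?tT ?(letr (ltW st))// (letr s0)// ltW.
- by move=> s u t _ _ _ _; exact: drv_chen.
- move=> s sT; split; first exact: drvxx. by rewrite /drv_ctrl /ctrl sup_psumxx subrr addr0 mulr0.
- move=> s t s0 st tT; rewrite mulr_gt0// ltr_wpDl ?subr_gt0//. apply: letr (pvf_ge0 (increment x) s t) _.
 by have := sup_psum_ub HB s0 tT (itv_partition1 st); rewrite /= addr0.
- move=> s u t s0 su ut tT; rewrite -mulrDr ler_wpM2l ?(ltW c0)//. have := sup_psum_super HB s0 su ut tT; lra.
Qed.

Definition rdrv x s t := drv x (T - s) (T - t).
Definition rdrv_ctrl x s t := drv_ctrl x (T - t) (T - s).

Lemma rdrv_driver x : rpath x -> driver p T (rdrv x) (rdrv_ctrl x).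
move=> rx; have [_ _ X0 op os] := drv_driver rx; split.
- move=> s t s0 st tT; split=> [|v vM].
  by apply: drv_glike => //; apply/andP; split; lra.
 by apply: (drv_bd rx _ _ _ vM).2; lra.
- by move=> s u t _ _ _ _; exact: drv_chen.
- move=> s /andP[s0 sT]; split; first exact: drvxx.
 by have [|_] := X0 (T - s); first by apply/andP; split; lra.
- by move=> s t s0 st tT; apply: op; lra.
- by move=> s u t s0 su ut tT; rewrite addrC; apply: os; lra.
Qed.

Lemma rdrv_rev x : rpath x -> rev_driver T (drv x) (drv_ctrl x) (rdrv x) (rdrv_ctrl x) /\ rev_driver T (rdrv
  x) (rdrv_ctrl x) (drv x) (drv_ctrl x).
move=> rx; split; split=> //.
- by move=> s t _ _ _; rewrite drv_chen// drvxx.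
- by move=> s t _ _; rewrite /rdrv !subKr.
- by move=> s t _ _; rewrite /rdrv_ctrl !subKr.
- by move=> s t _ _ _; rewrite /rdrv drv_chen// drvxx.
Qed.

Definition small_ctrl x (e de : R) := forall s t, 0 <= s -> s <= t -> t <= T -> t - s <= de -> drv_ctrl x s t
  <= e.

(** Half of [e] pays for the distance of the paths to one smooth path near the limit, the other half
    for the Lipschitz control of that smooth path. *)
Lemma ctrl_seq (xk : nat -> R -> tensor R d N) x : (forall k, rpath (xk k)) -> rpath x -> rpath_cvg xk x ->
  forall e : R, 0 < e -> exists (k0 : nat) (de : R), 0 < de /\ forall k, (k0 <= k)%N -> small_ctrl (xk k) e
  de.
move=> rk rx kx e e0; have C1 := inv_cst_ge1. set c := inv_cst `^ p.
have c0 : 0 < c by apply: powR_gt0; exact: lt_le_trans C1. have L0 : 0 <= lv_cst p by pos.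
have e2 : 0 < e / 2 by lra. have [de de0 Hde] := gg_fun_small p1 (divr_gt0 e2 c0).
have de2 : 0 < de / 2 by lra. have [_ _ H] := rx; have [z sz dz] := H _ de2. have [k0 Hk0] := kx _ de2.
have [A A0 HA] := smth_lip_lvs T0 p1 sz.
have a0 : 0 < c * (lv_cst p * A + 1) by rewrite mulr_gt0// ltr_wpDl// mulr_ge0.
exists k0, (e / 2 / (c * (lv_cst p * A + 1))); split; first by rewrite divr_gt0. move=> k kk s t s0 st tT ts.
have dk : (pvar_dist T (increment (xk k)) (smth_inc p z) < de%:E)%E.
 apply: le_lt_trans (pvar_dist_triangle T (increment x) _ _) _.
 rewrite [in X in (_ + X)%E]pvar_dist_sym (splitr de) EFinD. by apply: lteD; [exact: Hk0|exact: dz].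
apply: letr (ctrl_le p1 (ltW c0) de0 dk HA s0 st tT) _; rewrite mulrDr (splitr e).
apply: lerD; first by rewrite mulrC -ler_pdivlMr. by rewrite mulrA mulrC -ler_pdivlMr.
Qed.

Lemma ctrl_one x : rpath x -> forall e : R, 0 < e -> exists2 de, 0 < de & small_ctrl x e de.
move=> rx e e0; have [|k0 [de [de0 H]]] := ctrl_seq (fun=> rx) rx _ e0.
 by move=> e' e'0; exists 0%N => k _; rewrite pvar_distxx// lte_fin.
by exists de => //; exact: (H k0).
Qed.

Lemma rdrv_small x (e de : R) : small_ctrl x e de -> forall s t, 0 <= s -> s <= t -> t <= T -> t - s <= de ->
  rdrv_ctrl x s t <= e. by move=> H s t s0 st tT ts; apply: H; lra. Qed.

(** The tail of the sequence is covered by [ctrl_seq], the finitely many remaining members and the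
    limit one at a time. *)
Lemma unif_fams (xk : nat -> R -> tensor R d N) x : (forall k, rpath (xk k)) -> rpath x -> rpath_cvg xk x ->
  exists Om mu, (forall e, 0 < e -> 0 < mu e) /\ [/\ forall k, dfam T Om mu (drv (xk k)) (drv_ctrl (xk k)),
  forall k, dfam T Om mu (rdrv (xk k)) (rdrv_ctrl (xk k)), dfam T Om mu (drv x) (drv_ctrl x) & dfam T Om mu
  (rdrv x) (rdrv_ctrl x)].
move=> rk rx kx.
have all (e : R) : 0 < e -> exists2 de, 0 < de & (forall k, small_ctrl (xk k) e de) /\ small_ctrl x e de.
 move=> e0; have [k0 [d1 [d10 H1]]] := ctrl_seq rk rx kx e0. have [d2 d20 H2] := ctrl_one rx e0.
 have mono y a b : a <= b -> small_ctrl y e b -> small_ctrl y e a.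
  by move=> ab H s t s0 st tT /letr => /(_ _ ab); exact: H.
 have [d3 d30 H3] : exists2 d3, 0 < d3 & forall k, (k < k0)%N -> small_ctrl (xk k) e d3.
  elim: (k0) => [|n [d3 d30 H3]]; first by exists 1. have [d4 d40 H4] := ctrl_one (rk n) e0.
  exists (Num.min d3 d4) => [|k]; first by rewrite lt_min d30.
  rewrite ltnS leq_eqVlt => /orP[/eqP ->|kn]; last by apply: mono (H3 k kn); rewrite ge_min lexx.
  by apply: mono H4; rewrite ge_min lexx orbT.
 exists (Num.min d1 (Num.min d2 d3)); first by rewrite !lt_min d10 d20.
 split=> [k|]; last by apply: mono H2; rewrite !ge_min lexx orbT.
 have [kk|kk] := ltnP k k0; last by apply: mono (H1 k kk); rewrite ge_min lexx.
 by apply: mono (H3 k kk); rewrite !ge_min lexx !orbT.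
have [mu Hmu] : exists mu : R -> R, forall e, 0 < e -> 0 < mu e /\ ((forall k, small_ctrl (xk k) e (mu e)) /\
 small_ctrl x e (mu e)).
 have tot (e : R) : exists de, 0 < e -> 0 < de /\ ((forall k, small_ctrl (xk k) e de) /\ small_ctrl x e de).
  have [e0|e0] := ltP 0 e; last by exists 0. by have [de d0 H] := all e e0; exists de.
 by have [mu H] := choice tot; exists mu.
have [Om HOm] : exists Om, (forall k, drv_ctrl (xk k) 0 T <= Om) /\ drv_ctrl x 0 T <= Om.
 have [_ _ H] := rx; have [z sz dz] := H 1 ltr01. have [k0 Hk0] := kx _ ltr01.
 have [A A0 HA] := smth_lip_lvs T0 p1 sz. have c0 : 0 <= inv_cst `^ p by pos.
 pose B := inv_cst `^ p * (gg_fun p 2 + (lv_cst p * A + 1) * (T - 0)).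
 have HB k : (k0 <= k)%N -> drv_ctrl (xk k) 0 T <= B.
  move=> kk; have dk : (pvar_dist T (increment (xk k)) (smth_inc p z) < 2%:E)%E.
   apply: le_lt_trans (pvar_dist_triangle T (increment x) _ _) _.
   rewrite [in X in (_ + X)%E]pvar_dist_sym -[2]/(1 + 1) EFinD. by apply: lteD; [exact: Hk0|exact: dz].
  by apply: (ctrl_le p1 c0 _ dk HA (lexx 0) (ltW T0) (lexx T)).
 have [B' HB'] : exists B', forall k, (k < k0)%N -> drv_ctrl (xk k) 0 T <= B'.
  exact: bd_prefix.
 exists (Num.max (drv_ctrl x 0 T) (Num.max B B')); split=> [k|]; last by rewrite le_max lexx.
 rewrite le_max; apply/orP; right; rewrite le_max; apply/orP.
 by have [/HB' h|/HB h] := ltnP k k0; [right|left].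
have fam y : rpath y -> drv_ctrl y 0 T <= Om -> (forall e, 0 < e -> small_ctrl y e (mu e)) -> dfam T Om mu
 (drv y) (drv_ctrl y) /\ dfam T Om mu (rdrv y) (rdrv_ctrl y).
 move=> ry yO ym; split; split.
 - exact: drv_driver.
 - by [].
 - by [].
 - exact: rdrv_driver.
 - by rewrite /rdrv_ctrl subr0 subrr.
 - by move=> e e0; exact/rdrv_small/ym.
have fk k := fam _ (rk k) (HOm.1 k) (fun e e0 => (Hmu e e0).2.1 k).
have fx := fam _ rx HOm.2 (fun e e0 => (Hmu e e0).2.2). exists Om, mu; split; first by move=> e /Hmu[].
by split=> [k|k||]; [exact: (fk k).1|exact: (fk k).2|exact: fx.1|exact: fx.2].
Qed.

End rough_path_drivers.

(** * Higher derivatives from iterated tangent maps *)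

Section iterated_tangents.
Context {R : realType}.
Implicit Types (E F W : normedModType R).

Lemma der_snd_comp E W (W' : normedModType R) (g : E -> W * W') q w : differentiable g q -> differentiable
  (fun y => (g y).2) q /\ 'D_w (fun y => (g y).2) q = ('D_w g q).2.
move=> dg; have ds := diff_snd (g q). split; first exact: (differentiable_comp dg ds).
by rewrite -[LHS]/('D_w (snd \o g) q) der_comp// der_snd.
Qed.

Lemma der_slice_comp E F W (g : E * F -> W) (c : F) x u : differentiable g (x, c) -> differentiable (fun y =>
  g (y, c)) x /\ 'D_u (fun y => g (y, c)) x = 'D_(u, 0) g (x, c).
move=> dg; have [di Di] := der_slice x u c. split; first exact: (differentiable_comp di dg).
by rewrite -[LHS]/('D_u (g \o (fun y => (y, c))) x) der_comp// Di.
Qed.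

Section three_times.
Context {E W : normedModType R} (f : E -> W).
Hypothesis d1 : forall x, differentiable f x.
Hypothesis d2 : forall q, differentiable (tmap f) q.
Hypothesis d3 : forall q, differentiable (tmap (tmap f)) q.

Lemma dderiv1 u x : dderiv [:: u] f x = (tmap f (x, u)).2. by []. Qed.

Lemma dderiv2 u v x : differentiable (dderiv [:: v] f) x /\ dderiv [:: u; v] f x = (tmap (tmap f) ((x, v), (u,
  0))).2.2.
have [h1 h2] := der_snd_comp (u, 0) (d2 (x, v)). have [h3 h4] := der_slice_comp u h1.
by split; [exact: h3|exact: etrans h4 h2].
Qed.

(** The zero components of the iterated tangent vector suppress every term in which a derivative of
    lower order meets a direction of higher order; only the pure third derivative remains in the
    last component. *)
Lemma dderiv3 u v w x : differentiable (dderiv [:: v; w] f) x /\ dderiv [:: u; v; w] f x = (tmap (tmap (tmap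
  f)) (((x, w), (v, 0)), ((u, 0), (0, 0)))).2.2.2.
have e2 : dderiv [:: v; w] f = (fun x => (tmap (tmap f) ((x, w), (v, 0))).2.2).
 by apply/funext => y; exact: (dderiv2 v w y).2.
have [g1 G1] := der_snd_comp ((u, 0), (0, 0)) (d3 ((x, w), (v, 0))).
have [g2 G2] := der_snd_comp ((u, 0), (0, 0)) g1. have [s1 S1] := der_slice_comp (u, 0) g2.
have [s2 S2] := der_slice_comp u s1. rewrite -[dderiv [:: u; v; w] f x]/('D_u (dderiv [:: v; w] f) x) e2.
by split; [exact: s2|rewrite S2 S1 G2 G1].
Qed.

Lemma ndiff_tan : ndiff 3 f.
move=> [|v [|w [|u vs]]] //= _ x; first exact: (dderiv2 0 v x).1. exact: (dderiv3 0 v w x).1.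
Qed.

End three_times.

Lemma dderiv_scale E W (f : E -> W) (c : E -> R) vs : ndiff (size vs) f -> forall x, dderiv (map (fun v => c v
  *: v) vs) f x = (\prod_(v <- vs) c v) *: dderiv vs f x.
elim: vs => [|v vs IH] H x /=; first by rewrite big_nil scale1r.
have Hs : ndiff (size vs) f by move=> ws wss; apply: H; exact: leq_trans wss _.
rewrite (funext (IH Hs)) big_cons. have dv := H vs (ltnSn _) x.
have dk : derivable (dderiv vs f) x (c v *: v) by exact: diff_derivable.
by rewrite deriveZ//= der_scale// scalerA mulrC.
Qed.

(** Homogeneity in each direction reduces to unit vectors. A list containing 0 is treated apart: the
    same scaling shows that the derivative vanishes there. *)
Lemma deriv_bd_unit E W (f : E -> W) j (M : R) : ndiff j f -> 0 <= M -> (forall vs, size vs = j -> (forall v,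
  v \in vs -> `|v| <= 1) -> forall x, `|dderiv vs f x| <= M) -> deriv_bound j f M.
move=> df M0 H vs vj x. pose c (v : E) : R := `|v|^-1; pose ws := map (fun v => c v *: v) vs.
have Hn : ndiff (size ws) f by rewrite size_map vj. have -> : vs = map (fun v => `|v| *: (c v *: v)) vs.
 rewrite -[LHS]map_id; apply/eq_in_map => v _; rewrite scalerA /c.
 have [->|v0] := eqVneq v 0; first by rewrite scaler0. by rewrite divff ?scale1r// normr_eq0.
have Hv : ndiff (size vs) f by rewrite vj. have D1 := dderiv_scale c Hv x; rewrite -/ws in D1.
have bw : `|dderiv ws f x| <= M.
 apply: H; first by rewrite size_map. move=> _ /mapP[v _ ->]; rewrite normrZ /c ger0_norm ?invr_ge0//.
 have [->|v0] := eqVneq v 0; first by rewrite normr0 mulr0. by rewrite mulVf ?normr_eq0.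
have -> : map (fun v => `|v| *: (c v *: v)) vs = vs.
 rewrite -[RHS]map_id; apply/eq_in_map => v _; rewrite scalerA /c.
 have [->|v0] := eqVneq v 0; first by rewrite scaler0. by rewrite divff ?scale1r// normr_eq0.
have [z0|z0] := boolP (0 \in vs).
 suff -> : dderiv vs f x = 0.
  by rewrite normr0 mulr_ge0// prodr_ge0.
 pose c0 (v : E) : R := (v != 0)%:R. have -> : vs = map (fun v => c0 v *: v) vs.
  rewrite -[LHS]map_id; apply/eq_in_map => v _; rewrite /c0.
  by case: eqVneq => [->|_]; rewrite ?scaler0 ?scale1r.
 rewrite dderiv_scale// (big_rem 0 z0) /= /c0 eqxx mul0r scale0r//.
have P0 : 0 < \prod_(v <- vs) `|v|.
 rewrite big_seq; apply: prodr_gt0 => v vv; rewrite normr_gt0. by apply: contraNneq z0 => <-.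
have -> : dderiv vs f x = (\prod_(v <- vs) `|v|) *: dderiv ws f x.
 rewrite D1 scalerA -big_split /= big_seq big1 ?scale1r// => v vv.
 by rewrite /c divff// normr_eq0; apply: contraNneq z0 => <-.
by rewrite normrZ (gtr0_norm P0) mulrC ler_wpM2r// ltW.
Qed.

End iterated_tangents.

(** * Sequential criteria *)

Section sequential_continuity.
Context {R : realType}.
Implicit Types (E W : normedModType R).

Lemma pair_cvg E W (u : nat -> E) (v : nat -> W) a b : u @ \oo --> a -> v @ \oo --> b -> (u k, v k) @[k -->
  \oo] --> ((a, b) : E * W). by move=> ua vb; exact: cvg_pair. Qed.

Lemma not_near_seq E (A : set E) (P : set E) (x : E) : (forall u : nat -> E, (forall k, A (u k)) -> u @ \oo
  --> x -> exists k, P (u k)) -> \forall y \near x, A y -> P y.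
move=> H; apply: contrapT => nP. have pick (k : nat) : exists y, `|x - y| < k.+1%:R^-1 /\ (A y /\ ~ P y).
 apply: contrapT => nE; apply: nP; apply/nbhs_normP. exists (k.+1%:R^-1); first by rewrite /= invr_gt0.
 move=> y /= xy Ay; apply: contrapT => nPy; apply: nE. by exists y.
have [u Hu] := choice pick. have [|k Pk] := H u (fun k => (Hu k).2.1); last exact: (Hu k).2.2.
apply/cvgrPdist_le => e e0. have [k0 _ Hk0] := near_infty_natSinv_lt (PosNum e0).
by exists k0 => // k /= kk; apply: ltW; apply: lt_trans (Hu k).1 (Hk0 _ kk).
Qed.

Lemma sequential_within E W (A : set E) (f : E -> W) : (forall (u : nat -> E) x, (forall k, A (u k)) -> A x ->
  u @ \oo --> x -> f (u k) @[k --> \oo] --> f x) -> {within A, continuous f}.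
move=> H; apply/subspace_continuousP => x Ax; apply/cvgrPdist_le => e e0.
rewrite near_withinE; apply: not_near_seq => u uA ux.
have /cvgrPdist_le/(_ e e0) [k _ /(_ k (leqnn k)) Hk] := H u x uA Ax ux. by exists k.
Qed.

End sequential_continuity.

(** * Sequential continuity of the flow in path, times and point *)

Section flow_families.
Context {R : realType} {d M : nat} (al p : R).
Context (al01 : 0 < al <= 1) (p1 : 1 <= p) (pN : p < M.+1%:R + al).
Local Notation N := M.+1.
Local Notation dfam := (@dfam R d M p).
Local Notation good_sys := (@good_sys R d M al).
Implicit Types (E W : normedModType R) (X Y : R -> R -> tensor R d N) (om : R -> R -> R).

Definition drivers_cvg (T : R) (Xk : nat -> R -> R -> tensor R d N) X := forall (ak bk : nat -> R) a b,
  (forall k, 0 <= ak k <= T) -> (forall k, 0 <= bk k <= T) -> 0 <= a <= T -> 0 <= b <= T -> ak @ \oo --> a ->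
  bk @ \oo --> b -> tcvg \oo (fun k => Xk k (ak k) (bk k)) (X a b).

(** What the limit flow requires, without the spare derivative of [good_sys]; the third tangent
    system is only of this kind. *)
Definition weak_sys E (rho : E -> R) (V : 'I_d -> E -> E) := [/\ seq_compl E, is_gg rho, forall i, hcl al M
  rho (V i), dilatable rho V & @euler_cauchy R d M p E rho V].

Lemma good_weak_sys E (rho : E -> R) (V : 'I_d -> E -> E) : seq_compl E -> good_sys rho V -> weak_sys rho V.
move=> cE GV; have [g _ S] := GV; split=> //; first exact: good_weak al01 _ _ _ GV.
exact: good_cauchy al01 p1 pN _ _ _ GV.
Qed.

Lemma good_tmap_weak_sys E (rho : E -> R) (V : 'I_d -> E -> E) : seq_compl E -> good_sys rho V -> weak_sys
  (tgauge rho) (fun i => tmap (V i)).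
move=> cE GV; have [g HV S] := good_tmap_weak al01 GV; split=> //.
 exact: seq_compl_pair.
exact: good_tmap_cauchy al01 p1 pN _ _ _ GV.
Qed.

Lemma tick_bds n (T s t : R) i : (i <= 2 ^ n)%N -> 0 <= s -> s <= t -> t <= T -> 0 <= tick n s t i <= T.
move=> i2 s0 st tT; have [h1 h2] : s <= tick n s t i /\ tick n s t i <= t.
 have e0 : 0 < 2 ^+ n :> R by rewrite exprn_gt0. have q0 : 0 <= i%:R / 2 ^+ n :> R by [].
 have q1 : i%:R / 2 ^+ n <= 1 :> R by rewrite ler_pdivrMr// mul1r -natrX ler_nat.
 have ts : 0 <= t - s by lra. rewrite /tick lerDl mulr_ge0//; split=> //. by rewrite -lerBrDl ler_piMr.
by lra.
Qed.

Lemma tick_cvg n i (sk tk : nat -> R) s t : sk @ \oo --> s -> tk @ \oo --> t -> tick n (sk k) (tk k) i @[k -->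
  \oo] --> tick n s t i.
move=> cs ct; apply: cvgD => //; apply: cvgM; last exact: cvg_cst. exact: cvgB.
Qed.

Lemma flw_seq E (rho : E -> R) (V : 'I_d -> E -> E) : weak_sys rho V -> forall (T Om : R) (mu : R -> R), 0 <=
  T -> (forall e : R, 0 < e -> 0 < mu e) -> forall Xk omk X om, (forall k, dfam T Om mu (Xk k) (omk k)) ->
  dfam T Om mu X om -> drivers_cvg T Xk X -> forall (sk tk : nat -> R) (s t : R) (xk : nat -> E) (x : E),
  (forall k, [/\ 0 <= sk k, sk k <= tk k & tk k <= T]) -> 0 <= s -> s <= t -> t <= T -> sk @ \oo --> s -> tk @
  \oo --> t -> xk @ \oo --> x -> flw V (Xk k) (sk k) (tk k) (xk k) @[k --> \oo] --> flw V X s t x.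
move=> [cE g HV _ EC] T Om mu T0 mu0 Xk omk X om Fk F XX sk tk s t xk x stk s0 st tT cs ct cx.
apply/cvgrPdist_le => e e0. have [n [de [de0 H]]] := flw_close al01 p1 cE g HV EC Om T0 mu0 (rho x) e0.
have tkk k i : (i <= 2 ^ n)%N -> 0 <= tick n (sk k) (tk k) i <= T.
 by move=> i2; have [h1 h2 h3] := stk k; exact: tick_bds.
have cells : \forall k \near \oo, forall (i : 'I_(2 ^ n)) (w : N.-bseq 'I_d), `|tcf (X (tick n s t i) (tick n
 s t i.+1)) w - tcf (Xk k (tick n (sk k) (tk k) i) (tick n (sk k) (tk k) i.+1)) w| <= de.
 apply: filter_forall => i; apply: filter_forall => w. have i1 : (i <= 2 ^ n)%N by exact: ltnW.
 have := XX (fun k => tick n (sk k) (tk k) i) (fun k => tick n (sk k) (tk k) i.+1) _ _ (fun k => tkk k i i1)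
  (fun k => tkk k i.+1 (ltn_ord i)) (tick_bds i1 s0 st tT) (tick_bds (ltn_ord i) s0 st tT) (tick_cvg (n :=
  n) (i := i) cs ct) (tick_cvg (n := n) (i := i.+1) cs ct) w. by move/cvgrPdist_le => /(_ de de0).
near=> k; have [h1 h2 h3] := stk k. apply: (H X om (Xk k) (omk k)) => //.
- move=> i v i2 vN; have : forall (i : 'I_(2 ^ n)) (w : N.-bseq 'I_d), `|tcf (X (tick n s t i) (tick n s t
 i.+1)) w - tcf (Xk k (tick n (sk k) (tk k) i) (tick n (sk k) (tk k) i.+1)) w| <= de by near: k.
 by move=> /(_ (Ordinal i2) (insub_bseq N v)); rewrite val_insub_bseq.
- by near: k; move/cvgrPdist_le: cx => /(_ de de0).
Unshelve. all: by end_near. Qed.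

End flow_families.

(** * Three derivatives of the flow *)

Section smooth_flows.
Context {R : realType} {n d M : nat} (al p : R).
Context (al01 : 0 < al <= 1) (p1 : 1 <= p) (pN : p < M.+1%:R + al).
Local Notation N := M.+1.
Local Notation E := 'rV[R]_n.
Local Notation dfam := (@dfam R d M p).
Context (V : 'I_d -> E -> E) (HV : forall i, hcl al M.+3 (fun=> 0) (V i)).
Implicit Types (X Y : R -> R -> tensor R d N) (om : R -> R -> R).

Let V1 i := tmap (V i).
Let V2 i := tmap (V1 i).
Let V3 i := tmap (V2 i).
Let g0 (x : E) : R := 0.
Let g1 := tgauge g0.
Let g2 := tgauge g1.
Let g3 := tgauge g2.

Let good0 : @good_sys R d M al E g0 V.
split; [exact: gauge0| |exact: dilatable0].
by move=> i; exact: (hclass_le al01 (gauge0 _) (leq_trans (leqnSn _) (leqnSn _)) (HV i)).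
Qed.

Let HV1 i : hcl al M.+2 g1 (V1 i). exact: hclass_tmap al01 _ _ _ _ _ (gauge0 _) (HV i). Qed.

Let HV2 i : hcl al M.+1 g2 (V2 i). exact: hclass_tmap al01 _ _ _ _ _ (tgg_gg (gauge0 _)) (HV1 i). Qed.

Let good1 : @good_sys R d M al _ g1 V1.
have g := tgg_gg (@gauge0 R E); split=> //.
 by move=> i; apply: (hclass_le al01 g _ (HV1 i)).
apply: dilatable_tmap; last exact: dilatable0. by move=> i x; exact: hclass_diff (HV i) x.
Qed.

Let good2 : @good_sys R d M al _ g2 V2.
have g := tgg_gg (tgg_gg (@gauge0 R E)); split=> //. apply: dilatable_tmap; last by case: good1.
by move=> i x; exact: hclass_diff (HV1 i) x.
Qed.

Let c0 := @seq_compl_row R n.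
Let c1 := seq_compl_pair c0 c0.
Let c2 := seq_compl_pair c1 c1.

Let weak0 := good_weak_sys al01 p1 pN c0 good0.
Let weak1 := good_weak_sys al01 p1 pN c1 good1.
Let weak2 := good_weak_sys al01 p1 pN c2 good2.
Let weak3 := good_tmap_weak_sys al01 p1 pN c2 good2.

Section one_family.
Context (T Om : R) (mu : R -> R) (T0 : 0 <= T) (mu0 : forall e : R, 0 < e -> 0 < mu e).

(** [tmap_flw] applied three times, to [V], [V1] and [V2]. The [M.+3] derivatives of [V] are exactly
    what keeps [V2] a good system. *)
Lemma flow_tan X om s t : dfam T Om mu X om -> 0 <= s -> s <= t -> t <= T -> let f := flw V X s t in [/\
  forall x, differentiable f x, forall q, differentiable (tmap f) q, forall q, differentiable (tmap (tmap f))
  q & [/\ flw V1 X s t = tmap f, flw V2 X s t = tmap (tmap f) & flw V3 X s t = tmap (tmap (tmap f))]].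
move=> F s0 st tT f. have [h1 e1] := tmap_flw al01 p1 pN c0 good0 T0 mu0 F s0 st tT.
have [h2 e2] := tmap_flw al01 p1 pN c1 good1 T0 mu0 F s0 st tT.
have [h3 e3] := tmap_flw al01 p1 pN c2 good2 T0 mu0 F s0 st tT.
rewrite -/V1 in e1; rewrite -/V2 in e2; rewrite -/V3 in e3. rewrite e1 in h2 e2; rewrite e2 in h3 e3.
by split.
Qed.

Lemma flow_ndiff X om s t : dfam T Om mu X om -> 0 <= s -> s <= t -> t <= T -> ndiff 3 (flw V X s t).
by move=> F s0 st tT; have [h1 h2 h3 _] := flow_tan F s0 st tT; exact: ndiff_tan.
Qed.

Lemma flow_dderiv_seq Xk omk X om (sk tk : nat -> R) s t (xk : nat -> E) x vs : (forall k, dfam T Om mu (Xk k)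
  (omk k)) -> dfam T Om mu X om -> drivers_cvg T Xk X -> (forall k, [/\ 0 <= sk k, sk k <= tk k & tk k <= T])
  -> 0 <= s -> s <= t -> t <= T -> sk @ \oo --> s -> tk @ \oo --> t -> xk @ \oo --> x -> (size vs <= 3)%N ->
  dderiv vs (flw V (Xk k) (sk k) (tk k)) (xk k) @[k --> \oo] --> dderiv vs (flw V X s t) x.
move=> Fk F XX stk s0 st tT cs ct cx.
have tk' k : let f := flw V (Xk k) (sk k) (tk k) in [/\ forall x, differentiable f x, forall q, differentiable
 (tmap f) q, forall q, differentiable (tmap (tmap f)) q & [/\ flw V1 (Xk k) (sk k) (tk k) = tmap f, flw V2
 (Xk k) (sk k) (tk k) = tmap (tmap f) & flw V3 (Xk k) (sk k) (tk k) = tmap (tmap (tmap f))]].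
 by have [a1 a2 a3] := stk k; exact: (flow_tan (Fk k) a1 a2 a3).
have [h1 h2 h3 [e1 e2 e3]] := flow_tan F s0 st tT.
have cc (W : normedModType R) (a : W) : (fun _ : nat => a) @ \oo --> a by exact: cvg_cst.
case: vs => [|v [|w [|u [|//]]]] _.
- exact: (flw_seq al01 p1 weak0 T0 mu0 Fk F XX stk s0 st tT cs ct cx).
- have cv := flw_seq al01 p1 weak1 T0 mu0 Fk F XX stk s0 st tT cs ct (pair_cvg cx (cc _ v)).
 rewrite dderiv1 -e1; have [_] := cvg_components cv. by under eq_fun => k do have [_ _ _ [-> _ _]] := tk' k.
- have cv := flw_seq al01 p1 weak2 T0 mu0 Fk F XX stk s0 st tT cs ct (pair_cvg (pair_cvg cx (cc _ w)) (cc _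
 (v, 0))). rewrite (dderiv2 h2 v w x).2 -e2; have [_ /cvg_components[_]] := cvg_components cv.
 have -> // : (fun k => (flw V2 (Xk k) (sk k) (tk k) ((xk k, w), (v, 0))).2.2) = (fun k => dderiv [:: v; w]
  (flw V (Xk k) (sk k) (tk k)) (xk k)). apply/funext => k.
 by have [_ a2 _ [_ -> _]] := tk' k; rewrite (dderiv2 a2 v w (xk k)).2.
- have cv := flw_seq al01 p1 weak3 T0 mu0 Fk F XX stk s0 st tT cs ct (pair_cvg (pair_cvg (pair_cvg cx (cc _
 u)) (cc _ (w, 0))) (cc _ ((v, 0), (0, 0)))). rewrite (dderiv3 h2 h3 v w u x).2 -e3.
 have [_ /cvg_components[_ /cvg_components[_]]] := cvg_components cv.
 have -> // : (fun k => (flw V3 (Xk k) (sk k) (tk k) (((xk k, u), (w, 0)), ((v, 0), (0, 0)))).2.2.2) = (fun k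
  => dderiv [:: v; w; u] (flw V (Xk k) (sk k) (tk k)) (xk k)). apply/funext => k.
 by have [_ a2 a3 [_ _ ->]] := tk' k; rewrite (dderiv3 a2 a3 v w u (xk k)).2.
Qed.

End one_family.

(** Iterated tangent vectors built from unit vectors and zeros lie in one gauge ball whatever the
    base point, because the base gauge is 0; a gauge bound on the tangent flow is therefore a global
    bound on the derivative. *)
Lemma flow_deriv_bd (Om : R) j : (1 <= j <= 3)%N -> exists2 C : R, 0 <= C & forall T mu, 0 <= T -> (forall e :
  R, 0 < e -> 0 < mu e) -> forall X om s t, dfam T Om mu X om -> 0 <= s -> s <= t -> t <= T -> deriv_bound j
  (flw V X s t) C.
have get (W : normedModType R) (rho : W -> R) (U : 'I_d -> W -> W) : @weak_sys R d M al p W rho U -> exists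
 r', forall T mu, 0 <= T -> (forall e : R, 0 < e -> 0 < mu e) -> forall X om s t x, dfam T Om mu X om -> 0 <=
 s -> s <= t -> t <= T -> rho x <= 1 -> rho (flw U X s t x) <= r'.
 move=> [cE g HU S EC]; have [r' H] := flw_bd al01 p1 pN cE g HU S EC 1 Om.
 by exists r' => T mu T0 mu0 X om s t x; exact: H.
case: j => [|[|[|[|//]]]] // _.
- have [C HC] := get _ _ _ weak1; exists (Num.max C 0) => [|T mu T0 mu0 X om s t F s0 st tT].
  by rewrite le_max lexx orbT.
 have [h1 h2 h3 [e1 e2 e3]] := flow_tan T0 mu0 F s0 st tT.
 apply: deriv_bd_unit => [ws ws1|| ]; first by apply: ndiff_tan => //; exact: leq_trans ws1 _.
  by rewrite le_max lexx orbT.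
 case=> [//|u [|//]] _ u1 x; rewrite dderiv1 -e1. have /(_ _ _ T0 mu0 _ _ _ _ (x, u) F s0 st tT) := HC.
 rewrite /g1 /tgauge /= /g0 !ge_max ler01 u1 ?mem_head// => /(_ isT) /andP[_ h]. by rewrite le_max h.
- have [C HC] := get _ _ _ weak2; exists (Num.max C 0) => [|T mu T0 mu0 X om s t F s0 st tT].
  by rewrite le_max lexx orbT.
 have [h1 h2 h3 [e1 e2 e3]] := flow_tan T0 mu0 F s0 st tT.
 apply: deriv_bd_unit => [ws ws1|| ]; first by apply: ndiff_tan => //; exact: leq_trans ws1 _.
  by rewrite le_max lexx orbT.
 case=> [//|u [//|v [|//]]] _ H1 x; rewrite (dderiv2 h2 u v x).2 -e2.
 have /(_ _ _ T0 mu0 _ _ _ _ ((x, v), (u, 0)) F s0 st tT) := HC.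
 rewrite /g2 /g1 /tgauge /= /g0 !prod_normE /= normr0 !ge_max ler01 !H1 ?inE ?eqxx ?orbT//.
 move=> /(_ isT) /andP[_ /andP[_ h]]. by rewrite le_max h.
- have [C HC] := get _ _ _ weak3; exists (Num.max C 0) => [|T mu T0 mu0 X om s t F s0 st tT].
  by rewrite le_max lexx orbT.
 have [h1 h2 h3 [e1 e2 e3]] := flow_tan T0 mu0 F s0 st tT.
 apply: deriv_bd_unit => [ws ws1|| ]; first by apply: ndiff_tan => //; exact: leq_trans ws1 _.
  by rewrite le_max lexx orbT.
 case=> [//|u [//|v [//|w [|//]]]] _ H1 x; rewrite (dderiv3 h2 h3 u v w x).2 -e3.
 have /(_ _ _ T0 mu0 _ _ _ _ (((x, w), (v, 0)), ((u, 0), (0, 0))) F s0 st tT) := HC.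
 rewrite /g3 /g2 /g1 /tgauge /= /g0 !prod_normE /= !normr0 !ge_max ler01 !H1 ?inE ?eqxx ?orbT//.
 move=> /(_ isT) /andP[_ /andP[_ /andP[_ h]]]. by rewrite le_max h.
Qed.

End smooth_flows.

Lemma unif_rad (R : realType) (I : finType) (P : I -> R -> Prop) : (forall i r r', 0 < r' -> r' <= r -> P i r
  -> P i r') -> (forall i, exists2 r, 0 < r & P i r) -> exists2 r, 0 < r & forall i, P i r.
move=> mono H. have [i C C' CC [C0 PC]|i|C C0 HC] := @unif_bd R I (fun i C => 0 < C /\ P i C^-1).
- have C'0 := lt_le_trans C0 CC; split=> //. by apply: mono PC; rewrite ?invr_gt0// lef_pV2.
- by have [r r0 Pr] := H i; exists r^-1; rewrite invr_gt0 invrK.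
by exists C^-1; rewrite ?invr_gt0// => i; exact: (HC i).2.
Qed.

Section euler_first_order.
Context {R : realType} {d M : nat} (al : R) (al01 : 0 < al <= 1).
Local Notation N := M.+1.

Lemma eul_first_order (E : normedModType R) (rho : E -> R) (V : 'I_d -> E -> E) : is_gg rho -> (forall i, hcl
  al M rho (V i)) -> forall r : R, exists2 C : R, 0 <= C & forall (a : tensor R d N) x k, rho x <= r -> 0 <= k
  <= 1 -> (forall v, (size v <= N)%N -> `|tcf a v| <= k ^+ size v) -> tcf a [::] = 1 -> `|eul V a x - x -
  \sum_i tcf a [:: i] *: V i x| <= C * k ^+ 2.
move=> g HV r; have [C C0 HC] := vfw_bd al01 g HV r.
exists ((\sum_(j < N.+1) d%:R ^+ j) * C) => [|a x k xr k01 ak a1].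
 by pos.
have e2 : tsum 2 a (fun w => vf_word V w x) = x + \sum_i tcf a [:: i] *: V i x.
 rewrite /tsum !big_ord_recr big_ord0 /= add0r a1 scale1r; congr (_ + _).
 by apply: eq_bigr => i _; rewrite derive_id.
rewrite -addrA -opprD -e2 /eul. apply: tsum_tail => //; first exact: ltW.
move=> v /andP[v2 vN]; split; first by apply: ak; rewrite -ltnS.
by apply: HC => //; rewrite (leq_trans _ v2)//= -ltnS.
Qed.

End euler_first_order.

(** * Flows of rough paths and their motion in time along smooth paths *)

Section rough_flows.
Context {R : realType} {n d M : nat} (T p al : R).
Context (T0 : 0 < T) (p1 : 1 <= p) (al01 : 0 < al <= 1) (pN : p < M.+1%:R + al).
Context (hM : Num.truncn p = M.+1).
Local Notation N := (Num.truncn p).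
Local Notation E := 'rV[R]_n.
Local Notation rpath := (@rpath R d T p).
Local Notation rpath_cvg := (@rpath_cvg R d T p).
Local Notation drv := (@drv R d M p hM).
Local Notation rdrv := (@rdrv R d M T p hM).
Local Notation drv_ctrl := (@drv_ctrl R d p).
Local Notation rdrv_ctrl := (@rdrv_ctrl R d T p).
Context (V : 'I_d -> E -> E) (HV : forall i, hcl al M.+3 (fun=> 0) (V i)).
Implicit Types (x : R -> tensor R d N) (y : E) (s t : R).

Definition fwd_flow x t y := flw V (drv x) 0 t y.
(** The reversed path runs through the times from [t] down to 0 while its own clock goes from
    [T - t] to [T]. *)
Definition bwd_flow x t y := flw V (rdrv x) (T - t) T y.

Let TT : 0 <= T. by pos. Qed.

Lemma one_fam x : rpath x -> exists Om mu, (forall e : R, 0 < e -> 0 < mu e) /\ dfam p T Om mu (drv x)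
  (drv_ctrl x) /\ dfam p T Om mu (rdrv x) (rdrv_ctrl x).
move=> rx; have [|Om [mu [mu0 [_ _ h1 h2]]]] := unif_fams T0 p1 hM (fun=> rx) rx.
 by move=> e e0; exists 0%N => k _; rewrite pvar_distxx// lte_fin.
by exists Om, mu.
Qed.

Lemma drivers_cvg_drv (xk : nat -> R -> tensor R d N) x : (forall k, rpath (xk k)) -> rpath x -> rpath_cvg xk
  x -> drivers_cvg T (fun k => drv (xk k)) (drv x) /\ drivers_cvg T (fun k => rdrv (xk k)) (rdrv x).
move=> rk rx kx. have H : drivers_cvg T (fun k => drv (xk k)) (drv x).
 move=> ak bk a b akT bkT aT bT ca cb v; rewrite tcoef_tcast. under eq_fun do rewrite tcoef_tcast.
 exact: (rpath_tcvg T0 p1 rk rx kx akT bkT aT bT ca cb).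
split=> // ak bk a b akT bkT aT bT ca cb. have sT c : 0 <= c <= T -> 0 <= T - c <= T by lra.
have sc (ck : nat -> R) c : ck @ \oo --> c -> T - ck k @[k --> \oo] --> T - c.
 by move=> cc; apply: cvgB => //; exact: cvg_cst.
exact: (H (fun k => T - ak k) (fun k => T - bk k) _ _ (fun k => sT _ (akT k)) (fun k => sT _ (bkT k)) (sT _
 aT) (sT _ bT) (sc _ _ ca) (sc _ _ cb)).
Qed.

Lemma rough_flow_seq (xk : nat -> R -> tensor R d N) x (tk : nat -> R) t (yk : nat -> E) y vs : (forall k,
  rpath (xk k)) -> rpath x -> rpath_cvg xk x -> (forall k, 0 <= tk k <= T) -> 0 <= t <= T -> tk @ \oo --> t ->
  yk @ \oo --> y -> (size vs <= 3)%N -> dderiv vs (fwd_flow (xk k) (tk k)) (yk k) @[k --> \oo] --> dderiv vs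
  (fwd_flow x t) y /\ dderiv vs (bwd_flow (xk k) (tk k)) (yk k) @[k --> \oo] --> dderiv vs (bwd_flow x t) y.
move=> rk rx kx tkT /andP[t0 tT] ct cy vs3.
have [Om [mu [mu0 [fk fr fx frx]]]] := unif_fams T0 p1 hM rk rx kx. have [d1 d2] := drivers_cvg_drv rk rx kx.
have cc (a : R) : (fun _ : nat => a) @ \oo --> a by exact: cvg_cst. split.
 apply: (flow_dderiv_seq al01 p1 pN HV TT mu0 fk fx d1 _ (lexx 0) t0 tT (cc 0) ct cy vs3).
 by move=> k; have /andP[] := tkT k.
apply: (flow_dderiv_seq al01 p1 pN HV TT mu0 fr frx d2 _ _ _ (lexx T) _ (cc T) cy vs3).
- by move=> k; have /andP[a b] := tkT k; split=> //; lra.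
- by lra.
- by lra.
- by apply: cvgB => //; exact: cvg_cst.
Qed.

Lemma cstant_cvg x : rpath_cvg (fun=> x) x. by move=> e e0; exists 0%N => k _; rewrite pvar_distxx// lte_fin. Qed.

Lemma rough_flow x : rpath x -> flow 3 T (fwd_flow x) (bwd_flow x).
move=> rx; have [Om [mu [mu0 [fx fr]]]] := one_fam rx. have [v1 v2] := rdrv_rev hM rx.
have good0 : @good_sys R d M al E (fun=> 0) V.
 split; [exact: gauge0| |exact: dilatable0] => i.
 exact: (hclass_le al01 (gauge0 _) (leq_trans (leqnSn _) (leqnSn _)) (HV i)).
have cE := @seq_compl_row R n. have sub t : 0 <= t <= T -> 0 <= T - t /\ T - t <= T by lra.
have seqc vs : (size vs <= 3)%N -> {within [set q : R * E | 0 <= q.1 <= T], continuous (fun q => dderiv vs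
 (fwd_flow x q.1) q.2)} /\ {within [set q : R * E | 0 <= q.1 <= T], continuous (fun q => dderiv vs (bwd_flow
 x q.1) q.2)}.
 move=> vs3; split; apply: sequential_within => u q uT qT /cvg_components[c1 c2].
  exact: (rough_flow_seq (fun=> rx) rx (@cstant_cvg x) uT qT c1 c2 vs3).1.
 exact: (rough_flow_seq (fun=> rx) rx (@cstant_cvg x) uT qT c1 c2 vs3).2.
split.
- move=> t tT; have /andP[t0 tT'] := tT; have [s0 sT] := sub _ tT; split=> y.
  have := flw_rev al01 p1 pN cE good0 TT mu0 y fx fr v1 (lexx 0) t0 tT'. by rewrite subr0.
 have := flw_rev al01 p1 pN cE good0 TT mu0 y fr fx v2 s0 sT (lexx T). by rewrite subrr subKr.
- apply/funext => y; apply: (flw_refl V y (drv_driver T0 p1 hM rx)). by rewrite lexx.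
- split; first by move=> t /andP[t0 tT]; apply: (flow_ndiff al01 p1 pN HV TT mu0 fx).
  move=> j j3; have [C _ HC] := flow_deriv_bd al01 p1 pN HV Om j3.
  by exists C => t /andP[t0 tT]; apply: (HC T mu TT mu0 _ _ _ _ fx).
 by move=> vs vs3; exact: (seqc vs vs3).1.
- split.
 + move=> t tT; have [s0 sT] := sub _ tT; exact: (flow_ndiff al01 p1 pN HV TT mu0 fr s0 sT (lexx T)).
 + move=> j j3; have [C _ HC] := flow_deriv_bd al01 p1 pN HV Om j3.
  by exists C => t tT; have [s0 sT] := sub _ tT; exact: (HC T mu TT mu0 _ _ _ _ fr s0 sT (lexx T)).
 + by move=> vs vs3; exact: (seqc vs vs3).2.
Qed.

(** In [ctrl_le] the path is compared with itself, so the contribution of the distance can be made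
    arbitrarily small and only the term linear in [t - s] remains. *)
Lemma smth_ctrl z : smooth_path T z -> exists2 A : R, 0 < A & forall s t, 0 <= s -> s <= t -> t <= T ->
  drv_ctrl (signature N z 0) s t <= A * (t - s).
move=> sz; have [A A0 HA] := smth_lip_lvs T0 p1 sz. have L0 : 0 <= lv_cst p by pos.
have C1 := @inv_cst_ge1 R d p. have c0 : 0 < @inv_cst R d p `^ p by apply: powR_gt0; exact: lt_le_trans C1.
exists (@inv_cst R d p `^ p * (lv_cst p * A + 1)) => [|s t s0 st tT].
 by rewrite mulr_gt0// ltr_wpDl// mulr_ge0.
apply/ler_addgt0Pr => e e0. have [de de0 Hde] := gg_fun_small p1 (divr_gt0 e0 c0).
have dd : (pvar_dist T (increment (signature N z 0)) (smth_inc p z) < de%:E)%E by rewrite pvar_distxx//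
 lte_fin. apply: letr (ctrl_le p1 (ltW c0) de0 dd HA s0 st tT) _.
rewrite mulrDr mulrA addrC lerD2l mulrC -ler_pdivlMr//.
Qed.

(** The increment goes from [t] to [t0], so its first level is [z t0 - z t]; this explains the plus
    sign. *)
Lemma smth_letter (z : R -> 'rV[R]_d) t0 i : smooth_path T z -> 0 < t0 < T -> forall e : R, 0 < e -> exists2 r
  : R, 0 < r & forall t, `|t - t0| <= r -> `|tcf (increment (signature N z 0) t t0) [:: i] + (t - t0) *
  velocity z t0 i| <= e * `|t - t0|.
move=> sz /andP[t00 t0T] e e0. have t0I : 0 < t0 < T by lra.
have /cvgrPdist_le/(_ e e0)/nbhs_normP[r1 /= r10 H1] := @vel_cont R d T z i t0 sz t0I.
exists (Num.min (r1 / 2) (Num.min (t0 / 2) ((T - t0) / 2))) => [|t].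
 by rewrite !lt_min !divr_gt0// subr_gt0.
rewrite !le_min => /and3P[tr tt1 tt2]. have tT : 0 <= t <= T.
 move: tt1 tt2; rewrite !ler_norml => /andP[a1 a2] /andP[a3 a4]; apply/andP; split; lra.
have [[Lc L1 Ld] L2] := inc_lift N sz tT. set f := fun r : R => tcf (increment (signature N z 0) t r) [:: i].
have ft : f t = 0 by rewrite /f L2 tcoef_tone// hM. pose h r := f r - r * velocity z t0 i.
have -> : f t0 + (t - t0) * velocity z t0 i = h t0 - h t by rewrite /h ft; ring.
have hd r : 0 < r < T -> is_derive r 1 h (velocity z r i - velocity z t0 i).
 move=> rT; have fd : is_derive r 1 f (velocity z r i).
  have := Ld [::] i r; rewrite /= L1 mul1r; apply=> //; by rewrite hM.
 have id1 : is_derive r 1 (fun r : R => r * velocity z t0 i) (velocity z t0 i).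
  have -> : (fun r : R => r * velocity z t0 i) = velocity z t0 i \*: (@id R).
   by apply/funext => s; rewrite mulrC.
  apply: is_derive_eq; by rewrite scaler1.
 exact: is_deriveB.
have hc : {within `[0, T], continuous h}.
 move=> q; apply: cvgB; first exact: Lc.
 apply: (continuous_subspaceT (f := fun r : R => r * velocity z t0 i)) => r.
 by apply: cvgM; [exact: cvg_id|exact: cvg_cst].
apply: letr (_ : _ <= e * `|t0 - t|) _; last by rewrite distrC.
apply: (mean_value_abs (a := 0) (b := T)) => //; first by rewrite !ltW.
move=> r rT rmm; have [dd De] := hd r rT; split=> //; rewrite De distrC; apply: H1 => /=.
apply: le_lt_trans (_ : _ <= r1 / 2) _; last by rewrite ltr_pdivrMr// ltr_pMr// ltr1n.
apply: letr tr; move: rmm; case: (leP t t0) => [a|/ltW a] /andP[b c].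
 by rewrite [leRHS]distrC !ger0_norm ?subr_ge0 ?(ltW c)//; lra.
by rewrite distrC !ger0_norm ?subr_ge0 ?(ltW b)//; lra.
Qed.

Lemma base_sys : @good_sys R d M al E (fun=> 0) V.
split; [exact: gauge0| |exact: dilatable0] => i.
exact: (hclass_le al01 (gauge0 _) (leq_trans (leqnSn _) (leqnSn _)) (HV i)).
Qed.

(* both for t <= t0 and for t >= t0 the flow over the small interval is
   approximated by the Euler map of the increment from t to t0 *)
Lemma bwd_step (z : R -> 'rV[R]_d) t0 : smooth_path T z -> 0 <= t0 <= T ->
  exists A C K : R, [/\ 0 < A, 0 <= C, 0 < K & forall t y, 0 <= t <= T -> A * `|t - t0| <= K ->
    exists2 w, bwd_flow (signature N z 0) t y = bwd_flow (signature N z 0) t0 w &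
      `|eul V (drv (signature N z 0) t t0) y - w| <= C * (A * `|t - t0|) `^ (@theta R M al p)].
move=> sz /andP[t00 t0T]. set x := signature N z 0; have rx : rpath x := rpath_smth p T0 sz.
have [Om [mu [mu0 [fx fr]]]] := one_fam rx. have [v1 v2] := rdrv_rev hM rx.
have good0 := base_sys; have cE := @seq_compl_row R n.
have [K [C [K0 C0 HC]]] := flw_part al01 p1 pN cE good0 0 Om. have [A A0 HA] := smth_ctrl sz.
exists A, C, K; split=> // t y /andP[t0' tT] AK.
have th0 : 0 <= @theta R M al p by rewrite (letr ler01)// ltW// theta_gt1. case: (ltgtP t t0) => tt0.
- exists (flw V (drv x) t t0 y).
  have [h1 h2 h3] : [/\ 0 <= T - t0, T - t0 <= T - t & T - t <= T].
   by split; lra.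
  rewrite /bwd_flow. rewrite -(flw_cocycle al01 p1 pN cE good0 TT mu0 _ fr h1 h2 h3 (lexx T)).
  by rewrite (flw_rev al01 p1 pN cE good0 TT mu0 y fx fr v1 t0' (ltW tt0) t0T).
 have om : drv_ctrl x t t0 <= A * `|t - t0|.
  by rewrite distrC gtr0_norm ?subr_gt0//; exact: HA t0' (ltW tt0) t0T.
 have o0 : 0 <= drv_ctrl x t t0 by have [[_ _ _ op _] _ _] := fx; exact/ltW/op.
 have sc : mesh_le (drv_ctrl x) K t [:: t0] by rewrite /mesh_le /= (letr om AK).
 have := HC T mu (drv x) (drv_ctrl x) t t0 [:: t0] y TT mu0 fx t0' t0T (itv_partition1 tt0) sc (lexx 0).
 move=> h; apply: letr h _; rewrite /= addr0; apply: ler_wpM2l => //.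
 by apply: (ge0_ler_powR th0); rewrite ?nnegrE// (letr o0).
- have [h1 h2 h3] : [/\ 0 <= T - t, T - t < T - t0 & T - t0 <= T].
  by split; lra.
 exists (flw V (rdrv x) (T - t) (T - t0) y).
  by rewrite /bwd_flow -(flw_cocycle al01 p1 pN cE good0 TT mu0 _ fr h1 (ltW h2) h3 (lexx T)).
 have om : rdrv_ctrl x (T - t) (T - t0) <= A * `|t - t0|.
  rewrite gtr0_norm ?subr_gt0// /rdrv_ctrl !subKr; exact: HA t00 (ltW tt0) tT.
 have o0 : 0 <= rdrv_ctrl x (T - t) (T - t0) by have [[_ _ _ op _] _ _] := fr; exact/ltW/op.
 have sc : mesh_le (rdrv_ctrl x) K (T - t) [:: T - t0] by rewrite /mesh_le /= (letr om AK).
 have := HC T mu (rdrv x) (rdrv_ctrl x) (T - t) (T - t0) [:: T - t0] y TT mu0 fr h1 h3 (itv_partition1 h2) sc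
  (lexx 0). have -> : drv x t t0 = rdrv x (T - t) (T - t0) by rewrite /rdrv !subKr.
 move=> h; apply: letr h _; rewrite /= addr0; apply: ler_wpM2l => //.
 by apply: (ge0_ler_powR th0); rewrite ?nnegrE// (letr o0).
- exists y; first by rewrite tt0. by rewrite tt0 (drvxx hM _ rx) eul_tone subrr normr0 mulr_ge0 ?powR_ge0.
Qed.

Lemma euler_drift (z : R -> 'rV[R]_d) t0 y0 : smooth_path T z -> 0 < t0 < T -> forall e : R, 0 < e -> exists2
  r : R, 0 < r & forall t y, `|t - t0| <= r -> `|y - y0| <= r -> 0 <= t <= T /\ `|eul V (drv (signature N z 0)
  t t0) y - (y - (t - t0) *: \sum_i velocity z t0 i *: V i y0)| <= e * `|t - t0|.
move=> sz t0I e e0; have /andP[t00 t0T] := t0I.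
set x := signature N z 0; have rx : rpath x := rpath_smth p T0 sz.
have [C1 C10 HC1] := eul_first_order al01 (gauge0 _) (good_weak al01 base_sys) 0.
have [B B0 HB] := smth_inc_coef p sz. have e2 : 0 < e / 2 by pos. pose e' := e / 2 / (d%:R + 1).
have e'0 : 0 < e' by pos.
have letter : exists2 r : R, 0 < r & forall i t y, `|t - t0| <= r -> `|y - y0| <= r -> `|tcf (increment x t
 t0) [:: i] *: V i y + (t - t0) *: (velocity z t0 i *: V i y0)| <= e' * `|t - t0|.
 apply: unif_rad => [i r r' _ rr H t y tr yr|i].
  by apply: H; [exact: letr tr rr|exact: letr yr rr].
 have [Vb _] := HV i; have [CV HCV] := Vb 0.
 have CV0 : 0 <= CV by exact: letr (normr_ge0 _) (HCV 0 (lexx 0)). have e20 : 0 < e' / 2 by pos.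
 have [r1 r10 H1] := smth_letter i sz t0I (divr_gt0 e20 (ltr_wpDl CV0 ltr01)).
 have dV : differentiable (V i) y0 by exact: hclass_diff (HV i) y0.
 have v0 : 0 < `|velocity z t0 i| + 1 by [].
 have /cvgrPdist_le/(_ _ (divr_gt0 e20 v0))/nbhs_normP[r2 /= r20 H2] := differentiable_continuous dV.
 exists (Num.min r1 (r2 / 2)) => [|t y]; first by rewrite lt_min r10 divr_gt0.
 rewrite !le_min => /andP[tr _] /andP[_ yr].
 have -> : tcf (increment x t t0) [:: i] *: V i y + (t - t0) *: (velocity z t0 i *: V i y0) = (tcf (increment
  x t t0) [:: i] + (t - t0) * velocity z t0 i) *: V i y + ((t - t0) * velocity z t0 i) *: (V i y0 - V i y).
  by rewrite scalerA scalerDl scalerBr; zmod.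
 apply: letr (ler_normD _ _) _; rewrite !normrZ.
 apply: (@le_trans _ _ (e' / 2 * `|t - t0| + e' / 2 * `|t - t0|)); last by rewrite -mulrDl -splitr.
 apply: lerD.
  apply: (@le_trans _ _ (e' / 2 / (CV + 1) * `|t - t0| * CV)).
   by apply: ler_pM => //; [exact: H1|exact: HCV].
  have -> : e' / 2 / (CV + 1) * `|t - t0| * CV = e' / 2 * `|t - t0| * (CV / (CV + 1)) by ring.
  have CV1 : 0 < CV + 1 by rewrite ltr_wpDl.
  by rewrite ler_piMr ?(mulr_ge0 (ltW e20))// ler_pdivrMr// mul1r lerDl.
 rewrite -mulrA mulrC ler_wpM2r//. have hv : `|V i y0 - V i y| <= e' / 2 / (`|velocity z t0 i| + 1).
  by apply: H2; rewrite /= distrC (le_lt_trans yr)// ltr_pdivrMr// ltr_pMr// ltr1n.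
 apply: (@le_trans _ _ (`|velocity z t0 i| * (e' / 2 / (`|velocity z t0 i| + 1)))).
  by rewrite ler_wpM2l.
 by rewrite mulrCA ler_piMr ?(ltW e20)// ler_pdivrMr// mul1r lerDl.
have [r3 r30 H3] := letter. have b1 : 0 < B + 1 by rewrite ltr_wpDl.
have cb : 0 < C1 * B ^+ 2 + 1 by rewrite ltr_wpDl// mulr_ge0// exprn_ge0.
exists (Num.min r3 (Num.min (Num.min (t0 / 2) ((T - t0) / 2)) (Num.min (B + 1)^-1 (e / 2 / (C1 * B ^+ 2 +
 1))))) => [|t y].
 have ht : 0 < T - t0 by rewrite subr_gt0.
 by rewrite !lt_min r30 (divr_gt0 t00)// (divr_gt0 ht)// (divr_gt0 e2 cb) invr_gt0 b1.
rewrite !le_min => /and3P[tr3 /andP[tr4 tr5] /andP[tr6 tr7]] /andP[yr3 _]. have tT : 0 <= t <= T.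
 by move: tr4 tr5; rewrite !ler_norml => /andP[a1 a2] /andP[a3 a4]; apply/andP; split; lra.
split=> //. have Bt : 0 <= B * `|t - t0| <= 1.
 rewrite mulr_ge0//=; apply: (@le_trans _ _ ((B + 1) * (B + 1)^-1)); last by rewrite divff// gt_eqF.
 by apply: ler_pM => //; rewrite lerDl.
have ha v : (size v <= M.+1)%N -> `|tcf (drv x t t0) v| <= (B * `|t - t0|) ^+ size v.
 move=> vN; rewrite tcoef_tcast distrC; apply: HB => //; first by rewrite !ltW. by rewrite hM.
have a1 : tcf (drv x t t0) [::] = 1 by rewrite tcoef_tcast (rpath_coef_nil t t0 rx).
have := HC1 (drv x t t0) y _ (lexx 0) Bt ha a1. set Eu := eul _ _ _; move=> h1.
have -> : Eu - (y - (t - t0) *: \sum_i velocity z t0 i *: V i y0) = (Eu - y - \sum_i tcf (drv x t t0) [:: i]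
 *: V i y) + \sum_i (tcf (increment x t t0) [:: i] *: V i y + (t - t0) *: (velocity z t0 i *: V i y0)).
 rewrite big_split /= -scaler_sumr.
 have -> : \sum_i tcf (drv x t t0) [:: i] *: V i y = \sum_i tcf (increment x t t0) [:: i] *: V i y.
  by apply: eq_bigr => i _; rewrite tcoef_tcast.
 by rewrite addrA subrK opprB addrCA addrC -addrA.
apply: letr (ler_normD _ _) _; rewrite (splitr e) mulrDl; apply: lerD.
 apply: letr h1 _; rewrite exprMn mulrA expr2 mulrA ler_wpM2r//.
 move: tr7; rewrite ler_pdivlMr// mulrC => /(letr _); apply. by rewrite ler_wpM2r// lerDl.
apply: letr (ler_norm_sum _ _ _) _.
apply: (@le_trans _ _ (\sum_(i < d) e' * `|t - t0|)); first by apply: ler_sum => i _; exact: H3.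
rewrite sumr_const card_ord -[leLHS]mulr_natl mulrA ler_wpM2r//.
by rewrite /e' mulrCA ler_piMr ?(ltW e2)// ler_pdivrMr ?ltr_wpDl// mul1r lerDl.
Qed.

(** Takes the place of the differential equation of the inverse flow: moving the time from [t0] to
    [t] amounts, up to [o(|t - t0|)] and uniformly for [y] near [y0], to shifting the starting point
    against the velocity. This first-order expansion is all that the transport of jets asks about
    time. *)
Lemma bwd_motion (z : R -> 'rV[R]_d) t0 y0 : smooth_path T z -> 0 < t0 < T -> forall e : R, 0 < e -> exists2 r
  : R, 0 < r & forall t y, `|t - t0| <= r -> `|y - y0| <= r -> `|bwd_flow (signature N z 0) t y - bwd_flow
  (signature N z 0) t0 (y - (t - t0) *: \sum_i velocity z t0 i *: V i y0)| <= e * `|t - t0|.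
move=> sz t0I e e0; have /andP[t00 t0T] := t0I. have t0I' : 0 <= t0 <= T by lra.
have [A [C [K [A0 C0 K0 HS]]]] := bwd_step sz t0I'. have rx : rpath (signature N z 0) := rpath_smth p T0 sz.
have [Om [mu [mu0 [fx fr]]]] := one_fam rx.
have [L L0 HL] := flw_lip al01 p1 pN (@seq_compl_row R n) base_sys 0 Om.
have l1 : 0 < L + 1 by rewrite ltr_wpDl. have e2 : 0 < e / (L + 1) / 2 by pos.
have [r1 r10 H1] := euler_drift y0 sz t0I e2. have ca : 0 < C * A + 1 by rewrite ltr_wpDl// mulr_ge0// ltW.
(* The control of a smooth path is Lipschitz in time and [theta > 1], so the error of the Euler step
   is [o(|t - t0|)]. *)
have [h h0 Hh] := small_power p1 pN (divr_gt0 e2 ca).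
have th : 0 < @theta R M al p - 1 by rewrite subr_gt0 theta_gt1.
exists (Num.min r1 (Num.min (K / A) (h / A))) => [|t y].
 by rewrite !lt_min r10 !divr_gt0.
rewrite !le_min !ler_pdivlMr// !(mulrC _ A) => /and3P[tr1 tr2 tr3] /andP[yr1 _].
have [tT D1] := H1 t y tr1 yr1; have [w -> Hw] := HS t y tT tr2.
have [s0 sT] : 0 <= T - t0 /\ T - t0 <= T by split; lra.
apply: letr (HL T mu TT mu0 _ _ _ _ _ _ fr s0 sT (lexx T) (lexx 0) (lexx 0)) _.
move: D1 Hw; set Eu := eul _ _ _; set w0 := y - _ => D1 Hw.
have hp : (A * `|t - t0|) `^ (@theta R M al p) <= A * `|t - t0| * (e / (L + 1) / 2 / (C * A + 1)).
 have d0 : 0 <= A * `|t - t0| by rewrite mulr_ge0// ltW.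
 rewrite -mulr_powRB1// ?(lt_trans ltr01 (theta_gt1 p1 pN))// ler_wpM2l//.
 by apply: letr Hh; apply: (ge0_ler_powR (ltW th)); rewrite ?nnegrE// ltW.
have dw : `|w - w0| <= e / (L + 1) * `|t - t0|.
 apply: letr (ler_distD Eu _ _) _; rewrite (splitr (e / (L + 1))) mulrDl; apply: lerD => //.
 rewrite distrC; apply: letr Hw _; apply: letr (ler_wpM2l C0 hp) _.
 have -> : C * (A * `|t - t0| * (e / (L + 1) / 2 / (C * A + 1))) = e / (L + 1) / 2 * `|t - t0| * (C * A / (C
  * A + 1)) by ring. by rewrite ler_piMr ?(mulr_ge0 (ltW e2))// ler_pdivrMr// mul1r lerDl.
apply: letr (ler_wpM2l L0 dw) _; rewrite mulrA ler_wpM2r//.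
by rewrite mulrCA ler_piMr ?(ltW e0)// ler_pdivrMr// mul1r lerDl.
Qed.

End rough_flows.

(** * Quadratic polynomials in space and time *)

Section quadratic_functions.
Context {R : realType} {n : nat}.
Local Notation E := 'rV[R]_n.
Implicit Types (x y b : E) (A : 'M[R]_n) (q : R * E).

Definition dot x y : R := (x *m y^T) 0 0.

Lemma dotE x y : dot x y = \sum_i x 0 i * y 0 i. by rewrite /dot mxE; apply: eq_bigr => i _; rewrite mxE. Qed.

Lemma dotC x y : dot x y = dot y x. by rewrite !dotE; apply: eq_bigr => i _; rewrite mulrC. Qed.

Lemma dotDl x y z : dot (x + y) z = dot x z + dot y z. by rewrite /dot mulmxDl mxE. Qed.

Lemma dotZl (a : R) x y : dot (a *: x) y = a * dot x y. by rewrite /dot -scalemxAl mxE. Qed.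

Lemma dotDr x y z : dot x (y + z) = dot x y + dot x z. by rewrite dotC dotDl !(dotC x). Qed.

Lemma dotZr (a : R) x y : dot x (a *: y) = a * dot x y. by rewrite dotC dotZl dotC. Qed.

Lemma dot0l y : dot 0 y = 0. by rewrite /dot mul0mx mxE. Qed.

Lemma dotNl x y : dot (- x) y = - dot x y. by rewrite -scaleN1r dotZl mulN1r. Qed.

Lemma dot_sym A x y : A^T = A -> dot (x *m A) y = dot (y *m A) x.
have E1 (B : 'M[R]_1) : B 0 0 = B^T 0 0 by rewrite mxE.
by move=> AT; rewrite /dot [RHS]E1 !trmx_mul trmxK AT mulmxA.
Qed.

Lemma dot_unit x i : dot x (unit_vec i) = x 0 i.
rewrite dotE (bigD1 i)//= big1 ?addr0 => [|j ji]; first by rewrite mxE !eqxx mulr1.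
by rewrite mxE eqxx (negPf ji) mulr0.
Qed.

Lemma dot_bd x y : `|dot x y| <= n%:R * (`|x| * `|y|).
rewrite dotE; apply: letr (ler_norm_sum _ _ _) _. apply: (@le_trans _ _ (\sum_(i < n) `|x| * `|y|)).
 by apply: ler_sum => i _; rewrite normrM ler_pM// crd_norm_le.
by rewrite sumr_const card_ord -[leLHS]mulr_natl.
Qed.

Lemma norm_sqr_le x : `|x| ^+ 2 <= dot x x.
have d0 : 0 <= dot x x by rewrite dotE; apply: sumr_ge0 => i _; rewrite -expr2 sqr_ge0.
rewrite -(sqr_sqrtr d0) lerXn2r ?nnegrE ?sqrtr_ge0//. apply: row_norm_le => [|i]; first exact: sqrtr_ge0.
rewrite -sqrtr_sqr; apply: ler_wsqrtr; rewrite dotE (bigD1 i)//= -expr2 lerDl.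
by apply: sumr_ge0 => j _; rewrite -expr2 sqr_ge0.
Qed.

Lemma dot_ge0 x : 0 <= dot x x. exact: letr (sqr_ge0 _) (norm_sqr_le x). Qed.

Lemma quad_bd A : exists2 C : R, 0 <= C & forall x y, `|dot (x *m A) y| <= C * (`|x| * `|y|).
pose D := \sum_i \sum_j `|A i j|. have D0 : 0 <= D by pos.
exists (n%:R * D) => [|x y]; first by rewrite mulr_ge0.
apply: letr (dot_bd _ _) _; rewrite -mulrA ler_wpM2l// mulrA ler_wpM2r//.
apply: row_norm_le => [|j]; first by rewrite mulr_ge0.
rewrite mxE; apply: letr (ler_norm_sum _ _ _) _; rewrite /D mulr_suml.
apply: ler_sum => i _; rewrite normrM mulrC ler_pM ?crd_norm_le//. by rewrite (bigD1 j)//= lerDl sumr_ge0.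
Qed.

(** No mixed terms: [(a, b, A)] is a parabolic jet and [be] a penalty in time. The family is closed
    under differentiation, whence smoothness. *)
Definition jetpoly q0 (c a : R) b A (be : R) q : R := c + a * (q.1 - q0.1) + dot b (q.2 - q0.2) + dot ((q.2 -
  q0.2) *m A) (q.2 - q0.2) / 2 + be * (q.1 - q0.1) ^+ 2.

Lemma jetpoly_der q0 c a b A be q : A^T = A -> differentiable (jetpoly q0 c a b A be) q /\ forall v, 'D_v
  (jetpoly q0 c a b A be) q = jetpoly q0 (a * v.1 + dot b v.2) (2 * be * v.1) (v.2 *m A) 0 0 q.
move=> AT; set t := q.1 - q0.1; set x := q.2 - q0.2.
pose L (v : R * E) : R := a * v.1 + dot b v.2 + 2 * be * v.1 * t + dot (v.2 *m A) x.
have [C C0 HC] := quad_bd A. pose K := `|a| + n%:R * `|b| + `|2 * be * t| + C * `|x|. have Ll : linear L.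
 move=> k [u1 u2] [v1 v2].
 rewrite -[LHS]/(a * (k * u1 + v1) + dot b (k *: u2 + v2) + 2 * be * (k * u1 + v1) * t + dot ((k *: u2 + v2)
  *m A) x).
 rewrite -[RHS]/(k * (a * u1 + dot b u2 + 2 * be * u1 * t + dot (u2 *m A) x) + (a * v1 + dot b v2 + 2 * be *
  v1 * t + dot (v2 *m A) x)). rewrite mulmxDl -scalemxAl dotDl (dotDr b) dotZl dotZr.
 move: (dot _ _) (dot _ _) (dot _ _) (dot _ _) => w1 w2 w3 w4; ring.
have n1 (v : R * E) : `|v.1| <= `|v| by have := fst_bd v; rewrite mul1r.
have n2 (v : R * E) : `|v.2| <= `|v| by have := snd_bd v; rewrite mul1r. have LK v : `|L v| <= K * `|v|.
 rewrite /K; set k3 := `|2 * be * t|; rewrite !mulrDl.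
 apply: letr (ler_normD _ _) _; apply: lerD; last first.
  apply: letr (HC _ _) _; rewrite mulrAC -mulrA; apply: ler_wpM2l => //.
  by rewrite mulrC [leLHS]mulrC ler_wpM2r.
 apply: letr (ler_normD _ _) _; apply: lerD; last first.
  by rewrite mulrAC normrM /k3 ler_wpM2l.
 apply: letr (ler_normD _ _) _; apply: lerD; first by rewrite normrM ler_wpM2l.
 by apply: letr (dot_bd _ _) _; rewrite mulrA ler_wpM2l// mulr_ge0.
have [|df Df] := @diff_intro_linear R _ _ (jetpoly q0 c a b A be) q L K Ll LK.
 move=> e e0; pose B := C / 2 + `|be| + 1. have B0 : 0 < B by rewrite ltr_wpDl// addr_ge0// divr_ge0.
 exists (e / B) => [|h hr]; first exact: divr_gt0.
 have -> : jetpoly q0 c a b A be (q + h) - jetpoly q0 c a b A be q - L h = dot (h.2 *m A) h.2 / 2 + be * h.1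
  ^+ 2.
  rewrite /jetpoly /L -[(q + h).1]/(q.1 + h.1) -[(q + h).2]/(q.2 + h.2).
  have -> : q.1 + h.1 - q0.1 = t + h.1 by rewrite /t addrAC.
  have -> : q.2 + h.2 - q0.2 = x + h.2 by rewrite /x addrAC.
  rewrite -/t -/x mulmxDl dotDl (dotDr b x) (dotDr (x *m A) x h.2) (dotDr (h.2 *m A) x h.2).
  rewrite (dot_sym x h.2 AT).
  move: (dot b x) (dot b h.2) (dot (x *m A) x) (dot (h.2 *m A) x) (dot (h.2 *m A) h.2).
  by move=> u1 u2 u3 u4 u5; field.
 have h2 : `|h| ^+ 2 <= e / B * `|h| by rewrite expr2 ler_wpM2r// ltW.
 apply: (@le_trans _ _ (B * `|h| ^+ 2)); last first.
  by rewrite mulrC -ler_pdivlMr// mulrAC.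
 apply: (@le_trans _ _ ((C / 2 + `|be|) * `|h| ^+ 2)); last first.
  by rewrite ler_wpM2r ?exprn_ge0// /B lerDl.
 rewrite mulrDl; apply: letr (ler_normD _ _) _; apply: lerD.
  rewrite normrM (@ger0_norm _ 2^-1)// mulrAC ler_wpM2r//.
  apply: letr (HC _ _) _; rewrite ler_wpM2l// expr2; exact: ler_pM.
 rewrite normrM ler_wpM2l// normrX lerXn2r ?nnegrE//.
split=> // v; rewrite Df /L /jetpoly mulmx0 dot0l -/t -/x; ring.
Qed.

Lemma jetpoly_smth D q0 c a b A be : A^T = A -> smooth_on D (jetpoly q0 c a b A be).
move=> AT vs x _; suff [c' [a' [b' [A' [be' [AT' ->]]]]]] : exists c' a' b' A' be', A'^T = A' /\ dderiv vs
 (jetpoly q0 c a b A be) = jetpoly q0 c' a' b' A' be'.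
 exact: (jetpoly_der _ _ _ _ _ _ AT').1.
elim: vs => [|v vs [c' [a' [b' [A' [be' [AT' E1]]]]]]]; first by exists c, a, b, A, be.
do 5 eexists; split; last first.
 rewrite /= E1; apply/funext => q; exact: (jetpoly_der _ _ _ _ _ _ AT').2.
by rewrite trmx0.
Qed.

Lemma jetpoly_dt q0 c a b A be q : A^T = A -> dt (jetpoly q0 c a b A be) q = a + 2 * be * (q.1 - q0.1).
move=> AT; rewrite /dt (jetpoly_der _ _ _ _ _ _ AT).2 /jetpoly /= mulmx0 mul0mx !dot0l.
by rewrite (dotC b) dot0l; ring.
Qed.

Lemma jetpoly_grad q0 c a b A be q : A^T = A -> grad (jetpoly q0 c a b A be) q = b + (q.2 - q0.2) *m A.
move=> AT; apply/rowP => i; rewrite !mxE (jetpoly_der _ _ _ _ _ _ AT).2 /jetpoly /= mulmx0 dot0l.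
rewrite dot_sym// !dot_unit !mxE; ring.
Qed.

Lemma jetpoly_hess q0 c a b A be q : A^T = A -> hess (jetpoly q0 c a b A be) q = A.
move=> AT; apply/matrixP => i j; rewrite mxE /=.
have -> : 'D_(0, unit_vec j) (jetpoly q0 c a b A be) = jetpoly q0 (a * 0 + dot b (unit_vec j)) (2 * be * 0)
 (unit_vec j *m A) 0 0.
 by apply/funext => x; rewrite (jetpoly_der _ _ _ _ _ _ AT).2.
rewrite (jetpoly_der _ _ _ _ _ _ (trmx0 _ _ _)).2 /jetpoly /= !mulmx0 !dot0l.
rewrite dot_sym// dot_unit; have -> : (unit_vec i *m A) 0 j = A i j by rewrite -rowE mxE. by ring.
Qed.

End quadratic_functions.

(** * Parabolic superjets *)

Section superjets.
Context {R : realType} {n : nat}.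
Local Notation E := 'rV[R]_n.
Implicit Types (x y b : E) (A : 'M[R]_n) (q : R * E) (u : R * E -> R).

(** The parabolic scale, on which time counts like the square of space. *)
Definition gap q0 q : R := `|q.1 - q0.1| + dot (q.2 - q0.2) (q.2 - q0.2).

(** The second-order parabolic superjet. Smooth test functions could not be transported by a flow
    that has finitely many derivatives in space and a mere first-order expansion in time; jets
    can. *)
Definition superjet u q0 (a : R) b A := forall eta : R, 0 < eta -> exists2 r : R, 0 < r & forall q, `|q - q0|
  <= r -> u q <= jetpoly q0 (u q0) a b A 0 q + eta * gap q0 q.

Lemma der_dir_sum (W : normedModType R) (f : R * E -> W) q x : differentiable f q -> 'D_(0, x) f q = \sum_i x
  0 i *: 'D_(0, unit_vec i) f q.
move=> df; have -> : ((0, x) : R * E) = \sum_i x 0 i *: ((0, unit_vec i) : R * E).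
 rewrite {1}(row_sum_delta x); apply: injective_projections => /=.
  rewrite (raddf_sum (@fst R E)) big1// => i _; exact: scaler0.
 by rewrite (raddf_sum (@snd R E)).
rewrite deriveE// linear_sum; apply: eq_bigr => i _. by rewrite linearZ/= deriveE.
Qed.

Lemma pair_norm_le (t : R) x (r : R) : `|t| <= r -> `|x| <= r -> `|((t, x) : R * E)| <= r. by move=> h1 h2; rewrite prod_normE ge_max h1. Qed.

(** The segment from [q0] to [q] is replaced by a move in space, where the spatial gradient is
    expanded to first order, followed by a move in time, where the time derivative is continuous at
    [q0]. The two errors are of the two orders occurring in [gap]. *)
Lemma taylor_space_time (phi : R * E -> R) q0 : (exists2 r : R, 0 < r & forall q, `|q - q0| <= r ->
  differentiable phi q) -> differentiable ('D_(1, 0) phi) q0 -> (forall i, differentiable ('D_(0, unit_vec i)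
  phi) q0) -> (hess phi q0)^T = hess phi q0 -> forall eta : R, 0 < eta -> exists2 r : R, 0 < r & forall q, `|q
  - q0| <= r -> `|phi q - jetpoly q0 (phi q0) (dt phi q0) (grad phi q0) (hess phi q0) 0 q| <= eta * gap q0 q.
move=> [r1 r10 H1] dT dX hs eta e0; set P := jetpoly _ _ _ _ _ _.
have dP q : differentiable P q := (jetpoly_der _ _ _ _ _ _ hs).1. have n0 : 0 < n%:R + 1 :> R by [].
have /cvgrPdist_le/(_ _ e0)/nbhs_normP[r2 /= r20 H2] := differentiable_continuous dT.
have [r3 r30 H3] : exists2 r, 0 < r & forall i x, `|x| <= r -> `|'D_(0, unit_vec i) phi (q0 + (0, x)) - 'D_(0,
 unit_vec i) P (q0 + (0, x))| <= eta / (n%:R + 1) * `|x|.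
 apply: unif_rad => [i r r' _ rr H x xr|i]; first by apply: H; exact: letr xr rr.
 have [r r0 Hr] := diff_exp (dX i) (divr_gt0 e0 n0). exists (r / 2) => [|x xr]; first by rewrite divr_gt0.
 have nx : `|((0, x) : R * E)| = `|x| by rewrite prod_normE /= normr0; apply/max_idPr.
 have := Hr (0, x); rewrite nx => /(_ (le_lt_trans xr _)).
 move=> h; have {h} := h _; rewrite ltr_pdivrMr// ltr_pMr// ltr1n => /(_ isT).
 congr (`|_| <= _); rewrite -[RHS]/(_ - _) -addrA -opprD; congr (_ - _).
 have := jetpoly_grad q0 (phi q0) (dt phi q0) (grad phi q0) 0 (q0 + (0, x)) hs.
 move/rowP => /(_ i); rewrite [LHS]mxE -/P => ->.
 rewrite !mxE; congr (_ + _); rewrite der_dir_sum//; apply: eq_bigr => j _.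
 by rewrite !mxE /=; congr (_ * _); rewrite addrC addKr.
pose r := Num.min r1 (Num.min (r2 / 2) r3). exists r => [|q]; first by rewrite !lt_min r10 r30 divr_gt0.
rewrite !le_min => /and3P[qr1 qr2 qr3]. set t := q.1 - q0.1; set x := q.2 - q0.2.
have tq : `|t| <= `|q - q0| by have := fst_bd (q - q0); rewrite mul1r.
have xq : `|x| <= `|q - q0| by have := snd_bd (q - q0); rewrite mul1r. pose f q := phi q - P q.
have df q' : `|q' - q0| <= r1 -> differentiable f q' /\ forall v, 'D_v f q' = 'D_v phi q' - 'D_v P q'.
 move=> /H1 d1; split; first exact: differentiableB. by move=> v; rewrite deriveB//; exact: diff_derivable.
have f0 : f q0 = 0.
 by rewrite /f /P /jetpoly !subrr mul0mx (dotC (grad phi q0)) !dot0l expr0n /=; ring.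
have -> : phi q - P q = (f q - f (q0 + (0, x))) + (f (q0 + (0, x)) - f q0) by rewrite f0 subr0 subrK.
have qE : q = q0 + (t, x).
 by apply: injective_projections; rewrite /= addrC subrK.
have unit_itv (s : R) : 0 <= s <= 1 -> `|s| <= 1 by move=> /andP[s0 s1]; rewrite ger0_norm.
rewrite mulrDr; apply: letr (ler_normD _ _) _; apply: lerD.
 apply: segment_le => s /unit_itv s1. have -> : q - (q0 + (0, x)) = t *: (1, 0).
  rewrite {1}qE; apply: injective_projections => /=.
   by rewrite addr0 addrC addKr [RHS]mulr1.
  by rewrite subrr scaler0.
 have E1 : q0 + (0, x) + s *: (t *: (1, 0)) = q0 + ((s * t, x) : R * E).
  apply: injective_projections => /=; first by rewrite addr0 -[1%R in LHS]/(1 : R) -[t *: _]/(t * 1) mulr1.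
  by rewrite !scaler0 addr0.
 have nn : `|q0 + (0, x) + s *: (t *: (1, 0)) - q0| <= `|q - q0|.
  rewrite E1 addrC addKr; apply: pair_norm_le => //. by rewrite normrM (letr _ tq)// ler_piMl.
 have [d1 D1] := df _ (letr nn qr1); split=> //. rewrite der_scale// normrZ mulrC ler_wpM2r// D1.
 have -> : 'D_(1, 0) P (q0 + (0, x) + s *: (t *: (1, 0))) = 'D_(1, 0) phi q0.
  have := jetpoly_dt q0 (phi q0) (dt phi q0) (grad phi q0) 0 (q0 + (0, x) + s *: (t *: (1, 0))) hs.
  by rewrite mulr0 mul0r addr0.
 rewrite distrC; apply: H2; rewrite /= distrC (le_lt_trans nn)// (le_lt_trans qr2)//.
 by rewrite ltr_pdivrMr// ltr_pMr// ltr1n.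
apply: (@le_trans _ _ (eta * `|x| ^+ 2)); last by rewrite ler_wpM2l ?(ltW e0)// norm_sqr_le.
apply: segment_le => s s01; have s1 := unit_itv _ s01.
have -> : q0 + (0, x) - q0 = ((0, x) : R * E) by rewrite addrC addKr.
have E1 : q0 + s *: (0, x) = q0 + ((0, s *: x) : R * E).
 by apply: injective_projections => //=; rewrite scaler0.
have sx : `|s *: x| <= `|x| by rewrite normrZ ler_piMl. have nn : `|q0 + s *: (0, x) - q0| <= `|q - q0|.
 rewrite E1 addrC addKr; apply: pair_norm_le; rewrite ?normr0//; exact: letr xq.
have [d1 D1] := df _ (letr nn qr1); split=> //.
rewrite der_dir_sum//; apply: letr (ler_norm_sum _ _ _) _.
apply: (@le_trans _ _ (\sum_(i < n) eta / (n%:R + 1) * `|x| ^+ 2)).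
 apply: ler_sum => i _; rewrite normrZ D1 E1 expr2 mulrCA; apply: ler_pM => //.
  exact: crd_norm_le.
 apply: letr (H3 i _ (letr sx (letr xq qr3))) _. by rewrite ler_wpM2l// divr_ge0// ltW.
rewrite sumr_const card_ord -[leLHS]mulr_natl mulrA ler_wpM2r ?exprn_ge0//.
by rewrite mulrCA ler_piMr ?(ltW e0)// ler_pdivrMr// mul1r lerDl.
Qed.

End superjets.

Lemma near_rad (R : realType) (U : normedModType R) (P : set U) (q : U) (r : R) : 0 < r -> (forall q', `|q' -
  q| < r -> P q') -> nbhs q P. by move=> r0 H; apply/nbhs_normP; exists r => // q' /=; rewrite distrC; exact: H. Qed.

(** * Viscosity inequalities through jets, and half-relaxed limits *)

Section viscosity_jets.
Context {R : realType} {n : nat}.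
Local Notation E := 'rV[R]_n.
Implicit Types (x y b : E) (A : 'M[R]_n) (q : R * E) (u : R * E -> R) (G : generator R n).

Lemma slice_der (W : normedModType R) (f : R * E -> W) (t : R) x y : differentiable f (t, x) -> differentiable
  (fun z => f (t, z)) x /\ 'D_y (fun z => f (t, z)) x = 'D_(0, y) f (t, x).
move=> df; have d1 : differentiable (@id E) x := @ex_diff _ _ _ _ _ _ _ (is_diff_id x).
have dt := differentiable_cst (t : R^o) x. have ds : differentiable (fun z : E => (t, z)) x by [].
split; first exact: (@differentiable_comp _ _ _ _ (fun z : E => (t, z)) f).
rewrite (@der_comp _ _ _ _ (fun z : E => (t, z)) f x y ds df).
by rewrite (der_pair y dt d1) derive_id derive_cst.
Qed.

Lemma hess_sym (T : R) (phi : R * E -> R) q : smooth_on (open_slab T) phi -> open_slab T q -> (hess phi q)^T =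
  hess phi q.
move=> sphi; case: q => t x tT; apply/matrixP => i j; rewrite !mxE.
have d0 y : differentiable phi (t, y) by exact: (sphi [::]).
have d1 k y : differentiable ('D_(0, unit_vec k) phi) (t, y) by exact: (sphi [:: (0, unit_vec k)]).
pose f y := phi (t, y). have fk k : 'D_(unit_vec k) f = fun y => 'D_(0, unit_vec k) phi (t, y).
 by apply/funext => y; exact: (slice_der _ (d0 y)).2.
have hh k l : dderiv [:: (0, unit_vec k); (0, unit_vec l)] phi (t, x) = 'D_(unit_vec k) ('D_(unit_vec l) f) x.
 by rewrite fk (slice_der _ (d1 l x)).2.
have dk k : differentiable ('D_(unit_vec k) f) x.
 by rewrite fk; exact: (slice_der 0 (d1 k x)).1.
rewrite !hh; apply: der_schwarz => // y. exact: (slice_der 0 (d0 y)).1.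
Qed.

Lemma open_slab_near (T : R) q : open_slab T q -> exists2 r : R, 0 < r & forall q', `|q' - q| <= r ->
  open_slab T q'.
move=> /andP[q0 qT]; exists (Num.min (q.1 / 2) ((T - q.1) / 2)) => [|q'].
 by rewrite lt_min !divr_gt0// subr_gt0.
have h := fst_bd (q' - q); rewrite mul1r in h. rewrite le_min => /andP[/(letr h) + /(letr h)].
rewrite -[(q' - q).1]/(q'.1 - q.1) !ler_norml => /andP[a1 _] /andP[_ a2]. by apply/andP; split; lra.
Qed.

Lemma test_superjet (T : R) (phi : R * E -> R) u q : smooth_on (open_slab T) phi -> open_slab T q -> (\forall
  q' \near q, u q' - phi q' <= u q - phi q) -> superjet u q (dt phi q) (grad phi q) (hess phi q).
move=> sphi qT /nbhs_normP[r1 /= r10 H1] eta e0. have [r2 r20 H2] := open_slab_near qT.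
have [|||r3 r30 H3] := taylor_space_time _ _ _ (hess_sym sphi qT) e0.
- by exists r2 => // q' /H2 q'T; exact: (sphi [::]).
- exact: (sphi [:: (1, 0)]).
- by move=> i; exact: (sphi [:: (0, unit_vec i)]).
exists (Num.min (r1 / 2) r3) => [|q']; first by rewrite lt_min r30 divr_gt0.
rewrite le_min => /andP[q1 /H3]; rewrite ler_norml => /andP[_ h3].
have /H1 h1 : `|q - q'| < r1 by rewrite distrC (le_lt_trans q1)// ltr_pdivrMr// ltr_pMr// ltr1n.
have -> : jetpoly q (u q) (dt phi q) (grad phi q) (hess phi q) 0 q' = jetpoly q (phi q) (dt phi q) (grad phi
 q) (hess phi q) 0 q' + u q - phi q by rewrite /jetpoly; ring. lra.
Qed.

Definition jet_subsol (T : R) G u := forall q a b A, open_slab T q -> A^T = A -> superjet u q a b A -> a <= G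
  q.1 q.2 b A.

Lemma jet_subsol_sub (T : R) G u : usc_on (slab T) u -> jet_subsol T G u -> subsolution T G u.
move=> uu ju; split=> // phi q sphi qT loc.
exact: (ju _ _ _ _ qT (hess_sym sphi qT) (test_superjet sphi qT loc)).
Qed.

Lemma usc_rad (A : set (R * E)) u : (forall q, A q -> forall e : R, 0 < e -> exists2 r : R, 0 < r & forall q',
  A q' -> `|q' - q| <= r -> u q' <= u q + e) -> usc_on A u.
move=> H q a; rewrite lte_fin => aq. exists [set y | a < - u y]; last by move=> y /=; rewrite lte_fin.
have [Aq|nAq] := pselect (A q); last first.
 by rewrite /nbhs /= -nbhs_subspace_out// => y ->.
rewrite /nbhs /= -nbhs_subspace_in//. have e0 : 0 < (- u q - a) / 2 by lra. have [r r0 Hr] := H q Aq _ e0.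
apply: (near_rad r0) => y yr Ay. by rewrite /=; have := Hr y Ay (ltW yr); lra.
Qed.

Lemma compact_box q (r : R) : compact [set q' | `|q' - q| <= r].
case: q => t x. have c1 : compact [set s : R | `|s - t| <= r].
 rewrite (_ : [set s | _] = `[t - r, t + r]%classic); first exact: segment_compact.
 by apply/seteqP; split=> s /=; rewrite in_itv /= ler_distl.
have c2 : compact [set y : E | `|y - x| <= r].
 have [r0|r0] := ltP r 0.
  rewrite (_ : [set y | _] = set0); first exact: compact0.
  by apply/seteqP; split=> // y /= h; have := le_lt_trans (letr (normr_ge0 _) h) r0; rewrite ltxx.
 rewrite (_ : [set y | _] = [set y : E | forall i, `[x 0 i - r, x 0 i + r]%classic (y 0 i)]).
  by apply: (@rV_compact R n (fun i => `[x 0 i - r, x 0 i + r]%classic)) => i; exact: segment_compact.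
 apply/seteqP; split=> y /= h.
  move=> i; rewrite /= in_itv /= -ler_distl.
  by have := crd_norm_le (y - x) i; rewrite !mxE => /letr; apply.
 apply: row_norm_le => // i; rewrite !mxE ler_distl. by have := h i; rewrite in_itv.
have := compact_setX c1 c2; congr compact; apply/seteqP; split=> -[s y] /=.
 by move=> [h1 h2]; exact: pair_norm_le.
move=> h; split.
 by apply: letr h; have := fst_bd ((s, y) - (t, x)); rewrite mul1r.
by apply: letr h; have := snd_bd ((s, y) - (t, x)); rewrite mul1r.
Qed.

Lemma jetpoly_cont q0 (c a : R) b A (be : R) : A^T = A -> continuous (jetpoly q0 c a b A be). by move=> AT q; apply: differentiable_continuous; exact: (jetpoly_der _ _ _ _ _ _ AT).1. Qed.

Lemma gap_jetpoly q0 q : gap q0 q = `|q.1 - q0.1| + jetpoly q0 0 0 0 (2%:M) 0 q.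
rewrite /gap /jetpoly mul_mx_scalar dotZl dot0l; congr (_ + _). by lra.
Qed.

Lemma gap_cont q0 : continuous (gap q0).
move=> q; have -> : gap q0 = fun q => `|q.1 - q0.1| + jetpoly q0 0 0 0 (2%:M) 0 q.
 by apply/funext => q'; rewrite gap_jetpoly.
apply: cvgD; last by apply: jetpoly_cont; rewrite tr_scalar_mx.
by apply: cvg_norm; apply: cvgB; [exact: cvg_fst|exact: cvg_cst].
Qed.

Lemma matrix_norm_le (m k : nat) (B : 'M[R]_(m, k)) (C : R) : 0 <= C -> (forall i j, `|B i j| <= C) -> `|B| <=
  C.
move=> C0 H; rewrite [leLHS]/Num.norm /= mx_normrE. by apply: bigmax_le => // -[i j] _ /=.
Qed.

Lemma scalar_norm_le (c : R) : `|c%:M : 'M[R]_n| <= `|c|.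
apply: matrix_norm_le => // i j; rewrite mxE; case: eqP => _; rewrite ?mulr1n// mulr0n normr0//.
Qed.

Lemma mulmx_bd A : exists2 C : R, 0 <= C & forall x, `|x *m A| <= C * `|x|.
exists (\sum_i \sum_j `|A i j|) => [|x]; first by apply: sumr_ge0 => i _; exact: sumr_ge0.
apply: row_norm_le => [|j].
 by pos.
rewrite mxE; apply: letr (ler_norm_sum _ _ _) _; rewrite mulr_suml.
apply: ler_sum => i _; rewrite normrM mulrC ler_pM ?crd_norm_le//. by rewrite (bigD1 j)//= lerDl sumr_ge0.
Qed.

Definition poly_subsol (T : R) G u := forall q0 (c a : R) b A (be : R) q, A^T = A -> open_slab T q -> (\forall
  q' \near q, u q' - jetpoly q0 c a b A be q' <= u q - jetpoly q0 c a b A be q) -> a + 2 * be * (q.1 - q0.1)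
  <= G q.1 q.2 (b + (q.2 - q0.2) *m A) A.

Lemma subsol_poly (T : R) G u : subsolution T G u -> poly_subsol T G u.
move=> [_ sub] q0 c a b A be q AT qT loc.
have sQ : smooth_on (open_slab T) (jetpoly q0 c a b A be) by exact: jetpoly_smth.
by have := sub _ q sQ qT loc; rewrite jetpoly_dt// jetpoly_grad// jetpoly_hess.
Qed.

Definition dual G : generator R n := fun t x b A => - G t x (- b) (- A).

Lemma supersol_poly (T : R) G u : supersolution T G u -> poly_subsol T (dual G) (fun q => - u q).
move=> [_ sup] q0 c a b A be q AT qT loc. have ANT : (- A)^T = - A by rewrite raddfN /= AT.
have sQ : smooth_on (open_slab T) (jetpoly q0 (- c) (- a) (- b) (- A) (- be)) by exact: jetpoly_smth.
have jN q' : jetpoly q0 (- c) (- a) (- b) (- A) (- be) q' = - jetpoly q0 c a b A be q'.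
 by rewrite /jetpoly mulmxN !dotNl; ring.
have loc' : \forall q' \near q, u q - jetpoly q0 (- c) (- a) (- b) (- A) (- be) q <= u q' - jetpoly q0 (- c)
 (- a) (- b) (- A) (- be) q'.
 by apply: filterS loc => q'; rewrite !jN !opprK => h; clear - h; lra.
have := sup _ q sQ qT loc'; rewrite jetpoly_dt// jetpoly_grad// jetpoly_hess// mulmxN -opprD /dual. by lra.
Qed.

Lemma test_subjet (T : R) (phi : R * E -> R) u q : smooth_on (open_slab T) phi -> open_slab T q -> (\forall q'
  \near q, u q - phi q <= u q' - phi q') -> superjet (fun q => - u q) q (- dt phi q) (- grad phi q) (- hess
  phi q).
move=> sphi qT /nbhs_normP[r1 /= r10 H1] eta e0. have [r2 r20 H2] := open_slab_near qT.
have [|||r3 r30 H3] := taylor_space_time _ _ _ (hess_sym sphi qT) e0.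
- by exists r2 => // q' /H2 q'T; exact: (sphi [::]).
- exact: (sphi [:: (1, 0)]).
- by move=> i; exact: (sphi [:: (0, unit_vec i)]).
exists (Num.min (r1 / 2) r3) => [|q']; first by rewrite lt_min r30 divr_gt0.
rewrite le_min => /andP[q1 /H3]; rewrite ler_norml => /andP[h3 _].
have /H1 h1 : `|q - q'| < r1 by rewrite distrC (le_lt_trans q1)// ltr_pdivrMr// ltr_pMr// ltr1n.
have -> : jetpoly q (- u q) (- dt phi q) (- grad phi q) (- hess phi q) 0 q' = - jetpoly q (phi q) (dt phi q)
 (grad phi q) (hess phi q) 0 q' - u q + phi q.
 by rewrite /jetpoly mulmxN !dotNl; ring.
lra.
Qed.

Lemma jet_subsol_super (T : R) G u : usc_on (slab T) (fun q => - u q) -> jet_subsol T (dual G) (fun q => - u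
  q) -> supersolution T G u.
move=> uu ju; split=> [|phi q sphi qT loc].
 by move: uu; rewrite /usc_on; under [fun _ => - - _]eq_fun do rewrite opprK.
have hT : (- hess phi q)^T = - hess phi q by rewrite raddfN /= (hess_sym sphi qT).
have := ju _ _ _ _ qT hT (test_subjet sphi qT loc). by rewrite /dual !opprK lerN2.
Qed.

(** The upper half-relaxed limit, given by its two defining properties instead of a formula. *)
Definition up_rlx (T : R) (v : nat -> R * E -> R) (w : R * E -> R) := (forall q, slab T q -> forall (e : R) m,
  0 < e -> exists k q', [/\ (m <= k)%N, slab T q', `|q' - q| <= e & w q - e <= v k q']) /\ (forall q, slab T q
  -> forall e : R, 0 < e -> exists m, exists2 r : R, 0 < r & forall k q', (m <= k)%N -> slab T q' -> `|q' - q|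
  <= r -> v k q' <= w q + e).

Lemma up_rlx_usc T v w : up_rlx T v w -> usc_on (slab T) w.
move=> [r1 r2]; apply: usc_rad => q qT e e0. have e2 : 0 < e / 2 by lra.
have [m [r r0 Hr]] := r2 q qT _ e2; exists (r / 2) => [|q' q'T qr]; first by rewrite divr_gt0.
have d0 : 0 < Num.min (e / 2) (r / 2) by rewrite lt_min e2 divr_gt0.
have [k [q2 [mk q2T q2q h]]] := r1 q' q'T _ m d0. move: q2q h; set d := Num.min _ _ => q2q h.
have [de dr] : d <= e / 2 /\ d <= r / 2 by rewrite /d !ge_min !lexx orbT.
have := Hr k q2 mk q2T; have -> : `|q2 - q| <= r.
 by apply: letr (ler_distD q' _ _) _; rewrite (splitr r) lerD// (letr q2q).
by move=> /(_ isT); lra.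
Qed.

(** The value at a point is the infimum of the constants that bound late [v k] from above near the
    point. *)
Lemma up_rlx_exists (T C : R) v : (forall k q, slab T q -> `|v k q| <= C) -> exists w, up_rlx T v w /\ forall
  q, slab T q -> `|w q| <= C.
move=> vC.
pose S q := [set c : R | exists m, exists2 r : R, 0 < r & forall k q', (m <= k)%N -> slab T q' -> `|q' - q| <=
 r -> v k q' <= c]. have SC q : S q C.
 exists 0%N, 1 => // k q' _ q'T _; by have := vC k q' q'T; rewrite ler_norml => /andP[].
have Slb q : slab T q -> forall c, S q c -> - C <= c.
 move=> qT c [m [r r0 /(_ m q (leqnn m) qT)]]; rewrite subrr normr0 => /(_ (ltW r0)).
 by apply: letr; have := vC m q qT; rewrite ler_norml => /andP[].
have hi q : slab T q -> has_inf (S q).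
 by move=> qT; split; [exists C|exists (- C) => c; exact: Slb].
exists (fun q => inf (S q)); split; last first.
 move=> q qT; rewrite ler_norml; apply/andP; split.
  by apply: lb_le_inf; [exists C|move=> c; exact: Slb].
 by apply: ge_inf => //; exact: (hi q qT).2.
split=> q qT e.
 move=> m e0; apply: contrapT => nE. have : S q (inf (S q) - e).
  exists m, e => // k q' mk q'T qq'; rewrite leNgt; apply/negP => h; apply: nE.
  by exists k, q'; split=> //; exact: ltW.
 by move=> Sq; have := ge_inf (hi q qT).2 Sq; lra.
move=> e0; have [c [m [r r0 H]] ce] := inf_adherent e0 (hi q qT).
exists m, r => // k q' mk q'T qq'; apply: letr (H k q' mk q'T qq') _; exact: ltW.
Qed.

(** Continuous convergence along indices [m k >= k] that may skip or repeat, because the indices at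
    which perturbed tests attain their maxima cannot be prescribed. *)
Definition gen_cvg (D : set (R * E)) (Gk : nat -> generator R n) G := forall (m : nat -> nat) (qk : nat -> R *
  E) q (bk : nat -> E) b (Ak : nat -> 'M[R]_n) A, (forall k, (k <= m k)%N) -> (forall k, D (qk k)) -> D q ->
  (forall k, (Ak k)^T = Ak k) -> A^T = A -> qk @ \oo --> q -> bk @ \oo --> b -> Ak @ \oo --> A -> Gk (m k) (qk
  k).1 (qk k).2 (bk k) (Ak k) @[k --> \oo] --> G q.1 q.2 b A.

(** [s] and [D] are the time distance and the squared space distance of a maximum point, [ka] the
    scale of the time penalty. If [s] exceeded [ka], then [s^2 / ka] would exceed [s] and the
    inequality would give [s <= ka / 2]. The bound on [D] follows. *)
Lemma penalty_bd (r s D : R) : 0 < r -> r <= 1 -> 0 <= s -> 0 <= D -> s ^+ 2 / (r ^+ 2 / 4) + D / 2 <= s / 2 +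
  r ^+ 2 / 4 / 4 -> [/\ s <= r ^+ 2 / 4, s < r & D < r ^+ 2].
move=> r0 r1 s0 D0; have rr : r ^+ 2 <= r by rewrite expr2 ler_piMl// ltW. have r20 : 0 < r ^+ 2 by pos.
set ka : R := r ^+ 2 / 4; have ka0 : 0 < ka by rewrite divr_gt0. have kr : ka = r ^+ 2 / 4 by [].
have z0 : 0 <= s ^+ 2 / ka by pos. have zs : ka < s -> s <= s ^+ 2 / ka.
 by move=> h; rewrite ler_pdivlMr// expr2 ler_wpM2l// ltW.
move: (s ^+ 2 / ka) z0 zs => z z0 zs key. have ska : s <= ka by lra. by split=> //; lra.
Qed.

(* The test polynomial is the jet plus eta (|x - x0|^2 + (t - t0)^2 / kappa);
   the jet inequality holds with eta / 2, and since kappa is of the order of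
   the square of the radius of its validity, the maximum is interior and the
   time derivative of the penalty is at most 2 eta. *)
Lemma rlx_test_point (T : R) (v : nat -> R * E -> R) w (Gk : nat -> generator R n) q0 (a : R) b A :
  (forall k, {within slab T, continuous (v k)}) ->
  (forall k, poly_subsol T (Gk k) (v k)) -> up_rlx T v w ->
  open_slab T q0 -> A^T = A -> superjet w q0 a b A ->
  forall (eta : R) m, 0 < eta -> eta <= 1 -> exists k q,
    [/\ (m <= k)%N, open_slab T q, `|q - q0| <= eta &
     a - 2 * eta <= Gk k q.1 q.2 (b + (q.2 - q0.2) *m (A + (2 * eta)%:M)) (A + (2 * eta)%:M)].
move=> vc vs [R1 R2] q0T AT J eta m e0 e1.
have slT q : open_slab T q -> slab T q by move=> /andP[/ltW h1 h2]; apply/andP. have e2 : 0 < eta / 2 by lra.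
have [rJ rJ0 HJ] := J _ e2; have [rT rT0 HT] := open_slab_near q0T.
have [r [r0 r1 re rj rt]] : exists r : R, [/\ 0 < r, r <= 1, r <= eta, r <= rJ & r <= rT].
 exists (Num.min (Num.min rJ rT) eta); split.
 - by rewrite !lt_min rJ0 rT0 e0.
 - by rewrite (letr _ e1)// ge_min lexx orbT.
 - by rewrite ge_min lexx orbT.
 - by rewrite !ge_min lexx.
 - by rewrite !ge_min lexx orbT.
pose ka : R := r ^+ 2 / 4; have ka0 : 0 < ka by rewrite divr_gt0// exprn_gt0.
pose ep := eta * ka / 8; have ep0 : 0 < ep by rewrite divr_gt0// mulr_gt0.
pose A' := A + (2 * eta)%:M; have AT' : A'^T = A' by rewrite raddfD /= AT tr_scalar_mx.
pose Q := jetpoly q0 0 a b A' (eta / ka). have cQ : continuous Q by exact: jetpoly_cont.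
pose B := [set q : R * E | `|q - q0| <= r].
have BT q : B q -> open_slab T q by move=> /letr h; apply: HT; exact: h.
have cB : compact B := @compact_box q0 r. pose bnd q := jetpoly q0 (w q0) a b A 0 q + eta / 2 * gap q0 q.
have wb q : B q -> w q <= bnd q by move=> /letr h; apply: HJ; exact: h. have cb : continuous bnd.
 move=> q; apply: cvgD; first exact: jetpoly_cont. by apply: cvgM; [exact: cvg_cst|exact: gap_cont].
(* The local upper bounds of the half-relaxed limit are patched by compactness into one bound on the
   whole box, with loss [ep]. *)
have [m1 Hm1] : exists m1, forall k, (m1 <= k)%N -> forall q, B q -> v k q <= bnd q + ep.
 have [|m1 _ Hm1] := (compact_near_coveringP _).1 cB nat \oo (fun k q => slab T q -> v k q <= bnd q + ep) _.
  move=> q Bq; have ep2 : 0 < ep / 2 by rewrite divr_gt0.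
  have [m2 [r2 r20 H2]] := R2 q (slT _ (BT _ Bq)) _ ep2. have /cvgrPdist_le/(_ _ ep2) bq := cb q.
  have nb : nbhs q [set y | `|y - q| <= r2] by apply: (near_rad r20) => y; exact: ltW.
  near=> q' k => /= q'T. have h1 : v k q' <= w q + ep / 2.
   have mk : (m2 <= k)%N by near: k; exact: nbhs_infty_ge. have qq : `|q' - q| <= r2 by []. exact: H2.
  have h2 : `|bnd q - bnd q'| <= ep / 2 by near: q'.
  have h3 := wb q Bq; move: h2; rewrite ler_norml => /andP[_ h2]; lra.
 by exists m1 => k mk q Bq; apply: (Hm1 k mk q Bq); exact/slT/BT.
have Q0 : Q q0 = 0.
 by rewrite /Q /jetpoly !subrr mul0mx (dotC b) !dot0l expr0n /=; ring.
have [r3 r30 H3] : exists2 r3 : R, 0 < r3 & forall q, `|q - q0| <= r3 -> `|Q q| <= ep / 2.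
 have ep2 : 0 < ep / 2 by rewrite divr_gt0. have /cvgrPdist_le/(_ _ ep2)/nbhs_normP[r3 /= r30 H3] := cQ q0.
 exists (r3 / 2) => [|q qr]; first by rewrite divr_gt0. have := H3 q; rewrite /= -/Q Q0 sub0r normrN; apply.
 by rewrite distrC (le_lt_trans qr)// ltr_pdivrMr// ltr_pMr// ltr1n.
have [d [d0 dr dr3 de]] : exists d : R, [/\ 0 < d, d <= r, d <= r3 & d <= ep / 2].
 exists (Num.min (Num.min r r3) (ep / 2)); split.
 - by rewrite !lt_min r0 r30 divr_gt0.
 - by rewrite !ge_min lexx.
 - by rewrite !ge_min lexx orbT.
 - by rewrite ge_min lexx orbT.
have [k [q1 [mk q1T q1q h1]]] := R1 q0 (slT _ q0T) d (maxn m m1) d0.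
have [km km1] : (m <= k)%N /\ (m1 <= k)%N by move: mk; rewrite geq_max => /andP[].
have Bq1 : B q1 by exact: letr q1q dr. have low : w q0 - ep <= v k q1 - Q q1.
 have : `|Q q1| <= ep / 2 by apply: H3; exact: letr q1q dr3. by rewrite ler_norml => /andP[_ h3]; lra.
have [||q2 /set_mem Bq2 max2] := compact_EVT_max (f := fun q => v k q - Q q) _ cB.
- by exists q1.
- have vB : {within B, continuous (v k)} by apply: continuous_subspaceW (vc k) => q /BT/slT.
 move=> q; apply: cvgB; first exact: vB. exact: (continuous_subspaceT cQ).
have {low max2} [low max2] : w q0 - ep <= v k q2 - Q q2 /\ forall q, B q -> v k q - Q q <= v k q2 - Q q2.
 split; first by apply: letr low _; apply: max2; exact: mem_set.
 by move=> q Bq; apply: max2; exact: mem_set.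
exists k, q2; have up := Hm1 k km1 q2 Bq2.
have QE q : Q q = jetpoly q0 (w q0) a b A 0 q - w q0 + eta * dot (q.2 - q0.2) (q.2 - q0.2) + eta / ka * `|q.1
 - q0.1| ^+ 2.
 rewrite /Q /jetpoly /A'; move: (q.2 - q0.2) => x.
 rewrite mulmxDr mul_mx_scalar dotDl dotZl real_normK ?num_real//.
 by move: (dot _ _) (dot _ _) (dot _ _) => u1 u2 u3; field; rewrite gt_eqF.
pose s : R := `|q2.1 - q0.1|; pose D : R := dot (q2.2 - q0.2) (q2.2 - q0.2). have s0 : 0 <= s := normr_ge0 _.
have D0 : 0 <= D by exact: dot_ge0. have key : s ^+ 2 / ka + D / 2 <= s / 2 + ka / 4.
 have h : eta * (s ^+ 2 / ka + D / 2) <= eta * (s / 2 + ka / 4).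
  move: low up; rewrite QE /bnd /gap -/s -/D.
  have -> : eta * (s ^+ 2 / ka + D / 2) = eta / ka * s ^+ 2 + eta * D / 2 by ring.
  have -> : eta * (s / 2 + ka / 4) = eta / 2 * s + 2 * ep by rewrite /ep; field.
  move: (jetpoly _ _ _ _ _ _ _) (eta / ka * s ^+ 2) => u1 u2 h2 h3; lra.
 by rewrite -(ler_pM2l e0).
have [ska sr Dr] := penalty_bd r0 r1 s0 D0 key. have Dr' : `|q2.2 - q0.2| < r.
 have h2 := norm_sqr_le (q2.2 - q0.2); rewrite -/D in h2.
 rewrite -(ltr_pXn2r (ltn0Sn 1))// ?nnegrE ?(ltW r0)//. exact: le_lt_trans h2 Dr.
have nq : `|q2 - q0| < r by rewrite prod_normE gt_max sr.
split=> //; [exact: BT|by apply: letr (ltW nq) re|].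
have loc : \forall q' \near q2, v k q' - Q q' <= v k q2 - Q q2.
 apply/nbhs_normP; exists (r - `|q2 - q0|); first by rewrite /= subr_gt0.
 move=> q' /= h; apply: max2; rewrite /B /=. apply: letr (ler_distD q2 _ _) _; rewrite distrC; lra.
have := vs k _ _ _ _ _ _ _ AT' (BT _ Bq2) loc; apply: letr. rewrite lerD2l lerNl -mulNr.
have : `|2 * (eta / ka) * (q2.1 - q0.1)| <= 2 * eta.
 have -> : 2 * (eta / ka) * (q2.1 - q0.1) = 2 * eta * ((q2.1 - q0.1) / ka) by ring.
 have e20 : 0 <= 2 * eta by pos. have ki : 0 <= ka^-1 by rewrite invr_ge0 ltW.
 by rewrite normrM (ger0_norm e20) ler_piMr// normrM (ger0_norm ki) ler_pdivrMr// mul1r.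
by rewrite ler_norml => /andP[h _]; lra. Unshelve. all: by end_near. Qed.

(** The perturbed points and jets of [rlx_test_point] with [eta = 1 / (j + 1)] converge to the given
    ones, and [gen_cvg] passes to the limit in the inequality. *)
Lemma rlx_jet_subsol (T : R) (v : nat -> R * E -> R) w (Gk : nat -> generator R n) G : (forall k, {within slab
  T, continuous (v k)}) -> (forall k, poly_subsol T (Gk k) (v k)) -> up_rlx T v w -> gen_cvg (open_slab T) Gk
  G -> jet_subsol T G w.
move=> vc vs vw GG q0 a b A q0T AT J. pose e (j : nat) : R := j.+1%:R^-1. have e0 j : 0 < e j by pos.
have e1 j : e j <= 1 by rewrite invf_le1// ler1n. have ec : e @ \oo --> 0 by exact: cvg_harmonic.
have [mq Hmq] := choice (fun j => let: ex_intro k (ex_intro q H) := rlx_test_point vc vs vw q0T AT J j (e0 j)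
 (e1 j) in ex_intro (fun mq : nat * (R * E) => [/\ (j <= mq.1)%N, open_slab T mq.2, `|mq.2 - q0| <= e j & a -
 2 * e j <= Gk mq.1 mq.2.1 mq.2.2 (b + (mq.2.2 - q0.2) *m (A + (2 * e j)%:M)) (A + (2 * e j)%:M)]) (k, q) H).
pose Ak j := A + (2 * e j)%:M; pose bk j := b + ((mq j).2.2 - q0.2) *m Ak j.
have qc : (mq j).2 @[j --> \oo] --> q0.
 apply/cvgrPdist_le => d d0; near=> j; rewrite distrC. have [_ _ h _] := Hmq j; apply: letr h _.
 have h : `|0 - e j| <= d by near: j; move/cvgrPdist_le: ec => /(_ d d0).
 by move: h; rewrite sub0r normrN ger0_norm// ltW.
have Ac : Ak @ \oo --> A.
 apply/cvgrPdist_le => d d0; near=> j; rewrite /Ak opprD addrA subrr add0r normrN.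
 apply: letr (scalar_norm_le _) _. have h : `|0 - e j| <= d / 2.
  by near: j; move/cvgrPdist_le: ec => /(_ (d / 2) (divr_gt0 d0 (ltr0n _ 2))).
 by move: h; rewrite sub0r normrN normrM (@ger0_norm _ 2)// => h; lra.
have [C C0 HC] := mulmx_bd A. have bc : bk @ \oo --> b.
 have C2 : 0 < C + 2 by rewrite ltr_wpDl.
 apply/cvgrPdist_le => d d0; near=> j; rewrite /bk opprD addrA subrr add0r normrN. have [_ _ h _] := Hmq j.
 have h2 : `|(mq j).2.2 - q0.2| <= e j.
  by apply: letr h; have := snd_bd ((mq j).2 - q0); rewrite mul1r.
 rewrite /Ak mulmxDr mul_mx_scalar; apply: letr (ler_normD _ _) _.
 have h3 : `|0 - e j| <= d / (C + 2) by near: j; move/cvgrPdist_le: ec => /(_ _ (divr_gt0 d0 C2)).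
 move: h3; rewrite sub0r normrN (ger0_norm (ltW (e0 j))) ler_pdivlMr// => h3.
 apply: letr h3; rewrite mulrDr; apply: lerD.
  by apply: letr (HC _) _; rewrite mulrC ler_wpM2r.
 have e2j : 0 <= 2 * e j by pos. rewrite normrZ (ger0_norm e2j) [leRHS]mulrC ler_piMr//.
 exact: letr h2 (e1 j).
have At k : (Ak k)^T = Ak k by rewrite /Ak raddfD /= AT tr_scalar_mx.
have := GG (fun j => (mq j).1) (fun j => (mq j).2) q0 bk b Ak A (fun j => let: And4 h _ _ _ := Hmq j in h)
 (fun j => let: And4 _ h _ _ := Hmq j in h) q0T At AT qc bc Ac. set g := fun j : nat => _; move=> gc.
have cv : a - 2 * e j - g j @[j --> \oo] --> a - 2 * 0 - G q0.1 q0.2 b A.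
 apply: cvgB => //; apply: cvgB; first exact: cvg_cst. by apply: cvgM => //; exact: cvg_cst.
have : a - 2 * 0 - G q0.1 q0.2 b A <= 0.
 apply: (cvgr_le_bd _ cv); apply: nearW => j; rewrite subr_le0. by have [] := Hmq j.
by lra. Unshelve. all: by end_near. Qed.

(** For a constant sequence [rlx_jet_subsol] turns the definition by test functions into the one by
    jets; in this way a continuous solution is tested at all of its superjets. *)
Lemma cstant_rlx (T : R) u : {within slab T, continuous u} -> up_rlx T (fun=> u) u.
move=> /subspace_continuousP uc; split=> q qT e.
 move=> m e0; exists m, q; split=> //; first by rewrite subrr normr0 ltW. by lra.
move=> e0; have /cvgrPdist_le/(_ e e0) := uc q qT. rewrite near_withinE => /nbhs_normP[r /= r0 Hr].
exists 0%N, (r / 2) => [|_ q' _ q'T qr]; first by rewrite divr_gt0. have : `|u q - u q'| <= e.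
 by apply: Hr q'T; rewrite /= distrC (le_lt_trans qr)// ltr_pdivrMr// ltr_pMr// ltr1n.
by rewrite ler_norml => /andP[h _]; lra.
Qed.

End viscosity_jets.

(** * Convergence of transformed generators *)

Section generator_convergence.
Context {R : realType} {n : nat}.
Local Notation E := 'rV[R]_n.
Implicit Types (x y b : E) (A : 'M[R]_n) (q : R * E) (u : R * E -> R) (F G : generator R n).

Lemma within_seq (U W : normedModType R) (D : set U) (f : U -> W) (u : nat -> U) (x : U) : {within D,
  continuous f} -> (forall k, D (u k)) -> D x -> u @ \oo --> x -> f (u k) @[k --> \oo] --> f x.
move=> /subspace_continuousP fc uD xD ux; apply/cvgrPdist_le => e e0.
have /cvgrPdist_le/(_ e e0) := fc x xD; rewrite near_withinE => H.
near=> k; have : D (u k) -> `|f x - f (u k)| <= e.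
 by near: k; exact: (ux _ H).
by apply. Unshelve. all: by end_near. Qed.

Lemma mx_cvg (m k : nat) (Bk : nat -> 'M[R]_(m, k)) (B : 'M[R]_(m, k)) : (forall i j, Bk l i j @[l --> \oo]
  --> B i j) -> Bk @ \oo --> B.
move=> H; apply/cvgrPdist_le => e e0.
have : \forall l \near \oo, forall (i : 'I_m) (j : 'I_k), `|B i j - Bk l i j| <= e.
 apply: filter_forall => i; apply: filter_forall => j. by have /cvgrPdist_le/(_ e e0) := H i j.
apply: filterS => l Hl; apply: matrix_norm_le => [|i j]; first exact: ltW. by rewrite !mxE.
Qed.

Lemma crd_cvg (m k : nat) (Bk : nat -> 'M[R]_(m, k)) (B : 'M[R]_(m, k)) i j : Bk @ \oo --> B -> Bk l i j @[l
  --> \oo] --> B i j.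
move=> /cvgrPdist_le H; apply/cvgrPdist_le => e e0; apply: filterS (H e e0) => l; apply: letr.
have -> : B i j - Bk l i j = (B - Bk l) i j by rewrite !mxE. rewrite [leRHS]/Num.norm /= mx_normrE.
exact: (le_bigmax _ (fun p : 'I_m * 'I_k => `|(B - Bk l) p.1 p.2|) (i, j)).
Qed.

Lemma mulmx_cvg (m k l : nat) (Ak : nat -> 'M[R]_(m, k)) (A : 'M[R]_(m, k)) (Bk : nat -> 'M[R]_(k, l)) (B :
  'M[R]_(k, l)) : Ak @ \oo --> A -> Bk @ \oo --> B -> Ak j *m Bk j @[j --> \oo] --> A *m B.
move=> Ac Bc; apply: mx_cvg => i j; rewrite mxE; under eq_fun do rewrite mxE.
by apply: cvg_sumr => h; apply: cvgM; exact: crd_cvg.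
Qed.

Lemma trmx_cvg (m k : nat) (Ak : nat -> 'M[R]_(m, k)) (A : 'M[R]_(m, k)) : Ak @ \oo --> A -> (Ak j)^T @[j -->
  \oo] --> A^T.
move=> Ac; apply: mx_cvg => i j; rewrite mxE; under eq_fun do rewrite mxE. exact: crd_cvg.
Qed.

Lemma summx_cvg (m k : nat) (I : finType) (Ak : nat -> I -> 'M[R]_(m, k)) (A : I -> 'M[R]_(m, k)) : (forall i,
  Ak j i @[j --> \oo] --> A i) -> \sum_i Ak j i @[j --> \oo] --> \sum_i A i.
move=> Ac; apply: mx_cvg => i j; rewrite summxE; under eq_fun do rewrite summxE.
by apply: cvg_sumr => h; exact: crd_cvg.
Qed.

Lemma coefmx_cvg (wk : nat -> 'I_n -> 'I_n -> E) (w : 'I_n -> 'I_n -> E) m : (forall i j, wk k i j @[k -->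
  \oo] --> w i j) -> \matrix_(i, j) wk k i j 0 m @[k --> \oo] --> \matrix_(i, j) w i j 0 m.
move=> H; apply: mx_cvg => i j; rewrite mxE; under eq_fun do rewrite mxE. exact: crd_cvg.
Qed.

Definition flows_cvg (T : R) (fk gk : nat -> R -> E -> E) (f g : R -> E -> E) := forall (m : nat -> nat) (tk :
  nat -> R) t (yk : nat -> E) y vs, (forall k, (k <= m k)%N) -> (forall k, 0 <= tk k <= T) -> 0 <= t <= T ->
  tk @ \oo --> t -> yk @ \oo --> y -> (size vs <= 3)%N -> dderiv vs (fk (m k) (tk k)) (yk k) @[k --> \oo] -->
  dderiv vs (f t) y /\ dderiv vs (gk (m k) (tk k)) (yk k) @[k --> \oo] --> dderiv vs (g t) y.

(** Directions index rows and components index columns, so a displacement, being a row vector, is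
    multiplied on the right. *)
Definition tgrad (psi : R -> E -> E) (t : R) y : 'M[R]_n := \matrix_(i, m) 'D_(unit_vec i) (psi t) y 0 m.

Definition thess (psi : R -> E -> E) (t : R) y m : 'M[R]_n := \matrix_(i, j) dderiv [:: unit_vec i; unit_vec
  j] (psi t) y 0 m.

Lemma tgradE psi t y i m : tgrad psi t y i m = ('D_(unit_vec i) (psi t) y : E) 0 m. by rewrite mxE. Qed.

Lemma transformE F phi psi t x b A : transform F phi psi t x b A = F t (phi t x) (b *m (tgrad psi t (phi t
  x))^T) (tgrad psi t (phi t x) *m A *m (tgrad psi t (phi t x))^T + \sum_m b 0 m *: thess psi t (phi t x) m).
rewrite /transform; congr (F t _ _ _).
 by apply/rowP => i; rewrite !mxE; apply: eq_bigr => m _; rewrite !mxE.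
apply/matrixP => i j; rewrite !mxE summxE; congr (_ + _); last first.
 by apply: eq_bigr => m _; rewrite !mxE.
rewrite exchange_big /=; apply: eq_bigr => l _; rewrite !mxE mulr_suml.
by apply: eq_bigr => m _; rewrite !mxE; congr (_ * _); rewrite mulrC.
Qed.

Lemma thess_sym (psi : R -> E -> E) t y m : ndiff 3 (psi t) -> (thess psi t y m)^T = thess psi t y m.
move=> nd; apply/matrixP => i j; rewrite !mxE.
have -> : dderiv [:: unit_vec j; unit_vec i] (psi t) y = dderiv [:: unit_vec i; unit_vec j] (psi t) y.
 apply: der_schwarz => [z||]; first exact: (nd [::] isT).
  exact: (nd [:: unit_vec i] isT).
 exact: (nd [:: unit_vec j] isT).
by [].
Qed.

Lemma tr_sym (psi : R -> E -> E) t y b A : ndiff 3 (psi t) -> A^T = A -> (tgrad psi t y *m A *m (tgrad psi t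
  y)^T + \sum_m b 0 m *: thess psi t y m)^T = tgrad psi t y *m A *m (tgrad psi t y)^T + \sum_m b 0 m *: thess
  psi t y m.
move=> nd AT; rewrite raddfD /= !trmx_mul trmxK AT mulmxA; congr (_ + _).
rewrite raddf_sum; apply: eq_bigr => m _. by rewrite /= linearZ /= thess_sym.
Qed.

(** In the form of [transformE] every argument of [F] is built from convergent factors. By [tr_sym]
    the matrix arguments stay symmetric, hence inside the set on which [F] is continuous. *)
Lemma tr_cvg (T : R) F fk gk f g : continuous_generator T F -> (forall k, flow 3 T (fk k) (gk k)) -> flow 3 T
  f g -> flows_cvg T fk gk f g -> gen_cvg (slab T) (fun k => transform F (fk k) (gk k)) (transform F f g).
move=> Fc flk fl fc m qk q bk b Ak A mk qkT qT AkT AT qc bc Ac. have [q1 q2] := cvg_components qc.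
have tT k : 0 <= (qk k).1 <= T by have /andP[-> /ltW] := qkT k.
have tT' : 0 <= q.1 <= T by have /andP[-> /ltW] := qT.
pose yk k := fk (m k) (qk k).1 (qk k).2; pose y := f q.1 q.2.
have yc : yk @ \oo --> y by exact: (fc m _ _ _ _ [::] mk tT tT' q1 q2 isT).1.
have gc vs := fc m _ _ _ _ vs mk tT tT' q1 yc.
have nk k : ndiff 3 (gk (m k) (qk k).1) by have [_ _ _ [nd _ _]] := flk (m k); exact: nd.
have n0 : ndiff 3 (g q.1) by have [_ _ _ [nd _ _]] := fl; exact: nd.
rewrite transformE; under eq_fun do rewrite transformE.
pose Jk k := tgrad (gk (m k)) (qk k).1 (yk k); pose J := tgrad g q.1 y. have Jc : Jk @ \oo --> J.
 apply: mx_cvg => i j; rewrite tgradE; under eq_fun do rewrite tgradE.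
 apply: (@crd_cvg 1 n (fun k => 'D_(unit_vec i) (gk (m k) (qk k).1) (yk k))).
 exact: (gc [:: unit_vec i] isT).2.
have Hc l : thess (gk (m k)) (qk k).1 (yk k) l @[k --> \oo] --> thess g q.1 y l.
 apply: (@coefmx_cvg (fun k i j => dderiv [:: unit_vec i; unit_vec j] (gk (m k) (qk k).1) (yk k)) (fun i j =>
  dderiv [:: unit_vec i; unit_vec j] (g q.1) y) l) => i j. exact: (gc [:: unit_vec i; unit_vec j] isT).2.
pose pk k := bk k *m (Jk k)^T; pose p := b *m J^T.
have pc : pk @ \oo --> p by apply: mulmx_cvg => //; exact: trmx_cvg.
pose Xk k := Jk k *m Ak k *m (Jk k)^T + \sum_l bk k 0 l *: thess (gk (m k)) (qk k).1 (yk k) l.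
pose X := J *m A *m J^T + \sum_l b 0 l *: thess g q.1 y l. have Xc : Xk @ \oo --> X.
 apply: cvgD; first by apply: mulmx_cvg; [exact: mulmx_cvg|exact: trmx_cvg].
 by apply: summx_cvg => l; apply: cvgZ; [exact: crd_cvg|exact: Hc].
have := within_seq (u := fun k => ((((qk k).1, yk k), pk k), Xk k)) (x := (((q.1, y), p), X)) Fc.
apply=> [k||].
- by split; [exact: tT|exact: tr_sym].
- by split; [exact: tT'|exact: tr_sym].
- exact: (pair_cvg (pair_cvg (pair_cvg q1 yc) pc) Xc).
Qed.

Lemma driven_cvg d (T : R) F (V : 'I_d -> E -> E) (z : R -> 'rV[R]_d) : continuous_generator T F -> (forall i,
  continuous (V i)) -> smooth_path T z -> gen_cvg (open_slab T) (fun=> driven F V z) (driven F V z).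
move=> Fc Vc sz m qk q bk b Ak A mk qkT qT AkT AT qc bc Ac. have [q1 q2] := cvg_components qc. apply: cvgB.
 have := within_seq (u := fun k => ((((qk k).1, (qk k).2), bk k), Ak k)) (x := (((q.1, q.2), b), A)) Fc.
 apply=> [k||].
 - by split; [have /andP[h1 h2] := qkT k; rewrite /= !ltW|exact: AkT].
 - by split; [have /andP[h1 h2] := qT; rewrite /= !ltW|exact: AT].
 - exact: (pair_cvg (pair_cvg (pair_cvg q1 q2) bc) Ac).
apply: cvg_sumr => i; apply: cvgM.
 apply: cvg_sumr => l; apply: cvgM; first exact: crd_cvg.
 by apply: crd_cvg; apply: (cvg_comp _ _ q2); exact: Vc.
by apply: (cvg_comp _ _ q1); exact: (@vel_cont R d T z i q.1 sz qT).
Qed.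

Lemma dual_cvg D Gk G : gen_cvg D Gk G -> gen_cvg D (fun k => dual (Gk k)) (dual G).
move=> H m qk q bk b Ak A mk qkT qT AkT AT qc bc Ac; apply: cvgN.
apply: (H m qk q _ _ (fun k => - Ak k) (- A)) => //.
- by move=> k; rewrite raddfN /= AkT.
- by rewrite raddfN /= AT.
- exact: cvgN.
- exact: cvgN.
Qed.

Lemma gen_cvgW (D D' : set (R * E)) Gk G : D' `<=` D -> gen_cvg D Gk G -> gen_cvg D' Gk G. by move=> DD H m qk q bk b Ak A mk qkT qT; apply: H => // [k|]; exact: DD. Qed.

Lemma seq_to_local (D : set (R * E)) (P : nat -> R * E -> Prop) q : (forall (m : nat -> nat) (qk : nat -> R *
  E), (forall k, (k <= m k)%N) -> (forall k, D (qk k)) -> qk @ \oo --> q -> exists k, P (m k) (qk k)) ->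
  exists m, exists2 r : R, 0 < r & forall k q', (m <= k)%N -> D q' -> `|q' - q| <= r -> P k q'.
move=> H; apply: contrapT => nE.
have pick (j : nat) : exists kq : nat * (R * E), [/\ (j <= kq.1)%N, D kq.2, `|kq.2 - q| <= j.+1%:R^-1 & ~ P
 kq.1 kq.2].
 apply: contrapT => nE'; apply: nE; exists j, (j.+1%:R^-1); first by rewrite invr_gt0.
 move=> k q' jk Dq' qq; apply: contrapT => nP; apply: nE'. by exists (k, q').
have [kq Hkq] := choice pick.
have [||k Pk] := H (fun j => (kq j).1) (fun j => (kq j).2) (fun j => let: And4 h _ _ _ := Hkq j in h).
- by move=> j; have [] := Hkq j.
- apply/cvgrPdist_le => e e0; have [k0 _ Hk0] := near_infty_natSinv_lt (PosNum e0).
 exists k0 => // k /= kk; rewrite distrC; have [_ _ h _] := Hkq k.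
 by apply: letr h _; apply: ltW; exact: Hk0.
by have [_ _ _] := Hkq k.
Qed.

Lemma gen_loc_bd (T : R) Gk G (b : R * E -> E) A q : gen_cvg (slab T) Gk G -> continuous b -> A^T = A -> slab
  T q -> exists m, exists2 r : R, 0 < r & forall k q', (m <= k)%N -> slab T q' -> `|q' - q| <= r -> Gk k q'.1
  q'.2 (b q') A <= G q.1 q.2 (b q) A + 1.
move=> GG bc AT qT; apply: seq_to_local => m qk mk qkT qc.
have := GG m qk q (fun k => b (qk k)) (b q) (fun=> A) A mk qkT qT (fun=> AT) AT qc.
have c1 : b (qk k) @[k --> \oo] --> b q by apply: (cvg_comp _ _ qc); exact: bc.
have c2 : (fun _ : nat => A) @ \oo --> A by exact: cvg_cst.
move=> /(_ c1 c2) /cvgrPdist_le/(_ 1 ltr01) [k _ /(_ k (leqnn k)) h].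
by exists k; move: h; rewrite ler_norml => /andP[h _]; clear - h; lra.
Qed.

End generator_convergence.

(** * Initial values and stability of solutions *)

Section stability.
Context {R : realType} {n : nat} (T : R).
Local Notation E := 'rV[R]_n.
Implicit Types (x y b : E) (A : 'M[R]_n) (q : R * E) (u : R * E -> R) (F G : generator R n).

Lemma compact_closed_ball (x : E) (r : R) : compact [set y : E | `|y - x| <= r].
rewrite (_ : [set y | _] = snd @` [set q : R * E | `|q - (0, x)| <= r]).
 apply: continuous_compact; last exact: compact_box. by apply: continuous_subspaceT => q; exact: cvg_snd.
apply/seteqP; split=> [y /= yr|_ [q /= qr <-]].
 exists (0, y) => //=; rewrite prod_normE /= subrr normr0 ge_max yr andbT. exact: letr (normr_ge0 _) yr.
by apply: letr qr; rewrite prod_normE /= le_max lexx orbT.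
Qed.

Lemma compact_cylinder (a b : R) x (r : R) : compact [set q : R * E | a <= q.1 <= b /\ `|q.2 - x| <= r].
have c2 := @compact_closed_ball x r. have := compact_setX (@segment_compact R a b) c2; congr compact.
Qed.

(** The local bounds of [gen_loc_bd] are patched by compactness; the bound and the index are found
    together through a product filter. *)
Lemma unif_gen_bd Gk G (b : R * E -> E) A (K : set (R * E)) : gen_cvg (slab T) Gk G -> continuous b -> A^T = A
  -> compact K -> K `<=` slab T -> exists m (C : R), forall k q, (m <= k)%N -> K q -> Gk k q.1 q.2 (b q) A <=
  C.
move=> GG bc AT cK KT.
pose P (i : R * nat) q := slab T q -> forall k, (i.2 <= k)%N -> Gk k q.1 q.2 (b q) A <= i.1.
have [|[S1 S2] /= [[c [_ Hc]] [m _ Hm]] H] := (compact_near_coveringP _).1 cK (R * nat)%type (filter_prod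
 (pinfty_nbhs R) \oo) P _.
 move=> q Kq; have [m0 [r r0 Hr]] := gen_loc_bd GG bc AT (KT q Kq). set c0 := G q.1 q.2 (b q) A + 1 in Hr.
 have nb : nbhs q [set y | `|y - q| <= r] by apply: (near_rad r0) => y; exact: ltW.
 exists ([set y | `|y - q| <= r], [set i | c0 <= i.1 /\ (m0 <= i.2)%N]) => /=.
  split=> //; exists ([set c | c0 <= c], [set m | (m0 <= m)%N]) => /=.
   split; first by exists c0; split; [exact: num_real|move=> y /ltW]. by exists m0.
  by [].
 move=> [q' [c m]] /= [h1 [h2 h3]] q'T k /= mk. by apply: letr (Hr k q' (leq_trans h3 mk) q'T h1) h2.
exists m, (c + 1) => k q mk Kq. have := H (c + 1, m); rewrite /= => /(_ _ q Kq (KT q Kq) k mk); apply.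
by split; [apply: Hc; rewrite ltrDl|exact: (Hm m (leqnn m))].
Qed.

(** The barrier is [u0 x + e / 2 + C t + K |y - x|^2]. [K] lifts it above [M] outside the ball of
    radius [r], and [C] lifts it above [M] after time [T / 2] and also exceeds the late [Gk] on the
    remaining cylinder at the gradient and Hessian of the barrier. Were [v k] above it somewhere,
    the difference would have a maximum inside the cylinder and away from time 0, where the
    subsolution inequality says that [C] is at most [Gk]. *)
Lemma rlx_initial (v : nat -> R * E -> R) w Gk G (u0 : E -> R) (M : R) : 0 < T -> (forall k, {within slab T,
  continuous (v k)}) -> (forall k q, slab T q -> `|v k q| <= M) -> (forall k, poly_subsol T (Gk k) (v k)) ->
  gen_cvg (slab T) Gk G -> up_rlx T v w -> (forall x (e : R), 0 < e -> exists m, exists2 r : R, 0 < r & forall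
  k y, (m <= k)%N -> `|y - x| <= r -> v k (0, y) <= u0 x + e) -> forall x, w (0, x) <= u0 x.
move=> T0 vc vM vs GG [R1 _] v0 x; apply/ler_addgt0Pr => e e0. have e2 : 0 < e / 2 by lra.
have [m0 [r r0 Hr]] := v0 x _ e2. have zT : slab T (0, x) by apply/andP.
have M0 : 0 <= M by apply: letr (vM 0%N _ zT). pose B : R := 2 * M + `|u0 x| + 1.
have B0 : 0 < B by rewrite ltr_wpDl// addr_ge0// mulr_ge0. pose K : R := B / r ^+ 2.
have r20 : 0 < r ^+ 2 by pos. have K0 : 0 < K by pos.
pose A : 'M[R]_n := (2 * K)%:M; have AT : A^T = A by rewrite tr_scalar_mx. pose b q : E := 0 + (q.2 - x) *m A.
have bc : continuous b.
 move=> q; rewrite /b /A; apply: cvgD; first exact: cvg_cst. under eq_fun do rewrite mul_mx_scalar.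
 rewrite mul_mx_scalar; apply: cvgZr; apply: cvgB; [exact: cvg_snd|exact: cvg_cst].
pose D := [set q : R * E | 0 <= q.1 <= T / 2 /\ `|q.2 - x| <= r]. have DT : D `<=` slab T.
 move=> q [/andP[q0 qT] _]; apply/andP; split=> //; clear - qT T0; lra.
have cD : compact D by exact: compact_cylinder. have [m1 [C0 HC0]] := unif_gen_bd GG bc AT cD DT.
have [C [CC0 CT C1]] : exists C : R, [/\ C0 < C, B <= C * (T / 2) & 0 <= C].
 exists (`|C0| + 1 + B / (T / 2)). have T2 : 0 < T / 2 by pos. have BT : 0 <= B / (T / 2) by pos.
 split; last by rewrite !addr_ge0.
  have := ler_norm C0; clear - BT; lra.
 rewrite mulrDl divfK ?gt_eqF// lerDr; apply: mulr_ge0; last exact: ltW. by [].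
pose be := jetpoly (0, x) (u0 x + e / 2) C 0 A 0.
have beE q : be q = u0 x + e / 2 + C * q.1 + K * dot (q.2 - x) (q.2 - x).
 rewrite /be /jetpoly /= dot0l subr0 mul_mx_scalar dotZl. by move: (dot _ _) => d; field.
have cbe : continuous be by exact: jetpoly_cont.
have below k : (maxn m0 m1 <= k)%N -> forall q, slab T q -> v k q <= be q.
 rewrite geq_max => /andP[k0 k1] q qT; rewrite leNgt; apply/negP => hq.
 have u0x := ler_norm (- u0 x); rewrite normrN in u0x.
 have inside q' : slab T q' -> be q' < v k q' -> [/\ q'.1 < T / 2, `|q'.2 - x| < r & 0 < q'.1].
  move=> q'T h; have /andP[q'0 _] := q'T.
  have vq := vM k q' q'T; rewrite ler_norml in vq; have {vq} /andP[_ vq] := vq.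
  have Cq : 0 <= C * q'.1 by pos.
  have dq : 0 <= K * dot (q'.2 - x) (q'.2 - x) by rewrite mulr_ge0 ?dot_ge0// ltW. rewrite beE in h.
  have i1 : q'.1 < T / 2.
   rewrite ltNge; apply/negP => h1. have : C * (T / 2) <= C * q'.1 by rewrite ler_wpM2l.
   rewrite /B in CT; clear - h vq dq CT u0x M0 e0; lra.
  have i2 : `|q'.2 - x| < r.
   rewrite ltNge; apply/negP => h1. have : B <= K * dot (q'.2 - x) (q'.2 - x).
    have -> : B = K * r ^+ 2 by rewrite /K divfK// gt_eqF. apply: ler_wpM2l; first exact: ltW.
    apply: letr (norm_sqr_le _); rewrite lerXn2r ?nnegrE ?(ltW r0)//.
   rewrite /B; clear - h vq Cq u0x M0 e0; lra.
  split=> //; rewrite lt_neqAle q'0 andbT; apply/negP => /eqP z.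
  have := Hr k q'.2 k0 (ltW i2); rewrite {1}z -surjective_pairing. clear - h dq Cq; lra.
 have Dq : D q by have [h1 h2 h3] := inside q qT hq; split; [apply/andP; split; exact: ltW|exact: ltW].
 have [||q2 /set_mem Dq2 max2] := compact_EVT_max (f := fun q => v k q - be q) _ cD.
 - by exists q.
 - have vD : {within D, continuous (v k)} by apply: continuous_subspaceW (vc k).
  by move=> q'; apply: cvgB; [exact: vD|exact: (continuous_subspaceT cbe)].
 have h2 : be q2 < v k q2.
  have := max2 q (mem_set Dq); clear - hq; lra.
 have [i1 i2 i3] := inside q2 (DT _ Dq2) h2.
 have oq2 : open_slab T q2 by apply/andP; split=> //; clear - i1 T0; lra.
 have loc : \forall q' \near q2, v k q' - be q' <= v k q2 - be q2.
  pose s := Num.min (Num.min q2.1 (T / 2 - q2.1)) (r - `|q2.2 - x|).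
  have s0 : 0 < s by rewrite !lt_min i3 !subr_gt0 i1 i2.
  apply: (near_rad s0) => q'; rewrite !lt_min => /andP[/andP[a1 a2] a3]. apply: max2; apply: mem_set.
  have f1 := fst_bd (q' - q2); have f2 := snd_bd (q' - q2); rewrite !mul1r in f1 f2. split.
   have := le_lt_trans f1 a1; have := le_lt_trans f1 a2.
   rewrite -[(q' - q2).1]/(q'.1 - q2.1) !ltr_norml => /andP[_ b1] /andP[b2 _].
   by apply/andP; split; clear - b1 b2; lra.
  apply: letr (ler_distD q2.2 _ _) _. have := le_lt_trans f2 a3; rewrite -[(q' - q2).2]/(q'.2 - q2.2).
  clear; lra.
 have := vs k _ _ _ _ _ _ _ AT oq2 loc; rewrite mulr0 mul0r addr0 => h.
 have := HC0 k q2 k1 Dq2; rewrite /b leNgt => /negP; apply. exact: lt_le_trans CC0 h.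
have /cvgrPdist_le/(_ (e / 4)) := cbe (0, x). have e4 : 0 < e / 4 by pos.
move=> /(_ e4)/nbhs_normP[s /= s0 Hs]. have d0 : 0 < Num.min (s / 2) (e / 4) by rewrite lt_min e4 divr_gt0.
have [k [q' [mk q'T qq h]]] := R1 (0, x) zT _ (maxn m0 m1) d0.
have {}Hs := Hs q'; have {}below := below k mk q' q'T. move: qq; rewrite le_min => /andP[qs _].
have : `|(0, x) - q'| < s by rewrite distrC (le_lt_trans qs)// ltr_pdivrMr// ltr_pMr// ltr1n. move/Hs => {}Hs.
have de : Num.min (s / 2) (e / 4) <= e / 4 by rewrite ge_min lexx orbT.
have be0 : be (0, x) = u0 x + e / 2 by rewrite beE /= subrr dot0l; ring.
move: Hs; rewrite be0 ler_norml => /andP[Hs _]. clear - below Hs h de; lra.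
Qed.

Definition loc_cvg (v : nat -> R * E -> R) w := forall q, slab T q -> forall e : R, 0 < e -> exists m, exists2
  r : R, 0 < r & forall k q', (m <= k)%N -> slab T q' -> `|q' - q| <= r -> `|v k q' - w q| <= e.

Lemma loc_cvg_cont v w : loc_cvg v w -> (forall k, {within slab T, continuous (v k)}) -> {within slab T,
  continuous w}.
move=> vw vc; apply/subspace_continuousP => q qT; apply/cvgrPdist_le => e e0. have e2 : 0 < e / 2 by lra.
have [m [r r0 Hr]] := vw q qT _ e2.
rewrite near_withinE; apply: (near_rad (r := r / 2)) => [|q' qr q'T]; first by rewrite divr_gt0.
have [m' [r' r'0 Hr']] := vw q' q'T _ e2. have h1 := Hr (maxn m m') q' (leq_maxl _ _) q'T.
have h2 := Hr' (maxn m m') q' (leq_maxr _ _) q'T. rewrite subrr normr0 in h2; have {}h2 := h2 (ltW r'0).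
have {}h1 := h1 (letr (ltW qr) _). have rr : r / 2 <= r by clear - r0; lra.
rewrite /from_subspace /=; apply: letr (ler_distD (v (maxn m m') q') _ _) _.
by rewrite (splitr e) lerD// distrC; exact: h1.
Qed.

Definition cont_sol G (u0 : E -> R) (M : R) w := [/\ {within slab T, continuous w}, forall q, slab T q -> `|w
  q| <= M, solution T G w & forall x, w (0, x) = u0 x].

(** The lower half-relaxed limit is [- w'], with [w'] the upper one of [- v k]. Comparison gives
    [w <= - w'], the converse holds by construction, and the equality of the two limits is locally
    uniform convergence. *)
Lemma stable_sol (v : nat -> R * E -> R) Gk F phi psi (u0 : E -> R) (M : R) : 0 < T -> invariant_comparison 3
  T F -> flow 3 T phi psi -> (forall k, {within slab T, continuous (v k)}) -> (forall k q, slab T q -> `|v k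
  q| <= M) -> (forall k, solution T (Gk k) (v k)) -> gen_cvg (slab T) Gk (transform F phi psi) -> (forall x (e
  : R), 0 < e -> exists m, exists2 r : R, 0 < r & forall k y, (m <= k)%N -> `|y - x| <= r -> `|v k (0, y) - u0
  x| <= e) -> exists w, cont_sol (transform F phi psi) u0 M w /\ loc_cvg v w.
move=> T0 cmp fl vc vM vs GG v0; set G := transform F phi psi in GG *.
have oT q : open_slab T q -> slab T q by move=> /andP[/ltW h1 h2]; apply/andP.
have [w [vw wM]] := up_rlx_exists vM. have wi := rlx_initial T0 vc vM (fun k => subsol_poly (vs k).1) GG vw.
have {}wi : forall x, w (0, x) <= u0 x.
 apply: wi => x e e0; have [m [r r0 Hr]] := v0 x e e0; exists m, r => // k y mk yr.
 by have := Hr k y mk yr; rewrite ler_norml => /andP[_ h]; clear - h; lra.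
have wsub : subsolution T G w.
 apply: jet_subsol_sub; first exact: up_rlx_usc vw.
 apply: (rlx_jet_subsol vc (fun k => subsol_poly (vs k).1) vw). exact: gen_cvgW GG.
pose v' k q := - v k q. have vc' k : {within slab T, continuous (v' k)} by move=> q; apply: cvgN; exact: vc.
have vM' k q : slab T q -> `|v' k q| <= M by rewrite normrN; exact: vM.
have [w' [vw' wM']] := up_rlx_exists vM'.
have vs' k : poly_subsol T (dual (Gk k)) (v' k) := supersol_poly (vs k).2. have GG' := dual_cvg GG.
have wi' : forall x, w' (0, x) <= - u0 x.
 apply: (rlx_initial T0 vc' vM' vs' GG' vw') => x e e0.
 have [m [r r0 Hr]] := v0 x e e0; exists m, r => // k y mk yr.
 by have := Hr k y mk yr; rewrite /v' ler_norml => /andP[h _]; clear - h; lra.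
have sup u : up_rlx T v' (fun q => - u q) -> supersolution T G u.
 move=> vu; apply: jet_subsol_super; first exact: up_rlx_usc vu. apply: (rlx_jet_subsol vc' vs' vu).
 by apply: gen_cvgW GG'.
have bnd u : (forall q, slab T q -> `|u q| <= M) -> [bounded u q | q in slab T].
 move=> uM; exists M; split; first exact: num_real. by move=> C MC q qT; apply: letr (uM q qT) (ltW MC).
have w'sup : supersolution T G (fun q => - w' q).
 by apply: sup; under eq_fun do rewrite opprK.
have le1 q : slab T q -> w q <= - w' q.
 move=> qT; apply: (cmp phi psi fl w (fun q => - w' q)) => //.
 - exact: bnd.
 - by apply: bnd => q' q'T; rewrite normrN; exact: wM'.
 - by move=> x; apply: letr (wi x) _; rewrite lerNr; exact: wi'.
have le2 q : slab T q -> - w' q <= w q.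
 move=> qT; apply/ler_addgt0Pr => e e0; have e2 : 0 < e / 2 by rewrite divr_gt0.
 have [m1 [r1 r10 H1]] := vw.2 q qT _ e2; have [m2 [r2 r20 H2]] := vw'.2 q qT _ e2.
 have := H1 (maxn m1 m2) q (leq_maxl _ _) qT; have := H2 (maxn m1 m2) q (leq_maxr _ _) qT.
 rewrite subrr normr0 /v' => /(_ (ltW r20)) h1 /(_ (ltW r10)) h2; clear - h1 h2; lra.
have ww q : slab T q -> w' q = - w q.
 by move=> qT; apply/eqP; rewrite -eqr_oppLR eq_le le1// le2.
have vw2 : up_rlx T v' (fun q => - w q).
 split=> q qT e; first by move=> m e0; rewrite -ww//; exact: vw'.1.
 by move=> e0; rewrite -ww//; exact: vw'.2.
have lc : loc_cvg v w.
 move=> q qT e e0; have [m1 [r1 r10 H1]] := vw.2 q qT _ e0; have [m2 [r2 r20 H2]] := vw2.2 q qT _ e0.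
 exists (maxn m1 m2), (Num.min r1 r2) => [|k q']; first by rewrite lt_min r10.
 rewrite geq_max le_min => /andP[k1 k2] q'T /andP[h1 h2].
 have := H1 k q' k1 q'T h1; have := H2 k q' k2 q'T h2; rewrite /v' ler_norml => a1 a2.
 by apply/andP; split; clear - a1 a2; lra.
exists w; split=> //; split=> //.
- exact: loc_cvg_cont lc vc.
- by split=> //; exact: sup.
- move=> x; apply/eqP; rewrite eq_le wi /=; have := wi' x; rewrite ww ?lerN2//. by apply/andP.
Qed.

End stability.

(** * Transport of jets by a flow *)

Section change_of_variables.
Context {R : realType} {n : nat}.
Local Notation E := 'rV[R]_n.
Implicit Types (x y b h c : E) (A : 'M[R]_n) (q : R * E) (u : R * E -> R).

Lemma crd_comp (g : E -> E) y v m : differentiable g y -> differentiable (fun y => g y 0 m) y /\ 'D_v (fun y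
  => g y 0 m) y = ('D_v g y) 0 m.
move=> dg; pose L (w : E) : R := w 0 m. have Ll : linear L by move=> k w w'; rewrite /L !mxE.
have Lb w : `|L w| <= 1 * `|w| by rewrite mul1r crd_norm_le. have [dL DL] := lmap_diff Ll Lb (g y).
split; first exact: (differentiable_comp dg dL). by rewrite (@der_comp _ _ _ _ g L y v dg dL) DL.
Qed.

Lemma snd_comp (W : normedModType R) (f : E -> W) q v : differentiable f q.2 -> differentiable (fun q : R * E
  => f q.2) q /\ 'D_v (fun q : R * E => f q.2) q = 'D_v.2 f q.2.
move=> df; have ds := @diff_snd R R E q. split; first exact: (differentiable_comp ds df). by [].
Qed.

(** [taylor_space_time] for a component of [psi t], regarded as a function constant in the time
    variable. *)
Lemma space_taylor (psi : R -> E -> E) t y0 : ndiff 3 (psi t) -> forall e : R, 0 < e -> exists2 r : R, 0 < r &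
  forall m y, `|y - y0| <= r -> `|psi t y 0 m - (psi t y0 0 m + ((y - y0) *m tgrad psi t y0) 0 m + dot ((y -
  y0) *m thess psi t y0 m) (y - y0) / 2)| <= e * dot (y - y0) (y - y0).
move=> nd e e0; apply: unif_rad => [m r r' _ rr H y yr|m].
 by apply: H; exact: letr yr rr.
pose f q : R := psi t q.2 0 m; pose q0 : R * E := (0, y0).
have d0 y : differentiable (psi t) y by exact: (nd [::] isT).
have d1 v y : differentiable ('D_v (psi t)) y by exact: (nd [:: v] isT).
have df v q : differentiable f q /\ 'D_v f q = ('D_v.2 (psi t) q.2) 0 m.
 have [c1 c2] := crd_comp v.2 m (d0 q.2); have [s1 s2] := snd_comp v c1. by [].
have Df v : 'D_v f = fun q => ('D_v.2 (psi t) q.2) 0 m.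
 by apply/funext => q; exact: (df v q).2.
have ddf v w q : differentiable ('D_v f) q /\ 'D_w ('D_v f) q = ('D_w.2 ('D_v.2 (psi t)) q.2) 0 m.
 have [c1 c2] := crd_comp w.2 m (d1 v.2 q.2); have [s1 s2] := snd_comp w c1.
 by rewrite Df; split; [exact: s1|rewrite s2 c2].
have hE : hess f q0 = thess psi t y0 m.
 by apply/matrixP => i j; rewrite !mxE; exact: (ddf (0, unit_vec j) (0, unit_vec i) q0).2.
have [||||r r0 Hr] := @taylor_space_time R n f q0 _ _ _ _ e e0.
- by exists 1 => // q _; exact: (df 0 q).1.
- exact: (ddf _ 0 q0).1.
- by move=> i; exact: (ddf _ 0 q0).1.
- by rewrite hE thess_sym.
exists r => // y yr. have nq : `|((0, y) : R * E) - q0| <= r.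
 by apply: pair_norm_le => /=; rewrite ?subrr ?normr0// ltW.
have := Hr (0, y) nq; rewrite /gap /jetpoly /= subrr normr0 add0r hE.
congr (`|_ - _| <= _); rewrite mulr0 addr0 expr0n /= mulr0 addr0; congr (_ + _ + _).
rewrite dotE mxE; apply: eq_bigr => i _; rewrite !mxE mulrC; congr (_ * _).
by rewrite (df (0, unit_vec i) q0).2.
Qed.

Lemma small_rad (l : seq (R * R)) : (forall cd, cd \in l -> 0 < cd.2) -> exists2 r : R, 0 < r & forall cd, cd
  \in l -> `|cd.1| * r <= cd.2.
elim: l => [|[c d] l IH] H; first by exists 1.
have [|r r0 Hr] := IH; first by move=> cd cl; apply: H; rewrite inE cl orbT.
have d0 : 0 < d by apply: (H (c, d)); rewrite mem_head. have c0 : 0 < `|c| + 1 by [].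
exists (Num.min r (d / (`|c| + 1))) => [|cd]; first by rewrite lt_min r0 divr_gt0.
rewrite inE => /orP[/eqP -> /=|cl].
 apply: (@le_trans _ _ (`|c| * (d / (`|c| + 1)))).
  by rewrite ler_wpM2l// ge_min lexx orbT.
 by rewrite mulrCA ler_piMr ?(ltW d0)// ler_pdivrMr// mul1r lerDl.
by apply: letr (Hr _ cl); rewrite ler_wpM2l// ge_min lexx.
Qed.

Lemma quad_square A x y : A^T = A -> dot ((x + y) *m A) (x + y) = dot (x *m A) x + 2 * dot (x *m A) y + dot (y
  *m A) y.
move=> AT; rewrite mulmxDl dotDl !dotDr (dot_sym y x AT); ring.
Qed.

Lemma dot_mulmxr b h (J : 'M[R]_n) : dot b (h *m J) = dot (b *m J^T) h. by rewrite /dot trmx_mul mulmxA. Qed.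

(** [h] is the displacement with the drift in time removed; in terms of it only the spatial
    expansion of [psi t0] matters. The pairing with [b] keeps the quadratic term, with an error
    small against [|t - t0| + tau^2]; for the displacement itself first order suffices, as it enters
    only quadratically. [C] must not depend on [e]. *)
Lemma flow_exp (psi : R -> E -> E) t0 y0 c : ndiff 3 (psi t0) -> (forall e : R, 0 < e -> exists2 r : R, 0 < r
  & forall t y, `|t - t0| <= r -> `|y - y0| <= r -> `|psi t y - psi t0 (y - (t - t0) *: c)| <= e * `|t - t0|)
  -> let J := tgrad psi t0 y0 in exists2 C : R, 0 <= C & forall e : R, 0 < e -> e <= 1 -> exists2 r : R, 0 < r
  & forall t y, `|t - t0| <= r -> `|y - y0| <= r -> let h := y - y0 - (t - t0) *: c in let tau := `|h| + `|t -
  t0| in `|psi t y - psi t0 y0 - h *m J| <= e * tau /\ forall b, `|dot b (psi t y - psi t0 y0) - (dot b (h *m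
  J) + dot (h *m (\sum_m b 0 m *: thess psi t0 y0 m)) h / 2)| <= C * `|b| * e * (`|t - t0| + tau ^+ 2).
move=> nd mo J; pose K := `|c|.
have [CH CH0 HCH] : exists2 CH : R, 0 < CH & forall m h, `|dot (h *m thess psi t0 y0 m) h| <= CH * (`|h| *
 `|h|).
 apply: unif_bd => [m C C' CC H h|m].
  by apply: letr (H h) _; rewrite ler_wpM2r// mulr_ge0.
 by have [C _ HC] := quad_bd (thess psi t0 y0 m); exists C => h; exact: HC.
have n0 : 0 <= n%:R :> R by [].
exists (n%:R + n%:R * n%:R) => [|e e0 e1]; first by rewrite addr_ge0// mulr_ge0.
have [r1 r10 H1] := mo e e0; have [r2 r20 H2] := space_taylor y0 nd e0.
have [|r r0 Hr] := @small_rad [:: (1, r1); (1 + K, r2); ((CH + n%:R) * (1 + K), e)].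
 by move=> cd; rewrite !inE => /or3P[] /eqP ->.
have p1 : r <= r1 by have := Hr (1, r1); rewrite mem_head normr1 mul1r; exact.
have K0 : 0 <= 1 + K := addr_ge0 ler01 (normr_ge0 c). have p2 : (1 + K) * r <= r2.
 by have := Hr (1 + K, r2); rewrite !inE eqxx orbT /= (ger0_norm K0); exact.
have p3 : (CH + n%:R) * ((1 + K) * r) <= e.
 have := Hr ((CH + n%:R) * (1 + K), e); rewrite !inE eqxx !orbT /= ger0_norm.
  by rewrite mulrA; exact.
 by pos.
exists r => // t y tr yr h tau. have hr : `|h| <= (1 + K) * r.
 apply: letr (ler_normB _ _) _; rewrite mulrDl mul1r; apply: lerD => //.
 by rewrite normrZ mulrC ler_wpM2l.
pose X := psi t0 (y0 + h) - psi t0 y0; pose Y := psi t y - psi t0 y0.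
have hE : y - (t - t0) *: c = y0 + h by rewrite /h; zmod. have YX : `|Y - X| <= e * `|t - t0|.
 have := H1 t y (letr tr p1) (letr yr p1); rewrite hE. by congr (`|_| <= _); rewrite /Y /X; zmod.
have h2 : 0 <= `|h| ^+ 2 by [].
have XT m : `|X 0 m - ((h *m J) 0 m + dot (h *m thess psi t0 y0 m) h / 2)| <= e * (n%:R * `|h| ^+ 2).
 have := H2 m (y0 + h); have -> : y0 + h - y0 = h by zmod.
 move=> /(_ (letr hr p2)) h3; apply: letr (letr h3 _); last first.
  rewrite ler_wpM2l ?(ltW e0)// expr2; apply: letr (ler_norm _) (dot_bd _ _).
 rewrite le_eqVlt; apply/orP; left; apply/eqP; congr `|_|; rewrite !mxE; ring.
have tau0 : 0 <= tau by pos. split.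
 have -> : psi t y - psi t0 y0 - h *m J = (Y - X) + (X - h *m J) by rewrite /Y; zmod.
 rewrite /tau mulrDr [leRHS]addrC; apply: letr (ler_normD _ _) _; apply: lerD => //.
 have hh : (CH + n%:R) * `|h| <= e.
  by apply: letr p3; rewrite ler_wpM2l// addr_ge0// ltW.
 apply: (@le_trans _ _ ((CH + n%:R) * `|h| * `|h|)); last by rewrite ler_wpM2r.
 apply: row_norm_le => [|m]; first by rewrite !mulr_ge0// addr_ge0// ltW.
 have -> : (X - h *m J) 0 m = X 0 m - ((h *m J) 0 m + dot (h *m thess psi t0 y0 m) h / 2) + dot (h *m thess
  psi t0 y0 m) h / 2 by rewrite [LHS]mxE [X in _ + X]mxE; ring.
 apply: letr (ler_normD _ _) _; rewrite [leLHS]addrC -mulrA mulrDl; apply: lerD.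
  rewrite normrM; apply: letr (_ : _ <= CH * (`|h| * `|h|) * 1) _; last by rewrite mulr1.
  by apply: ler_pM => //; rewrite ger0_norm// invf_le1// ler1n.
 apply: letr (XT m) _; rewrite -expr2; apply: ler_piMl e1. by [].
move=> b.
have bX : dot b (h *m J) + dot (h *m (\sum_m b 0 m *: thess psi t0 y0 m)) h / 2 = \sum_m b 0 m * ((h *m J) 0 m
 + dot (h *m thess psi t0 y0 m) h / 2).
 rewrite [RHS](eq_bigr (fun m => b 0 m * (h *m J) 0 m + b 0 m * (dot (h *m thess psi t0 y0 m) h / 2))); last
  by move=> m _; rewrite mulrDr. rewrite big_split /= -dotE; congr (_ + _).
 rewrite mulmx_sumr /dot mulmx_suml summxE mulr_suml; apply: eq_bigr => m _.
 by rewrite -scalemxAr -scalemxAl [X in X / 2]mxE mulrA.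
rewrite bX -/Y; have -> : dot b Y = dot b (Y - X) + \sum_m b 0 m * X 0 m.
 by rewrite -dotE -dotDr; congr (dot b _); zmod.
rewrite -addrA -sumrB; apply: letr (ler_normD _ _) _.
rewrite mulrDr; have -> : (n%:R + n%:R * n%:R) * `|b| * e * `|t - t0| + (n%:R + n%:R * n%:R) * `|b| * e * tau
 ^+ 2 = n%:R * (`|b| * (e * `|t - t0|)) + n%:R * `|b| * (e * (n%:R * tau ^+ 2)) + (n%:R * n%:R * `|b| * e *
 `|t - t0| + n%:R * `|b| * e * tau ^+ 2) by ring. have e0' := ltW e0.
apply: ler_wpDr; first by rewrite addr_ge0// !mulr_ge0// exprn_ge0.
apply: lerD; first by apply: letr (dot_bd _ _) _; rewrite !ler_wpM2l.
apply: letr (ler_norm_sum _ _ _) _. apply: (@le_trans _ _ (\sum_(m < n) `|b| * (e * (n%:R * tau ^+ 2)))).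
 apply: ler_sum => m _; rewrite -mulrBr normrM; apply: ler_pM => //; first exact: crd_norm_le.
 apply: letr (XT m) _; rewrite ler_wpM2l// ler_wpM2l// lerXn2r ?nnegrE//. by rewrite /tau lerDl.
by rewrite sumr_const card_ord -[leLHS]mulr_natl mulrA.
Qed.

(** Brings the error scale of [flow_exp] back to [gap]: since [d <= 1], the square of a time
    displacement is absorbed by the displacement itself. *)
Lemma gap_tau (K d y2 h2 : R) : 0 <= K -> 0 <= d -> d <= 1 -> 0 <= y2 -> 0 <= h2 -> h2 <= y2 + K * d -> (h2 +
  d) ^+ 2 <= 2 * (1 + K) ^+ 2 * (d + y2 ^+ 2).
move=> K0 d0 d1 y0 h0 hy. have a1 : (h2 + d) ^+ 2 <= (y2 + (1 + K) * d) ^+ 2.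
 have k1 : 0 <= (1 + K) * d by rewrite mulr_ge0// addr_ge0.
 rewrite lerXn2r ?nnegrE ?addr_ge0//; clear - hy; lra.
have a2 : (y2 + (1 + K) * d) ^+ 2 <= 2 * (y2 ^+ 2 + ((1 + K) * d) ^+ 2).
 by have := sqr_ge0 (y2 - (1 + K) * d); move: ((1 + K) * d) => w; rewrite !expr2; clear; nra.
apply: letr a1 (letr a2 _); rewrite -mulrA ler_pM2l//.
have k1 : 1 <= (1 + K) ^+ 2 by apply: exprn_ege1; rewrite lerDl.
have b1 : y2 ^+ 2 <= (1 + K) ^+ 2 * y2 ^+ 2 by rewrite ler_peMl// exprn_ge0.
have b2 : ((1 + K) * d) ^+ 2 <= (1 + K) ^+ 2 * d by rewrite exprMn ler_wpM2l ?exprn_ge0 ?addr_ge0// expr2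
 ler_piMl. by lra.
Qed.

(** As [phi t (psi t y) = y], the jet is evaluated at [psi t y] and expanded by [flow_exp]. The part
    linear in [h] gives [b *m J^T], whose pairing with the drift [c] corrects the time slot; the
    quadratic parts are [J A J^T] and the term from the curvature of [psi]. These are the arguments
    that [transform] hands to [F]. *)
Lemma jets_transport (phi psi : R -> E -> E) (T : R) u t0 y0 c (a : R) b A : open_slab T (t0, y0) -> (forall
  t, 0 <= t <= T -> cancel (psi t) (phi t)) -> ndiff 3 (psi t0) -> (forall e : R, 0 < e -> exists2 r : R, 0 <
  r & forall t y, `|t - t0| <= r -> `|y - y0| <= r -> `|psi t y - psi t0 (y - (t - t0) *: c)| <= e * `|t -
  t0|) -> A^T = A -> superjet (fun q => u (q.1, phi q.1 q.2)) (t0, psi t0 y0) a b A -> let J := tgrad psi t0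
  y0 in superjet u (t0, y0) (a - dot (b *m J^T) c) (b *m J^T) (J *m A *m J^T + \sum_m b 0 m *: thess psi t0 y0
  m).
move=> t0T can nd mo AT Jv J. set b' := b *m J^T; set A' := J *m A *m J^T + _; pose K : R := `|c|.
have A'T : A'^T = A' by exact: tr_sym. have K0 : 0 <= K := normr_ge0 c. have [C C0 HC] := flow_exp nd mo.
have [CA CA0 HCA] := quad_bd A; have [CA' CA'0 HCA'] := quad_bd A'. have [CJ CJ0 HCJ] := mulmx_bd J.
have [rT rT0 HT] := open_slab_near t0T. pose C1 := 2 * (1 + K) ^+ 2. have C10 : 0 <= C1 by pos.
have CJ1 : 0 <= CJ + 1 by pos. pose C2 := CA * CJ + CA / 2 + n%:R * (CJ + 1) ^+ 2. have C20 : 0 <= C2.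
 apply: addr_ge0; last exact: mulr_ge0 (ler0n _ _) (exprn_ge0 _ CJ1). by pos.
(* [Ct] adds up the errors relative to [gap]: those of the linear part, of the drift inside the
   quadratic part, and of the remaining quadratic terms ([C2]). The accuracy [e] is chosen against
   it. *)
pose Ct := C * `|b| * (1 + C1) + 2 + C2 * C1. have Ct0 : 0 <= Ct.
 apply: addr_ge0; last exact: mulr_ge0. apply: addr_ge0 (ler0n _ 2); apply: mulr_ge0; first exact: mulr_ge0.
 by pos.
move=> eta eta0. pose e := Num.min 1 (eta / (Ct + 1)). have [e0 e1 eE] : [/\ 0 < e, e <= 1 & e * Ct <= eta].
 have c0 : 0 < Ct + 1 by rewrite ltr_wpDl. split; [by rewrite lt_min ltr01 divr_gt0|by rewrite ge_min lexx|].
 apply: (@le_trans _ _ (eta / (Ct + 1) * Ct)); first by rewrite ler_wpM2r// ge_min lexx orbT.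
 by rewrite mulrAC -mulrA ler_piMr ?(ltW eta0)// ler_pdivrMr// mul1r lerDl.
have [rJ rJ0 HJ] := Jv e e0; have [r1 r10 H1] := HC e e0 e1.
have [|r r0 Hr] := @small_rad [:: (1, 1); (1, r1); (1, rT); (1, rJ); ((CJ + 1) * (2 + K), rJ); (CA' * K * (1 +
 K), e)].
 by move=> cd; rewrite !inE => /orP[|/orP[|/orP[|/orP[|/orP[|]]]]] /eqP ->.
have [p1 p2 p3 p4] : [/\ r <= 1, r <= r1, r <= rT & r <= rJ].
 by split; [have := Hr (1, 1)|have := Hr (1, r1)|have := Hr (1, rT)|have := Hr (1, rJ)]; rewrite !inE eqxx
  ?orbT /= normr1 mul1r; exact.
have p5 : (CJ + 1) * ((2 + K) * r) <= rJ.
 have := Hr ((CJ + 1) * (2 + K), rJ); rewrite !inE eqxx !orbT /= ger0_norm.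
  by rewrite mulrA; exact.
 by pos.
have p6 : CA' * K * (1 + K) * r <= e.
 have := Hr (CA' * K * (1 + K), e); rewrite !inE eqxx !orbT /= ger0_norm; first exact. by pos.
exists r => // -[t y] qr. have [tr yr] : `|t - t0| <= r /\ `|y - y0| <= r.
 split; apply: letr qr; first by have := fst_bd ((t, y) - (t0, y0)); rewrite mul1r.
 by have := snd_bd ((t, y) - (t0, y0)); rewrite mul1r.
have tT : 0 <= t <= T by have /andP[/ltW -> /ltW ->] := HT (t, y) (letr qr p3).
have t0T' : 0 <= t0 <= T by have /andP[/ltW /= -> /ltW ->] := t0T.
have [] := H1 t y (letr tr p2) (letr yr p2).
set h := y - y0 - (t - t0) *: c; set d : R := `|t - t0|; set tau := `|h| + d.
set Y := psi t y - psi t0 y0; set W := Y - h *m J => hW /(_ b) hb. have d0 : 0 <= d by exact: normr_ge0. have d1 : d <= 1 by exact: letr tr p1.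
have hd : `|h| <= `|y - y0| + K * d.
 by apply: letr (ler_normB _ _) _; rewrite lerD2l normrZ mulrC.
have tau0 : 0 <= tau by pos. have taur : tau <= (2 + K) * r.
 rewrite /tau; have : K * d <= K * r by rewrite ler_wpM2l. rewrite -/d in tr; clear - hd tr yr; lra.
have YE : Y = h *m J + W by rewrite /W; zmod. have hJ : `|h *m J| <= CJ * tau.
 by apply: letr (HCJ h) _; rewrite ler_wpM2l// /tau lerDl.
have eW : `|W| <= tau by apply: letr hW _; rewrite ler_piMl. have YB : `|Y| <= (CJ + 1) * tau.
 by rewrite YE mulrDl mul1r; apply: letr (ler_normD _ _) _; exact: lerD.
have near : `|((t, psi t y) : R * E) - (t0, psi t0 y0)| <= rJ.
 apply: pair_norm_le; first exact: letr tr p4. by apply: letr YB (letr _ p5); rewrite ler_wpM2l.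
have := HJ (t, psi t y) near; rewrite /= (can t tT) (can t0 t0T') /jetpoly /gap /=.
rewrite -/Y -/h !mul0r !addr0 -/d => Hu; apply: letr Hu _. have tau2 : 0 <= tau ^+ 2 by pos.
have t1 : dot b Y <= dot b' h + dot (h *m (\sum_m b 0 m *: thess psi t0 y0 m)) h / 2 + C * `|b| * e * (d + tau
 ^+ 2).
 by move: hb; rewrite dot_mulmxr -/b' ler_norml => /andP[_ h3]; clear - h3; lra.
have t2 : dot (Y *m A) Y <= dot (h *m (J *m A *m J^T)) h + e * (2 * (CA * CJ) + CA) * tau ^+ 2.
 rewrite YE quad_square//.
 have -> : dot (h *m J *m A) (h *m J) = dot (h *m (J *m A *m J^T)) h by rewrite dot_mulmxr !mulmxA.
 have q1 : dot (h *m J *m A) W <= CA * (CJ * tau * (e * tau)).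
  apply: letr (letr (ler_norm _) (HCA _ _)) _; rewrite ler_wpM2l//. by apply: ler_pM.
 have q2 : dot (W *m A) W <= CA * (tau * (e * tau)).
  apply: letr (letr (ler_norm _) (HCA _ _)) _; rewrite ler_wpM2l//. by apply: ler_pM.
 have -> : e * (2 * (CA * CJ) + CA) * tau ^+ 2 = 2 * (CA * (CJ * tau * (e * tau))) + CA * (tau * (e * tau))
  by rewrite expr2; ring. by clear - q1 q2; lra.
have t3 : dot Y Y <= n%:R * (CJ + 1) ^+ 2 * tau ^+ 2.
 apply: letr (letr (ler_norm _) (dot_bd _ _)) _; rewrite -mulrA ler_wpM2l// -exprMn expr2.
 by apply: ler_pM.
have t4 : dot (h *m A') h <= dot ((y - y0) *m A') (y - y0) + 2 * e * d.
 rewrite /h quad_square// -scaleNr. have q1 : dot ((y - y0) *m A') (- (t - t0) *: c) <= CA' * (r * (d * K)).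
  apply: letr (letr (ler_norm _) (HCA' _ _)) _; rewrite ler_wpM2l//.
  by apply: ler_pM => //; rewrite normrZ normrN.
 have q2 : dot ((- (t - t0) *: c) *m A') (- (t - t0) *: c) <= CA' * (d * K * (r * K)).
  apply: letr (letr (ler_norm _) (HCA' _ _)) _; rewrite ler_wpM2l//.
  by apply: ler_pM => //; rewrite normrZ normrN// ler_wpM2r.
 have q3 : CA' * K * (1 + K) * r * d <= e * d by rewrite ler_wpM2r.
 have q4 : 0 <= CA' * (d * K * (r * K)) by rewrite !mulr_ge0// ltW.
 have q5 : CA' * K * (1 + K) * r * d = CA' * (r * (d * K)) + CA' * (d * K * (r * K)) by ring.
 by clear - q1 q2 q3 q4 q5; lra.
have A'E : dot (h *m A') h = dot (h *m (J *m A *m J^T)) h + dot (h *m (\sum_m b 0 m *: thess psi t0 y0 m)) h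
 by rewrite /A' mulmxDr dotDl.
have b'E : dot b' h = dot b' (y - y0) - (t - t0) * dot b' c by rewrite /h -scaleNr dotDr dotZr mulNr.
have tg : tau ^+ 2 <= C1 * (d + dot (y - y0) (y - y0)).
 apply: letr (gap_tau K0 d0 d1 (normr_ge0 (y - y0)) (normr_ge0 h) hd) _.
 by rewrite ler_wpM2l// lerD2l norm_sqr_le.
set g := d + dot (y - y0) (y - y0) in tg *. have dg : d <= g by rewrite lerDl dot_ge0.
have fin : e * (C * `|b| * (d + tau ^+ 2) + 2 * d + C2 * tau ^+ 2) <= eta * g.
 have g0 : 0 <= g by exact: letr d0 dg.
 apply: letr (_ : _ <= e * (Ct * g)) _; last by rewrite mulrA ler_wpM2r.
 have -> : Ct * g = C * `|b| * (g + C1 * g) + 2 * g + C2 * (C1 * g) by rewrite /Ct; ring.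
 apply: ler_wpM2l; first exact: ltW. apply: lerD; last exact: ler_wpM2l. apply: lerD; last exact: ler_wpM2l.
 by apply: ler_wpM2l; [exact: mulr_ge0|exact: lerD].
have cbe0 : 0 <= e * (n%:R * (CJ + 1) ^+ 2 * tau ^+ 2) by rewrite mulr_ge0 ?(ltW e0)// mulr_ge0// mulr_ge0//
 exprn_ge0. have t3' : e * dot Y Y <= e * (n%:R * (CJ + 1) ^+ 2 * tau ^+ 2) by rewrite ler_wpM2l// ltW.
have finE : e * (C * `|b| * (d + tau ^+ 2) + 2 * d + C2 * tau ^+ 2) = C * `|b| * e * (d + tau ^+ 2) + 2 * e *
 d + e * (2 * (CA * CJ) + CA) * tau ^+ 2 / 2 + e * (n%:R * (CJ + 1) ^+ 2 * tau ^+ 2) by rewrite /C2; field.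
rewrite finE in fin; rewrite A'E in t4; rewrite b'E in t1.
have tE : (a - dot b' c) * (t - t0) = a * (t - t0) - (t - t0) * dot b' c by ring.
rewrite tE mulrDr; move: t1 t2 t3' t4 fin. clear; lra.
Qed.

End change_of_variables.

(** * Uniform convergence on compact sets *)

Section unif_fams.
Context {R : realType}.

Lemma fam_cvg_intro (U : choiceType) (fam : set U -> Prop) (FF : set_system (U -> R)) (f : U -> R) : Filter FF
  -> (forall K, fam K -> forall e : R, 0 < e -> FF [set h | forall x, K x -> `|h x - f x| <= e]) -> {family
  fam, FF --> f}.
move=> FFF H; apply/(fam_cvgP _ _ FFF) => K famK P /uniform_nbhs[B [entB subP]].
move: entB; rewrite -entourage_ballE => -[e /= e0 eB].
apply: filterS (H K famK (e / 2) (divr_gt0 e0 (ltr0n _ 2))) => h Hh; apply: subP => y Ky.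
apply: eB; rewrite /= -ball_normE /= distrC; apply: le_lt_trans (Hh y Ky) _. by lra.
Qed.

Lemma fam_cvg_elim (U : choiceType) (fam : set U -> Prop) (FF : set_system (U -> R)) (f : U -> R) K (e : R) :
  {family fam, FF --> f} -> fam K -> 0 < e -> FF [set h | forall x, K x -> `|f x - h x| < e].
move=> H famK e0; apply: H.
have := @fam_nbhs U R fam K [set xy : R * R | ball xy.1 e xy.2] f (entourage_ball _ (PosNum e0)) famK. by [].
Qed.

Context {n : nat}.
Local Notation E := 'rV[R]_n.

(** The sets [U j] play the role of a countable base of the filter: a failure of the local estimate
    at a point would give indices in [U j] and points contradicting the sequential hypothesis.
    Compactness then patches the local estimates. *)
Lemma compact_cvg (I : Type) (FF : set_system I) (U : nat -> set I) (D : set (R * E)) (phi : I -> R * E -> R)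
  (s : R * E -> R) : Filter FF -> (forall j, FF (U j)) -> {within D, continuous s} -> (forall (i : nat -> I)
  (qk : nat -> R * E) q, (forall j, U j (i j)) -> (forall j, D (qk j)) -> D q -> qk @ \oo --> q -> phi (i j)
  (qk j) @[j --> \oo] --> s q) -> forall K, compactly_in D K -> forall e : R, 0 < e -> FF [set i | forall q, K
  q -> `|phi i q - s q| <= e].
move=> FFF FU sc H K [KD cK] e e0. pose P i q := D q -> `|phi i q - s q| <= e.
suff : FF [set i | K `<=` P i] by apply: filterS => i Hi q Kq; apply: (Hi q Kq); exact: KD.
apply: ((compact_near_coveringP _).1 cK I FF P FFF) => q Kq.
 have Dq := KD q Kq.
 have [j jP] : exists j, forall i q', U j i -> D q' -> `|q' - q| <= j.+1%:R^-1 -> `|phi i q' - s q'| <= e.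
  apply: contrapT => nE.
  have pick (j : nat) : exists iq : I * (R * E), [/\ U j iq.1, D iq.2, `|iq.2 - q| <= j.+1%:R^-1 & ~ `|phi
   iq.1 iq.2 - s iq.2| <= e].
   apply: contrapT => nE'; apply: nE; exists j => i q' Ui Dq' qq.
   by apply: contrapT => nP; apply: nE'; exists (i, q').
  have [iq Hiq] := choice pick. have qc : (iq j).2 @[j --> \oo] --> q.
   apply/cvgrPdist_le => d d0; have [k0 _ Hk0] := near_infty_natSinv_lt (PosNum d0).
   exists k0 => // k /= kk; rewrite distrC; have [_ _ h _] := Hiq k.
   by apply: letr h _; apply: ltW; exact: Hk0.
  have DD j : D (iq j).2 by have [] := Hiq j. have UU j : U j (iq j).1 by have [] := Hiq j.
  have c1 := H (fun j => (iq j).1) (fun j => (iq j).2) q UU DD Dq qc. have c2 := within_seq sc DD Dq qc.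
  have c3 : phi (iq j).1 (iq j).2 - s (iq j).2 @[j --> \oo] --> s q - s q by exact: cvgB.
  rewrite subrr in c3; move/cvgrPdist_le: c3 => /(_ e e0)[k _ /(_ k (leqnn k))].
  by rewrite sub0r normrN => h; have [_ _ _] := Hiq k.
 exists ([set y | `|y - q| <= j.+1%:R^-1], U j) => /=.
  split; last exact: FU. by apply: (near_rad (r := j.+1%:R^-1)) => [|y]; [rewrite invr_gt0|exact: ltW].
by move=> [q' i] /= [h1 h2] Dq'; exact: jP.
Qed.

End unif_fams.

(** * The transformed equation along rough paths *)

Section transformed_solutions.
Context {R : realType} {n d M : nat} (T p al : R).
Context (T0 : 0 < T) (p1 : 1 <= p) (al01 : 0 < al <= 1) (pN : p < M.+1%:R + al).
Context (hM : Num.truncn p = M.+1).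
Local Notation N := (Num.truncn p).
Local Notation E := 'rV[R]_n.
Local Notation rpath := (@rpath R d T p).
Local Notation rpath_cvg := (@rpath_cvg R d T p).
Context (V : 'I_d -> E -> E) (HV : forall i, hcl al M.+3 (fun=> 0) (V i)).
Context (F : generator R n) (Fc : continuous_generator T F) (cmp : invariant_comparison 3 T F).
Local Notation fwd := (fwd_flow hM V).
Local Notation bwd := (bwd_flow T hM V).
Implicit Types (x : R -> tensor R d N) (q : R * E) (u : R * E -> R).

Let rflow x (rx : rpath x) := rough_flow T0 p1 al01 pN hM HV rx.

Lemma rough_flows_cvg (xk : nat -> R -> tensor R d N) x : (forall k, rpath (xk k)) -> rpath x -> rpath_cvg xk
  x -> flows_cvg T (fun k => fwd (xk k)) (fun k => bwd (xk k)) (fwd x) (bwd x).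
move=> rk rx kx m tk t yk y vs mk tT tT' tc yc vs3.
apply: (rough_flow_seq T0 p1 al01 pN hM HV (fun k => rk (m k)) rx _ tT tT' tc yc vs3).
move=> e e0; have [k0 Hk0] := kx e e0; exists k0 => k kk; apply: Hk0. exact: leq_trans kk (mk k).
Qed.

Lemma slab_closed q : slab T q -> 0 <= q.1 <= T. by move=> /andP[-> /ltW]. Qed.

Definition pull (f : R -> E -> E) (u : R * E -> R) q := u (q.1, f q.1 q.2).

Lemma pull_seq (xk : nat -> R -> tensor R d N) x (m : nat -> nat) (qk : nat -> R * E) q : (forall k, rpath (xk
  k)) -> rpath x -> rpath_cvg xk x -> (forall k, (k <= m k)%N) -> (forall k, slab T (qk k)) -> slab T q -> qk
  @ \oo --> q -> ((qk k).1, fwd (xk (m k)) (qk k).1 (qk k).2) @[k --> \oo] --> ((q.1, fwd x q.1 q.2) : R * E)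
  /\ ((qk k).1, bwd (xk (m k)) (qk k).1 (qk k).2) @[k --> \oo] --> ((q.1, bwd x q.1 q.2) : R * E).
move=> rk rx kx mk qT q0T qc; have [c1 c2] := cvg_components qc.
have [h1 h2] := @rough_flows_cvg xk x rk rx kx m _ _ _ _ [::] mk (fun k => slab_closed (qT k)) (slab_closed
 q0T) c1 c2 isT. by split; exact: pair_cvg.
Qed.

Lemma pull_cont x u : rpath x -> {within slab T, continuous u} -> {within slab T, continuous (pull (fwd x) u)}
  /\ {within slab T, continuous (pull (bwd x) u)}.
move=> rx uc; split; apply: sequential_within => qk q qT q0T qc.
 have [h _] := pull_seq (fun=> rx) rx (@cstant_cvg R d T p x) (fun k => leqnn k) qT q0T qc.
 by have := within_seq (u := fun k => ((qk k).1, fwd x (qk k).1 (qk k).2)) (x := (q.1, fwd x q.1 q.2)) uc;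
  apply.
have [_ h] := pull_seq (fun=> rx) rx (@cstant_cvg R d T p x) (fun k => leqnn k) qT q0T qc.
by have := within_seq (u := fun k => ((qk k).1, bwd x (qk k).1 (qk k).2)) (x := (q.1, bwd x q.1 q.2)) uc;
 apply.
Qed.

Lemma usc_cont u : {within slab T, continuous u} -> usc_on (slab T) u. by move=> /cstant_rlx; exact: up_rlx_usc. Qed.

Lemma transported_jet (z : R -> 'rV[R]_d) u q (a : R) b (A : 'M[R]_n) : smooth_path T z -> open_slab T q ->
  A^T = A -> superjet (pull (fwd (signature N z 0)) u) q a b A -> let f := fwd (signature N z 0) in let g :=
  bwd (signature N z 0) in let y := f q.1 q.2 in let J := tgrad g q.1 y in superjet u (q.1, y) (a - \sum_i
  (\sum_m (b *m J^T) 0 m * V i y 0 m) * derive1 (fun r => z r 0 i) q.1) (b *m J^T) (J *m A *m J^T + \sum_m b 0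
  m *: thess g q.1 y m).
move=> sz qT AT Ju f g y J; have rx : rpath (signature N z 0) := rpath_smth p T0 sz.
have [can _ _ [nd _ _]] := rflow rx. have qT' : 0 <= q.1 <= T by have /andP[/ltW -> /ltW ->] := qT.
have cE : dot (b *m J^T) (\sum_i velocity z q.1 i *: V i y) = \sum_i (\sum_m (b *m J^T) 0 m * V i y 0 m) *
 derive1 (fun r => z r 0 i) q.1.
 rewrite dotC /dot mulmx_suml summxE; apply: eq_bigr => i _. by rewrite -/(dot _ _) dotZl dotC dotE mulrC.
have gE : g q.1 y = q.2 by exact: (can _ qT').1.
have Ju' : superjet (fun q => u (q.1, f q.1 q.2)) (q.1, g q.1 y) a b A by rewrite gE -surjective_pairing.
rewrite -cE; apply: (jets_transport (phi := f) (qT : open_slab T (q.1, y)) (fun t tT => (can t tT).2) (nd _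
 qT') _ AT Ju') => e e0. exact: (bwd_motion T0 p1 al01 pN hM HV y sz qT e0).
Qed.

(** [transported_jet] carries superjets of the pulled-back function to superjets of [u]; the
    correction of the time slot is exactly the transport term of [driven], and what remains is
    [transform]. The other half is the same argument for [- u] and [dual]. *)
Lemma tred_sol (z : R -> 'rV[R]_d) u : smooth_path T z -> {within slab T, continuous u} -> solution T (driven
  F V z) u -> solution T (transform F (fwd (signature N z 0)) (bwd (signature N z 0))) (pull (fwd (signature N
  z 0)) u).
move=> sz uc [usub usup]; have rx : rpath (signature N z 0) := rpath_smth p T0 sz.
have [pc _] := pull_cont rx uc. have Vc i : continuous (V i).
 by move=> y; apply: differentiable_continuous; exact: hclass_diff (HV i) y.
have conv := driven_cvg Fc Vc sz.
have uc' : {within slab T, continuous (fun q => - u q)} by move=> q; apply: cvgN; exact: uc.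
have pc' : {within slab T, continuous (fun q => - pull (fwd (signature N z 0)) u q)}.
 by move=> q; apply: cvgN; exact: pc.
split.
 apply: jet_subsol_sub; first exact: usc_cont. move=> q a b A qT AT Ju; have := transported_jet sz qT AT Ju.
 have ju := rlx_jet_subsol (fun=> uc) (fun=> subsol_poly usub) (cstant_rlx uc) conv.
 set f := fwd _ in Ju *; set g := bwd _; pose J := tgrad g q.1 (f q.1 q.2) => /= J'.
 have nd : ndiff 3 (g q.1).
  by have [_ _ _ [nd _ _]] := rflow rx; apply: nd; have /andP[/ltW -> /ltW ->] := qT.
 have qT' : open_slab T (q.1, f q.1 q.2) by []. have := ju _ _ _ _ qT' (tr_sym _ _ nd AT) J'.
 by rewrite transformE /driven /= lerD2r.
apply: jet_subsol_super; first exact: usc_cont.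
move=> q a b A qT AT Ju; have := @transported_jet z (fun q => - u q) q a b A sz qT AT Ju.
have ju := rlx_jet_subsol (fun=> uc') (fun=> supersol_poly usup) (cstant_rlx uc') (dual_cvg conv).
set f := fwd _ in Ju *; set g := bwd _; pose J := tgrad g q.1 (f q.1 q.2) => /= J'. have nd : ndiff 3 (g q.1).
 by have [_ _ _ [nd _ _]] := rflow rx; apply: nd; have /andP[/ltW -> /ltW ->] := qT.
have qT' : open_slab T (q.1, f q.1 q.2) by []. have := ju _ _ _ _ qT' (tr_sym _ _ nd AT) J'.
rewrite /dual transformE /driven /= -/f -/g -/J => h. have E1 : - b *m J^T = - (b *m J^T) by rewrite mulNmx.
have E2 : J *m - A *m J^T + \sum_m (- b) 0 m *: thess g q.1 (f q.1 q.2) m = - (J *m A *m J^T + \sum_m b 0 m *: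
 thess g q.1 (f q.1 q.2) m).
 rewrite mulmxN mulNmx opprD -sumrN; congr (_ + _); apply: eq_bigr => m _. by rewrite mxE scaleNr.
rewrite E1 E2; move: h; rewrite opprB.
have -> : \sum_i (\sum_m (- (b *m J^T)) 0 m * V i (f q.1 q.2) 0 m) * derive1 (fun r => z r 0 i) q.1 = - \sum_i
 (\sum_m (b *m J^T) 0 m * V i (f q.1 q.2) 0 m) * derive1 (fun r => z r 0 i) q.1.
 rewrite -sumrN; apply: eq_bigr => i _; rewrite -mulNr -sumrN; congr (_ * _).
 by apply: eq_bigr => m _; rewrite [in LHS]mxE mulNr.
by lra.
Qed.

Definition rough_sol x (u0 : E -> R) (C : R) w := cont_sol T (transform F (fwd x) (bwd x)) u0 C w.

Lemma bd_of u (D : set (R * E)) (C : R) : (forall q, D q -> `|u q| <= C) -> [bounded u q | q in D].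
move=> uC; exists C; split; first exact: num_real. by move=> C' CC q qT; apply: letr (uC q qT) (ltW CC).
Qed.

Lemma subsol_shift G u (c : R) : supersolution T G u -> supersolution T G (fun q => u q + c).
move=> [ul us]; split=> [q a|phi q sphi qT loc].
 rewrite lte_fin -ltrBlDr => h; have [W Wq HW] := ul q (a - c) h.
 by exists W => // y Wy; have := HW y Wy; rewrite !lte_fin ltrBlDr.
apply: us => //; apply: filterS loc => q'; rewrite addrAC [leRHS]addrAC lerD2r//.
Qed.

(** A constant may be added to a supersolution because the generators do not see the value of the
    solution. *)
Lemma rough_sol_contr x (u0 v0 : E -> R) (C C' c : R) (w w' : R * E -> R) : rpath x -> rough_sol x u0 C w ->
  rough_sol x v0 C' w' -> (forall y : E, u0 y <= v0 y + c) -> forall q, slab T q -> w q <= w' q + c.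
move=> rx [wc wC [wsub _] wi] [wc' wC' [_ wsup'] wi'] uv q qT.
apply: (cmp (rflow rx) (u := w) (v := fun q => w' q + c)) => //.
- exact: bd_of wC.
- apply: (bd_of (C := C' + `|c|)) => q' q'T. by apply: letr (ler_normD _ _) _; rewrite lerD2r; exact: wC'.
- exact: subsol_shift.
- by move=> y; rewrite wi wi'.
Qed.

Lemma rough_sol_unique x (u0 : E -> R) (C C' : R) (w w' : R * E -> R) : rpath x -> rough_sol x u0 C w ->
  rough_sol x u0 C' w' -> forall q, slab T q -> w q = w' q.
move=> rx sw sw' q qT; have h (y : E) : u0 y <= u0 y + 0 by rewrite addr0.
have := rough_sol_contr rx sw sw' h qT; have := rough_sol_contr rx sw' sw h qT. by lra.
Qed.

(** Stability holds for the transformed equation; composition with the convergent inverse flows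
    brings the convergence back to the original coordinates. *)
Lemma rough_stability (xk : nat -> R -> tensor R d N) x (vk : nat -> R * E -> R) (wk : nat -> E -> R) (u0 : E
  -> R) (C : R) : (forall k, rpath (xk k)) -> rpath x -> rpath_cvg xk x -> (forall k, rough_sol (xk k) (wk k)
  C (vk k)) -> (forall (y : E) (e : R), 0 < e -> exists m : nat, exists2 r : R, 0 < r & forall k (y' : E), (m
  <= k)%N -> `|y' - y| <= r -> `|wk k y' - u0 y| <= e) -> exists2 w : R * E -> R, rough_sol x u0 C w & forall
  (qk : nat -> R * E) q, (forall k, slab T (qk k)) -> slab T q -> qk @ \oo --> q -> pull (bwd (xk k)) (vk k)
  (qk k) @[k --> \oo] --> pull (bwd x) w q.
move=> rk rx kx sk wu. have GG := tr_cvg Fc (fun k => rflow (rk k)) (rflow rx) (rough_flows_cvg rk rx kx).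
have [|w [sw lw]] := stable_sol T0 cmp (rflow rx) (fun k => let: And4 h _ _ _ := sk k in h) (fun k => let:
 And4 _ h _ _ := sk k in h) (fun k => let: And4 _ _ h _ := sk k in h) GG (u0 := u0).
 move=> y e e0; have [m [r r0 Hr]] := wu y e e0; exists m, r => // k y' mk yr.
 by have [_ _ _ ->] := sk k; exact: Hr.
exists w => // qk q qT q0T qc; apply/cvgrPdist_le => e e0.
have [_ pc] := pull_seq rk rx kx (fun k => leqnn k) qT q0T qc. have qT' : slab T (q.1, bwd x q.1 q.2) by [].
have [m [r r0 Hr]] := lw _ qT' e e0. near=> k; rewrite distrC; apply: Hr => //.
- by near: k; exact: nbhs_infty_ge.
- exact: qT.
- by rewrite distrC; near: k; move/cvgrPdist_le: pc => /(_ r r0).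
Unshelve. all: by end_near. Qed.

End transformed_solutions.

Lemma BUC_cont (R : realType) (U : normedModType R) (f : U -> R) : BUC f -> continuous f.
move=> [_ uf] x; apply/cvgrPdist_lt => e e0.
have := uf _ (entourage_ball (R : pseudoMetricType R) (PosNum e0)).
by rewrite /nbhs /= -entourage_ballE => -[d /= d0 H]; apply/nbhs_ballP; exists d => // y xy; apply: (H (x,
 y)).
Qed.

(** * The limit and the solution map *)

Section limit_solution.
Context {R : realType} {n d M : nat} (T p al : R).
Context (T0 : 0 < T) (p1 : 1 <= p) (al01 : 0 < al <= 1) (pN : p < M.+1%:R + al).
Context (hM : Num.truncn p = M.+1).
Local Notation N := (Num.truncn p).
Local Notation E := 'rV[R]_n.
Local Notation rpath := (@rpath R d T p).
Local Notation rpath_cvg := (@rpath_cvg R d T p).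
Context (V : 'I_d -> E -> E) (HV : forall i, hcl al M.+3 (fun=> 0) (V i)).
Context (F : generator R n) (Fc : continuous_generator T F) (cmp : invariant_comparison 3 T F).
Local Notation fwd := (fwd_flow hM V).
Local Notation bwd := (bwd_flow T hM V).
Local Notation rough_sol := (rough_sol T hM V F).

Let rflow x (rx : rpath x) := rough_flow T0 p1 al01 pN hM HV rx.

(** Data of quality [j]: close in rough path distance, and close in initial value on the ball of
    radius [j]. Solutions of the smooth equations and values of the solution map at neighbouring
    data are both of this kind, so convergence and continuity share one proof. *)
Definition approximant (x : R -> tensor R d N) (u0 : E -> R) (C : R) (j : nat) (X : R -> tensor R d N) (g : E
  -> R) (phi : R * E -> R) := [/\ rpath X, (pvar_dist T (increment X) (increment x) < (j.+1%:R^-1)%:E)%E,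
  forall y, `|y| <= j%:R -> `|g y - u0 y| <= j.+1%:R^-1 & exists2 v, rough_sol X g C v & {in slab T, phi =1
  pull (bwd X) v}].

Lemma apx_cvg (x : R -> tensor R d N) (u0 : E -> R) (C : R) : rpath x -> continuous u0 -> forall (X : nat -> R
  -> tensor R d N) (g : nat -> E -> R) (phi : nat -> R * E -> R), (forall j, approximant x u0 C j (X j) (g j)
  (phi j)) -> exists2 w : R * E -> R, rough_sol x u0 C w & forall (qk : nat -> R * E) q, (forall k, slab T (qk
  k)) -> slab T q -> qk @ \oo --> q -> phi k (qk k) @[k --> \oo] --> pull (bwd x) w q.
move=> rx uc X g phi H. have small (e : R) : 0 < e -> exists k0, forall k, (k0 <= k)%N -> k.+1%:R^-1 < e.
 by move=> e0; have [k0 _ Hk0] := near_infty_natSinv_lt (PosNum e0); exists k0.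
have rk k : rpath (X k) by have [] := H k. have kx : rpath_cvg X x.
 move=> e e0; have [k0 Hk0] := small e e0; exists k0 => k kk; have [_ h _ _] := H k.
 by apply: lt_trans h _; rewrite lte_fin; exact: Hk0.
have [v Hv] : exists v : nat -> R * E -> R, forall k, rough_sol (X k) (g k) C (v k) /\ {in slab T, phi k =1
 pull (bwd (X k)) (v k)}.
 suff /choice[v Hv] : forall k, exists v, rough_sol (X k) (g k) C v /\ {in slab T, phi k =1 pull (bwd (X k))
  v} by exists v. by move=> k; have [_ _ _ [v h1 h2]] := H k; exists v.
have gc (y : E) (e : R) : 0 < e -> exists m : nat, exists2 r : R, 0 < r & forall k (y' : E), (m <= k)%N ->
 `|y' - y| <= r -> `|g k y' - u0 y| <= e.
 move=> e0; have e2 : 0 < e / 2 by rewrite divr_gt0.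
 have /cvgrPdist_le/(_ _ e2)/nbhs_normP[r /= r0 Hr] := uc y.
 have [k0 Hk0] := small _ e2; pose m := maxn k0 (Num.truncn (`|y| + 1)).+1.
 exists m, (Num.min (r / 2) 1); first by rewrite lt_min ltr01 divr_gt0.
 move=> k y' mk; rewrite le_min => /andP[yr y1]. have kr : `|y| + 1 <= k%:R.
  apply: ltW; apply: lt_le_trans (truncnS_gt _) _; rewrite ler_nat. by apply: leq_trans mk; exact: leq_maxr.
 have [_ _ h _] := H k; have yk : `|y'| <= k%:R.
  by apply: letr kr; rewrite -lerBlDl; apply: letr y1; exact: lerB_dist.
 have h1 := h _ yk; have h2 := Hk0 k (leq_trans (leq_maxl _ _) mk). have h3 : `|u0 y' - u0 y| <= e / 2.
  rewrite distrC; apply: Hr; rewrite /= distrC; apply: le_lt_trans yr _.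
  by rewrite ltr_pdivrMr// ltr_pMr// ltr1n.
 apply: letr (ler_distD (u0 y') _ _) _; rewrite [e]splitr. exact: lerD (letr h1 (ltW h2)) h3.
have [w sw cw] := rough_stability T0 p1 al01 pN HV Fc cmp rk rx kx (fun k => (Hv k).1) gc.
exists w => // qk q qT q0T qc. have -> : (fun k => phi k (qk k)) = (fun k => pull (bwd (X k)) (v k) (qk k)).
 by apply/funext => k; apply: (Hv k).2; rewrite inE; exact: qT.
exact: cw.
Qed.

(** The limit is found along one sequence of approximants and identified along all others by
    uniqueness. *)
Lemma local_cvg (I : Type) (FF : set_system I) (X : I -> R -> tensor R d N) (g : I -> E -> R) (phi : I -> R *
  E -> R) (x : R -> tensor R d N) (u0 : E -> R) (C : R) : Filter FF -> rpath x -> continuous u0 -> (forall j,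
  FF [set i | approximant x u0 C j (X i) (g i) (phi i)]) -> (forall j, exists i, approximant x u0 C j (X i) (g
  i) (phi i)) -> exists2 w : R * E -> R, rough_sol x u0 C w & forall K, compactly_in (slab T) K -> forall e :
  R, 0 < e -> FF [set i | forall q, K q -> `|phi i q - pull (bwd x) w q| <= e].
move=> FFF rx uc FU /choice[i Hi]. have [w sw _] := apx_cvg rx uc Hi. exists w => // K cK e e0.
apply: (compact_cvg (s := pull (bwd x) w) (D := slab T) FFF FU _ _ cK e0).
 by have [wc _ _ _] := sw; have [_ h] := pull_cont T0 p1 al01 pN hM HV rx wc; exact: h.
move=> ik qk q Hik qT q0T qc. have [w' sw' cw'] := apx_cvg rx uc Hik.
have -> : pull (bwd x) w q = pull (bwd x) w' q by exact: (rough_sol_unique T0 p1 al01 pN HV cmp rx sw sw').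
exact: cw'.
Qed.

(** The transformed equation has at most one solution on the slab, so the choice by [xget] is
    harmless there and involves the path and the initial value only. Where there is no solution the
    value is 0. *)
Definition lim_map (a : rough_path d T p * (E -> R)) : R * E -> R := pull (bwd a.1) (xget (fun=> 0) [set w |
  exists C, rough_sol a.1 a.2 C w]).

Lemma lim_map_sol (Z : rough_path d T p) (u0 : E -> R) (C : R) (w : R * E -> R) : rough_sol Z u0 C w -> forall
  q, slab T q -> lim_map (Z, u0) q = pull (bwd Z) w q.
move=> sw q qT; rewrite /lim_map /=.
set w' := xget _ _; have [C' sw'] : [set w | exists C, rough_sol Z u0 C w] w'.
 by apply: (xgetPex (fun=> 0)); exists w, C.
exact: (rough_sol_unique T0 p1 al01 pN HV cmp (rpath_rough Z) sw' sw).
Qed.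

(** For small [e] the smooth data are approximants of any given quality [j], since [tred_sol] makes
    the pulled-back [w e] a solution of the transformed equation; the flow starts at the identity,
    so initial values are unchanged. *)
Lemma approx_lim (Z : rough_path d T p) (u0 : E -> R) z w0 (w : R -> R * E -> R) : approx_data F V Z u0 z w0 w
  -> exists C : R, (exists w', rough_sol Z u0 C w') /\ {family compactly_in (slab T), w @ 0^'+ --> lim_map (Z,
  u0)}.
move=> [[sz cz] [[ub uu] _] c0 sol [C HC]]. pose X e := signature N (z e) 0. have rZ := rpath_rough Z.
have uc := BUC_cont (conj ub uu). have FU j : 0^'+ [set e | approximant Z u0 C j (X e) (w0 e) (w e)].
 have j0 : 0 < j.+1%:R^-1 :> R by rewrite invr_gt0.
 near=> e; have e0 : 0 < e by near: e; exact: nbhs_right_gt.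
 have [[wb wc] ws wi] := sol e e0; have sze := sz e e0; have rX : rpath (X e) := rpath_smth p T0 sze.
 have [can id0 _ _] := rflow rX. split => //.
 - rewrite -(eq_pvar_dist (X := signature N (z e)) (Y := increment Z))//.
   near: e. have : nbhs (0%E : \bar R) [set y | (y < (j.+1%:R^-1)%:E)%E].
    by apply: open_nbhs_nbhs; split; [exact: open_ereal_lt_ereal|rewrite /= lte_fin].
   by move=> /cz.
  by move=> s t s0 /ltW st tT; exact: sig_chen sze s0 st tT.
 - move=> y yj; rewrite distrC; apply: ltW. have : [set y : E | `|y - 0| <= j%:R] y by rewrite /= subr0.
  move: y {yj}; near: e; apply: (fam_cvg_elim c0) => //; exact: compact_closed_ball.
 - exists (pull (fwd (X e)) (w e)).
   split.
   + exact: (pull_cont T0 p1 al01 pN hM HV rX wc).1.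
   + by move=> q qT; apply: HC.
   + exact: (tred_sol T0 p1 al01 pN hM HV Fc sze wc ws).
   + by move=> y; rewrite /pull /= id0.
  move=> q; rewrite inE => qT; have qT' := slab_closed qT.
  by rewrite /pull /= (can _ qT').2 -surjective_pairing.
have [v sv cv] := local_cvg (@filter_filter R 0^'+ _) rZ uc FU (fun j => filter_ex (FU j)).
exists C; split; first by exists v.
apply: fam_cvg_intro => K fK e e0; apply: filterS (cv K fK e e0) => e' He' q Kq.
by rewrite (lim_map_sol sv) ?He'//; exact: fK.1. Unshelve. all: by end_near. Qed.

Lemma lim_map_contr (Z : rough_path d T p) (u0 v0 : E -> R) (C C' c : R) (w w' : R * E -> R) : rough_sol Z u0
  C w -> rough_sol Z v0 C' w' -> (forall x, `|u0 x - v0 x| <= c) -> forall q, slab T q -> `|lim_map (Z, u0) q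
  - lim_map (Z, v0) q| <= c.
move=> sw sw' uv q qT; rewrite (lim_map_sol sw qT) (lim_map_sol sw' qT).
have rZ := rpath_rough Z; set q' := (q.1, bwd Z q.1 q.2); have qT' : slab T q' by exact: qT.
have h1 x : u0 x <= v0 x + c by have := uv x; rewrite ler_norml => /andP[_]; rewrite lerBlDl.
have h2 x : v0 x <= u0 x + c.
 by have := uv x; rewrite distrC ler_norml => /andP[_]; rewrite lerBlDl.
have := rough_sol_contr T0 p1 al01 pN HV cmp rZ sw sw' h1 qT'.
have := rough_sol_contr T0 p1 al01 pN HV cmp rZ sw' sw h2 qT'.
rewrite /pull -/q' ler_norml => ha hb; apply/andP; split; last by rewrite lerBlDl. by lra.
Qed.

(** Neighbouring data in the set are approximants, and [B] is the common bound that half-relaxed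
    limits require; continuity is [local_cvg] for the trace of the neighbourhood filter on the
    set. *)
Lemma lim_map_cont (B : R) (S : rough_path d T p * {family compact, E -> R} -> {family compactly_in (slab T),
  R * E -> R}) : (forall a, S a = lim_map a) -> {within [set a : rough_path d T p * {family compact, E -> R} |
  approximable F V a.1 a.2 /\ forall q, slab T q -> `|S a q| <= B], continuous S}.
move=> SE; set A := [set _ | _]; apply/subspace_continuousP => a Aa.
have sol b : A b -> exists2 w, rough_sol b.1 b.2 B w & {in slab T, S b =1 pull (bwd b.1) w}.
 case: b => Z v [/= [z [v0 [v' /approx_lim[C [[w sw] _]]]]] vB].
 have wS q : slab T q -> S (Z, v) q = pull (bwd Z) w q by rewrite SE; exact: lim_map_sol sw _.
 have [can _ _ _] := rflow (rpath_rough Z); exists w => [|q]; last by rewrite inE; exact: wS.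
 have [wc _ ws wi] := sw; split=> // q qT. have qT' : slab T (q.1, fwd Z q.1 q.2) by [].
 by have := vB _ qT'; rewrite wS// /pull /= (can _ (slab_closed qT)).1 -surjective_pairing.
have ac : continuous a.2 by case: Aa => -[z [v0 [v' [_ [/BUC_cont]]]]].
have near j : nbhs a [set b | A b -> approximant a.1 a.2 B j b.1 b.2 (S b)].
 have j0 : 0 < j.+1%:R^-1 :> R by rewrite invr_gt0.
 have n1 : nbhs a.1 (ball a.1 (j.+1%:R^-1 : R)) by exact: nbhsx_ballx.
 pose W : set {family compact, E -> R} := [set h | forall x, [set y : E | `|y - 0| <= j%:R] x -> `|a.2 x - h
  x| < j.+1%:R^-1]. have n2 : nbhs a.2 W.
  exact: (@fam_cvg_elim R E compact (nbhs (a.2 : {family compact, E -> R})) a.2 _ _ (fun P h => h)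
   (@compact_closed_ball R n 0 j%:R) j0).
 exists (ball a.1 (j.+1%:R^-1 : R), W) => [|b [/= b1 b2] Ab]; first by split; [exact: n1|exact: n2].
 split; last exact: sol.
 - exact: rpath_rough.
 - by rewrite pvar_dist_sym; exact: b1.
 - by move=> y yj; rewrite distrC; apply/ltW/b2; rewrite /= subr0.
have Aj j : approximant a.1 a.2 B j a.1 a.2 (S a) by have := nbhs_singleton (near j); apply.
have [w sw cw] := local_cvg (within_filter A (nbhs_filter a)) (rpath_rough a.1) ac near (fun j => ex_intro _ a
 (Aj j)). apply: fam_cvg_intro => K fK e e0; apply: filterS (cw K fK e e0) => b Hb q Kq.
have -> : from_subspace A S a q = pull (bwd a.1) w q.
 rewrite /from_subspace. by rewrite SE [a]surjective_pairing; apply: (lim_map_sol sw); exact: fK.1.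
exact: Hb.
Qed.

End limit_solution.

Theorem theorem1 (R : realType) (n d : nat) (T p gamma : R)
    (F : generator R n) (V : 'I_d -> 'rV[R]_n -> 'rV[R]_n)
    (T_gt0 : 0 < T) (p_ge1 : 1 <= p) (p_lt_gamma : p < gamma)
    (F_continuous : continuous_generator T F)
    (F_elliptic : degenerate_elliptic T F)
    (F_comparison : invariant_comparison 3 T F)
    (V_lip : forall i, lip (gamma + 2) (V i)) :
  exists S : rough_path d T p * {family compact, 'rV[R]_n -> R} ->
             {family compactly_in (slab T), R * 'rV[R]_n -> R},
  [/\ forall (Z : rough_path d T p) (u0 : 'rV[R]_n -> R) z w0 w,
        approx_data F V Z u0 z w0 w ->
        [/\ bounded_continuous_on (slab T) (S (Z, u0)),
            {family compactly_in (slab T), w @ 0^'+ --> S (Z, u0)} &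
            forall u : R * 'rV[R]_n -> R,
              bounded_continuous_on (slab T) u ->
              {family compactly_in (slab T), w @ 0^'+ --> u} ->
              forall q, slab T q -> u q = S (Z, u0) q],
      forall (Z : rough_path d T p) (u0 v0 : 'rV[R]_n -> R),
        approximable F V Z u0 -> approximable F V Z v0 ->
        (ereal_sup [set `|S (Z, u0) q - S (Z, v0) q|%:E | q in slab T]
           <= ereal_sup [set `|u0 x - v0 x|%:E | x in setT])%E &
      forall M : R,
        {within [set a : rough_path d T p * {family compact, 'rV[R]_n -> R} |
                   approximable F V a.1 a.2 /\
                   forall q, slab T q -> `|S a q| <= M],
          continuous S}].
Proof.
have [al [al01 pN HV]] := lip_hclass_fam p_ge1 p_lt_gamma V_lip. have [M hM] : exists M, Num.truncn p = M.+1.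
  by exists (Num.truncn p).-1; rewrite prednK// truncn_gt0.
rewrite hM in pN HV.
pose S : rough_path d T p * {family compact, 'rV[R]_n -> R} -> {family compactly_in (slab T), R * 'rV[R]_n ->
  R} := lim_map hM V F.
have lim Z u0 z w0 w := @approx_lim R n d M T p al T_gt0 p_ge1 al01 pN hM V HV F F_continuous F_comparison Z
  u0 z w0 w. exists S; split.
- move=> Z u0 z w0 w dat; have [C [[v sv] cv]] := lim _ _ _ _ _ dat.
  have SE q : slab T q -> S (Z, u0) q = pull (bwd_flow T hM V Z) v q.
    by move=> qT; exact: (lim_map_sol T_gt0 p_ge1 al01 pN HV F_comparison sv qT).
  have [vc vC _ _] := sv. have [_ pc] := pull_cont T_gt0 p_ge1 al01 pN hM HV (rpath_rough Z) vc.
  split; [split| |].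
  + by apply: (bd_of (C := C)) => q qT; rewrite SE//; apply: vC.
  + apply: subspace_eq_continuous pc => q; rewrite inE => qT; exact/esym/SE.
  + by [].
  (* One-point subsets of the slab are compact, so the two limits already agree pointwise. *)
  + move=> u _ cu q qT; have fq : compactly_in (slab T) [set q] by split; [move=> _ ->|exact: compact_set1].
    apply/eqP; rewrite -subr_eq0 -normr_le0; apply/ler_addgt0Pl => e e0; rewrite addr0.
    have e2 : 0 < e / 2 by pos.
    have H1 : 0^'+ [set r | `|u q - w r q| < e / 2] by apply: (@filterS R 0^'+ _ [set r | forall x, [set q] x
      -> `|u x - w r x| < e / 2] _ _ (fam_cvg_elim cu fq e2)) => r /(_ q erefl).
    have H2 : 0^'+ [set r | `|S (Z, u0) q - w r q| < e / 2] by apply: (@filterS R 0^'+ _ [set r | forall x,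
      [set q] x -> `|S (Z, u0) x - w r x| < e / 2] _ _ (fam_cvg_elim cv fq e2)) => r /(_ q erefl).
    have [r [h1 h2]] := filter_ex (filterI H1 H2).
    apply: le_trans (ler_distD (w r q) _ _) _; rewrite [e]splitr [X in _ + X]distrC.
    by apply: lerD; apply: ltW.
- move=> Z u0 v0 [z [w0 [w /lim[C [[u su] _]]]]] [z' [w0' [w' /lim[C' [[v sv] _]]]]].
  set c := ereal_sup [set `|u0 x - v0 x|%:E | x in setT].
  have ub x : (`|u0 x - v0 x|%:E <= c)%E by apply: ereal_sup_ubound; exists x.
  (* An infinite supremum makes the claim trivial, and the value [-oo] is excluded by the point
     0. *)
  case: c ub => [c| |] ub; [|by rewrite leey|by have := ub 0].
  apply: ge_ereal_sup => _ [q qT <-]; rewrite lee_fin.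
  by apply: (lim_map_contr T_gt0 p_ge1 al01 pN HV F_comparison su sv) => // x; rewrite -lee_fin.
- move=> B; exact: (lim_map_cont T_gt0 p_ge1 al01 pN HV F_continuous F_comparison).
Qed.
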